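(* Let $0<\kappa\le c<1$. Then for every $g\in SO(3)$ there is an optimal decomposition of $g$ which is a subword of one of the following patterns, or of a pattern obtained from it by the indicated symmetries: (I) $R(t_XX)\,R(t_YY)\,R(-t_XX)\,R(-t_YY)$ with $0<t_X,t_Y\le\pi$, $\tan(t_X/2)=\kappa\tan(t_Y/2)$, and its images under the group $(X,Y)\mapsto\{\pm X,\pm Y\}$; (IV) $R(\hat t_YY)\,R(\hat t_XX)\,R(tW_+)\,R(\hat t_XX)\,R(\hat t_YY)$, $t\ge0$, and its images under $(X,Y)\mapsto\{-X,-Y\}$; (V) $R(\hat t_YY)\,R(\hat t_XX)\,R(tW_+)\,R(-\hat t_YY)\,R(-\hat t_XX)$, $t\ge0$, and its images under $(X,Y)\mapsto\{-X,-Y\}$; (VIII) $R(\pi Y)\,R(tX)\,R(\pi Y)$ with $0\le t\le 2\hat t_X$, and its image under $(X,Y)\mapsto(-X,-Y)$.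
   Context: Fix unit vectors $X,Y\in\mathbb R^3$ with angle $\alpha\in(0,\pi/2]$, $c=\cos\alpha\in[0,1)$, and $\kappa\in[0,1]$. For a unit vector $v$, $R(tv)\in SO(3)$ is rotation by angle $t$ about $v$ (counterclockwise viewed from the tip): $R(tv)=\cos t\,I+\sin t\,[v]_\times+(1-\cos t)vv^T$, $[v]_\times w=v\times w$; for nonzero non-unit $v$, $R(tv):=R((t|v|)\,v/|v|)$. For nonzero $C=aX+bY$, $\mathrm{cost}(C)=|a|+\kappa|b|$. A decomposition of $g\in SO(3)$ is a finite product $g=R(\tau_1C_1)\cdots R(\tau_nC_n)$ with $\tau_j\ge0$, $C_j$ nonzero in $\mathrm{span}\{X,Y\}$ (a factor $R(-\tau C)$, $\tau\ge0$, means $R(\tau(-C))$), with cost $\sum\tau_j\mathrm{cost}(C_j)$. Problem 1: minimize the cost over all decompositions of $g$; a decomposition is optimal if its cost equals the infimum. Set $W_+=(1+\kappa c)X-(\kappa+c)Y$, $W_-=(1-\kappa c)X+(\kappa-c)Y$, and (when $c+\kappa>0$) $\hat t_X=\arccos\frac{c-\kappa}{c+\kappa}$, $\hat t_Y=\arccos\left(-\frac{1-\kappa c}{1+\kappa c}\right)$, both in $[0,\pi]$. Subword: for a word $R(\tau_1C_1)\cdots R(\tau_nC_n)$ ($\tau_j\ge0$), a subword is $R(\tau_k'C_k)R(\tau_{k+1}C_{k+1})\cdots R(\tau_{m-1}C_{m-1})R(\tau_m'C_m)$ with $1\le k\le m\le n$, $0\le\tau_k'\le\tau_k$, $0\le\tau_m'\le\tau_m$.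 Symmetries of patterns: labels are $\pm X,\pm Y,\pm W_+,\pm W_-$; define label maps, each extended by $\sigma(-C)=-\sigma(C)$: $\nu:C\mapsto -C$; $\rho: X\mapsto X,\ Y\mapsto -Y,\ W_+\mapsto W_-,\ W_-\mapsto W_+$; $\varsigma: X\mapsto Y,\ Y\mapsto X,\ W_+\mapsto -W_+,\ W_-\mapsto W_-$. Applying $\nu$ or $\rho$ to a pattern replaces each label by its image and keeps the times. Applying $\varsigma$ replaces each label by its image and interchanges $t_X\leftrightarrow t_Y$ and $\hat t_X\leftrightarrow\hat t_Y$ in the times (times $\pi$ and free parameters $t$ unchanged), so that factors labelled $\pm X$ carry the $X$-time and factors labelled $\pm Y$ carry the $Y$-time; stated relations and ranges are kept verbatim. ''Under $(X,Y)\mapsto(-X,-Y)$'' means images under $\{\mathrm{id},\nu\}$; ''under $(X,Y)\mapsto\{-X,-Y\}$'' means under $\{\mathrm{id},\nu,\varsigma,\nu\varsigma\}$; ''under $(X,Y)\mapsto\{\pm X,\pm Y\}$'' means under the 8-element group generated by $\nu,\rho,\varsigma$. *)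

(* Defs.v *)
From Stdlib Require Import Reals List.
Import ListNotations.
Open Scope R_scope.

Record V3 := mkV { vx : R; vy : R; vz : R }.

Definition vadd (u v : V3) : V3 := mkV (vx u + vx v) (vy u + vy v) (vz u + vz v).
Definition vscale (s : R) (v : V3) : V3 := mkV (s * vx v) (s * vy v) (s * vz v).
Definition dot (u v : V3) : R := vx u * vx v + vy u * vy v + vz u * vz v.
Definition vnorm (v : V3) : R := sqrt (dot v v).

Record M3 := mkM {
  m11 : R; m12 : R; m13 : R;
  m21 : R; m22 : R; m23 : R;
  m31 : R; m32 : R; m33 : R }.

Definition mid : M3 := mkM 1 0 0 0 1 0 0 0 1.

Definition mmul (A B : M3) : M3 :=
  mkM (m11 A * m11 B + m12 A * m21 B + m13 A * m31 B)
      (m11 A * m12 B + m12 A * m22 B + m13 A * m32 B)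
      (m11 A * m13 B + m12 A * m23 B + m13 A * m33 B)
      (m21 A * m11 B + m22 A * m21 B + m23 A * m31 B)
      (m21 A * m12 B + m22 A * m22 B + m23 A * m32 B)
      (m21 A * m13 B + m22 A * m23 B + m23 A * m33 B)
      (m31 A * m11 B + m32 A * m21 B + m33 A * m31 B)
      (m31 A * m12 B + m32 A * m22 B + m33 A * m32 B)
      (m31 A * m13 B + m32 A * m23 B + m33 A * m33 B).

Definition mtr (A : M3) : M3 :=
  mkM (m11 A) (m21 A) (m31 A) (m12 A) (m22 A) (m32 A) (m13 A) (m23 A) (m33 A).

Definition mdet (A : M3) : R :=
  m11 A * (m22 A * m33 A - m23 A * m32 A)
  - m12 A * (m21 A * m33 A - m23 A * m31 A)
  + m13 A * (m21 A * m32 A - m22 A * m31 A).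

Definition SO3 (A : M3) : Prop := mmul (mtr A) A = mid /\ mdet A = 1.

(* Rodrigues: rotation by angle th about the unit vector u,
   cos th I + sin th [u]_x + (1 - cos th) u u^T *)
Definition rot_unit (th : R) (u : V3) : M3 :=
  let c := cos th in let s := sin th in
  let x := vx u in let y := vy u in let z := vz u in
  mkM (c + (1 - c) * x * x)      (s * (- z) + (1 - c) * x * y) (s * y + (1 - c) * x * z)
      (s * z + (1 - c) * y * x)  (c + (1 - c) * y * y)         (s * (- x) + (1 - c) * y * z)
      (s * (- y) + (1 - c) * z * x) (s * x + (1 - c) * z * y)  (c + (1 - c) * z * z).

Definition rot (t : R) (v : V3) : M3 :=
  rot_unit (t * vnorm v) (vscale (/ vnorm v) v).

(* A factor R(tau C) with C = a X + b Y, stored by its time and the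
   coefficients (a, b) of C in the basis X, Y (unique since X, Y are
   linearly independent). *)
Record factor := mkF { ftau : R; fa : R; fb : R }.

Definition fvec (X Y : V3) (f : factor) : V3 := vadd (vscale (fa f) X) (vscale (fb f) Y).

Definition word_eval (X Y : V3) (w : list factor) : M3 :=
  fold_right (fun f acc => mmul (rot (ftau f) (fvec X Y f)) acc) mid w.

Definition word_cost (kappa : R) (w : list factor) : R :=
  fold_right (fun f acc => ftau f * (Rabs (fa f) + kappa * Rabs (fb f)) + acc) 0 w.

Definition is_decomposition (X Y : V3) (w : list factor) (g : M3) : Prop :=
  Forall (fun f => 0 <= ftau f /\ ~ (fa f = 0 /\ fb f = 0)) w /\ word_eval X Y w = g.

Definition optimal_decomposition (X Y : V3) (kappa : R) (w : list factor) (g : M3) : Prop :=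
  is_decomposition X Y w g /\
  forall w', is_decomposition X Y w' g -> word_cost kappa w <= word_cost kappa w'.

Definition shrunk (f' f : factor) : Prop :=
  0 <= ftau f' <= ftau f /\ fa f' = fa f /\ fb f' = fb f.

Definition subword (s l : list factor) : Prop :=
  (exists pre f post f', l = pre ++ f :: post /\ shrunk f' f /\ s = [f'])
  \/
  (exists pre f1 middle f2 post f1' f2',
      l = pre ++ f1 :: middle ++ f2 :: post /\ shrunk f1' f1 /\ shrunk f2' f2 /\
      s = f1' :: middle ++ [f2']).

Inductive base := BX | BY | BWp | BWm.
(* a label: (negated?, base) ; (true, BX) is -X *)
Definition label := (bool * base)%type.

Inductive tm := TX | TY | THX | THY | TPi | TFree.

Definition pattern := list (tm * label).

Definition lab_nu (l : label) : label := (negb (fst l), snd l).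
Definition lab_rho (l : label) : label :=
  match l with
  | (s, BX) => (s, BX) | (s, BY) => (negb s, BY)
  | (s, BWp) => (s, BWm) | (s, BWm) => (s, BWp)
  end.
Definition lab_vsig (l : label) : label :=
  match l with
  | (s, BX) => (s, BY) | (s, BY) => (s, BX)
  | (s, BWp) => (negb s, BWp) | (s, BWm) => (s, BWm)
  end.
Definition tm_swap (t : tm) : tm :=
  match t with
  | TX => TY | TY => TX | THX => THY | THY => THX | TPi => TPi | TFree => TFree
  end.

Inductive gen := Gnu | Grho | Gvsig.

Definition apply_gen (s : gen) (p : pattern) : pattern :=
  match s with
  | Gnu => map (fun e => (fst e, lab_nu (snd e))) p
  | Grho => map (fun e => (fst e, lab_rho (snd e))) p
  | Gvsig => map (fun e => (tm_swap (fst e), lab_vsig (snd e))) p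
  end.

Definition apply_gens (gs : list gen) (p : pattern) : pattern :=
  fold_right apply_gen p gs.

Inductive pat_id := PI_I | PI_IV | PI_V | PI_VIII.

Definition pX : label := (false, BX).
Definition mX : label := (true, BX).
Definition pY : label := (false, BY).
Definition mY : label := (true, BY).
Definition pWp : label := (false, BWp).

Definition pat (p : pat_id) : pattern :=
  match p with
  | PI_I => [(TX, pX); (TY, pY); (TX, mX); (TY, mY)]
  | PI_IV => [(THY, pY); (THX, pX); (TFree, pWp); (THX, pX); (THY, pY)]
  | PI_V => [(THY, pY); (THX, pX); (TFree, pWp); (THY, mY); (THX, mX)]
  | PI_VIII => [(TPi, pY); (TFree, pX); (TPi, pY)]
  end.

(* allowed symmetry generators: (I) the 8-element group <nu,rho,vsig>;
   (IV),(V) {id,nu,vsig,nu vsig} = <nu,vsig>; (VIII) {id,nu} = <nu> *)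
Definition gen_allowed (p : pat_id) (s : gen) : Prop :=
  match p, s with
  | PI_I, _ => True
  | PI_IV, Grho => False
  | PI_V, Grho => False
  | PI_IV, _ => True
  | PI_V, _ => True
  | PI_VIII, Gnu => True
  | PI_VIII, _ => False
  end.

Definition hat_tX (kappa c : R) : R := acos ((c - kappa) / (c + kappa)).
Definition hat_tY (kappa c : R) : R := acos (- ((1 - kappa * c) / (1 + kappa * c))).

Definition base_coef (kappa c : R) (b : base) : R * R :=
  match b with
  | BX => (1, 0)
  | BY => (0, 1)
  | BWp => (1 + kappa * c, - (kappa + c))
  | BWm => (1 - kappa * c, kappa - c)
  end.

Definition label_coef (kappa c : R) (l : label) : R * R :=
  let ab := base_coef kappa c (snd l) in
  if fst l then (- fst ab, - snd ab) else ab.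

Definition tm_val (kappa c tX tY t : R) (x : tm) : R :=
  match x with
  | TX => tX | TY => tY | THX => hat_tX kappa c | THY => hat_tY kappa c
  | TPi => PI | TFree => t
  end.

Definition pattern_word (kappa c tX tY t : R) (p : pattern) : list factor :=
  map (fun e => let ab := label_coef kappa c (snd e) in
                mkF (tm_val kappa c tX tY t (fst e)) (fst ab) (snd ab)) p.

(* constraints on the parameters (kept verbatim under the symmetries).
   tan(t_X/2) = kappa tan(t_Y/2) is written without division:
   sin(t_X/2) cos(t_Y/2) = kappa cos(t_X/2) sin(t_Y/2). *)
Definition pat_constraint (kappa c : R) (p : pat_id) (tX tY t : R) : Prop :=
  match p with
  | PI_I => 0 < tX <= PI /\ 0 < tY <= PI /\
            sin (tX / 2) * cos (tY / 2) = kappa * (cos (tX / 2) * sin (tY / 2))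
  | PI_IV => 0 <= t
  | PI_V => 0 <= t
  | PI_VIII => 0 <= t <= 2 * hat_tX kappa c
  end.

Definition subword_of_listed_pattern (kappa c : R) (w : list factor) : Prop :=
  exists (p : pat_id) (gs : list gen) (tX tY t : R),
    Forall (gen_allowed p) gs /\ pat_constraint kappa c p tX tY t /\
    subword w (pattern_word kappa c tX tY t (apply_gens gs (pat p))).

(* Main.v *)
(** The generators are lifted to unit quaternions in a plane of imaginary quaternions, where
    every letter C has an inverse -C of the same cost and words are reversed by an
    anti-automorphism. For fixed K, minimise cost(w) + K (1 - <w, g>^2) over all words w; a
    minimising sequence, parametrised by cost, converges along an ultrafilter to a Lipschitz
    curve. Replacing any stretch of that curve by a word cannot lower the value, and this
    yields the maximum principle: a covector h is transported along the curve with
    |h.X| <= 1, |h.Y| <= kappa, and the velocity maximises h. The curve thus consists of X-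
    and Y-arcs, switching at the corners of the rectangle of bounds, together with W-arcs,
    along which h rests at a corner where h.X and h.Y have opposite signs (an O-corner).

    If no O-corner is met, the curve is Y^x X^t Y^y. If an O-corner is met with h leaving the
    plane, the letters cycle through X, Y, -X, -Y with fixed full lengths, and a second
    variation excludes five arcs. If an O-corner is met with h in the plane, the curve is a
    W-arc between two excursions. A complete excursion M = X^(tX) Y^(tY) is a half-turn with
    M W = W^(-1) M, and M followed by a further arc is not optimal: sliding a short W-arc
    through M shortens the word, by a monotonicity argument in one variable.

    Each of these words is a slice of a listed pattern with bounded parameters, so the
    parameters converge as K tends to infinity, and the limit word is optimal for g. *)

Require Import Defs.
From Stdlib Require Import Reals List Lra Psatz IndefiniteDescription Classical.
From Coquelicot Require Import Coquelicot.
From mathcomp Require filter.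
Import ListNotations.
Open Scope R_scope.

(** Words have unboundedly many letters, so they carry no compactness, and an optimal word is not
    known to exist in advance. The penalty leaves the end point free: every local replacement is an
    admissible competitor, the multiplier of the cost is 1 from the start, and abnormal extremals do
    not arise. Its square makes it blind to the sign of the quaternion, since q and -q are the same
    rotation. The limit curve is only Lipschitz, so differential equations are kept as increment
    estimates with quadratic error. The direction W is forced: at an O-corner with h in the plane, h
    is parallel to W, and turning about W fixes h. The hypothesis kappa <= c acts at the corners of
    equal sign. There a resting h would ask for the velocity W_-, whose Y-coefficient kappa - c is
    not positive while the corner asks for a nonnegative one; so no W_- occurs in the patterns. The
    saving behind the exclusion of an arc after M is only of third order in the length of the W-arc.
    A second variation does not see it, and the cost has to be treated exactly. *)

(** * Quaternions with their inner product, norm and two anti-automorphisms *)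

Record quat := mkQ { q0 : R; q1 : R; q2 : R; q3 : R }.

Definition qone : quat := mkQ 1 0 0 0.
Definition qmul (p q : quat) : quat :=
  mkQ (q0 p * q0 q - q1 p * q1 q - q2 p * q2 q - q3 p * q3 q)
      (q0 p * q1 q + q1 p * q0 q + q2 p * q3 q - q3 p * q2 q)
      (q0 p * q2 q - q1 p * q3 q + q2 p * q0 q + q3 p * q1 q)
      (q0 p * q3 q + q1 p * q2 q - q2 p * q1 q + q3 p * q0 q).
Definition qadd (p q : quat) : quat :=
  mkQ (q0 p + q0 q) (q1 p + q1 q) (q2 p + q2 q) (q3 p + q3 q).
Definition qscal (a : R) (q : quat) : quat :=
  mkQ (a * q0 q) (a * q1 q) (a * q2 q) (a * q3 q).
Definition qsub (p q : quat) : quat := qadd p (qscal (-1) q).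
Definition qopp (q : quat) : quat := qscal (-1) q.
Definition qconj (q : quat) : quat := mkQ (q0 q) (- q1 q) (- q2 q) (- q3 q).
(* The anti-automorphism fixing 1, i, j: it reverses words whose letters lie in the plane. *)
Definition qrev (q : quat) : quat := mkQ (q0 q) (q1 q) (q2 q) (- q3 q).
Definition ip (p q : quat) : R :=
  q0 p * q0 q + q1 p * q1 q + q2 p * q2 q + q3 p * q3 q.
Definition qn (q : quat) : R := sqrt (ip q q).
Definition pl (x y : R) : quat := mkQ 0 x y 0.

Lemma quat_ext (p q : quat) :
  q0 p = q0 q -> q1 p = q1 q -> q2 p = q2 q -> q3 p = q3 q -> p = q.
Proof. destruct p, q; simpl; intros; subst; reflexivity. Qed.

Ltac qring := intros; apply quat_ext; simpl; ring.

Lemma qmul_assoc p q r : qmul p (qmul q r) = qmul (qmul p q) r.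
Proof. qring. Qed.
Lemma qmul_1_l p : qmul qone p = p.
Proof. qring. Qed.
Lemma qmul_1_r p : qmul p qone = p.
Proof. qring. Qed.
Lemma qconj_mul p q : qconj (qmul p q) = qmul (qconj q) (qconj p).
Proof. qring. Qed.
Lemma qconj_conj p : qconj (qconj p) = p.
Proof. qring. Qed.
Lemma qrev_mul p q : qrev (qmul p q) = qmul (qrev q) (qrev p).
Proof. qring. Qed.
Lemma qrev_rev p : qrev (qrev p) = p.
Proof. qring. Qed.
Lemma qrev_conj p : qrev (qconj p) = qconj (qrev p).
Proof. qring. Qed.
Lemma ip_rev p q : ip (qrev p) (qrev q) = ip p q.
Proof. unfold ip; simpl; ring. Qed.
Lemma ip_conj p q : ip (qconj p) (qconj q) = ip p q.
Proof. unfold ip; simpl; ring. Qed.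
Lemma ip_comm p q : ip p q = ip q p.
Proof. unfold ip; ring. Qed.
Lemma ip_mul p a b : ip (qmul p a) (qmul p b) = ip p p * ip a b.
Proof. unfold ip; simpl; ring. Qed.
Lemma ip_mul_sq p q : ip (qmul p q) (qmul p q) = ip p p * ip q q.
Proof. apply ip_mul. Qed.
Lemma ip_mul_l_conj p a b : ip (qmul p a) b = ip a (qmul (qconj p) b).
Proof. unfold ip; simpl; ring. Qed.
Lemma ip_mul_r_conj p a b : ip (qmul a p) b = ip a (qmul b (qconj p)).
Proof. unfold ip; simpl; ring. Qed.
Lemma ip_add_l p q r : ip (qadd p q) r = ip p r + ip q r.
Proof. unfold ip; simpl; ring. Qed.
Lemma ip_scal_l a p r : ip (qscal a p) r = a * ip p r.
Proof. unfold ip; simpl; ring. Qed.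
Lemma ip_pos p : 0 <= ip p p.
Proof. unfold ip; nra. Qed.
Lemma qmul_conj_l p : ip p p = 1 -> qmul (qconj p) p = qone.
Proof.
  unfold ip; intros H; apply quat_ext; simpl; try ring.
  rewrite <- H; ring.
Qed.
Lemma qmul_conj_r p : ip p p = 1 -> qmul p (qconj p) = qone.
Proof.
  unfold ip; intros H; apply quat_ext; simpl; try ring.
  rewrite <- H; ring.
Qed.

Lemma ip_cauchy p q : ip p q * ip p q <= ip p p * ip q q.
Proof.
  unfold ip.
  set (a := q0 p); set (b := q1 p); set (c := q2 p); set (d := q3 p).
  set (e := q0 q); set (f := q1 q); set (g := q2 q); set (h := q3 q).
  (* Lagrange's identity: this sum of squares is the difference of the two sides. *)
  assert (0 <= (a*f-b*e)^2 + (a*g-c*e)^2 + (a*h-d*e)^2 + (b*g-c*f)^2 + (b*h-d*f)^2 + (c*h-d*g)^2)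
    by (repeat apply Rplus_le_le_0_compat; apply pow2_ge_0).
  nra.
Qed.

Lemma qn_pos p : 0 <= qn p.
Proof. apply sqrt_pos. Qed.
Lemma qn_sq p : qn p * qn p = ip p p.
Proof. apply sqrt_sqrt, ip_pos. Qed.
Lemma qn_mul p q : qn (qmul p q) = qn p * qn q.
Proof. unfold qn; rewrite ip_mul_sq; apply sqrt_mult; apply ip_pos. Qed.
Lemma qn_unit p : ip p p = 1 -> qn p = 1.
Proof. unfold qn; intros ->; apply sqrt_1. Qed.
Lemma ip_le p q : Rabs (ip p q) <= qn p * qn q.
Proof.
  apply Rsqr_incr_0_var; [| apply Rmult_le_pos; apply qn_pos].
  rewrite <- Rsqr_abs; unfold Rsqr.
  replace (qn p * qn q * (qn p * qn q)) with ((qn p * qn p) * (qn q * qn q)) by ring.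
  rewrite !qn_sq; apply ip_cauchy.
Qed.
Lemma qn_le p a : 0 <= a -> ip p p <= a * a -> qn p <= a.
Proof.
  intros Ha H; unfold qn; rewrite <- (sqrt_square a Ha); apply sqrt_le_1_alt; exact H.
Qed.
Lemma qn_add p q : qn (qadd p q) <= qn p + qn q.
Proof.
  apply qn_le; [generalize (qn_pos p) (qn_pos q); lra|].
  replace (ip (qadd p q) (qadd p q)) with (ip p p + ip q q + 2 * ip p q)
    by (unfold ip; simpl; ring).
  rewrite <- !qn_sq; generalize (ip_le p q) (Rle_abs (ip p q)); nra.
Qed.
Lemma qn_scal a p : qn (qscal a p) = Rabs a * qn p.
Proof.
  unfold qn; replace (ip (qscal a p) (qscal a p)) with (Rsqr a * ip p p)
    by (unfold ip, Rsqr; simpl; ring).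
  rewrite sqrt_mult; [rewrite sqrt_Rsqr_abs; reflexivity | apply Rle_0_sqr | apply ip_pos].
Qed.
Lemma qn_sub p q : qn (qsub p q) <= qn p + qn q.
Proof.
  unfold qsub; eapply Rle_trans; [apply qn_add|].
  rewrite qn_scal, Rabs_left by lra; lra.
Qed.
Lemma qn_conj p : qn (qconj p) = qn p.
Proof. unfold qn; rewrite ip_conj; reflexivity. Qed.
Lemma qn_0 p : qn p = 0 -> p = mkQ 0 0 0 0.
Proof.
  intros H; generalize (qn_sq p); rewrite H; unfold ip; intros H'.
  apply quat_ext; simpl; nra.
Qed.

Lemma qn_comp p : Rabs (q0 p) <= qn p /\ Rabs (q1 p) <= qn p /\ Rabs (q2 p) <= qn p /\ Rabs (q3 p) <= qn p.
Proof.
  repeat split; apply Rsqr_incr_0_var; try apply qn_pos;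
    rewrite <- Rsqr_abs; unfold Rsqr; rewrite qn_sq; unfold ip; nra.
Qed.

(** * One-parameter groups *)

(** Half angles: this is the lift of the rotation by [th] to the unit quaternions. It has period 4
    pi, and a full turn gives -1 ([rt_2PI]). *)
Definition rt (v : quat) (th : R) : quat :=
  qadd (qscal (cos (th / 2)) qone) (qscal (sin (th / 2)) v).

Definition unitv (v : quat) : Prop := q0 v = 0 /\ ip v v = 1.

Lemma unitv_sq v : unitv v -> qmul v v = qscal (-1) qone.
Proof.
  intros [H0 H]; unfold ip in H; apply quat_ext; simpl; rewrite H0 in *; try ring.
  nra.
Qed.

Lemma rt_0 v : rt v 0 = qone.
Proof.
  unfold rt; replace (0 / 2) with 0 by field; rewrite cos_0, sin_0; qring.
Qed.

Lemma rt_add v a b : unitv v -> qmul (rt v a) (rt v b) = rt v (a + b).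
Proof.
  intros Hv; unfold rt.
  replace ((a + b) / 2) with (a / 2 + b / 2) by field.
  rewrite cos_plus, sin_plus.
  set (ca := cos (a / 2)); set (cb := cos (b / 2)); set (sa := sin (a / 2)); set (sb := sin (b / 2)).
  replace (qmul (qadd (qscal ca qone) (qscal sa v)) (qadd (qscal cb qone) (qscal sb v)))
    with (qadd (qadd (qscal (ca * cb) qone) (qscal (sa * cb + ca * sb) v)) (qscal (sa * sb) (qmul v v)))
    by (apply quat_ext; simpl; ring).
  rewrite (unitv_sq v Hv); apply quat_ext; simpl; ring.
Qed.

Lemma ip_rt v a : unitv v -> ip (rt v a) (rt v a) = 1.
Proof.
  intros [H0 H]; unfold rt, ip in *; simpl; rewrite H0 in *.
  generalize (sin2_cos2 (a / 2)); unfold Rsqr; intros Hs.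
  replace (_ + _) with (cos (a/2) * cos (a/2) + sin (a/2) * sin (a/2) * (0 * 0 + q1 v * q1 v + q2 v * q2 v + q3 v * q3 v)) by ring.
  rewrite H; lra.
Qed.

Lemma rt_conj v a : q0 v = 0 -> qconj (rt v a) = rt v (- a).
Proof.
  intros H0; unfold rt; replace (- a / 2) with (- (a / 2)) by field.
  rewrite cos_neg, sin_neg; apply quat_ext; simpl; rewrite ?H0; ring.
Qed.

Lemma rt_opp v a : rt (qopp v) a = rt v (- a).
Proof.
  unfold rt; replace (- a / 2) with (- (a / 2)) by field.
  rewrite cos_neg, sin_neg; apply quat_ext; simpl; ring.
Qed.

Lemma rt_2PI v a : rt v (a + 2 * PI) = qopp (rt v a).
Proof.
  unfold rt; replace ((a + 2 * PI) / 2) with (a / 2 + PI) by field.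
  rewrite neg_cos, neg_sin; qring.
Qed.

(** The exponential of v / 2. At v = 0 the quotient is 0 times the inverse of 0, hence 0, and the
    value is 1 as it should be. *)
Definition qexp (v : quat) : quat :=
  qadd (qscal (cos (qn v / 2)) qone) (qscal (sin (qn v / 2) / qn v) v).

Lemma qexp_scal u t : unitv u -> qexp (qscal t u) = rt u t.
Proof.
  intros [H0 Hu]; unfold qexp, rt.
  rewrite qn_scal, (qn_unit u Hu), Rmult_1_r.
  destruct (Rtotal_order t 0) as [Ht|[->|Ht]].
  - rewrite Rabs_left by lra.
    replace (- t / 2) with (- (t / 2)) by field.
    rewrite cos_neg, sin_neg; apply quat_ext; simpl; field; lra.
  - rewrite Rabs_R0; unfold Rdiv; rewrite !Rmult_0_l, sin_0, cos_0; qring.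
  - rewrite Rabs_right by lra; apply quat_ext; simpl; field; lra.
Qed.

Lemma qexp_0 : qexp (mkQ 0 0 0 0) = qone.
Proof.
  replace (mkQ 0 0 0 0) with (qscal 0 (pl 1 0)) by qring.
  rewrite qexp_scal; [apply rt_0 | split; unfold ip, pl; simpl; ring].
Qed.

(** Reduces statements on [qexp] to [rt]. At v = 0 the direction is arbitrary, and any unit vector
    serves. *)
Lemma qexp_polar v : q0 v = 0 -> exists u t, unitv u /\ 0 <= t /\ v = qscal t u /\ t = qn v.
Proof.
  intros H0; destruct (Req_dec (qn v) 0) as [E|E].
  - exists (pl 1 0), 0; repeat split; try (unfold ip; simpl; ring); try lra.
    rewrite (qn_0 v E); qring.
  - exists (qscal (/ qn v) v), (qn v).
    assert (Hs : ip v v = qn v * qn v) by (rewrite qn_sq; reflexivity).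
    split; [|split; [apply qn_pos|split; [|reflexivity]]].
    + split; [simpl; rewrite H0; ring|].
      replace (ip (qscal (/ qn v) v) (qscal (/ qn v) v)) with (/ qn v * / qn v * ip v v)
        by (unfold ip; simpl; ring).
      rewrite Hs; field; exact E.
    + apply quat_ext; simpl; field; exact E.
Qed.

Lemma ip_qexp v : q0 v = 0 -> ip (qexp v) (qexp v) = 1.
Proof.
  intros H0; destruct (qexp_polar v H0) as (u & t & Hu & _ & -> & _).
  rewrite (qexp_scal u t Hu); apply ip_rt, Hu.
Qed.

Lemma one_minus_cos x : 0 <= 1 - cos x <= x * x / 2.
Proof.
  split; [generalize (COS_bound x); lra|].
  replace x with (2 * (x / 2)) at 1 by field; rewrite cos_2a_sin.
  assert (H : Rabs (sin (x / 2)) <= Rabs (x / 2)).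
  { destruct (Rle_dec 0 (x/2)) as [H|H].
    - rewrite (Rabs_right (x / 2)) by lra; apply Rabs_le.
      destruct (Rle_lt_or_eq_dec _ _ H) as [H1|<-]; [|rewrite sin_0; lra].
      generalize (sin_lt_x _ H1) (sin_lt_x _ H1); intros.
      split; [|lra].
      destruct (Rle_dec 1 (x/2)); [generalize (SIN_bound (x/2)); lra|].
      generalize (sin_ge_0 (x/2)) PI2_1; intros; nra.
    - rewrite (Rabs_left (x / 2)) by lra; rewrite <- Rabs_Ropp, <- sin_neg; apply Rabs_le.
      assert (H1 : 0 < - (x / 2)) by lra.
      generalize (sin_lt_x _ H1); intros.
      split; [|lra].
      destruct (Rle_dec 1 (- (x/2))); [generalize (SIN_bound (- (x/2))); lra|].
      generalize (sin_ge_0 (- (x/2))) PI2_1; intros; nra. }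
  apply Rsqr_le_abs_1 in H; unfold Rsqr in H; nra.
Qed.

Lemma sin_minus_id x : 0 <= x -> Rabs (sin x - x) <= x * x.
Proof.
  intros [Hx|<-]; [|rewrite sin_0, Rminus_0_r, Rabs_R0; lra].
  destruct (MVT_cor2 (fun y => sin y - y) (fun y => cos y - 1) 0 x Hx) as (y & E & Hy).
  { intros y _; apply derivable_pt_lim_minus; [apply derivable_pt_lim_sin|apply derivable_pt_lim_id]. }
  rewrite sin_0 in E; replace (sin x - x) with ((cos y - 1) * x) by lra.
  rewrite Rabs_mult, (Rabs_right x) by lra; apply Rmult_le_compat_r; [lra|].
  generalize (one_minus_cos y) (COS_bound y); intros.
  rewrite Rabs_left1 by lra.
  destruct (Rle_dec y 2); nra.
Qed.

Lemma qexp_near_one v : q0 v = 0 -> qn (qsub (qexp v) qone) <= qn v.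
Proof.
  intros H0; apply qn_le; [apply qn_pos|].
  destruct (qexp_polar v H0) as (u & t & Hu & Ht & E & En).
  rewrite <- En, E, (qexp_scal u t Hu).
  replace (ip (qsub (rt u t) qone) (qsub (rt u t) qone))
    with (ip (rt u t) (rt u t) + 1 - 2 * q0 (rt u t)) by (unfold ip; simpl; ring).
  rewrite (ip_rt u t Hu); destruct Hu as [Hu _]; simpl; rewrite Hu.
  generalize (one_minus_cos (t / 2)); nra.
Qed.

Lemma qexp_expand v : q0 v = 0 ->
  qn (qsub (qsub (qexp v) qone) (qscal (/ 2) v)) <= qn v * qn v.
Proof.
  intros H0; destruct (qexp_polar v H0) as (u & t & Hu & Ht & E & En).
  rewrite <- En, E, (qexp_scal u t Hu).
  replace (qsub (qsub (rt u t) qone) (qscal (/ 2) (qscal t u)))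
    with (qadd (qscal (cos (t / 2) - 1) qone) (qscal (sin (t / 2) - t / 2) u))
    by (apply quat_ext; simpl; field).
  eapply Rle_trans; [apply qn_add|].
  rewrite !qn_scal; destruct Hu as [_ Hu]; rewrite (qn_unit u Hu), (qn_unit qone) by (unfold ip; simpl; ring).
  generalize (one_minus_cos (t / 2)) (sin_minus_id (t / 2)); intros H1 H2.
  rewrite (Rabs_left1 (cos (t/2) - 1)) by lra.
  assert (0 <= t / 2) by lra; specialize (H2 H); nra.
Qed.

(** * Limits along a free ultrafilter *)

(** One ultrafilter provides limits of all bounded sequences simultaneously, hence at all times of
    the curves at once; no subsequence has to be extracted. *)
Lemma ultrafilter_exists :
  exists U : (nat -> Prop) -> Prop,
    ProperFilter U /\ (forall P, U P \/ U (fun n => ~ P n)) /\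
    (forall N, U (fun n => (N <= n)%nat)).
Proof.
  destruct (filter.ultraFilterLemma (T := nat) (F := (eventually : (nat -> Prop) -> Prop))) as (U & HU & Hsub).
  { constructor.
    - intros [N HN]; exact (HN N (Nat.le_refl N)).
    - constructor.
      + apply filter_true.
      + intros P Q HP HQ; exact (filter_and P Q HP HQ).
      + intros P Q H HP; exact (filter_imp P Q H HP). }
  exists U.
  destruct (filter.ultra_proper (UltraFilter := HU)) as [H0 [HT HI HS]].
  split; [|split].
  - constructor.
    + intros P HP; destruct (Classical_Prop.classic (exists x, P x)) as [|N]; [assumption|].
      exfalso; apply H0; refine (HS P _ _ HP); intros x Px; apply N; exists x; exact Px.
    + constructor; [exact HT|exact HI|]. intros P Q H HP; exact (HS P Q H HP).
  - intros P; exact (filter.in_ultra_setVsetC P HU).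
  - intros N; apply Hsub; exists N; intros n Hn; exact Hn.
Qed.

Lemma ultra_limit (U : (nat -> Prop) -> Prop) {FU : ProperFilter U} :
  (forall P, U P \/ U (fun n => ~ P n)) ->
  forall (u : nat -> R) (M : R), (forall n, Rabs (u n) <= M) ->
  exists l, filterlim u U (locally l).
Proof.
  intros HU u M HM.
  (* The limit is the supremum of the x that lie below [u n] for almost all n. That almost all [u n]
     stay below l + eps uses that [U] decides every set. *)
  set (E := fun x => U (fun n => x <= u n)).
  assert (Hb : bound E).
  { exists M; intros x Hx; destruct (filter_ex _ Hx) as [n Hn].
    generalize (HM n) (Rle_abs (u n)); lra. }
  assert (Hne : exists x, E x).
  { exists (- M); unfold E; apply filter_forall; intros n; generalize (HM n); intros H; apply Rabs_le_between in H; lra. }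
  destruct (completeness E Hb Hne) as [l [Hub Hlub]]; exists l.
  intros P [eps HP]; unfold filtermap.
  assert (H1 : U (fun n => l - eps < u n)).
  { destruct (Classical_Prop.classic (exists x, E x /\ l - eps < x)) as [(x & Hx & Hlt)|N].
    - apply filter_imp with (2 := Hx); intros n; lra.
    - exfalso; assert (H : is_upper_bound E (l - eps)).
      { intros x Hx; destruct (Rle_lt_dec x (l - eps)); [assumption|]. exfalso; apply N; exists x; split; assumption. }
      apply Hlub in H; generalize (cond_pos eps); lra. }
  assert (H2 : U (fun n => u n < l + eps)).
  { destruct (HU (fun n => l + eps <= u n)) as [H|H].
    - exfalso; generalize (Hub _ H) (cond_pos eps); lra.
    - apply filter_imp with (2 := H); intros n; lra. }
  apply filter_imp with (2 := filter_and _ _ H1 H2).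
  intros n [Ha Hb']; apply HP.
  change (Rabs (u n - l) < eps); apply Rabs_lt_between'; lra.
Qed.

(** * Frames and plans *)

(* A frame lists two plane letters with their costs, their inner product and
   their (signed) wedge; a plan is a list of increments (a, b), meaning
   the factor exp(aP + bQ). *)
Record frame := mkFr { fP : quat; fQ : quat; al : R; be : R; cc : R; sg : R }.

Record frame_ok (F : frame) : Prop := {
  ok_P : unitv (fP F); ok_P3 : q3 (fP F) = 0;
  ok_Q : unitv (fQ F); ok_Q3 : q3 (fQ F) = 0;
  ok_cc : ip (fP F) (fQ F) = cc F;
  ok_sg : q1 (fP F) * q2 (fQ F) - q2 (fP F) * q1 (fQ F) = sg F;
  ok_al : 0 < al F; ok_be : 0 < be F; ok_sg0 : sg F <> 0 }.

(** The quarter turn (P, Q) -> (Q, -P) permutes the sides of the rectangle |h.P| <= al, |h.Q| <= be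
    cyclically and keeps the wedge; [flipF] reflects it. Together they generate the dihedral
    symmetries, so an analysis need only treat the side h.P = al. *)
Definition rotF (F : frame) : frame := mkFr (fQ F) (qopp (fP F)) (be F) (al F) (- cc F) (sg F).
Definition flipF (F : frame) : frame := mkFr (fP F) (qopp (fQ F)) (al F) (be F) (- cc F) (- sg F).

Lemma unitv_opp v : unitv v -> unitv (qopp v).
Proof. intros [H0 H]; split; [simpl; rewrite H0; ring|]. unfold ip in *; simpl; rewrite <- H; ring. Qed.

Lemma rotF_ok F : frame_ok F -> frame_ok (rotF F).
Proof.
  intros []; constructor; simpl; auto using unitv_opp; try lra.
  - rewrite <- ok_cc0; unfold ip; simpl; ring.
Qed.

Lemma flipF_ok F : frame_ok F -> frame_ok (flipF F).
Proof.
  intros []; constructor; simpl; auto using unitv_opp; try lra.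
  - rewrite <- ok_cc0; unfold ip; simpl; ring.
Qed.

Definition vec (F : frame) (a b : R) : quat := qadd (qscal a (fP F)) (qscal b (fQ F)).
Definition ecost (F : frame) (e : R * R) : R := al F * Rabs (fst e) + be F * Rabs (snd e).
Definition eexp (F : frame) (e : R * R) : quat := qexp (vec F (fst e) (snd e)).

Definition pe (F : frame) (l : list (R * R)) : quat :=
  fold_right (fun e q => qmul (eexp F e) q) qone l.
Definition pc (F : frame) (l : list (R * R)) : R :=
  fold_right (fun e x => ecost F e + x) 0 l.
Definition sA (l : list (R * R)) : R := fold_right (fun e x => fst e + x) 0 l.
Definition sB (l : list (R * R)) : R := fold_right (fun e x => snd e + x) 0 l.

(** The cost enters as an upper bound, so that words can be concatenated and estimated without
    tracking exact costs. *)
Definition reach (F : frame) (q : quat) (x : R) : Prop :=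
  exists l, pe F l = q /\ pc F l <= x.

Lemma pe_app F l m : pe F (l ++ m) = qmul (pe F l) (pe F m).
Proof.
  induction l as [|e l IH]; simpl; [rewrite qmul_1_l; reflexivity|].
  rewrite IH, qmul_assoc; reflexivity.
Qed.
Lemma pc_app F l m : pc F (l ++ m) = pc F l + pc F m.
Proof. induction l as [|e l IH]; simpl; [ring|]. rewrite IH; ring. Qed.

Section Frame.
Variable F : frame.
Hypothesis OK : frame_ok F.

Lemma al_pos : 0 < al F. Proof. apply OK. Qed.
Lemma be_pos : 0 < be F. Proof. apply OK. Qed.

Lemma ecost_pos e : 0 <= ecost F e.
Proof.
  unfold ecost; generalize al_pos be_pos (Rabs_pos (fst e)) (Rabs_pos (snd e)); nra.
Qed.

Lemma pc_pos l : 0 <= pc F l.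
Proof. induction l as [|e l IH]; simpl; [lra|]. generalize (ecost_pos e); lra. Qed.

Lemma vec_0 a b : q0 (vec F a b) = 0.
Proof. destruct OK; simpl; destruct ok_P0 as [-> _], ok_Q0 as [-> _]; ring. Qed.

(** Conversion factor from cost to the length |a| + |b| of an increment ([abs_le_cost]). *)
Definition lip : R := / al F + / be F.

Lemma lip_pos : 0 < lip.
Proof.
  unfold lip; apply Rplus_lt_0_compat; apply Rinv_0_lt_compat; [apply al_pos|apply be_pos].
Qed.

Lemma qn_vec a b : qn (vec F a b) <= Rabs a + Rabs b.
Proof.
  unfold vec; eapply Rle_trans; [apply qn_add|]; rewrite !qn_scal.
  destruct OK as [[_ HP] _ [_ HQ] _ _ _ _ _ _]; rewrite (qn_unit _ HP), (qn_unit _ HQ); lra.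
Qed.

Lemma abs_le_cost a b : Rabs a + Rabs b <= lip * (al F * Rabs a + be F * Rabs b).
Proof.
  generalize al_pos be_pos (Rabs_pos a) (Rabs_pos b); intros Ha Hb H1 H2.
  unfold lip.
  replace ((/ al F + / be F) * (al F * Rabs a + be F * Rabs b))
    with (Rabs a + Rabs b + (al F * Rabs a / be F + be F * Rabs b / al F)) by (field; lra).
  assert (0 <= al F * Rabs a / be F) by (apply Rmult_le_pos; [nra|left; apply Rinv_0_lt_compat; lra]).
  assert (0 <= be F * Rabs b / al F) by (apply Rmult_le_pos; [nra|left; apply Rinv_0_lt_compat; lra]).
  lra.
Qed.

Lemma vec_le_cost e : qn (vec F (fst e) (snd e)) <= lip * ecost F e.
Proof. eapply Rle_trans; [apply qn_vec|apply abs_le_cost]. Qed.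

Lemma pe_unit l : ip (pe F l) (pe F l) = 1.
Proof.
  induction l as [|e l IH]; simpl; [unfold ip; simpl; ring|].
  rewrite ip_mul_sq, IH; unfold eexp; rewrite ip_qexp by apply vec_0; ring.
Qed.

Lemma pe_near_one l : qn (qsub (pe F l) qone) <= lip * pc F l.
Proof.
  induction l as [|e l IH]; simpl.
  - replace (qsub qone qone) with (qscal 0 qone) by qring.
    rewrite qn_scal, Rabs_R0; lra.
  - replace (qsub (qmul (eexp F e) (pe F l)) qone)
      with (qadd (qmul (eexp F e) (qsub (pe F l) qone)) (qsub (eexp F e) qone)) by qring.
    eapply Rle_trans; [apply qn_add|]; rewrite qn_mul.
    rewrite (qn_unit (eexp F e)) by (apply ip_qexp, vec_0).
    generalize (qexp_near_one _ (vec_0 (fst e) (snd e))) (vec_le_cost e).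
    unfold eexp; lra.
Qed.

(** The bound involves the cost alone and not the number of letters. It therefore survives the
    passage to the limit, where it becomes [ex_lin]. *)
Lemma pe_expand l :
  qn (qsub (qsub (pe F l) qone) (qscal (/ 2) (vec F (sA l) (sB l))))
  <= lip * lip * (pc F l * pc F l).
Proof.
  induction l as [|e l IH].
  - simpl; replace (qsub _ _) with (qscal 0 qone) by qring.
    rewrite qn_scal, Rabs_R0; lra.
  - change (pe F (e :: l)) with (qmul (eexp F e) (pe F l)).
    change (pc F (e :: l)) with (ecost F e + pc F l).
    change (sA (e :: l)) with (fst e + sA l); change (sB (e :: l)) with (snd e + sB l).
    set (E := eexp F e); set (p := pe F l) in *.
    replace (qsub (qsub (qmul E p) qone) (qscal (/ 2) (vec F (fst e + sA l) (snd e + sB l))))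
      with (qadd (qadd (qsub (qsub E qone) (qscal (/ 2) (vec F (fst e) (snd e))))
                       (qsub (qsub p qone) (qscal (/ 2) (vec F (sA l) (sB l)))))
                 (qmul (qsub E qone) (qsub p qone))) by (unfold vec; qring).
    eapply Rle_trans; [apply qn_add|].
    eapply Rle_trans; [apply Rplus_le_compat_r, qn_add|]; rewrite qn_mul.
    assert (H1 : qn (qsub (qsub E qone) (qscal (/ 2) (vec F (fst e) (snd e))))
                 <= qn (vec F (fst e) (snd e)) * qn (vec F (fst e) (snd e))) by apply (qexp_expand _ (vec_0 _ _)).
    assert (H2 : qn (qsub E qone) <= qn (vec F (fst e) (snd e))) by apply (qexp_near_one _ (vec_0 _ _)).
    assert (H3 := vec_le_cost e); assert (H4 := pe_near_one l); fold p in H4.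
    assert (H5 := ecost_pos e); assert (H6 := pc_pos l).
    assert (H7 := qn_pos (vec F (fst e) (snd e))); assert (H8 := qn_pos (qsub E qone)).
    assert (H9 := qn_pos (qsub p qone)); assert (H10 := lip_pos).
    revert IH H1 H2 H3 H4 H5 H6 H7 H8 H9 H10.
    set (n1 := qn (qsub E qone)); set (n2 := qn (qsub p qone)); set (v := qn (vec F (fst e) (snd e))).
    set (c := lip); set (x := ecost F e); set (y := pc F l) in *.
    set (r1 := qn (qsub (qsub E _) _)); set (r2 := qn (qsub (qsub p _) _)).
    clearbody n1 n2 v c x y r1 r2; intros IH H1 H2 H3 H4 H5 H6 H7 H8 H9 H10.
    assert (v * v <= c * x * (c * x)) by (apply Rmult_le_compat; lra).
    assert (n1 * n2 <= c * x * (c * y)) by (apply Rmult_le_compat; lra).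
    assert (0 <= c * c * (x * y)) by (apply Rmult_le_pos; nra).
    replace (c * c * ((x + y) * (x + y))) with (c * x * (c * x) + c * c * (y * y) + 2 * (c * c * (x * y))) by ring.
    replace (c * x * (c * y)) with (c * c * (x * y)) in * by ring.
    lra.
Qed.

Lemma sum_cost l : al F * Rabs (sA l) + be F * Rabs (sB l) <= pc F l.
Proof.
  induction l as [|e l IH]; simpl; [rewrite Rabs_R0; lra|].
  unfold ecost; generalize (Rabs_triang (fst e) (sA l)) (Rabs_triang (snd e) (sB l)) al_pos be_pos.
  nra.
Qed.

(** * Curves traced by plans, parametrised by cost *)

(** Past the total cost the curve rests at its end. The strict test skips letters of cost 0, so for
    t >= 0 the division is never by 0. [cA] and [cB] accumulate the coefficients of P and Q. *)
Fixpoint cur (l : list (R * R)) (t : R) : quat :=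
  match l with
  | [] => qone
  | e :: l' => if Rlt_dec t (ecost F e)
               then eexp F (t / ecost F e * fst e, t / ecost F e * snd e)
               else qmul (eexp F e) (cur l' (t - ecost F e))
  end.
Fixpoint cA (l : list (R * R)) (t : R) : R :=
  match l with
  | [] => 0
  | e :: l' => if Rlt_dec t (ecost F e) then t / ecost F e * fst e else fst e + cA l' (t - ecost F e)
  end.
Fixpoint cB (l : list (R * R)) (t : R) : R :=
  match l with
  | [] => 0
  | e :: l' => if Rlt_dec t (ecost F e) then t / ecost F e * snd e else snd e + cB l' (t - ecost F e)
  end.

Lemma ecost_scal k e : ecost F (k * fst e, k * snd e) = Rabs k * ecost F e.
Proof. unfold ecost; simpl; rewrite !Rabs_mult; ring. Qed.

Lemma eexp_split e k m :
  qmul (eexp F (k * fst e, k * snd e)) (eexp F (m * fst e, m * snd e))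
  = eexp F ((k + m) * fst e, (k + m) * snd e).
Proof.
  unfold eexp; simpl.
  destruct (qexp_polar (vec F (fst e) (snd e)) (vec_0 _ _)) as (u & t & Hu & _ & E & _).
  assert (G : forall k, vec F (k * fst e) (k * snd e) = qscal (k * t) u).
  { intros j; replace (vec F (j * fst e) (j * snd e)) with (qscal j (vec F (fst e) (snd e)))
      by (unfold vec; qring). rewrite E; qring. }
  rewrite !G, !(qexp_scal u _ Hu), rt_add by exact Hu; f_equal; ring.
Qed.

Lemma eexp_1 e : eexp F (1 * fst e, 1 * snd e) = eexp F e.
Proof. unfold eexp; simpl; rewrite !Rmult_1_l; reflexivity. Qed.

Lemma eexp_00 : eexp F (0, 0) = qone.
Proof.
  unfold eexp; simpl; replace (vec F 0 0) with (mkQ 0 0 0 0) by (unfold vec; qring); apply qexp_0.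
Qed.

Lemma cur_0 l : cur l 0 = qone /\ cA l 0 = 0 /\ cB l 0 = 0.
Proof.
  induction l as [|e l IH]; simpl; [auto|].
  destruct (Rlt_dec 0 (ecost F e)) as [H|H].
  - unfold Rdiv; rewrite !Rmult_0_l, eexp_00; auto.
  - assert (E : ecost F e = 0) by (generalize (ecost_pos e); lra).
    rewrite E, Rminus_0_r; destruct IH as (-> & -> & ->).
    unfold ecost in E; generalize al_pos be_pos (Rabs_pos (fst e)) (Rabs_pos (snd e)); intros.
    assert (Rabs (fst e) = 0) by nra. assert (Rabs (snd e) = 0) by nra.
    assert (F1 : fst e = 0) by (destruct (Req_dec (fst e) 0) as [|N]; [assumption|apply Rabs_no_R0 in N; lra]).
    assert (F2 : snd e = 0) by (destruct (Req_dec (snd e) 0) as [|N]; [assumption|apply Rabs_no_R0 in N; lra]).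
    destruct e as [a b]; simpl in F1, F2; subst; rewrite eexp_00, qmul_1_l; simpl; repeat split; lra.
Qed.

Lemma cur_between l : forall s t, 0 <= s <= t ->
  exists m, cur l t = qmul (cur l s) (pe F m) /\ pc F m <= t - s /\
            cA l t = cA l s + sA m /\ cB l t = cB l s + sB m.
Proof.
  induction l as [|e l IH]; intros s t Hst; simpl.
  - exists []; simpl; rewrite qmul_1_l; repeat split; lra.
  - set (x := ecost F e).
    assert (Hx : 0 <= x) by apply ecost_pos.
    destruct (Rlt_dec t x) as [Ht|Ht]; destruct (Rlt_dec s x) as [Hs|Hs]; try lra.
    + exists [((t / x - s / x) * fst e, (t / x - s / x) * snd e)]; simpl.
      rewrite qmul_1_r, eexp_split.
      replace (s / x + (t / x - s / x)) with (t / x) by ring.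
      split; [reflexivity|]; rewrite ecost_scal; fold x.
      assert (0 <= t / x - s / x).
      { replace (t / x - s / x) with ((t - s) / x) by (field; lra).
        apply Rmult_le_pos; [lra|left; apply Rinv_0_lt_compat; lra]. }
      rewrite Rabs_right by lra; repeat split; try (field; lra).
      right; field; lra.
    + destruct (IH 0 (t - x)) as (m & E & Hm & EA & EB); [lra|].
      destruct (cur_0 l) as (Z1 & Z2 & Z3).
      rewrite Z1, qmul_1_l in E; rewrite Z2 in EA; rewrite Z3 in EB.
      exists (((1 - s / x) * fst e, (1 - s / x) * snd e) :: m); simpl.
      rewrite E, qmul_assoc, eexp_split, EA, EB.
      replace (s / x + (1 - s / x)) with 1 by ring; rewrite eexp_1.
      split; [reflexivity|]; rewrite ecost_scal; fold x.
      assert (0 <= 1 - s / x).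
      { replace (1 - s / x) with ((x - s) / x) by (field; lra).
        apply Rmult_le_pos; [lra|left; apply Rinv_0_lt_compat; lra]. }
      rewrite Rabs_right by lra.
      repeat split; try (field; lra).
      replace ((1 - s / x) * x) with (x - s) by (field; lra); lra.
    + destruct (IH (s - x) (t - x)) as (m & E & Hm & EA & EB); [lra|].
      exists m; rewrite E, EA, EB, qmul_assoc; repeat split; try lra.
Qed.

Lemma cur_tail l : forall t, 0 <= t ->
  exists m, pe F l = qmul (cur l t) (pe F m) /\ pc F m <= Rmax 0 (pc F l - t).
Proof.
  induction l as [|e l IH]; intros t Ht; simpl.
  - exists []; simpl; rewrite qmul_1_l; split; [reflexivity|apply Rmax_l].
  - set (x := ecost F e).
    assert (Hx : 0 <= x) by apply ecost_pos.
    destruct (Rlt_dec t x) as [H|H].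
    + exists (((1 - t / x) * fst e, (1 - t / x) * snd e) :: l); simpl.
      rewrite qmul_assoc, eexp_split.
      replace (t / x + (1 - t / x)) with 1 by ring; rewrite eexp_1.
      split; [reflexivity|]; rewrite ecost_scal; fold x.
      assert (0 <= 1 - t / x).
      { replace (1 - t / x) with ((x - t) / x) by (field; lra).
        apply Rmult_le_pos; [lra|left; apply Rinv_0_lt_compat; lra]. }
      rewrite Rabs_right by lra.
      replace ((1 - t / x) * x) with (x - t) by (field; lra).
      eapply Rle_trans; [|apply Rmax_r]; lra.
    + destruct (IH (t - x)) as (m & E & Hm); [lra|].
      exists m; rewrite E, qmul_assoc; split; [reflexivity|].
      replace (x + pc F l - t) with (pc F l - (t - x)) by ring; exact Hm.
Qed.

Lemma cur_unit l t : 0 <= t -> ip (cur l t) (cur l t) = 1.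
Proof.
  intros Ht; destruct (cur_between l 0 t) as (m & -> & _); [lra|].
  rewrite ip_mul_sq, pe_unit; destruct (cur_0 l) as (-> & _); unfold ip; simpl; ring.
Qed.

(** * Reachability at a given cost *)

Lemma reach_pos q x : reach F q x -> 0 <= x.
Proof. intros (l & _ & H); generalize (pc_pos l); lra. Qed.
Lemma reach_le q x y : reach F q x -> x <= y -> reach F q y.
Proof. intros (l & E & H) Hxy; exists l; split; [exact E|lra]. Qed.
Lemma reach_one : reach F qone 0.
Proof. exists []; simpl; split; [reflexivity|lra]. Qed.
Lemma reach_mul p q x y : reach F p x -> reach F q y -> reach F (qmul p q) (x + y).
Proof.
  intros (l & <- & Hl) (m & <- & Hm); exists (l ++ m); rewrite pe_app, pc_app; split; [reflexivity|lra].
Qed.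
Lemma reach_exp a b : reach F (qexp (vec F a b)) (al F * Rabs a + be F * Rabs b).
Proof.
  exists [(a, b)]; simpl; rewrite qmul_1_r; unfold eexp, ecost; simpl; split; [reflexivity|lra].
Qed.
Lemma reach_P t : reach F (rt (fP F) t) (al F * Rabs t).
Proof.
  replace (rt (fP F) t) with (qexp (vec F t 0)).
  - eapply reach_le; [apply reach_exp|]; rewrite Rabs_R0; lra.
  - replace (vec F t 0) with (qscal t (fP F)) by (unfold vec; qring).
    apply qexp_scal, OK.
Qed.
Lemma reach_Q t : reach F (rt (fQ F) t) (be F * Rabs t).
Proof.
  replace (rt (fQ F) t) with (qexp (vec F 0 t)).
  - eapply reach_le; [apply reach_exp|]; rewrite Rabs_R0; lra.
  - replace (vec F 0 t) with (qscal t (fQ F)) by (unfold vec; qring).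
    apply qexp_scal, OK.
Qed.

Lemma qrev_exp a b : qrev (qexp (vec F a b)) = qexp (vec F a b).
Proof.
  unfold qexp; apply quat_ext; simpl; try ring.
  destruct OK; rewrite ok_P4, ok_Q4; ring.
Qed.
Lemma reach_rev q x : reach F q x -> reach F (qrev q) x.
Proof.
  intros (l & <- & Hl); exists (rev l).
  split.
  - clear Hl; induction l as [|e l IH]; simpl; [qring|].
    rewrite pe_app, IH; simpl; rewrite qmul_1_r, qrev_mul; f_equal.
    unfold eexp; rewrite qrev_exp; reflexivity.
  - apply Rle_trans with (2 := Hl); right; clear Hl.
    induction l as [|e l IH]; simpl; [reflexivity|]; rewrite pc_app, IH; simpl; ring.
Qed.
End Frame.

Lemma reach_map F F' (f : R * R -> R * R) :
  (forall e, eexp F' (f e) = eexp F e) -> (forall e, ecost F' (f e) = ecost F e) ->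
  forall q x, reach F q x -> reach F' q x.
Proof.
  intros H1 H2 q x (l & <- & Hl); exists (map f l); split.
  - clear Hl; induction l as [|e l IH]; simpl; [reflexivity|]; rewrite IH, H1; reflexivity.
  - apply Rle_trans with (2 := Hl); right; clear Hl.
    induction l as [|e l IH]; simpl; [reflexivity|]; rewrite IH, H2; reflexivity.
Qed.

Lemma reach_rot_inv F q x : reach (rotF F) q x -> reach F q x.
Proof.
  apply (reach_map (rotF F) F (fun e => (- snd e, fst e))).
  - intros e; unfold eexp; f_equal; unfold vec; simpl; qring.
  - intros e; unfold ecost; simpl; rewrite Rabs_Ropp; ring.
Qed.
Lemma reach_flip_inv F q x : reach (flipF F) q x -> reach F q x.
Proof.
  apply (reach_map (flipF F) F (fun e => (fst e, - snd e))).
  - intros e; unfold eexp; f_equal; unfold vec; simpl; qring.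
  - intros e; unfold ecost; simpl; rewrite Rabs_Ropp; ring.
Qed.

(** * Limits along a filter *)

Section Limits.
Context {U : (nat -> Prop) -> Prop} {FU : ProperFilter U}.

Definition flim (u : nat -> R) (l : R) : Prop := filterlim u U (locally l).
Definition qlim (u : nat -> quat) (q : quat) : Prop :=
  flim (fun n => q0 (u n)) (q0 q) /\ flim (fun n => q1 (u n)) (q1 q) /\
  flim (fun n => q2 (u n)) (q2 q) /\ flim (fun n => q3 (u n)) (q3 q).

Lemma flim_const a : flim (fun _ => a) a.
Proof. apply filterlim_const. Qed.
Lemma flim_plus u v a b : flim u a -> flim v b -> flim (fun n => u n + v n) (a + b).
Proof. intros Hu Hv; eapply filterlim_comp_2; [exact Hu|exact Hv|apply (filterlim_plus a b)]. Qed.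
Lemma flim_mult u v a b : flim u a -> flim v b -> flim (fun n => u n * v n) (a * b).
Proof. intros Hu Hv; eapply filterlim_comp_2; [exact Hu|exact Hv|apply (filterlim_mult a b)]. Qed.
Lemma flim_opp u a : flim u a -> flim (fun n => - u n) (- a).
Proof. intros Hu; eapply filterlim_comp; [exact Hu|apply (filterlim_opp a)]. Qed.
Lemma flim_minus u v a b : flim u a -> flim v b -> flim (fun n => u n - v n) (a - b).
Proof. intros Hu Hv; apply flim_plus, flim_opp; assumption. Qed.
Lemma flim_cont u a f : continuous f a -> flim u a -> flim (fun n => f (u n)) (f a).
Proof. intros Hf Hu; eapply filterlim_comp; [exact Hu|exact Hf]. Qed.
Lemma flim_abs u a : flim u a -> flim (fun n => Rabs (u n)) (Rabs a).
Proof. apply flim_cont, continuous_Rabs. Qed.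
Lemma flim_ext u v a : (forall n, u n = v n) -> flim u a -> flim v a.
Proof. intros E; apply filterlim_ext; exact E. Qed.
Lemma flim_le u v a b : U (fun n => u n <= v n) -> flim u a -> flim v b -> a <= b.
Proof. intros H Hu Hv; exact (filterlim_le u v a b H Hu Hv). Qed.
Lemma flim_unique u a b : flim u a -> flim u b -> a = b.
Proof.
  intros Ha Hb; apply Rle_antisym;
    [apply (flim_le u u)|apply (flim_le u u)]; auto; apply filter_forall; intros; lra.
Qed.

Ltac flim_step :=
  lazymatch goal with
  | |- flim (fun n => _ - _) _ => apply flim_minus
  | |- flim (fun n => _ + _) _ => apply flim_plus
  | |- flim (fun n => _ * _) _ => apply flim_mult
  end.

Lemma qlim_mul u v p q : qlim u p -> qlim v q -> qlim (fun n => qmul (u n) (v n)) (qmul p q).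
Proof.
  intros (A0 & A1 & A2 & A3) (B0 & B1 & B2 & B3); repeat split; simpl;
    repeat flim_step; assumption.
Qed.
Lemma qlim_conj u p : qlim u p -> qlim (fun n => qconj (u n)) (qconj p).
Proof.
  intros (A0 & A1 & A2 & A3); repeat split; simpl; try apply flim_opp; assumption.
Qed.
Lemma qlim_const p : qlim (fun _ => p) p.
Proof. repeat split; apply flim_const. Qed.
Lemma qlim_ext u v p : (forall n, u n = v n) -> qlim u p -> qlim v p.
Proof.
  intros E (A0 & A1 & A2 & A3); repeat split;
    [eapply flim_ext; [|exact A0]|eapply flim_ext; [|exact A1]
    |eapply flim_ext; [|exact A2]|eapply flim_ext; [|exact A3]];
    intros n; simpl; rewrite E; reflexivity.
Qed.
Lemma qlim_add u v p q : qlim u p -> qlim v q -> qlim (fun n => qadd (u n) (v n)) (qadd p q).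
Proof.
  intros (A0 & A1 & A2 & A3) (B0 & B1 & B2 & B3); repeat split; simpl; apply flim_plus; assumption.
Qed.
Lemma qlim_scal u p a c : flim a c -> qlim u p -> qlim (fun n => qscal (a n) (u n)) (qscal c p).
Proof.
  intros Ha (A0 & A1 & A2 & A3); repeat split; simpl; apply flim_mult; assumption.
Qed.
Lemma qlim_sub u v p q : qlim u p -> qlim v q -> qlim (fun n => qsub (u n) (v n)) (qsub p q).
Proof. intros Hu Hv; apply qlim_add, qlim_scal; auto using flim_const. Qed.
Lemma flim_ip u v p q : qlim u p -> qlim v q -> flim (fun n => ip (u n) (v n)) (ip p q).
Proof.
  intros (A0 & A1 & A2 & A3) (B0 & B1 & B2 & B3); unfold ip;
    repeat flim_step; assumption.
Qed.
Lemma flim_qn u p : qlim u p -> flim (fun n => qn (u n)) (qn p).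
Proof.
  intros H; unfold qn; apply (flim_cont (fun n => ip (u n) (u n)) (ip p p) sqrt).
  - apply continuity_pt_filterlim, continuity_pt_sqrt, ip_pos.
  - apply flim_ip; exact H.
Qed.
Lemma qlim_unique u p q : qlim u p -> qlim u q -> p = q.
Proof.
  intros (A0 & A1 & A2 & A3) (B0 & B1 & B2 & B3); apply quat_ext; eapply flim_unique; eassumption.
Qed.
End Limits.

(** * Extremal curves *)

(** On unit quaternions it vanishes exactly at [gh] and its opposite, the two lifts of one
    rotation. *)
Definition pen (gh q : quat) : R := 1 - ip q gh * ip q gh.

Lemma pen_pos gh q : ip gh gh = 1 -> ip q q = 1 -> 0 <= pen gh q.
Proof. intros H1 H2; unfold pen; generalize (ip_cauchy q gh); rewrite H1, H2; lra. Qed.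

(* [ex_min] says that the curve minimises cost + K * penalty even after any
   stretch [s, t] is replaced by an arbitrary word. *)
Record ext (F : frame) (K : R) (gh : quat) (T : R) (ga : R -> quat) (A B : R -> R) : Prop := {
  ex_K : 0 <= K;
  ex_gh : ip gh gh = 1;
  ex_T : 0 <= T;
  ex_0 : ga 0 = qone;
  ex_u : forall t, 0 <= t <= T -> ip (ga t) (ga t) = 1;
  ex_cost : forall s t, 0 <= s <= t -> t <= T ->
    al F * Rabs (A t - A s) + be F * Rabs (B t - B s) <= t - s;
  ex_lin : exists C, 0 <= C /\ forall s t, 0 <= s <= t -> t <= T ->
    qn (qsub (qsub (qmul (qconj (ga s)) (ga t)) qone)
             (qscal (/ 2) (vec F (A t - A s) (B t - B s)))) <= C * ((t - s) * (t - s));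
  ex_min : forall s t q x, 0 <= s <= t -> t <= T -> reach F q x ->
    T + K * pen gh (ga T)
    <= s + x + (T - t) + K * pen gh (qmul (qmul (ga s) q) (qmul (qconj (ga t)) (ga T))) }.

Lemma ext_exists F K gh : frame_ok F -> 0 <= K -> ip gh gh = 1 ->
  exists T ga A B, ext F K gh T ga A B.
Proof.
  intros OK HK Hgh.
  set (J := fun l => pc F l + K * pen gh (pe F l)).
  assert (HJ : forall l, 0 <= J l).
  { intros l; unfold J; generalize (pc_pos F OK l) (pen_pos gh (pe F l) Hgh (pe_unit F OK l)); nra. }
  destruct (completeness (fun y => exists l, y = - J l)) as [m [Hub Hlub]].
  { exists 0; intros y [l ->]; generalize (HJ l); lra. }
  { exists (- J []); exists []; reflexivity. }
  assert (Hinf : forall l, - m <= J l).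
  { intros l; assert (- J l <= m) by (apply Hub; exists l; reflexivity); lra. }
  assert (Hseq : forall n : nat, exists l, J l < - m + / (INR n + 1)).
  { intros n; apply Classical_Prop.NNPP; intros N.
    assert (Hn : 0 < / (INR n + 1)) by (apply Rinv_0_lt_compat; generalize (pos_INR n); lra).
    assert (is_upper_bound (fun y => exists l, y = - J l) (m - / (INR n + 1))).
    { intros y [l ->]; destruct (Rle_lt_dec (- m + / (INR n + 1)) (J l)); [lra|].
      exfalso; apply N; exists l; assumption. }
    apply Hlub in H; lra. }
  apply functional_choice in Hseq; destruct Hseq as [L HL].
  destruct ultrafilter_exists as (U & FU & HU & Hev).
  set (M := - m + 1).
  assert (HLM : forall n, 0 <= pc F (L n) <= M).
  { intros n; split; [apply (pc_pos F OK)|].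
    generalize (HL n) (pen_pos gh (pe F (L n)) Hgh (pe_unit F OK (L n))).
    assert (/ (INR n + 1) <= 1).
    { apply Rle_trans with (/ 1); [apply Rinv_le_contravar; generalize (pos_INR n); lra|lra]. }
    unfold J, M; nra. }
  assert (BL := @ultra_limit U FU HU).
  destruct (BL (fun n => pc F (L n)) M) as [T HT].
  { intros n; rewrite Rabs_right; generalize (HLM n); lra. }
  assert (BLf : forall (u : nat -> R -> R), (forall t, exists M, forall n, Rabs (u n t) <= M) ->
            exists f : R -> R, forall t, @flim U (fun n => u n t) (f t)).
  { intros u Hu; apply (functional_choice (fun t y => @flim U (fun n => u n t) y)).
    intros t; destruct (Hu t) as [Mt Ht]; exact (BL _ Mt Ht). }
  (* Clamped at 0 because the limits are chosen for all real t, while [cur] is meaningful only for t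
     >= 0. *)
  set (G := fun n t => cur F (L n) (Rmax 0 t)).
  assert (HG : forall n t, qn (G n t) = 1).
  { intros n t; apply qn_unit, cur_unit; [exact OK|apply Rmax_l]. }
  assert (HAB : forall n t, al F * Rabs (cA F (L n) (Rmax 0 t)) + be F * Rabs (cB F (L n) (Rmax 0 t)) <= Rmax 0 t).
  { intros n t; destruct (cur_between F OK (L n) 0 (Rmax 0 t)) as (w & _ & Hw & EA & EB).
    { generalize (Rmax_l 0 t); lra. }
    destruct (cur_0 F OK (L n)) as (_ & Z2 & Z3); rewrite Z2 in EA; rewrite Z3 in EB.
    rewrite EA, EB, !Rplus_0_l; generalize (sum_cost F OK w); lra. }
  assert (Ha := al_pos F OK); assert (Hb := be_pos F OK).
  destruct (BLf (fun n t => q0 (G n t))) as [g0 Hg0].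
  { intros t; exists 1; intros n; rewrite <- (HG n t); apply qn_comp. }
  destruct (BLf (fun n t => q1 (G n t))) as [g1 Hg1].
  { intros t; exists 1; intros n; rewrite <- (HG n t); apply qn_comp. }
  destruct (BLf (fun n t => q2 (G n t))) as [g2 Hg2].
  { intros t; exists 1; intros n; rewrite <- (HG n t); apply qn_comp. }
  destruct (BLf (fun n t => q3 (G n t))) as [g3 Hg3].
  { intros t; exists 1; intros n; rewrite <- (HG n t); apply qn_comp. }
  destruct (BLf (fun n t => cA F (L n) (Rmax 0 t))) as [A HA].
  { intros t; exists (Rmax 0 t / al F); intros n; generalize (HAB n t).
    intros H; apply Rmult_le_reg_l with (al F); [lra|].
    replace (al F * (Rmax 0 t / al F)) with (Rmax 0 t) by (field; lra).
    generalize (Rabs_pos (cB F (L n) (Rmax 0 t))); nra. }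
  destruct (BLf (fun n t => cB F (L n) (Rmax 0 t))) as [B HB].
  { intros t; exists (Rmax 0 t / be F); intros n; generalize (HAB n t).
    intros H; apply Rmult_le_reg_l with (be F); [lra|].
    replace (be F * (Rmax 0 t / be F)) with (Rmax 0 t) by (field; lra).
    generalize (Rabs_pos (cA F (L n) (Rmax 0 t))); nra. }
  set (ga := fun t => mkQ (g0 t) (g1 t) (g2 t) (g3 t)).
  assert (Hga : forall t, @qlim U (fun n => G n t) (ga t)) by (intros t; repeat split; simpl; auto).
  assert (HT0 : 0 <= T).
  { apply (@flim_le U FU (fun _ => 0) (fun n => pc F (L n))); auto using flim_const.
    apply filter_forall; intros n; apply HLM. }
  assert (Hu : forall t, ip (ga t) (ga t) = 1).
  { intros t; eapply (@flim_unique U FU); [apply flim_ip; apply Hga|].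
    apply flim_ext with (fun _ => 1); [|apply flim_const].
    intros n; symmetry; apply cur_unit; [exact OK|apply Rmax_l]. }
  (* The n-th word ends at its own cost [pc F (L n)] and not at the limit T. The gap in cost tends
     to 0, and by [pe_near_one] so does the distance of the end points. *)
  assert (Hend : @qlim U (fun n => pe F (L n)) (ga T)).
  { assert (Hd : forall n, qn (qsub (pe F (L n)) (G n T)) <= lip F * Rabs (pc F (L n) - T)).
    { intros n; destruct (cur_tail F OK (L n) (Rmax 0 T)) as (w & -> & Hw); [apply Rmax_l|].
      fold (G n T).
      replace (qsub (qmul (G n T) (pe F w)) (G n T)) with (qmul (G n T) (qsub (pe F w) qone)) by qring.
      rewrite qn_mul, HG, Rmult_1_l.
      eapply Rle_trans; [apply (pe_near_one F OK)|].
      apply Rmult_le_compat_l; [left; apply (lip_pos F OK)|].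
      eapply Rle_trans; [exact Hw|].
      rewrite (Rmax_right 0 T) by exact HT0.
      apply Rmax_lub; [apply Rabs_pos|apply Rle_abs]. }
    assert (H0 : @flim U (fun n => lip F * Rabs (pc F (L n) - T)) 0).
    { replace 0 with (lip F * Rabs (T - T)) by (rewrite Rminus_diag, Rabs_R0; ring).
      apply flim_mult; [apply flim_const|].
      apply flim_abs, flim_minus; [exact HT|apply flim_const]. }
    assert (Hz : forall f : quat -> R, (forall p q, f (qadd p q) = f p + f q) ->
       (forall p, Rabs (f p) <= qn p) -> @flim U (fun n => f (G n T)) (f (ga T)) ->
       @flim U (fun n => f (pe F (L n))) (f (ga T))).
    { intros f Hf1 Hf2 Hf3.
      apply flim_ext with (fun n => f (G n T) + f (qsub (pe F (L n)) (G n T))).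
      { intros n; rewrite <- Hf1; f_equal; qring. }
      replace (f (ga T)) with (f (ga T) + 0) by ring.
      apply flim_plus; [exact Hf3|].
      intros Pz [eps HPz]; unfold filtermap.
      assert (HU0 : U (fun n => lip F * Rabs (pc F (L n) - T) < eps)).
      { apply (H0 (fun y => y < eps)); exists eps; intros y Hy.
        change (Rabs (y - 0) < eps) in Hy; apply Rabs_lt_between in Hy; lra. }
      apply filter_imp with (2 := HU0); intros n Hn; apply HPz.
      change (Rabs (f (qsub (pe F (L n)) (G n T)) - 0) < eps).
      rewrite Rminus_0_r; generalize (Hf2 (qsub (pe F (L n)) (G n T))) (Hd n); lra. }
    destruct (Hga T) as (L0 & L1 & L2 & L3).
    split; [|split; [|split]].
    - apply (Hz q0); auto; intros p; apply qn_comp.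
    - apply (Hz q1); auto; intros p; apply qn_comp.
    - apply (Hz q2); auto; intros p; apply qn_comp.
    - apply (Hz q3); auto; intros p; apply qn_comp. }
  assert (Hpen : forall u q, @qlim U u q -> @flim U (fun n => pen gh (u n)) (pen gh q)).
  { intros u q Hq; unfold pen; apply flim_minus; [apply flim_const|].
    apply flim_mult; apply flim_ip; auto using qlim_const. }
  assert (Hval : T + K * pen gh (ga T) <= - m).
  { apply (@flim_le U FU (fun n => J (L n)) (fun n => - m + / (INR n + 1))).
    - apply filter_forall; intros n; left; apply HL.
    - unfold J; apply flim_plus; [exact HT|]; apply flim_mult; [apply flim_const|].
      apply Hpen, Hend.
    - cut (@flim U (fun n => - m + / (INR n + 1)) (- m + 0)); [rewrite Rplus_0_r; auto|].
      apply flim_plus; [apply flim_const|].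
      intros Pz [eps HPz]; unfold filtermap.
      destruct (archimed_cor1 eps (cond_pos eps)) as (N & HN & HN0).
      apply filter_imp with (2 := Hev N); intros n Hn; apply HPz.
      change (Rabs (/ (INR n + 1) - 0) < eps).
      assert (0 < INR N) by (apply lt_0_INR; exact HN0).
      assert (INR N <= INR n) by (apply le_INR; exact Hn).
      assert (0 < / (INR n + 1)) by (apply Rinv_0_lt_compat; lra).
      rewrite Rminus_0_r, Rabs_right by lra.
      apply Rle_lt_trans with (2 := HN); apply Rinv_le_contravar; lra. }
  exists T, ga, A, B; constructor; auto.
  - eapply (@qlim_unique U FU); [apply Hga|].
    apply qlim_ext with (fun _ => qone); [|apply qlim_const].
    intros n; unfold G; rewrite Rmax_left by lra; symmetry; apply (cur_0 F OK).
  - intros s t Hst HtT.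
    apply (@flim_le U FU (fun n => al F * Rabs (cA F (L n) (Rmax 0 t) - cA F (L n) (Rmax 0 s))
              + be F * Rabs (cB F (L n) (Rmax 0 t) - cB F (L n) (Rmax 0 s))) (fun _ => t - s)).
    + apply filter_forall; intros n; rewrite !Rmax_right by lra.
      destruct (cur_between F OK (L n) s t Hst) as (w & _ & Hw & EA & EB).
      rewrite EA, EB.
      replace (cA F (L n) s + sA w - cA F (L n) s) with (sA w) by ring.
      replace (cB F (L n) s + sB w - cB F (L n) s) with (sB w) by ring.
      generalize (sum_cost F OK w); lra.
    + apply flim_plus; apply flim_mult; try apply flim_const; apply flim_abs, flim_minus; auto.
    + apply flim_const.
  - exists (lip F * lip F); split; [generalize (lip_pos F OK); nra|].
    intros s t Hst HtT.
    apply (@flim_le U FU (fun n => qn (qsub (qsub (qmul (qconj (G n s)) (G n t)) qone)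
       (qscal (/ 2) (vec F (cA F (L n) (Rmax 0 t) - cA F (L n) (Rmax 0 s))
                           (cB F (L n) (Rmax 0 t) - cB F (L n) (Rmax 0 s))))))
       (fun _ => lip F * lip F * ((t - s) * (t - s)))).
    + apply filter_forall; intros n; unfold G; rewrite !Rmax_right by lra.
      destruct (cur_between F OK (L n) s t Hst) as (w & E & Hw & EA & EB).
      rewrite E, EA, EB, qmul_assoc, qmul_conj_l, qmul_1_l by (apply cur_unit; [exact OK|lra]).
      replace (cA F (L n) s + sA w - cA F (L n) s) with (sA w) by ring.
      replace (cB F (L n) s + sB w - cB F (L n) s) with (sB w) by ring.
      eapply Rle_trans; [apply (pe_expand F OK)|].
      apply Rmult_le_compat_l; [generalize (lip_pos F OK); nra|].
      generalize (pc_pos F OK w); intros; apply Rmult_le_compat; lra.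
    + apply flim_qn, qlim_sub; [apply qlim_sub; [|apply qlim_const]|].
      * apply qlim_mul; [apply qlim_conj|]; apply Hga.
      * apply qlim_scal; [apply flim_const|]; unfold vec; apply qlim_add; apply qlim_scal;
          try apply qlim_const; apply flim_minus; auto.
    + apply flim_const.
  - intros s t q x Hst HtT (w & Ew & Hw).
    apply Rle_trans with (1 := Hval).
    (* The competitor follows the n-th word up to s, inserts [w], and resumes the n-th word at t.
       Its value is at least the infimum - m. The term [Rabs (pc F (L n) - T)] absorbs the
       difference between the n-th total cost and T. *)
    apply (@flim_le U FU (fun _ => - m) (fun n => s + x + Rabs (pc F (L n) - T) + (T - t)
        + K * pen gh (qmul (qmul (G n s) q) (qmul (qconj (G n t)) (pe F (L n)))))).
    + apply filter_forall; intros n; unfold G; rewrite !Rmax_right by lra.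
      destruct (cur_between F OK (L n) 0 s) as (w1 & E1 & Hw1 & _); [lra|].
      destruct (cur_0 F OK (L n)) as (Z1 & _); rewrite Z1, qmul_1_l in E1.
      destruct (cur_tail F OK (L n) t) as (w2 & E2 & Hw2); [lra|].
      rewrite E2, qmul_assoc with (p := qconj _), qmul_conj_l, qmul_1_l by (apply cur_unit; [exact OK|lra]).
      rewrite E1, <- Ew, <- !pe_app.
      eapply Rle_trans; [apply (Hinf ((w1 ++ w) ++ w2))|].
      unfold J; apply Rplus_le_compat_r; rewrite !pc_app.
      assert (Rmax 0 (pc F (L n) - t) <= Rabs (pc F (L n) - T) + (T - t)).
      { generalize (Rabs_pos (pc F (L n) - T)) (Rle_abs (pc F (L n) - T)); intros.
        apply Rmax_lub; lra. }
      lra.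
    + apply flim_const.
    + replace (s + x + (T - t)) with (s + x + Rabs (T - T) + (T - t)) by (rewrite Rminus_diag, Rabs_R0; ring).
      repeat (first [apply flim_plus | apply flim_const]).
      * apply flim_abs, flim_minus; [exact HT|apply flim_const].
      * apply flim_mult; [apply flim_const|]; apply Hpen.
        apply qlim_mul; apply qlim_mul; auto using qlim_const, qlim_conj.
Qed.

(** * The covector along an extremal curve *)

(** Its product with an imaginary w is the rate at which K [pen] falls when the end point is
    multiplied on the left by the lift of a rotation about w ([lam_ip]). The 2 from the square
    cancels the half angle. *)
Definition lam (K : R) (gh : quat) (T : R) (ga : R -> quat) : quat :=
  let L := qmul gh (qconj (ga T)) in
  qscal (K * ip (ga T) gh) (mkQ 0 (q1 L) (q2 L) (q3 L)).

(** A letter v inserted at time t moves the end point by the conjugate of v under [ga t].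
    Conjugating the covector instead turns the effect of v into the product of h(t) and v
    ([h_ip]). *)
Definition hh (K : R) (gh : quat) (T : R) (ga : R -> quat) (t : R) : quat :=
  qmul (qmul (qconj (ga t)) (lam K gh T ga)) (ga t).

Lemma ext_rot F K gh T ga A B :
  ext F K gh T ga A B -> ext (rotF F) K gh T ga B (fun t => - A t).
Proof.
  intros E; destruct E as [H1 H2 H3 H4 H5 H6 H7 H8]; constructor; auto.
  - intros s t Hs Ht; simpl; specialize (H6 s t Hs Ht).
    replace (- A t - - A s) with (- (A t - A s)) by ring; rewrite Rabs_Ropp; lra.
  - destruct H7 as (C & HC & H7); exists C; split; [exact HC|]; intros s t Hs Ht.
    specialize (H7 s t Hs Ht).
    replace (vec (rotF F) (B t - B s) (- A t - - A s)) with (vec F (A t - A s) (B t - B s))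
      by (unfold vec; simpl; qring); exact H7.
  - intros s t q x Hs Ht Hr; apply H8; auto using reach_rot_inv.
Qed.

Lemma ext_flip F K gh T ga A B :
  ext F K gh T ga A B -> ext (flipF F) K gh T ga A (fun t => - B t).
Proof.
  intros E; destruct E as [H1 H2 H3 H4 H5 H6 H7 H8]; constructor; auto.
  - intros s t Hs Ht; simpl; specialize (H6 s t Hs Ht).
    replace (- B t - - B s) with (- (B t - B s)) by ring; rewrite Rabs_Ropp; lra.
  - destruct H7 as (C & HC & H7); exists C; split; [exact HC|]; intros s t Hs Ht.
    specialize (H7 s t Hs Ht).
    replace (vec (flipF F) (A t - A s) (- B t - - B s)) with (vec F (A t - A s) (B t - B s))
      by (unfold vec; simpl; qring); exact H7.
  - intros s t q x Hs Ht Hr; apply H8; auto using reach_flip_inv.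
Qed.

(** Stands in for comparing derivatives at 0: it extracts the first-order inequality from an
    estimate with quadratic error. *)
Lemma le_of_quadratic y w C :
  (forall e, 0 < e < 1 -> y * e <= w * e + C * (e * e)) -> y <= w.
Proof.
  intros H; apply Rnot_lt_le; intros Hlt.
  assert (HC : 0 < Rabs C + 1) by (generalize (Rabs_pos C); lra).
  set (e := Rmin (1 / 2) ((y - w) / 2 / (Rabs C + 1))).
  assert (He : 0 < e) by (apply Rmin_glb_lt; [lra|]; apply Rdiv_lt_0_compat; lra).
  assert (He1 : e <= 1 / 2) by apply Rmin_l.
  assert (He2 : e * (Rabs C + 1) <= (y - w) / 2).
  { apply Rle_trans with ((y - w) / 2 / (Rabs C + 1) * (Rabs C + 1));
      [apply Rmult_le_compat_r; [lra|apply Rmin_r]|right; field; lra]. }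
  clearbody e; assert (He3 : e < 1) by lra.
  specialize (H e (conj He He3)); generalize (Rle_abs C); intros.
  assert (y <= w + C * e) by (apply Rmult_le_reg_r with e; nra).
  assert (C * e <= Rabs C * e) by (apply Rmult_le_compat_r; lra). nra.
Qed.

Lemma ip_abs_le p q a b : qn p <= a -> qn q <= b -> Rabs (ip p q) <= a * b.
Proof.
  intros Ha Hb; eapply Rle_trans; [apply ip_le|].
  apply Rmult_le_compat; auto using qn_pos.
Qed.

(** The exact remainder of the first-order expansion of the conjugate of k by p, for p close to 1.
    Every term on the right is quadratic in u or contains e, which is itself of second order in the
    application. *)
Lemma conj_expand (k u e : quat) : q0 u = 0 ->
  let p := qadd (qadd qone (qscal (/ 2) u)) e in
  qsub (qsub (qmul (qmul (qconj p) k) p) k) (qscal (/ 2) (qsub (qmul k u) (qmul u k)))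
  = qadd (qscal (- / 4) (qmul (qmul u k) u))
      (qadd (qmul (qmul (qconj e) k) p) (qmul (qmul (qadd qone (qscal (- / 2) u)) k) e)).
Proof.
  destruct k, u, e; simpl; intros ->; apply quat_ext; simpl; field.
Qed.

Section Ext.
Variables (F : frame) (K : R) (gh : quat) (T : R) (ga : R -> quat) (A B : R -> R).
Hypothesis OK : frame_ok F.
Hypothesis E : ext F K gh T ga A B.

Let h := hh K gh T ga.
Let L := lam K gh T ga.
Let a0 := ip (ga T) gh.

Lemma lam_0 : q0 L = 0.
Proof. unfold L, lam; simpl; ring. Qed.

Lemma ga_T : ip (ga T) (ga T) = 1.
Proof. apply (ex_u _ _ _ _ _ _ _ E); generalize (ex_T _ _ _ _ _ _ _ E); lra. Qed.

Lemma lam_ip w : q0 w = 0 -> ip L w = K * a0 * ip (qmul w (ga T)) gh.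
Proof.
  intros Hw; rewrite ip_mul_r_conj; unfold L, lam, a0, ip; simpl; rewrite Hw; ring.
Qed.

Lemma h_0 t : q0 (h t) = 0.
Proof.
  assert (G : forall g v, q0 v = 0 -> q0 (qmul (qmul (qconj g) v) g) = 0)
    by (intros g v Hv; simpl; rewrite Hv; ring).
  apply G, lam_0.
Qed.

Lemma h_ip t v : ip (h t) v = ip L (qmul (qmul (ga t) v) (qconj (ga t))).
Proof.
  unfold h, hh; fold L; rewrite ip_mul_r_conj, ip_mul_l_conj, qconj_conj, qmul_assoc; reflexivity.
Qed.

Lemma conj_imag g v : q0 v = 0 -> q0 (qmul (qmul g v) (qconj g)) = 0.
Proof. intros Hv; simpl; rewrite Hv; ring. Qed.

Lemma h_norm t : 0 <= t <= T -> ip (h t) (h t) = ip L L.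
Proof.
  intros Ht; unfold h, hh; fold L; rewrite ip_mul_sq, ip_mul_sq, ip_conj, (ex_u _ _ _ _ _ _ _ E t Ht); ring.
Qed.

Lemma a0_le : Rabs a0 <= 1.
Proof.
  unfold a0; replace 1 with (1 * 1) by ring.
  apply ip_abs_le; right; apply qn_unit; [apply ga_T|apply (ex_gh _ _ _ _ _ _ _ E)].
Qed.

(** Insert the short word at time t: the cost grows by w e, and the penalty falls by e times the
    product of h(t) and v, up to O(e^2). Minimality compares the two at first order. *)
Lemma pmp v w : unitv v -> (forall e, 0 < e < 1 -> reach F (rt v e) (w * e)) ->
  forall t, 0 <= t <= T -> ip (h t) v <= w.
Proof.
  intros Hv Hr t Ht.
  assert (Hg := ex_gh _ _ _ _ _ _ _ E); assert (HK := ex_K _ _ _ _ _ _ _ E).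
  assert (Hu := ex_u _ _ _ _ _ _ _ E t Ht).
  set (V := qmul (qmul (ga t) v) (qconj (ga t))).
  assert (HV0 : q0 V = 0) by (apply conj_imag, Hv).
  rewrite h_ip; fold V; rewrite (lam_ip V HV0).
  set (b := ip (qmul V (ga T)) gh).
  assert (HVn : qn V = 1).
  { apply qn_unit; unfold V; rewrite !ip_mul_sq, ip_conj, Hu; destruct Hv as [_ ->]; ring. }
  assert (Hb : Rabs b <= 1).
  { unfold b; replace 1 with (1 * 1) by ring; apply ip_abs_le; right.
    - rewrite qn_mul, HVn, (qn_unit _ ga_T); ring.
    - apply qn_unit, Hg. }
  apply le_of_quadratic with (2 * K + K); intros e He.
  assert (Hm := ex_min _ _ _ _ _ _ _ E t t (rt v e) (w * e) (conj (proj1 Ht) (Rle_refl t)) (proj2 Ht) (Hr e He)).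
  assert (Eq : qmul (qmul (ga t) (rt v e)) (qmul (qconj (ga t)) (ga T))
               = qadd (qscal (cos (e / 2)) (ga T)) (qscal (sin (e / 2)) (qmul V (ga T)))).
  { transitivity (qmul (qadd (qscal (cos (e/2)) (qmul (ga t) (qconj (ga t)))) (qscal (sin (e/2)) V)) (ga T)).
    - unfold rt, V; qring.
    - rewrite qmul_conj_r by exact Hu; qring. }
  rewrite Eq in Hm; unfold pen in Hm.
  rewrite ip_add_l, !ip_scal_l in Hm; fold a0 b in Hm.
  assert (Hab : a0 * b <= 1 /\ -1 <= a0 * b).
  { generalize a0_le; intros H1; apply Rabs_le_between in H1; apply Rabs_le_between in Hb; nra. }
  assert (Hb2 : 0 <= b * b) by nra.
  assert (Ha2 : a0 * a0 <= 1).
  { generalize a0_le; intros H1; apply Rabs_le_between in H1; nra. }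
  set (c := cos (e / 2)) in *; set (s := sin (e / 2)) in *.
  assert (Hcs : c * c + s * s = 1) by (unfold c, s; generalize (sin2_cos2 (e/2)); unfold Rsqr; lra).
  assert (Hsin : 2 * (c * s) = sin e).
  { unfold c, s; replace e with (2 * (e / 2)) at 3 by field; rewrite sin_2a; ring. }
  assert (H1 : Rabs (sin e - e) <= e * e) by (apply sin_minus_id; lra).
  apply Rabs_le_between in H1.
  assert (H2 : s * s <= e * e).
  { generalize (one_minus_cos e); replace e with (2 * (e / 2)) at 2 by field; rewrite cos_2a_sin; fold s; nra. }
  assert (Hk : K * (a0 * b * sin e) <= w * e + K * (s * s)).
  { assert (K * (s * s * (a0 * a0)) <= K * (s * s)).
    { apply Rmult_le_compat_l; [exact HK|]; nra. }
    assert (0 <= K * (s * s * (b * b))) by (apply Rmult_le_pos; nra).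
    rewrite <- Hsin.
    replace (c * a0 + s * b) with (c * a0 + s * b) in Hm by ring.
    assert (Hx : (c * a0 + s * b) * (c * a0 + s * b) = (1 - s * s) * (a0 * a0) + 2 * (c * s) * (a0 * b) + s * s * (b * b)).
    { replace (1 - s * s) with (c * c) by lra; ring. }
    rewrite Hx in Hm; nra. }
  assert (K * (a0 * b * e) <= K * (a0 * b * sin e) + K * (e * e)).
  { rewrite <- Rmult_plus_distr_l; apply Rmult_le_compat_l; [exact HK|]; nra. }
  assert (K * (s * s) <= K * (e * e)) by (apply Rmult_le_compat_l; lra).
  assert (0 <= K * (e * e)) by (apply Rmult_le_pos; nra).
  lra.
Qed.

Lemma hp_le t : 0 <= t <= T -> Rabs (ip (h t) (fP F)) <= al F.
Proof.
  intros Ht; apply Rabs_le; split.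
  - assert (ip (h t) (qopp (fP F)) <= al F).
    { apply pmp; [apply unitv_opp, OK| |exact Ht].
      intros e He; rewrite rt_opp; eapply reach_le; [apply (reach_P F OK)|].
      rewrite Rabs_Ropp, Rabs_right; lra. }
    replace (ip (h t) (qopp (fP F))) with (- ip (h t) (fP F)) in H by (unfold ip; simpl; ring); lra.
  - apply pmp; [apply OK| |exact Ht].
    intros e He; eapply reach_le; [apply (reach_P F OK)|]; rewrite Rabs_right; lra.
Qed.

Lemma dvec_le s t : 0 <= s <= t -> t <= T -> qn (vec F (A t - A s) (B t - B s)) <= lip F * (t - s).
Proof.
  intros Hs Ht; eapply Rle_trans; [apply (qn_vec F OK)|].
  eapply Rle_trans; [apply (abs_le_cost F OK)|].
  apply Rmult_le_compat_l; [left; apply (lip_pos F OK)|]; apply (ex_cost _ _ _ _ _ _ _ E); assumption.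
Qed.

(** Deleting the stretch [s, t] saves t - s, which cannot exceed the increase of the penalty.
    Together with [pmp] and [ex_cost] this forces equality to first order in h.(A' P + B' Q) <= al
    |A'| + be |B'| <= 1: the velocity maximises h. *)
Lemma cut_ineq : exists C, 0 <= C /\ forall s t, 0 <= s <= t -> t <= T ->
  t - s - C * ((t - s) * (t - s)) <= ip (h s) (vec F (A t - A s) (B t - B s)).
Proof.
  destruct (ex_lin _ _ _ _ _ _ _ E) as (C & HC & Hl).
  assert (HK := ex_K _ _ _ _ _ _ _ E); assert (Hg := ex_gh _ _ _ _ _ _ _ E).
  exists (2 * K * C); split; [nra|]; intros s t Hs Ht.
  assert (Hm := ex_min _ _ _ _ _ _ _ E s t qone 0 Hs Ht (reach_one F)).
  assert (Hus := ex_u _ _ _ _ _ _ _ E s (ltac:(lra))); assert (Hut := ex_u _ _ _ _ _ _ _ E t (ltac:(lra))).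
  specialize (Hl s t Hs Ht).
  set (u := vec F (A t - A s) (B t - B s)) in *.
  set (e := qsub (qsub (qmul (qconj (ga s)) (ga t)) qone) (qscal (/ 2) u)) in *.
  assert (Hu0 : q0 u = 0) by apply (vec_0 F OK).
  clearbody u.
  set (V := qmul (qmul (ga s) u) (qconj (ga s))).
  set (eta := ip (qmul (qmul (ga s) (qconj e)) (qmul (qconj (ga s)) (ga T))) gh).
  rewrite h_ip; fold V; rewrite (lam_ip V (conj_imag _ _ Hu0)).
  set (b := ip (qmul V (ga T)) gh).
  assert (Eq : ip (qmul (qmul (ga s) qone) (qmul (qconj (ga t)) (ga T))) gh = a0 - / 2 * b + eta).
  { unfold eta, b, a0.
    replace (ip (ga T) gh - / 2 * ip (qmul V (ga T)) gh) with (ip (qsub (ga T) (qscal (/ 2) (qmul V (ga T)))) gh)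
      by (unfold ip; simpl; ring).
    rewrite <- ip_add_l; apply (f_equal (fun x => ip x gh)).
    assert (E1 : qconj (ga t) = qmul (qadd (qadd qone (qscal (- / 2) u)) (qconj e)) (qconj (ga s))).
    { transitivity (qmul (qmul (qconj (ga t)) (ga s)) (qconj (ga s))).
      - rewrite <- qmul_assoc, qmul_conj_r, qmul_1_r by exact Hus; reflexivity.
      - f_equal; unfold e; apply quat_ext; simpl; try rewrite Hu0; field. }
    transitivity (qadd (qsub (qmul (qmul (ga s) (qconj (ga s))) (ga T)) (qscal (/ 2) (qmul V (ga T))))
                    (qmul (qmul (ga s) (qconj e)) (qmul (qconj (ga s)) (ga T)))).
    - rewrite E1; unfold V; clearbody e; clear; qring.
    - rewrite qmul_conj_r, qmul_1_l by exact Hus; reflexivity. }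
  unfold pen in Hm; rewrite Eq in Hm; fold a0 in Hm.
  assert (He : Rabs eta <= C * ((t - s) * (t - s))).
  { unfold eta; rewrite <- (Rmult_1_r (C * _)); apply ip_abs_le.
    - rewrite !qn_mul, !qn_conj, (qn_unit _ Hus), (qn_unit _ ga_T); lra.
    - right; apply qn_unit, Hg. }
  generalize a0_le; intros H1; apply Rabs_le_between in H1; apply Rabs_le_between in He.
  assert (H2 : - (2 * K * (a0 * eta)) <= 2 * K * C * ((t - s) * (t - s))).
  { replace (2 * K * C * ((t - s) * (t - s))) with (2 * K * (C * ((t - s) * (t - s)))) by ring.
    replace (- (2 * K * (a0 * eta))) with (2 * K * - (a0 * eta)) by ring.
    apply Rmult_le_compat_l; [lra|]; nra. }
  assert (0 <= K * ((/ 2 * b - eta) * (/ 2 * b - eta)))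
    by (apply Rmult_le_pos; [exact HK|exact (Rle_0_sqr (/ 2 * b - eta))]).
  nra.
Qed.

Definition rr : R := qn L.

Lemma transport s t : 0 <= s <= t -> t <= T ->
  h t = qmul (qmul (qconj (qmul (qconj (ga s)) (ga t))) (h s)) (qmul (qconj (ga s)) (ga t)).
Proof.
  intros Hs Ht; assert (Hus := ex_u _ _ _ _ _ _ _ E s (ltac:(lra))).
  unfold h, hh; fold L; rewrite qconj_mul, qconj_conj.
  rewrite !qmul_assoc.
  rewrite <- (qmul_assoc (qconj (ga t)) (ga s) (qconj (ga s))), qmul_conj_r, qmul_1_r by exact Hus.
  rewrite <- (qmul_assoc _ (ga s) (qconj (ga s))), qmul_conj_r, qmul_1_r by exact Hus.
  reflexivity.
Qed.

(** The adjoint equation h' = (h u - u h) / 2 in integrated form, since the velocity u exists only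
    through the increments of A and B. *)
Lemma h_expand : exists C, 0 <= C /\ forall s t, 0 <= s <= t -> t <= T ->
  qn (qsub (qsub (h t) (h s))
        (qscal (/ 2) (qsub (qmul (h s) (vec F (A t - A s) (B t - B s)))
                           (qmul (vec F (A t - A s) (B t - B s)) (h s))))) <= C * ((t - s) * (t - s)) /\
  qn (qsub (h t) (h s)) <= C * (t - s).
Proof.
  destruct (ex_lin _ _ _ _ _ _ _ E) as (C & HC & Hl).
  assert (HT := ex_T _ _ _ _ _ _ _ E).
  assert (Hrr : 0 <= rr) by apply qn_pos.
  assert (Hlp := lip_pos F OK).
  set (D := rr * (lip F * lip F + 2 * C + lip F * C * T)).
  assert (HD : 0 <= D).
  { unfold D; apply Rmult_le_pos; [exact Hrr|].
    assert (0 <= lip F * C * T) by (repeat apply Rmult_le_pos; lra). nra. }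
  exists (D * (1 + T) + rr * lip F); split; [nra|]; intros s t Hs Ht.
  specialize (Hl s t Hs Ht); assert (Hu := dvec_le s t Hs Ht).
  assert (Hus := ex_u _ _ _ _ _ _ _ E s (ltac:(lra))); assert (Hut := ex_u _ _ _ _ _ _ _ E t (ltac:(lra))).
  set (u := vec F (A t - A s) (B t - B s)) in *.
  set (p := qmul (qconj (ga s)) (ga t)) in *.
  set (e := qsub (qsub p qone) (qscal (/ 2) u)) in *.
  assert (Hu0 : q0 u = 0) by apply (vec_0 F OK).
  assert (Hn : qn (h s) = rr) by (unfold qn, rr, qn; rewrite h_norm by lra; reflexivity).
  assert (Hp : qn p = 1) by (unfold p; rewrite qn_mul, qn_conj, (qn_unit _ Hus), (qn_unit _ Hut); ring).
  set (d := t - s) in *; assert (Hd : 0 <= d <= T) by (unfold d; lra).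
  set (X := qscal (/ 2) (qsub (qmul (h s) u) (qmul u (h s)))).
  assert (EQ : qsub (qsub (h t) (h s)) X =
    qadd (qscal (- / 4) (qmul (qmul u (h s)) u))
      (qadd (qmul (qmul (qconj e) (h s)) p) (qmul (qmul (qadd qone (qscal (- / 2) u)) (h s)) e))).
  { unfold X; rewrite (transport s t Hs Ht); fold p.
    assert (Ep : p = qadd (qadd qone (qscal (/ 2) u)) e) by (unfold e; generalize p u; qring).
    rewrite Ep at 1 2 3; apply conj_expand, Hu0. }
  assert (Hcl : C * (d * d) <= C * T * d).
  { rewrite Rmult_assoc; apply Rmult_le_compat_l; [exact HC|]; apply Rmult_le_compat_r; lra. }
  assert (H1 : qn (qsub (qsub (h t) (h s)) X) <= D * (d * d)).
  { rewrite EQ; eapply Rle_trans; [apply qn_add|].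
    eapply Rle_trans; [apply Rplus_le_compat_l, qn_add|].
    rewrite qn_scal, !qn_mul, qn_conj, Hn, Hp, Rabs_left by lra.
    assert (H2 : qn (qadd qone (qscal (- / 2) u)) <= 1 + lip F * d).
    { eapply Rle_trans; [apply qn_add|]; rewrite qn_scal, Rabs_left by lra.
      rewrite (qn_unit qone) by (unfold ip; simpl; ring).
      generalize (qn_pos u); lra. }
    assert (H3 : qn u * rr * qn u <= rr * (lip F * lip F) * (d * d)).
    { replace (rr * (lip F * lip F) * (d * d)) with ((lip F * d) * rr * (lip F * d)) by ring.
      apply Rmult_le_compat; [generalize (qn_pos u); nra|apply qn_pos| |lra].
      apply Rmult_le_compat_r; lra. }
    assert (H4 : qn (qadd qone (qscal (- / 2) u)) * rr * qn e <= (1 + lip F * T) * rr * (C * (d * d))).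
    { apply Rmult_le_compat; [generalize (qn_pos (qadd qone (qscal (- / 2) u))); nra|apply qn_pos| |lra].
      apply Rmult_le_compat_r; [lra|].
      assert (lip F * d <= lip F * T) by (apply Rmult_le_compat_l; lra). lra. }
    assert (H5 : qn e * rr * 1 <= rr * C * (d * d)).
    { rewrite Rmult_1_r; replace (rr * C * (d * d)) with (C * (d * d) * rr) by ring.
      apply Rmult_le_compat_r; lra. }
    assert (0 <= qn u * rr * qn u) by (generalize (qn_pos u); intros; repeat apply Rmult_le_pos; lra).
    unfold D; nra. }
  split.
  - eapply Rle_trans; [exact H1|].
    assert (0 <= d * d) by nra.
    assert (0 <= rr * lip F * (d * d)) by (apply Rmult_le_pos; nra).
    assert (0 <= D * T * (d * d)) by (apply Rmult_le_pos; nra).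
    clearbody D d; nra.
  - assert (H6 : qn X <= rr * lip F * d).
    { unfold X; rewrite qn_scal, Rabs_right by lra.
      assert (qn (qsub (qmul (h s) u) (qmul u (h s))) <= 2 * (rr * (lip F * d))).
      { eapply Rle_trans; [apply qn_sub|]; rewrite !qn_mul, Hn.
        assert (rr * qn u <= rr * (lip F * d)) by (apply Rmult_le_compat_l; lra). lra. }
      lra. }
    clearbody X.
    replace (qsub (h t) (h s)) with (qadd (qsub (qsub (h t) (h s)) X) X)
      by (generalize (h t) (h s); qring).
    eapply Rle_trans; [apply qn_add|].
    assert (D * (d * d) <= D * T * d).
    { rewrite Rmult_assoc; apply Rmult_le_compat_l; [exact HD|]; apply Rmult_le_compat_r; lra. }
    assert (0 <= D * d) by nra.
    nra.
Qed.
End Ext.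

(** * Elementary real analysis *)

Definition lipschitz_on (f : R -> R) (a b : R) : Prop :=
  exists C, 0 <= C /\ forall s t, a <= s <= t -> t <= b -> Rabs (f t - f s) <= C * (t - s).

Lemma lipschitz_sub f a b a' b' : lipschitz_on f a b -> a <= a' -> b' <= b -> lipschitz_on f a' b'.
Proof. intros (C & HC & H) Ha Hb; exists C; split; [exact HC|]; intros; apply H; lra. Qed.

Lemma lipschitz_near f a b : lipschitz_on f a b -> forall t eps, a <= t <= b -> 0 < eps ->
  exists eta, 0 < eta /\ forall t', a <= t' <= b -> Rabs (t' - t) < eta -> Rabs (f t' - f t) < eps.
Proof.
  intros (C & HC & H) t eps Ht He; exists (eps / (C + 1)).
  split; [apply Rdiv_lt_0_compat; lra|]; intros t' Ht' Hd.
  assert (Hk : C * Rabs (t' - t) < eps).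
  { apply Rle_lt_trans with ((C + 1) * Rabs (t' - t)); [apply Rmult_le_compat_r; [apply Rabs_pos|lra]|].
    replace eps with ((C + 1) * (eps / (C + 1))) by (field; lra).
    apply Rmult_lt_compat_l; lra. }
  destruct (Rle_dec t t').
  - rewrite (Rabs_right (t' - t)) in Hk by lra; eapply Rle_lt_trans; [apply H; lra|exact Hk].
  - rewrite (Rabs_left (t' - t)) in Hk by lra; rewrite Rabs_minus_sym.
    eapply Rle_lt_trans; [apply H; lra|lra].
Qed.

Lemma lipschitz_pos f a b : lipschitz_on f a b -> forall t, a <= t <= b -> 0 < f t ->
  exists eta, 0 < eta /\ forall t', a <= t' <= b -> Rabs (t' - t) < eta -> 0 < f t'.
Proof.
  intros Hf t Ht Hp; destruct (lipschitz_near _ _ _ Hf t (f t) Ht Hp) as (eta & He & H).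
  exists eta; split; [exact He|]; intros t' Ht' Hd.
  specialize (H t' Ht' Hd); apply Rabs_lt_between in H; lra.
Qed.

Lemma lipschitz_opp f a b : lipschitz_on f a b -> lipschitz_on (fun t => - f t) a b.
Proof.
  intros (C & HC & H); exists C; split; [exact HC|]; intros s t Hs Ht.
  replace (- f t - - f s) with (- (f t - f s)) by ring; rewrite Rabs_Ropp; apply H; assumption.
Qed.

(** G is asked for on open intervals only: at t0 the covector usually sits on a corner, where the
    strict inequality that defines the arc fails. *)
Lemma first_exit (G : R -> Prop) t0 T : t0 < T ->
  (exists eta, 0 < eta /\ forall t, t0 < t < t0 + eta -> t < T -> G t) ->
  (forall t, t0 < t < T -> G t -> exists eta, 0 < eta /\ forall t', Rabs (t' - t) < eta -> t0 < t' < T -> G t') ->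
  exists t1, t0 < t1 <= T /\ (forall t, t0 < t < t1 -> G t) /\ (t1 = T \/ ~ G t1).
Proof.
  intros HT (eta & He & H0) Hop.
  set (S := fun t => t0 < t <= T /\ forall t', t0 < t' < t -> G t').
  destruct (completeness S) as [t1 [Hub Hlub]].
  { exists T; intros t [Ht _]; lra. }
  { exists (Rmin T (t0 + eta)); split.
    - split; [apply Rmin_glb_lt; lra|apply Rmin_l].
    - intros t' Ht'; apply H0.
      + generalize (Rmin_r T (t0 + eta)); lra.
      + generalize (Rmin_l T (t0 + eta)); lra. }
  assert (Hm : S (Rmin T (t0 + eta))).
  { split.
    - split; [apply Rmin_glb_lt; lra|apply Rmin_l].
    - intros t' Ht'; apply H0.
      + generalize (Rmin_r T (t0 + eta)); lra.
      + generalize (Rmin_l T (t0 + eta)); lra. }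
  assert (H1 : t0 < t1).
  { apply Rlt_le_trans with (2 := Hub _ Hm); apply Hm. }
  assert (H2 : t1 <= T) by (apply Hlub; intros t [Ht _]; lra).
  assert (H3 : forall t, t0 < t < t1 -> G t).
  { intros t Ht; apply Classical_Prop.NNPP; intros N.
    assert (is_upper_bound S t); [|apply Hlub in H; lra].
    intros t' [Ht' HG]; apply Rnot_lt_le; intros Hlt; apply N, HG; lra. }
  exists t1; repeat split; try assumption.
  destruct (Req_dec t1 T) as [|NT]; [left; assumption|right; intros HG].
  destruct (Hop t1) as (e & He1 & Hn); [lra|exact HG|].
  set (t2 := Rmin T (t1 + e / 2)).
  assert (t1 < t2) by (apply Rmin_glb_lt; lra).
  assert (Hx : S t2).
  { split; [split; [lra|apply Rmin_l]|]; intros t' Ht'.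
    destruct (Rlt_dec t' t1); [apply H3; lra|].
    apply Hn; [|split; [lra|apply Rlt_le_trans with t2; [lra|apply Rmin_l]]].
    generalize (Rmin_r T (t1 + e / 2)); fold t2; intros; rewrite Rabs_right; lra. }
  apply Hub in Hx; lra.
Qed.

Lemma lipschitz_zero f a b : lipschitz_on f a b -> a < b -> f a < 0 -> 0 < f b ->
  exists t, a < t < b /\ f t = 0.
Proof.
  intros Hf Hab Ha Hb.
  destruct (first_exit (fun t => f t < 0) a b Hab) as (t1 & Ht1 & Hn & Hx).
  - destruct (lipschitz_pos (fun t => - f t) a b (lipschitz_opp _ _ _ Hf) a) as (eta & He & H); [lra|lra|].
    exists eta; split; [exact He|]; intros t Ht HtT.
    assert (0 < - f t); [|lra]. apply H; [lra|rewrite Rabs_right; lra].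
  - intros t Ht Hft.
    destruct (lipschitz_pos (fun t => - f t) a b (lipschitz_opp _ _ _ Hf) t) as (eta & He & H); [lra|lra|].
    exists eta; split; [exact He|]; intros t' Hd Ht'.
    assert (0 < - f t'); [|lra]. apply H; [lra|exact Hd].
  - assert (Hle : f t1 <= 0).
    { apply Rnot_lt_le; intros Hp.
      destruct (lipschitz_pos f a b Hf t1) as (eta & He & H); [lra|exact Hp|].
      set (u := Rmax ((a + t1) / 2) (t1 - eta / 2)).
      assert (u < t1) by (apply Rmax_lub_lt; lra).
      assert (a < u) by (apply Rlt_le_trans with ((a + t1) / 2); [lra|apply Rmax_l]).
      assert (t1 - eta / 2 <= u) by apply Rmax_r.
      specialize (Hn u (ltac:(lra))).
      assert (0 < f u); [|lra]. apply H; [lra|rewrite Rabs_left; lra]. }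
    destruct Hx as [->|Hx]; [lra|].
    exists t1; split; [|lra].
    split; [lra|]; destruct (Rle_lt_or_eq_dec _ _ (proj2 Ht1)) as [|E]; [assumption|subst; lra].
Qed.

(** The derivative is 0 at interior points, and the Lipschitz bound reaches the end points. M and
    eta may depend on t, which is all that the estimates along a curve provide. *)
Lemma loc_quad_const f a b : a < b -> lipschitz_on f a b ->
  (forall t, a < t < b -> exists M eta, 0 < eta /\
     forall t', a < t' < b -> Rabs (t' - t) < eta -> Rabs (f t' - f t) <= M * ((t' - t) * (t' - t))) ->
  forall t, a <= t <= b -> f t = f a.
Proof.
  intros Hab Hl Hq.
  assert (Hd : forall x, a < x < b -> derivable_pt_lim f x 0).
  { intros x Hx eps He; destruct (Hq x Hx) as (M & eta & Het & H).
    set (M' := Rabs M + 1); assert (HM : 0 < M') by (unfold M'; generalize (Rabs_pos M); lra).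
    set (d := Rmin (Rmin eta (eps / M')) (Rmin (x - a) (b - x))).
    assert (Hd : 0 < d).
    { unfold d; repeat apply Rmin_glb_lt; try lra; apply Rdiv_lt_0_compat; lra. }
    exists (mkposreal d Hd); simpl; intros h Hh0 Hh.
    assert (Hh1 : Rabs h < eta) by (eapply Rlt_le_trans; [exact Hh|]; unfold d; eapply Rle_trans; [apply Rmin_l|apply Rmin_l]).
    assert (Hh2 : Rabs h < eps / M') by (eapply Rlt_le_trans; [exact Hh|]; unfold d; eapply Rle_trans; [apply Rmin_l|apply Rmin_r]).
    assert (Hh3 : Rabs h < x - a) by (eapply Rlt_le_trans; [exact Hh|]; unfold d; eapply Rle_trans; [apply Rmin_r|apply Rmin_l]).
    assert (Hh4 : Rabs h < b - x) by (eapply Rlt_le_trans; [exact Hh|]; unfold d; eapply Rle_trans; [apply Rmin_r|apply Rmin_r]).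
    apply Rabs_lt_between in Hh3; apply Rabs_lt_between in Hh4.
    specialize (H (x + h) (ltac:(lra))); replace (x + h - x) with h in H by ring; specialize (H Hh1).
    rewrite Rminus_0_r; unfold Rdiv; rewrite Rabs_mult, Rabs_inv.
    assert (Hp : 0 < Rabs h) by (apply Rabs_pos_lt; exact Hh0).
    apply Rmult_lt_reg_r with (Rabs h); [exact Hp|].
    rewrite Rmult_assoc, Rinv_l, Rmult_1_r by lra.
    eapply Rle_lt_trans; [exact H|].
    assert (M * (h * h) <= M' * (Rabs h * Rabs h)).
    { rewrite <- (Rabs_right (h * h)), Rabs_mult by (apply Rle_ge, Rle_0_sqr).
      apply Rmult_le_compat_r; [nra|]; unfold M'; generalize (Rle_abs M); lra. }
    assert (M' * Rabs h < eps).
    { replace eps with (M' * (eps / M')) by (field; lra); apply Rmult_lt_compat_l; lra. }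
    nra. }
  assert (Hin : forall s t, a < s <= t -> t < b -> f s = f t).
  { intros s t Hs Ht; destruct (Rle_lt_or_eq_dec _ _ (proj2 Hs)) as [Hlt| ->]; [|reflexivity].
    destruct (MVT_cor2 f (fun _ => 0) s t Hlt) as (x & Ex & _); [intros; apply Hd; lra|lra]. }
  assert (Hin2 : forall s t, a < s < b -> a < t < b -> f s = f t).
  { intros s t Hs Ht; destruct (Rle_dec s t); [|symmetry]; apply Hin; lra. }
  set (mid := (a + b) / 2).
  assert (Hend : forall t, a <= t <= b -> f t = f mid).
  { intros t Ht; apply Rminus_diag_uniq.
    apply cond_eq; intros eps He; rewrite Rminus_0_r.
    destruct (lipschitz_near _ _ _ Hl t eps Ht He) as (eta & Het & H).
    set (u := if Rle_dec t mid then t + Rmin (eta / 2) ((b - a) / 4) else t - Rmin (eta / 2) ((b - a) / 4)).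
    assert (Hm : 0 < Rmin (eta / 2) ((b - a) / 4)) by (apply Rmin_glb_lt; lra).
    assert (Hm1 := Rmin_l (eta / 2) ((b - a) / 4)); assert (Hm2 := Rmin_r (eta / 2) ((b - a) / 4)).
    assert (Hu : a < u < b /\ Rabs (u - t) < eta).
    { unfold u, mid; destruct (Rle_dec t ((a + b) / 2)).
      - split; [lra|]; rewrite Rabs_right; lra.
      - split; [lra|]; rewrite Rabs_left; lra. }
    rewrite <- (Hin2 u mid) by (unfold mid; lra).
    rewrite Rabs_minus_sym; apply H; [lra|apply Hu]. }
  intros t Ht; rewrite (Hend t Ht), (Hend a) by lra; reflexivity.
Qed.

(** Multiply the curve by the inverse of the expected solution: the increments of the product are
    quadratic, so each of its coordinates is constant. *)
Lemma curve_of_velocity (ga : R -> quat) (U : quat) (k a b : R) : a <= b -> unitv U ->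
  (forall t, a <= t <= b -> ip (ga t) (ga t) = 1) ->
  (exists C, 0 <= C /\ forall s t, a <= s <= t -> t <= b ->
    qn (qsub (qsub (qmul (qconj (ga s)) (ga t)) qone) (qscal (/ 2) (qscal (k * (t - s)) U)))
      <= C * ((t - s) * (t - s))) ->
  forall t, a <= t <= b -> ga t = qmul (ga a) (rt U (k * (t - a))).
Proof.
  intros Hab HU Hu (C & HC & Hv) t Ht.
  destruct Hab as [Hab| <-].
  2: { replace t with a by lra; rewrite Rminus_diag, Rmult_0_r, rt_0, qmul_1_r; reflexivity. }
  set (f := fun t => qmul (ga t) (rt U (- (k * (t - a))))).
  set (M := C + k * k).
  assert (HM : 0 <= M) by (unfold M; nra).
  assert (Hf : forall s t, a <= s <= t -> t <= b -> qn (qsub (f t) (f s)) <= M * ((t - s) * (t - s))).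
  { intros s u Hs Hub; unfold f.
    set (p := qmul (qconj (ga s)) (ga u)).
    assert (Eu : ga u = qmul (ga s) p).
    { unfold p; rewrite qmul_assoc, qmul_conj_r, qmul_1_l by (apply Hu; lra); reflexivity. }
    set (d := k * (u - s)).
    assert (E : qsub (qmul (ga u) (rt U (- (k * (u - a))))) (qmul (ga s) (rt U (- (k * (s - a)))))
            = qmul (qmul (ga s) (qsub p (rt U d))) (rt U (- (k * (u - a))))).
    { replace (- (k * (s - a))) with (d + - (k * (u - a))) by (unfold d; ring).
      rewrite <- rt_add by exact HU; rewrite Eu; generalize (rt U d) (rt U (- (k * (u - a)))) p (ga s); qring. }
    rewrite E, !qn_mul, (qn_unit (ga s)), (qn_unit (rt U _)) by (try apply ip_rt, HU; apply Hu; lra).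
    rewrite Rmult_1_l, Rmult_1_r.
    set (e1 := qsub (qsub p qone) (qscal (/ 2) (qscal d U))).
    set (e2 := qsub (qsub (rt U d) qone) (qscal (/ 2) (qscal d U))).
    replace (qsub p (rt U d)) with (qsub e1 e2) by (unfold e1, e2; generalize p (rt U d); qring).
    eapply Rle_trans; [apply qn_sub|].
    assert (qn e1 <= C * ((u - s) * (u - s))) by (apply Hv; lra).
    assert (qn e2 <= d * d).
    { unfold e2; rewrite <- (qexp_scal U d HU).
      eapply Rle_trans; [apply qexp_expand; simpl; destruct HU as [-> _]; ring|].
      rewrite qn_scal; destruct HU as [_ HU1]; rewrite (qn_unit U HU1).
      right; rewrite Rmult_1_r; rewrite <- Rabs_mult; apply Rabs_right, Rle_ge, Rle_0_sqr. }
    unfold M, d in *; nra. }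
  assert (Hc : forall pr : quat -> R, (forall p q, pr (qsub p q) = pr p - pr q) -> (forall p, Rabs (pr p) <= qn p) ->
     pr (f t) = pr (f a)).
  { intros pr H1 H2; apply (loc_quad_const (fun t => pr (f t)) a b Hab); [| |exact Ht].
    - exists (M * (b - a)); split; [apply Rmult_le_pos; lra|]; intros s u Hs Hub.
      rewrite <- H1; eapply Rle_trans; [apply H2|]; eapply Rle_trans; [apply Hf; assumption|].
      rewrite Rmult_assoc; apply Rmult_le_compat_l; [exact HM|]; apply Rmult_le_compat_r; lra.
    - intros s Hs; exists M, 1; split; [lra|]; intros u Hub _.
      destruct (Rle_dec s u).
      + rewrite <- H1; eapply Rle_trans; [apply H2|]; apply Hf; lra.
      + rewrite Rabs_minus_sym, <- H1; eapply Rle_trans; [apply H2|].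
        replace ((u - s) * (u - s)) with ((s - u) * (s - u)) by ring; apply Hf; lra. }
  assert (Ef : f t = f a).
  { apply quat_ext; apply Hc; try (intros; apply qn_comp); intros; simpl; ring. }
  assert (Ea : f a = ga a) by (unfold f; rewrite Rminus_diag, Rmult_0_r, Ropp_0, rt_0, qmul_1_r; reflexivity).
  rewrite <- Ea, <- Ef; unfold f.
  rewrite <- qmul_assoc, rt_add by exact HU.
  replace (- (k * (t - a)) + k * (t - a)) with 0 by ring; rewrite rt_0, qmul_1_r; reflexivity.
Qed.

Set Implicit Arguments.

(** * Switching functions *)

Definition hp (F : frame) (h : R -> quat) (t : R) : R := ip (h t) (fP F).
Definition hq (F : frame) (h : R -> quat) (t : R) : R := ip (h t) (fQ F).
Definition hz (h : R -> quat) (t : R) : R := q3 (h t).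

Lemma hp_rot F h t : hp (rotF F) h t = hq F h t.
Proof. reflexivity. Qed.
Lemma hq_rot F h t : hq (rotF F) h t = - hp F h t.
Proof. unfold hq, hp, ip; simpl; ring. Qed.
Lemma hp_flip F h t : hp (flipF F) h t = hp F h t.
Proof. reflexivity. Qed.
Lemma hq_flip F h t : hq (flipF F) h t = - hq F h t.
Proof. unfold hq, ip; simpl; ring. Qed.

Lemma frame_id F : frame_ok F -> cc F * cc F + sg F * sg F = 1.
Proof.
  intros [[P0 PP] P3 [Q0 QQ] Q3 <- <- _ _ _]; unfold ip in *; rewrite P0, P3, Q0, Q3 in *.
  rewrite <- (Rmult_1_r 1), <- PP at 1; rewrite <- QQ; ring.
Qed.

(** Gram's formula for the plane part of v in the oblique basis P, Q. Since |h| is conserved, it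
    makes a quadratic form in the switching functions constant ([h_const_norm]). *)
Lemma norm_split F (v : quat) : frame_ok F -> q0 v = 0 ->
  sg F * sg F * ip v v = ip v (fP F) * ip v (fP F) + ip v (fQ F) * ip v (fQ F)
    - 2 * cc F * ip v (fP F) * ip v (fQ F) + sg F * sg F * (q3 v * q3 v).
Proof.
  intros [[P0 PP] P3 [Q0 QQ] Q3 <- <- _ _ _] V0; unfold ip in *; rewrite P0, P3, Q0, Q3, V0 in *.
  set (x1 := q1 (fP F)) in *; set (x2 := q2 (fP F)) in *; set (y1 := q1 (fQ F)) in *; set (y2 := q2 (fQ F)) in *.
  assert (E1 : x1 * x1 = 1 - x2 * x2) by lra.
  assert (E2 : y1 * y1 = 1 - y2 * y2) by lra.
  ring_simplify; ring_simplify in E1; ring_simplify in E2.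
  rewrite E1, E2; ring_simplify.
  assert (E3 : x1 ^ 2 = 1 - x2 ^ 2) by lra; nra.
Qed.

(** Together with [bracket_q3] these are the equations of motion: hp' = - sg hz B', hq' = sg hz A',
    and sg hz' = - A' (hq - cc hp) + B' (hp - cc hq). *)
Lemma bracket_ip F (k : quat) x y : frame_ok F -> q0 k = 0 ->
  ip (qscal (/ 2) (qsub (qmul k (vec F x y)) (qmul (vec F x y) k))) (fP F) = - (sg F * q3 k * y) /\
  ip (qscal (/ 2) (qsub (qmul k (vec F x y)) (qmul (vec F x y) k))) (fQ F) = sg F * q3 k * x.
Proof.
  intros [[P0 _] P3 [Q0 _] Q3 _ <- _ _ _] K0; unfold vec, ip; simpl.
  rewrite P0, P3, Q0, Q3, K0; split; field.
Qed.

Lemma bracket_q3 F (k : quat) x y : frame_ok F -> q0 k = 0 ->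
  sg F * q3 (qscal (/ 2) (qsub (qmul k (vec F x y)) (qmul (vec F x y) k)))
  = - x * (ip k (fQ F) - cc F * ip k (fP F)) + y * (ip k (fP F) - cc F * ip k (fQ F)).
Proof.
  intros [[P0 PP] P3 [Q0 QQ] Q3 <- <- _ _ _] K0; unfold vec, ip in *; simpl.
  rewrite P0, P3, Q0, Q3, K0 in *.
  set (x1 := q1 (fP F)) in *; set (x2 := q2 (fP F)) in *; set (y1 := q1 (fQ F)) in *; set (y2 := q2 (fQ F)) in *.
  assert (G : x1 * x1 + x2 * x2 = 1) by lra.
  assert (G' : y1 * y1 + y2 * y2 = 1) by lra.
  transitivity (- x * ((q1 k * y1 + q2 k * y2) * (x1 * x1 + x2 * x2) - (x1 * y1 + x2 * y2) * (q1 k * x1 + q2 k * x2))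
     + y * ((q1 k * x1 + q2 k * x2) * (y1 * y1 + y2 * y2) - (x1 * y1 + x2 * y2) * (q1 k * y1 + q2 k * y2)));
    [field|rewrite G, G'; ring].
Qed.

Section Scalar.
Variables (F : frame) (K : R) (gh : quat) (T : R) (ga : R -> quat) (A B : R -> R).
Hypothesis OK : frame_ok F.
Hypothesis E : ext F K gh T ga A B.
Let h := hh K gh T ga.

(** The primed versions read the covector at the right end of the interval. [loc_quad_const] needs
    estimates on both sides of a given time, hence on intervals that start there and on intervals
    that end there. *)
Record sfacts (C : R) (s t : R) : Prop := {
  sf_cut : t - s - C * ((t - s) * (t - s)) <= hp F h s * (A t - A s) + hq F h s * (B t - B s);
  sf_cut' : t - s - C * ((t - s) * (t - s)) <= hp F h t * (A t - A s) + hq F h t * (B t - B s);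
  sf_p : Rabs (hp F h t - hp F h s + sg F * hz h s * (B t - B s)) <= C * ((t - s) * (t - s));
  sf_q : Rabs (hq F h t - hq F h s - sg F * hz h s * (A t - A s)) <= C * ((t - s) * (t - s));
  sf_p' : Rabs (hp F h t - hp F h s + sg F * hz h t * (B t - B s)) <= C * ((t - s) * (t - s));
  sf_q' : Rabs (hq F h t - hq F h s - sg F * hz h t * (A t - A s)) <= C * ((t - s) * (t - s));
  sf_z : Rabs (sg F * (hz h t - hz h s) + (hq F h s - cc F * hp F h s) * (A t - A s)
               - (hp F h s - cc F * hq F h s) * (B t - B s)) <= C * ((t - s) * (t - s));
  sf_lp : Rabs (hp F h t - hp F h s) <= C * (t - s);
  sf_lq : Rabs (hq F h t - hq F h s) <= C * (t - s);
  sf_lz : Rabs (hz h t - hz h s) <= C * (t - s) }.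

Lemma scalar_facts : exists C, 0 <= C /\ forall s t, 0 <= s <= t -> t <= T -> sfacts C s t.
Proof.
  destruct (cut_ineq F K gh T ga A B OK E) as (C1 & HC1 & H1).
  destruct (h_expand F K gh T ga A B OK E) as (C2 & HC2 & H2).
  fold h in H1, H2.
  assert (Hlp := lip_pos F OK); set (l := lip F) in *.
  exists (C1 + C2 + C2 * l); split; [nra|]; intros s t Hs Ht.
  specialize (H1 s t Hs Ht); destruct (H2 s t Hs Ht) as [H3 H4]; clear H2.
  assert (Hu := dvec_le F K gh T ga A B OK E s t Hs Ht); fold l in Hu.
  assert (Hcost := ex_cost _ _ _ _ _ _ _ E s t Hs Ht).
  assert (Hab := abs_le_cost F OK (A t - A s) (B t - B s)); fold l in Hab.
  set (dA := A t - A s) in *; set (dB := B t - B s) in *; set (d := t - s) in *.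
  assert (Hd : 0 <= d) by (unfold d; lra).
  assert (Hdd : 0 <= d * d) by nra.
  assert (HP : qn (fP F) = 1) by (apply qn_unit, OK).
  assert (HQ : qn (fQ F) = 1) by (apply qn_unit, OK).
  assert (H0 := h_0 K gh T ga s); fold h in H0.
  set (X := qscal (/ 2) (qsub (qmul (h s) (vec F dA dB)) (qmul (vec F dA dB) (h s)))) in *.
  destruct (bracket_ip (F := F) (h s) dA dB OK H0) as [EP EQ]; fold X in EP, EQ.
  change (q3 (h s)) with (hz h s) in EP, EQ.
  assert (Hz : Rabs (hz h t - hz h s) <= C2 * d).
  { eapply Rle_trans; [|exact H4]; unfold hz.
    replace (q3 (h t) - q3 (h s)) with (q3 (qsub (h t) (h s))) by (generalize (h t) (h s); intros; simpl; ring).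
    apply qn_comp. }
  assert (Hp : Rabs (hp F h t - hp F h s + sg F * hz h s * dB) <= C2 * (d * d)).
  { replace (hp F h t - hp F h s + sg F * hz h s * dB) with (ip (qsub (qsub (h t) (h s)) X) (fP F)).
    - rewrite <- (Rmult_1_r (C2 * (d * d))), <- HP; apply ip_abs_le; lra.
    - unfold qsub at 1; rewrite ip_add_l, ip_scal_l, EP; unfold hp, qsub; rewrite ip_add_l, ip_scal_l; ring. }
  assert (Hq : Rabs (hq F h t - hq F h s - sg F * hz h s * dA) <= C2 * (d * d)).
  { replace (hq F h t - hq F h s - sg F * hz h s * dA) with (ip (qsub (qsub (h t) (h s)) X) (fQ F)).
    - rewrite <- (Rmult_1_r (C2 * (d * d))), <- HQ; apply ip_abs_le; lra.
    - unfold qsub at 1; rewrite ip_add_l, ip_scal_l, EQ; unfold hq, qsub; rewrite ip_add_l, ip_scal_l; ring. }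
  assert (Hsg : Rabs (sg F) <= 1).
  { apply Rabs_le; generalize (frame_id OK); nra. }
  assert (HdA : Rabs dA <= l * d).
  { generalize (Rabs_pos dB); assert (l * (al F * Rabs dA + be F * Rabs dB) <= l * d) by (apply Rmult_le_compat_l; lra); lra. }
  assert (HdB : Rabs dB <= l * d).
  { generalize (Rabs_pos dA); assert (l * (al F * Rabs dA + be F * Rabs dB) <= l * d) by (apply Rmult_le_compat_l; lra); lra. }
  assert (Hprod : forall x, Rabs x <= l * d -> Rabs (sg F * (hz h t - hz h s) * x) <= C2 * l * (d * d)).
  { intros x Hx; rewrite !Rabs_mult.
    replace (C2 * l * (d * d)) with (1 * (C2 * d) * (l * d)) by ring.
    generalize (Rabs_pos (sg F)) (Rabs_pos (hz h t - hz h s)) (Rabs_pos x); intros.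
    apply Rmult_le_compat; [nra|lra| |exact Hx]. apply Rmult_le_compat; lra. }
  assert (HpB := Hprod dB HdB); assert (HpA := Hprod dA HdA).
  assert (Ecut : ip (h s) (vec F dA dB) = hp F h s * dA + hq F h s * dB) by (unfold vec, hp, hq, ip; simpl; ring).
  assert (Q1 : 0 <= C1 * (d * d)) by (apply Rmult_le_pos; lra).
  assert (Q2 : 0 <= C2 * (d * d)) by (apply Rmult_le_pos; lra).
  assert (Q3 : 0 <= C2 * l * (d * d)) by (apply Rmult_le_pos; [nra|lra]).
  assert (Q4 : 0 <= C1 * d) by (apply Rmult_le_pos; lra).
  assert (Q5 : 0 <= C2 * l * d) by (apply Rmult_le_pos; [nra|lra]).
  constructor; fold dA dB d; rewrite ?Rmult_plus_distr_r.
  - lra.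
  - assert (Hx : Rabs (ip (qsub (h t) (h s)) (vec F dA dB)) <= C2 * d * (l * d)) by (apply ip_abs_le; lra).
    apply Rabs_le_between in Hx.
    replace (ip (qsub (h t) (h s)) (vec F dA dB)) with
      (hp F h t * dA + hq F h t * dB - ip (h s) (vec F dA dB)) in Hx
      by (unfold vec, hp, hq, ip; generalize (h t) (h s); intros; simpl; ring).
    replace (C2 * d * (l * d)) with (C2 * l * (d * d)) in Hx by ring; lra.
  - lra.
  - lra.
  - replace (hp F h t - hp F h s + sg F * hz h t * dB)
      with ((hp F h t - hp F h s + sg F * hz h s * dB) + sg F * (hz h t - hz h s) * dB) by ring.
    eapply Rle_trans; [apply Rabs_triang|]; lra.
  - replace (hq F h t - hq F h s - sg F * hz h t * dA)
      with ((hq F h t - hq F h s - sg F * hz h s * dA) + - (sg F * (hz h t - hz h s) * dA)) by ring.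
    eapply Rle_trans; [apply Rabs_triang|]; rewrite Rabs_Ropp; lra.
  - set (Y := qsub (qsub (h t) (h s)) X) in *.
    assert (EZ : sg F * (hz h t - hz h s) + (hq F h s - cc F * hp F h s) * dA
               - (hp F h s - cc F * hq F h s) * dB = sg F * q3 Y).
    { assert (G := bracket_q3 (F := F) (h s) dA dB OK H0); fold X in G.
      change (ip (h s) (fP F)) with (hp F h s) in G; change (ip (h s) (fQ F)) with (hq F h s) in G.
      assert (GY : q3 Y = hz h t - hz h s - q3 X)
        by (unfold Y, hz; generalize (h t) (h s) X; intros; simpl; ring).
      rewrite GY; replace (sg F * (hz h t - hz h s - q3 X)) with (sg F * (hz h t - hz h s) - sg F * q3 X) by ring.
      rewrite G; ring. }
    rewrite EZ, Rabs_mult.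
    assert (Rabs (q3 Y) <= qn Y) by apply qn_comp.
    apply Rle_trans with (1 * (C2 * (d * d))); [|lra].
    apply Rmult_le_compat; try apply Rabs_pos; lra.
  - replace (hp F h t - hp F h s) with (ip (qsub (h t) (h s)) (fP F))
      by (unfold qsub, hp; rewrite ip_add_l, ip_scal_l; ring).
    eapply Rle_trans; [apply ip_abs_le; [exact H4|right; exact HP]|]; lra.
  - replace (hq F h t - hq F h s) with (ip (qsub (h t) (h s)) (fQ F))
      by (unfold qsub, hq; rewrite ip_add_l, ip_scal_l; ring).
    eapply Rle_trans; [apply ip_abs_le; [exact H4|right; exact HQ]|]; lra.
  - lra.
Qed.

Lemma hp_lip : lipschitz_on (hp F h) 0 T.
Proof.
  destruct scalar_facts as (C & HC & H); exists C; split; [exact HC|]; intros s t Hs Ht.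
  apply (H s t Hs Ht).
Qed.
Lemma hq_lip : lipschitz_on (hq F h) 0 T.
Proof.
  destruct scalar_facts as (C & HC & H); exists C; split; [exact HC|]; intros s t Hs Ht.
  apply (H s t Hs Ht).
Qed.
Lemma hz_lip : lipschitz_on (hz h) 0 T.
Proof.
  destruct scalar_facts as (C & HC & H); exists C; split; [exact HC|]; intros s t Hs Ht.
  apply (H s t Hs Ht).
Qed.

Lemma hp_bound t : 0 <= t <= T -> Rabs (hp F h t) <= al F.
Proof. apply (hp_le F K gh T ga A B OK E). Qed.
Lemma hq_bound t : 0 <= t <= T -> Rabs (hq F h t) <= be F.
Proof. apply (hp_le _ K gh T ga _ _ (rotF_ok F OK) (ext_rot _ _ _ _ _ _ _ E)). Qed.

Lemma h_const_norm t : 0 <= t <= T ->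
  hp F h t * hp F h t + hq F h t * hq F h t - 2 * cc F * hp F h t * hq F h t
    + sg F * sg F * (hz h t * hz h t) = sg F * sg F * ip (lam K gh T ga) (lam K gh T ga).
Proof.
  intros Ht; rewrite <- (h_norm F K gh T ga A B E t Ht); fold h.
  symmetry; apply norm_split; [exact OK|apply h_0].
Qed.

Lemma A_lip : lipschitz_on A 0 T.
Proof.
  exists (/ al F); assert (Ha := al_pos F OK); split; [left; apply Rinv_0_lt_compat; lra|].
  intros s t Hs Ht; assert (H := ex_cost _ _ _ _ _ _ _ E s t Hs Ht).
  apply Rmult_le_reg_l with (al F); [lra|]; rewrite <- Rmult_assoc, Rinv_r, Rmult_1_l by lra.
  generalize (Rabs_pos (B t - B s)) (be_pos F OK); nra.
Qed.

(* If both switching functions were strictly inside their bounds, the cut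
   inequality would fail on short intervals. *)
Lemma on_boundary t : 0 <= t <= T -> 0 < T ->
  Rabs (hp F h t) = al F \/ Rabs (hq F h t) = be F.
Proof.
  intros Ht HT; apply Classical_Prop.NNPP; intros N.
  assert (Hp := hp_bound Ht); assert (Hq := hq_bound Ht).
  assert (Hp' : Rabs (hp F h t) < al F) by (destruct Hp; [assumption|exfalso; apply N; left; assumption]).
  assert (Hq' : Rabs (hq F h t) < be F) by (destruct Hq; [assumption|exfalso; apply N; right; assumption]).
  destruct scalar_facts as (C & HC & Hsf).
  assert (Ha := al_pos F OK); assert (Hb := be_pos F OK).
  (* An increment of cost d pairs with h(t) to at most m d, and m < 1, while the cut inequality
     demands d - C d^2. At t = T only intervals ending at t are available, so the cut inequality is
     taken at the right end. *)
  set (m := Rmax (Rabs (hp F h t) / al F) (Rabs (hq F h t) / be F)).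
  assert (Hm : m < 1).
  { apply Rmax_lub_lt; [apply Rmult_lt_reg_r with (1 := Ha)|apply Rmult_lt_reg_r with (1 := Hb)];
      unfold Rdiv; rewrite Rmult_assoc, Rinv_l; lra. }
  assert (Hpm : Rabs (hp F h t) <= m * al F).
  { replace (Rabs (hp F h t)) with (Rabs (hp F h t) / al F * al F) by (field; lra).
    apply Rmult_le_compat_r; [lra|apply Rmax_l]. }
  assert (Hqm : Rabs (hq F h t) <= m * be F).
  { replace (Rabs (hq F h t)) with (Rabs (hq F h t) / be F * be F) by (field; lra).
    apply Rmult_le_compat_r; [lra|apply Rmax_r]. }
  assert (Hm0 : 0 <= m).
  { apply Rle_trans with (Rabs (hp F h t) / al F); [|apply Rmax_l].
    apply Rmult_le_pos; [apply Rabs_pos|left; apply Rinv_0_lt_compat; lra]. }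
  assert (key : forall x y d, al F * Rabs x + be F * Rabs y <= d ->
      hp F h t * x + hq F h t * y <= m * d).
  { intros x y d Hd.
    assert (hp F h t * x <= m * al F * Rabs x).
    { eapply Rle_trans; [apply Rle_abs|]; rewrite Rabs_mult; apply Rmult_le_compat_r; [apply Rabs_pos|lra]. }
    assert (hq F h t * y <= m * be F * Rabs y).
    { eapply Rle_trans; [apply Rle_abs|]; rewrite Rabs_mult; apply Rmult_le_compat_r; [apply Rabs_pos|lra]. }
    apply Rle_trans with (m * (al F * Rabs x + be F * Rabs y)); [lra|apply Rmult_le_compat_l; lra]. }
  assert (1 <= m); [|lra].
  assert (Hfin : forall D, 0 < D -> (forall d, 0 < d <= D -> d <= m * d + C * (d * d)) -> 1 <= m).
  { intros D HD H; apply le_of_quadratic with (C * D); intros e He.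
    specialize (H (e * D) (ltac:(nra))); apply Rmult_le_reg_r with D; nra. }
  destruct (Rlt_dec t T) as [HtT|HtT].
  - apply (Hfin (T - t)); [lra|]; intros d Hd.
    destruct (Hsf t (t + d)) as [H1 _ _ _ _ _ _ _ _ _]; [lra|lra|].
    assert (H2 := key _ _ _ (ex_cost _ _ _ _ _ _ _ E t (t + d) (ltac:(lra)) (ltac:(lra)))).
    replace (t + d - t) with d in * by ring; lra.
  - apply (Hfin t); [lra|]; intros d Hd.
    destruct (Hsf (t - d) t) as [_ H1 _ _ _ _ _ _ _ _]; [lra|lra|].
    assert (H2 := key _ _ _ (ex_cost _ _ _ _ _ _ _ E (t - d) t (ltac:(lra)) (ltac:(lra)))).
    replace (t - (t - d)) with d in * by ring; lra.
Qed.
End Scalar.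

(** * Arcs of a single letter *)

(** Rodrigues' formula: for imaginary quaternions half the commutator is the cross product. *)
Lemma rt_conj_action (P k : quat) th : unitv P -> q0 k = 0 ->
  qmul (qmul (qconj (rt P th)) k) (rt P th)
  = qadd (qadd (qscal (cos th) k) (qscal (sin th) (qscal (/ 2) (qsub (qmul k P) (qmul P k)))))
         (qscal ((1 - cos th) * ip k P) P).
Proof.
  intros [P0 PP] K0.
  replace th with (2 * (th / 2)) at 3 4 5 by field; rewrite cos_2a, sin_2a.
  unfold rt; set (c := cos (th / 2)); set (s := sin (th / 2)).
  assert (Hcs : c * c + s * s = 1) by (unfold c, s; generalize (sin2_cos2 (th / 2)); unfold Rsqr; lra).
  assert (E1 : qmul (qmul P k) P = qsub (qscal (ip P P) k) (qscal (2 * ip k P) P))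
    by (unfold ip; apply quat_ext; simpl; rewrite P0, K0; ring).
  rewrite PP in E1.
  transitivity (qadd (qadd (qscal (c * c) k) (qscal (c * s) (qsub (qmul k P) (qmul P k))))
                  (qscal (- (s * s)) (qmul (qmul P k) P))).
  - apply quat_ext; simpl; rewrite P0; ring.
  - rewrite E1; replace (1 - (c * c - s * s)) with (2 * (s * s)) by lra.
    apply quat_ext; simpl; field.
Qed.

(** On a P-arc the point (hq - cc hp, sg hz) runs on a circle about the origin through the angle
    [th]. The arc lengths below are angles between two points of such a circle. *)
Lemma arc_scalars F (k : quat) th : frame_ok F -> q0 k = 0 ->
  let k' := qmul (qmul (qconj (rt (fP F) th)) k) (rt (fP F) th) in
  ip k' (fP F) = ip k (fP F) /\
  ip k' (fQ F) - cc F * ip k (fP F)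
    = (ip k (fQ F) - cc F * ip k (fP F)) * cos th + sg F * q3 k * sin th /\
  sg F * q3 k' = sg F * q3 k * cos th - (ip k (fQ F) - cc F * ip k (fP F)) * sin th.
Proof.
  intros OK K0 k'; unfold k'; rewrite rt_conj_action by (apply OK || exact K0); clear k'.
  destruct (bracket_ip k 1 0 OK K0) as [E1 E2].
  replace (vec F 1 0) with (fP F) in E1, E2 by (unfold vec; qring).
  set (b := qscal (/ 2) (qsub (qmul k (fP F)) (qmul (fP F) k))) in *.
  assert (E3 : sg F * q3 b = - (ip k (fQ F) - cc F * ip k (fP F))).
  { unfold b; destruct OK as [[P0 PP] P3 [Q0 QQ] Q3 <- <- _ _ _]; unfold ip in *; simpl.
    rewrite P0, P3, Q0, Q3, K0 in *.
    set (x1 := q1 (fP F)) in *; set (x2 := q2 (fP F)) in *; set (y1 := q1 (fQ F)) in *; set (y2 := q2 (fQ F)) in *.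
    assert (G : x1 * x1 + x2 * x2 = 1) by lra.
    transitivity (- ((q1 k * y1 + q2 k * y2) * (x1 * x1 + x2 * x2) - (x1 * y1 + x2 * y2) * (q1 k * x1 + q2 k * x2)));
      [field|rewrite G; ring]. }
  rewrite !ip_add_l, !ip_scal_l, E1, E2.
  assert (HPQ := ok_cc F OK); destruct (ok_P F OK) as [_ PP].
  rewrite PP, HPQ; split; [ring|split; [ring|]].
  change (q3 (qadd (qadd (qscal (cos th) k) (qscal (sin th) b)) (qscal ((1 - cos th) * ip k (fP F)) (fP F))))
    with (cos th * q3 k + sin th * q3 b + (1 - cos th) * ip k (fP F) * q3 (fP F)).
  rewrite (ok_P3 F OK), !Rmult_plus_distr_l.
  replace (sg F * (sin th * q3 b)) with (sin th * (sg F * q3 b)) by ring; rewrite E3; ring.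
Qed.

Section Arcs.
Variables (F : frame) (K : R) (gh : quat) (T : R) (ga : R -> quat) (A B : R -> R).
Hypothesis OK : frame_ok F.
Hypothesis E : ext F K gh T ga A B.
Let h := hh K gh T ga.

Definition arc_on (a b : R) : Prop :=
  forall t, a <= t <= b -> ga t = qmul (ga a) (rt (fP F) ((t - a) / al F)).

Lemma arc_h a b t : 0 <= a -> b <= T -> arc_on a b -> a <= t <= b ->
  let th := (t - a) / al F in
  hp F h t = hp F h a /\
  hq F h t - cc F * hp F h a = (hq F h a - cc F * hp F h a) * cos th + sg F * hz h a * sin th /\
  sg F * hz h t = sg F * hz h a * cos th - (hq F h a - cc F * hp F h a) * sin th.
Proof.
  intros Ha Hb Harc Ht th.
  assert (Et : h t = qmul (qmul (qconj (rt (fP F) th)) (h a)) (rt (fP F) th)).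
  { unfold h; rewrite (transport F K gh T ga A B E a t) by lra.
    replace (qmul (qconj (ga a)) (ga t)) with (rt (fP F) th); [reflexivity|].
    rewrite (Harc t Ht), qmul_assoc, qmul_conj_l, qmul_1_l by (apply (ex_u _ _ _ _ _ _ _ E); lra).
    reflexivity. }
  unfold hp, hq, hz; rewrite Et; apply arc_scalars; [exact OK|apply h_0].
Qed.

(** An arc of angle th > pi can be replaced by the backward arc of angle 2 pi - th, which is cheaper
    and ends at the opposite quaternion; the penalty does not see the sign. *)
Lemma arc_le_pi a b : 0 <= a <= b -> b <= T -> arc_on a b -> b - a <= al F * PI.
Proof.
  intros Ha Hb Harc; apply Rnot_lt_le; intros Hlt.
  assert (Hal := al_pos F OK); assert (HPI := PI_RGT_0).
  (* Cutting the arc at 3 pi / 2 keeps 2 pi - th positive, as the cost of the backward arc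
     requires. *)
  set (b' := Rmin b (a + al F * (3 * PI / 2))).
  assert (Hb1 : b' <= b) by apply Rmin_l.
  assert (Hb2 : b' <= a + al F * (3 * PI / 2)) by apply Rmin_r.
  assert (Hb3 : a + al F * PI < b') by (apply Rmin_glb_lt; nra).
  set (th := (b' - a) / al F).
  assert (Eth : b' - a = al F * th) by (unfold th; field; lra).
  assert (Hth : PI < th <= 3 * PI / 2).
  { split; apply Rmult_lt_reg_l with (al F) || apply Rmult_le_reg_l with (al F); lra. }
  assert (Hr : reach F (rt (fP F) (th - 2 * PI)) (al F * (2 * PI - th))).
  { eapply reach_le; [apply (reach_P F OK)|]; rewrite Rabs_left by lra; right; ring. }
  assert (Hm := ex_min _ _ _ _ _ _ _ E a b' _ _ (ltac:(nra)) (ltac:(lra)) Hr).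
  rewrite (Harc b') in Hm by nra.
  fold th in Hm.
  assert (Eq : qmul (qmul (ga a) (rt (fP F) (th - 2 * PI))) (qmul (qconj (qmul (ga a) (rt (fP F) th))) (ga T))
     = qopp (ga T)).
  { replace th with (th - 2 * PI + 2 * PI) at 2 by ring; rewrite rt_2PI.
    set (g := ga a); set (r := rt (fP F) (th - 2 * PI)).
    assert (Hg : ip g g = 1) by (apply (ex_u _ _ _ _ _ _ _ E); lra).
    assert (Hrr : ip r r = 1) by (apply ip_rt, OK).
    transitivity (qopp (qmul (qmul (qmul g r) (qconj (qmul g r))) (ga T))).
    - generalize g r (ga T); qring.
    - rewrite qmul_conj_r, qmul_1_l by (rewrite ip_mul_sq, Hg, Hrr; ring); reflexivity. }
  rewrite Eq in Hm.
  replace (pen gh (qopp (ga T))) with (pen gh (ga T)) in Hm by (unfold pen, qopp; rewrite ip_scal_l; ring).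
  nra.
Qed.

(** B has derivative 0 and is constant. The cut inequality then forces A to grow at the full rate 1
    / al, so the velocity is that of P. *)
Lemma straight_arc_gen a b : 0 <= a -> a <= b -> b <= T ->
  (forall t, a <= t <= b -> hp F h t = al F) ->
  (forall t, a < t < b -> exists M, 0 <= M /\ forall s u, a <= s <= u -> u <= b -> (t = s \/ t = u) ->
       Rabs (B u - B s) <= M * ((u - s) * (u - s))) ->
  arc_on a b.
Proof.
  intros Ha Hab Hb Hhp HBq.
  destruct Hab as [Hab| <-].
  2: { intros t Ht; replace t with a by lra; unfold Rdiv; rewrite Rminus_diag, Rmult_0_l, rt_0, qmul_1_r; reflexivity. }
  destruct (scalar_facts OK E) as (C & HC & Hsf); fold h in Hsf.
  assert (Hal := al_pos F OK); assert (Hbe := be_pos F OK); assert (Hsg := ok_sg0 F OK).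
  assert (HA := A_lip OK E).
  assert (HB : lipschitz_on B 0 T) by exact (A_lip (rotF_ok F OK) (ext_rot _ _ _ _ _ _ _ E)).
  assert (HqB : forall t, 0 <= t <= T -> Rabs (hq F h t) <= be F) by apply (hq_bound OK E).
  assert (key : forall t, a < t < b -> exists M, 0 <= M /\ forall s u, a <= s <= u -> u <= b -> (t = s \/ t = u) ->
     Rabs (B u - B s) <= M * ((u - s) * (u - s)) /\
     Rabs (A u - A s - (u - s) / al F) <= M * ((u - s) * (u - s))).
  { intros t Ht.
    destruct (HBq t Ht) as (M & HM0 & HM).
    exists (M + (C + be F * M) / al F); split.
    { apply Rplus_le_le_0_compat; [exact HM0|]; apply Rmult_le_pos; [nra|left; apply Rinv_0_lt_compat; lra]. }
    intros s u Hs Hu Htt; specialize (HM s u Hs Hu Htt).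
    destruct (Hsf s u) as [H1 H2 _ _ _ _ _ _ _ _]; [lra|lra|].
    assert (Hc := ex_cost _ _ _ _ _ _ _ E s u (ltac:(lra)) (ltac:(lra))).
    set (x := A u - A s) in *; set (y := B u - B s) in *; set (d := u - s) in *.
    assert (Hdd : 0 <= d * d) by nra.
    assert (Hpos : 0 <= (C + be F * M) / al F * (d * d)).
    { apply Rmult_le_pos; [apply Rmult_le_pos; [nra|left; apply Rinv_0_lt_compat; lra]|exact Hdd]. }
    split; [nra|].
    assert (H3 : d - C * (d * d) <= al F * x + hq F h t * y).
    { rewrite <- (Hhp t) by lra; destruct Htt as [<-|<-]; assumption. }
    assert (H4 : hq F h t * y <= be F * (M * (d * d))).
    { apply Rle_trans with (Rabs (hq F h t) * Rabs y); [rewrite <- Rabs_mult; apply Rle_abs|].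
      apply Rmult_le_compat; try apply Rabs_pos; [apply HqB; lra|exact HM]. }
    assert (H5 : al F * x <= d).
    { generalize (Rle_abs x) (Rabs_pos y); nra. }
    assert (H6 : x - d / al F <= 0).
    { apply Rmult_le_reg_l with (al F); [lra|]; replace (al F * (x - d / al F)) with (al F * x - d) by (field; lra); lra. }
    rewrite Rabs_left1 by exact H6.
    apply Rmult_le_reg_l with (al F); [lra|].
    replace (al F * - (x - d / al F)) with (d - al F * x) by (field; lra).
    replace (al F * ((M + (C + be F * M) / al F) * (d * d))) with (al F * (M * (d * d)) + (C * (d * d) + be F * (M * (d * d)))) by (field; lra).
    assert (0 <= al F * (M * (d * d))) by (apply Rmult_le_pos; [lra|apply Rmult_le_pos; lra]).
    lra. }
  assert (loc : forall phi : R -> R, lipschitz_on phi a b ->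
     (forall t, a < t < b -> exists M, 0 <= M /\ forall s u, a <= s <= u -> u <= b -> (t = s \/ t = u) ->
        Rabs (phi u - phi s) <= M * ((u - s) * (u - s))) -> forall t, a <= t <= b -> phi t = phi a).
  { intros phi Hl Hq; apply (loc_quad_const phi a b Hab Hl).
    intros t Ht; destruct (Hq t Ht) as (M & _ & HM); exists M, 1; split; [lra|]; intros t' Ht' _.
    destruct (Rle_dec t t').
    - apply HM; lra.
    - rewrite Rabs_minus_sym; replace ((t' - t) * (t' - t)) with ((t - t') * (t - t')) by ring; apply HM; lra. }
  assert (EB : forall t, a <= t <= b -> B t = B a).
  { apply loc; [apply lipschitz_sub with (1 := HB); lra|].
    intros t Ht; destruct (key t Ht) as (M & HM0 & HM); exists M; split; [exact HM0|]; intros; apply HM; assumption. }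
  assert (EA : forall t, a <= t <= b -> A t - t / al F = A a - a / al F).
  { apply (loc (fun t => A t - t / al F)).
    - destruct HA as (CA & HCA & HA); exists (CA + / al F); split.
      { generalize (Rinv_0_lt_compat _ Hal); lra. }
      intros s t Hs Ht.
      replace (A t - t / al F - (A s - s / al F)) with ((A t - A s) + - ((t - s) * / al F)) by (field; lra).
      eapply Rle_trans; [apply Rabs_triang|]; rewrite Rabs_Ropp, (Rabs_right ((t - s) * / al F)).
      + specialize (HA s t (ltac:(lra)) (ltac:(lra))); lra.
      + apply Rle_ge, Rmult_le_pos; [lra|left; apply Rinv_0_lt_compat; lra].
    - intros t Ht; destruct (key t Ht) as (M & HM0 & HM); exists M; split; [exact HM0|]; intros s u Hs Hu Htt.
      replace (A u - u / al F - (A s - s / al F)) with (A u - A s - (u - s) / al F) by (field; lra).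
      apply HM; assumption. }
  intros t Ht.
  replace ((t - a) / al F) with (/ al F * (t - a)) by (field; lra).
  apply (curve_of_velocity ga (fP F) (/ al F) a b); [lra|apply OK| | |exact Ht].
  - intros u Hu; apply (ex_u _ _ _ _ _ _ _ E); lra.
  - destruct (ex_lin _ _ _ _ _ _ _ E) as (C' & HC' & Hl); exists C'; split; [exact HC'|].
    intros s u Hs Hu; specialize (Hl s u (ltac:(lra)) (ltac:(lra))).
    assert (E1 := EA s (ltac:(lra))); assert (E2 := EA u (ltac:(lra))).
    rewrite (EB s), (EB u), Rminus_diag in Hl by lra.
    replace (qscal (/ al F * (u - s)) (fP F)) with (vec F (A u - A s) 0); [exact Hl|].
    replace (A u - A s) with (/ al F * (u - s)).
    + unfold vec; qring.
    + replace (A u) with (A a - a / al F + u / al F) by lra.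
      replace (A s) with (A a - a / al F + s / al F) by lra. field; lra.
Qed.

(** Two reasons for B' = 0: where |hq| < be, motion along Q gains less than it costs; where hz <> 0,
    the constancy of hp and hp' = - sg hz B' exclude it. *)
Lemma straight_arc a b : 0 <= a -> a <= b -> b <= T ->
  (forall t, a <= t <= b -> hp F h t = al F) ->
  (forall t, a < t < b -> Rabs (hq F h t) < be F \/ hz h t <> 0) ->
  arc_on a b.
Proof.
  intros Ha Hab Hb Hhp Hint; apply straight_arc_gen; try assumption; intros t Ht.
  destruct (scalar_facts OK E) as (C & HC & Hsf); fold h in Hsf.
  assert (Hal := al_pos F OK); assert (Hbe := be_pos F OK); assert (Hsg := ok_sg0 F OK).
  destruct (Hint t Ht) as [Hq|Hz].
      - exists (C / (be F - Rabs (hq F h t))); split.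
        { apply Rmult_le_pos; [exact HC|left; apply Rinv_0_lt_compat; lra]. }
        intros s u Hs Hu Htt.
        destruct (Hsf s u) as [H1 H2 _ _ _ _ _ _ _ _]; [lra|lra|].
        assert (Hc := ex_cost _ _ _ _ _ _ _ E s u (ltac:(lra)) (ltac:(lra))).
        set (x := A u - A s) in *; set (y := B u - B s) in *; set (d := u - s) in *.
        assert (H3 : d - C * (d * d) <= al F * x + hq F h t * y).
        { rewrite <- (Hhp t) by lra; destruct Htt as [<-|<-]; assumption. }
        assert (hq F h t * y <= Rabs (hq F h t) * Rabs y).
        { rewrite <- Rabs_mult; apply Rle_abs. }
        generalize (Rle_abs x); intros.
        apply Rmult_le_reg_l with (be F - Rabs (hq F h t)); [lra|].
        replace ((be F - Rabs (hq F h t)) * (C / (be F - Rabs (hq F h t)) * (d * d))) with (C * (d * d)) by (field; lra).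
        nra.
      - assert (Hw : 0 < Rabs (sg F * hz h t)) by (apply Rabs_pos_lt, Rmult_integral_contrapositive_currified; assumption).
        exists (C / Rabs (sg F * hz h t)); split.
        { apply Rmult_le_pos; [exact HC|left; apply Rinv_0_lt_compat; lra]. }
        intros s u Hs Hu Htt.
        destruct (Hsf s u) as [_ _ H1 _ H2 _ _ _ _ _]; [lra|lra|]; fold h in H1, H2.
        set (y := B u - B s) in *; set (d := u - s) in *.
        assert (Eu := Hhp u (ltac:(lra))); assert (Es := Hhp s (ltac:(lra))).
        rewrite Eu, Es, Rminus_diag, Rplus_0_l in H1; rewrite Eu, Es, Rminus_diag, Rplus_0_l in H2.
        assert (H3 : Rabs (sg F * hz h t * y) <= C * (d * d)) by (destruct Htt as [<-|<-]; assumption).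
        rewrite Rabs_mult in H3.
        apply Rmult_le_reg_l with (Rabs (sg F * hz h t)); [lra|].
        replace (Rabs (sg F * hz h t) * (C / Rabs (sg F * hz h t) * (d * d))) with (C * (d * d)) by (field; lra).
        exact H3.
Qed.

(** As |hq| < be, [on_boundary] gives |hp| = al, and hp cannot change sign without passing 0. *)
Lemma face_arc a b : 0 <= a -> a < b -> b <= T ->
  (forall t, a < t < b -> Rabs (hq F h t) < be F) ->
  (exists t, a < t < b /\ 0 < hp F h t) ->
  arc_on a b /\ forall t, a <= t <= b -> hp F h t = al F.
Proof.
  intros Ha Hab Hb Hq (t0 & Ht0 & Hp0).
  assert (Hal := al_pos F OK).
  assert (Hl : lipschitz_on (hp F h) 0 T) by apply (hp_lip OK E).
  assert (Habs : forall t, a < t < b -> Rabs (hp F h t) = al F).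
  { intros t Ht; destruct (on_boundary OK E (t := t)) as [H|H]; [lra|lra|exact H|].
    exfalso; specialize (Hq t Ht); fold h in H; lra. }
  assert (Hpos : forall t, a < t < b -> 0 < hp F h t).
  { intros t Ht; apply Rnot_le_lt; intros Hneg.
    assert (Hz : exists u, a < u < b /\ hp F h u = 0).
    { destruct (Rle_lt_or_eq_dec _ _ Hneg) as [Hlt|Heq]; [|exists t; split; assumption].
      destruct (Rtotal_order t t0) as [H|[->|H]]; [| lra |].
      - destruct (lipschitz_zero (hp F h) t t0) as (u & Hu & Eu);
          [apply lipschitz_sub with (1 := Hl); lra|lra|exact Hlt|exact Hp0|].
        exists u; split; [lra|exact Eu].
      - destruct (lipschitz_zero (fun u => - hp F h u) t0 t) as (u & Hu & Eu);
          [apply lipschitz_opp, lipschitz_sub with (1 := Hl); lra|lra|lra|lra|].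
        exists u; split; [lra|lra]. }
    destruct Hz as (u & Hu & Eu); specialize (Habs u Hu); rewrite Eu, Rabs_R0 in Habs; lra. }
  assert (Hin : forall t, a < t < b -> hp F h t = al F).
  { intros t Ht; rewrite <- (Habs t Ht); symmetry; apply Rabs_right; left; apply Hpos, Ht. }
  assert (Hall : forall t, a <= t <= b -> hp F h t = al F).
  { intros t Ht; rewrite <- (Hin ((a + b) / 2)) by lra.
    apply (loc_quad_const (hp F h) a b Hab) with (t := t) in Ht as Ht'.
    - rewrite Ht'; symmetry; apply (loc_quad_const (hp F h) a b Hab); try lra.
      + apply lipschitz_sub with (1 := Hl); lra.
      + intros u Hu; exists 0, 1; split; [lra|]; intros v Hv _; rewrite (Hin u Hu), (Hin v Hv), Rminus_diag, Rabs_R0; lra.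
    - apply lipschitz_sub with (1 := Hl); lra.
    - intros u Hu; exists 0, 1; split; [lra|]; intros v Hv _; rewrite (Hin u Hu), (Hin v Hv), Rminus_diag, Rabs_R0; lra. }
  split; [|exact Hall].
  apply straight_arc; try lra; [exact Hall|]; intros t Ht; left; apply Hq, Ht.
Qed.

(** Since hp <= al, the equation hp' = - sg hz B' allows no growth of B beyond O(d^2). The cut
    inequality then makes A grow at a positive rate, and hq' = sg hz A' < 0 carries hq below be. *)
Lemma corner_right t : 0 <= t < T -> hp F h t = al F -> hq F h t = be F -> sg F * hz h t < 0 ->
  exists eta, 0 < eta /\ forall t', t < t' < t + eta -> t' <= T -> Rabs (hq F h t') < be F /\ 0 < hp F h t'.
Proof.
  intros Ht Ep Eq Hz.
  destruct (scalar_facts OK E) as (C & HC & Hsf); fold h in Hsf.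
  assert (Hal := al_pos F OK); assert (Hbe := be_pos F OK).
  set (w := - (sg F * hz h t)); assert (Hw : 0 < w) by (unfold w; lra).
  set (M := C / w + C / be F).
  assert (HM : 0 <= M).
  { unfold M; apply Rplus_le_le_0_compat; apply Rmult_le_pos; try lra; left; apply Rinv_0_lt_compat; lra. }
  destruct (lipschitz_near _ _ _ (hp_lip OK E) t (al F)) as (e1 & He1 & H1); [lra|lra|]; fold h in H1.
  destruct (lipschitz_near _ _ _ (hq_lip OK E) t (be F)) as (e2 & He2 & H2); [lra|lra|]; fold h in H2.
  set (D := w / al F * (C + be F * M) + C).
  assert (HD : 0 <= D).
  { unfold D; apply Rplus_le_le_0_compat; [|exact HC]; apply Rmult_le_pos; [|nra].
    apply Rmult_le_pos; [lra|left; apply Rinv_0_lt_compat; lra]. }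
  assert (Hwa : 0 < w / al F) by (apply Rdiv_lt_0_compat; lra).
  set (e3 := w / al F / (D + 1)).
  assert (He3 : 0 < e3) by (apply Rdiv_lt_0_compat; lra).
  exists (Rmin e1 (Rmin e2 e3)); split; [repeat apply Rmin_glb_lt; assumption|].
  intros t' Ht' HT.
  assert (Hd1 : t' - t < e1) by (generalize (Rmin_l e1 (Rmin e2 e3)); lra).
  assert (Hd2 : t' - t < e2) by (generalize (Rmin_r e1 (Rmin e2 e3)) (Rmin_l e2 e3); lra).
  assert (Hd3 : t' - t < e3) by (generalize (Rmin_r e1 (Rmin e2 e3)) (Rmin_r e2 e3); lra).
  specialize (H1 t' (ltac:(lra)) (ltac:(rewrite Rabs_right; lra))).
  specialize (H2 t' (ltac:(lra)) (ltac:(rewrite Rabs_right; lra))).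
  rewrite Ep in H1; rewrite Eq in H2; apply Rabs_lt_between in H1; apply Rabs_lt_between in H2.
  destruct (Hsf t t') as [S1 _ S3 S4 _ _ _ _ _ _]; [lra|lra|]; fold h in S1, S3, S4.
  assert (Hc := ex_cost _ _ _ _ _ _ _ E t t' (ltac:(lra)) (ltac:(lra))).
  assert (Hpb := hp_bound OK E (t := t') (ltac:(lra))); fold h in Hpb; apply Rabs_le_between in Hpb.
  rewrite Ep, Eq in S1; rewrite Ep in S3; rewrite Eq in S4.
  set (x := A t' - A t) in *; set (y := B t' - B t) in *; set (d := t' - t) in *.
  assert (Hd : 0 < d) by (unfold d; lra).
  assert (Hdd : 0 <= d * d) by nra.
  apply Rabs_le_between in S3; apply Rabs_le_between in S4.
  replace (sg F * hz h t) with (- w) in S3, S4 by (unfold w; ring).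
  assert (Hy1 : w * y <= C * (d * d)) by lra.
  assert (Hy1' : y <= C / w * (d * d)).
  { apply Rmult_le_reg_l with w; [lra|]; replace (w * (C / w * (d * d))) with (C * (d * d)) by (field; lra); lra. }
  assert (Hx2 : be F * y <= be F * (M * (d * d))).
  { apply Rmult_le_compat_l; [lra|]; unfold M.
    assert (0 <= C / be F * (d * d)) by (apply Rmult_le_pos; [apply Rmult_le_pos; [lra|left; apply Rinv_0_lt_compat; lra]|lra]).
    lra. }
  assert (Hx : d - (C + be F * M) * (d * d) <= al F * x) by lra.
  assert (Hx' : w / al F * (d - (C + be F * M) * (d * d)) <= w * x).
  { replace (w * x) with (w / al F * (al F * x)) by (field; lra); apply Rmult_le_compat_l; lra. }
  assert (Hlast : (D + 1) * d < w / al F).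
  { replace (w / al F) with ((D + 1) * e3) by (unfold e3; field; lra).
    apply Rmult_lt_compat_l; lra. }
  assert (Hneg : hq F h t' < be F).
  { assert (w / al F * d - D * (d * d) <= w * x - C * (d * d)).
    { unfold D; lra. }
    assert (0 < w / al F * d - D * (d * d)).
    { replace (w / al F * d - D * (d * d)) with (d * (w / al F - D * d)) by ring.
      apply Rmult_lt_0_compat; [lra|]; nra. }
    lra. }
  split; [apply Rabs_def1; lra|lra].
Qed.
End Arcs.

(** * Zeros and sign intervals of Lipschitz functions *)

Lemma lipschitz_reflect f a b : lipschitz_on f a b -> lipschitz_on (fun t => f (- t)) (- b) (- a).
Proof.
  intros (C & HC & H); exists C; split; [exact HC|]; intros s t Hs Ht.
  rewrite Rabs_minus_sym; replace (t - s) with (- s - - t) by ring; apply H; lra.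
Qed.

Lemma lipschitz_nonneg_closed f a b : lipschitz_on f a b -> forall t, a <= t <= b ->
  (forall eta, 0 < eta -> exists t', a <= t' <= b /\ Rabs (t' - t) < eta /\ 0 <= f t') -> 0 <= f t.
Proof.
  intros Hf t Ht H; apply Rnot_lt_le; intros Hn.
  destruct (lipschitz_pos _ _ _ (lipschitz_opp _ _ _ Hf) t Ht) as (eta & He & Hp); [lra|].
  destruct (H eta He) as (t' & Ht' & Hd & Hf'); specialize (Hp t' Ht' Hd); lra.
Qed.

Lemma right_exit f a b : lipschitz_on f a b -> a < b -> 0 < f a -> f b <= 0 ->
  exists v, a < v <= b /\ f v = 0 /\ forall x, a <= x < v -> 0 < f x.
Proof.
  intros Hf Hab Ha Hb.
  destruct (first_exit (fun t => 0 < f t) a b Hab) as (v & Hv & Hn & Hx).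
  - destruct (lipschitz_pos f a b Hf a) as (eta & He & H); [lra|lra|].
    exists eta; split; [exact He|]; intros t Ht HtT; apply H; [lra|rewrite Rabs_right; lra].
  - intros t Ht Hft; destruct (lipschitz_pos f a b Hf t) as (eta & He & H); [lra|lra|].
    exists eta; split; [exact He|]; intros t' Hd Ht'; apply H; [lra|exact Hd].
  - assert (Hle : f v <= 0) by (destruct Hx as [->|Hx]; [exact Hb|lra]).
    exists v; split; [exact Hv|]; split.
    + apply Rle_antisym; [exact Hle|].
      apply (lipschitz_nonneg_closed Hf); [lra|]; intros eta He.
      exists (Rmax ((a + v) / 2) (v - eta / 2)).
      assert (Rmax ((a + v) / 2) (v - eta / 2) < v) by (apply Rmax_lub_lt; lra).
      generalize (Rmax_l ((a + v) / 2) (v - eta / 2)) (Rmax_r ((a + v) / 2) (v - eta / 2)); intros.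
      split; [lra|]; split; [rewrite Rabs_left; lra|]; left; apply Hn; lra.
    + intros x Hx'; destruct (Req_dec x a) as [->|]; [exact Ha|apply Hn; lra].
Qed.

Lemma positive_component f a b t : lipschitz_on f a b -> a < t < b -> 0 < f t -> f a <= 0 -> f b <= 0 ->
  exists u v, a <= u < t /\ t < v <= b /\ f u = 0 /\ f v = 0 /\ forall x, u < x < v -> 0 < f x.
Proof.
  intros Hf Ht Hp Ha Hb.
  destruct (@right_exit f t b) as (v & Hv & Ev & Pv);
    [apply lipschitz_sub with (1 := Hf); lra|lra|exact Hp|exact Hb|].
  destruct (@right_exit (fun t => f (- t)) (- t) (- a)) as (u & Hu & Eu & Pu).
  - apply lipschitz_reflect, lipschitz_sub with (1 := Hf); lra.
  - lra.
  - rewrite Ropp_involutive; exact Hp.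
  - rewrite Ropp_involutive; exact Ha.
  - exists (- u), v; repeat split; try lra; try assumption.
    intros x Hx; destruct (Rle_dec t x); [apply Pv; lra|].
    replace x with (- - x) by ring; apply Pu; lra.
Qed.

Lemma last_zero f a b : lipschitz_on f a b -> (exists t, a <= t <= b /\ f t = 0) ->
  exists m, a <= m <= b /\ f m = 0 /\ forall t, m < t <= b -> f t <> 0.
Proof.
  intros Hf (t0 & Ht0 & E0).
  destruct (completeness (fun t => a <= t <= b /\ f t = 0)) as [m [Hub Hlub]].
  { exists b; intros t [Ht _]; lra. }
  { exists t0; split; assumption. }
  assert (Hm : a <= m <= b).
  { split; [apply Rle_trans with t0; [lra|apply Hub; split; assumption]|apply Hlub; intros t [Ht _]; lra]. }
  assert (Hz : forall eta, 0 < eta -> exists t', a <= t' <= b /\ Rabs (t' - m) < eta /\ f t' = 0).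
  { intros eta He; apply Classical_Prop.NNPP; intros N.
    assert (is_upper_bound (fun t => a <= t <= b /\ f t = 0) (m - eta)); [|apply Hlub in H; lra].
    intros t [Ht Et]; apply Rnot_lt_le; intros Hlt; apply N; exists t; split; [exact Ht|split; [|exact Et]].
    assert (t <= m) by (apply Hub; split; assumption); apply Rabs_def1; lra. }
  exists m; split; [exact Hm|]; split.
  - apply Rle_antisym.
    + apply Ropp_le_cancel; rewrite Ropp_0.
      apply (lipschitz_nonneg_closed (lipschitz_opp _ _ _ Hf)); [exact Hm|]; intros eta He.
      destruct (Hz eta He) as (t' & Ht' & Hd & Et); exists t'; split; [exact Ht'|]; split; [exact Hd|]; lra.
    + apply (lipschitz_nonneg_closed Hf); [exact Hm|]; intros eta He.
      destruct (Hz eta He) as (t' & Ht' & Hd & Et); exists t'; split; [exact Ht'|]; split; [exact Hd|]; lra.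
  - intros t Ht Et; assert (t <= m) by (apply Hub; split; [lra|exact Et]); lra.
Qed.

Lemma first_zero f a b : lipschitz_on f a b -> (exists t, a <= t <= b /\ f t = 0) ->
  exists m, a <= m <= b /\ f m = 0 /\ forall t, a <= t < m -> f t <> 0.
Proof.
  intros Hf (t0 & Ht0 & E0).
  destruct (last_zero (lipschitz_reflect Hf)) as (m & Hm & Em & Hl).
  { exists (- t0); rewrite Ropp_involutive; split; [lra|exact E0]. }
  exists (- m); split; [lra|split; [exact Em|]]; intros t Ht.
  replace t with (- - t) by ring; apply Hl; lra.
Qed.

Lemma nonzero_sign f a b : lipschitz_on f a b -> (forall t, a < t < b -> f t <> 0) ->
  (forall t, a < t < b -> f t < 0) \/ (forall t, a < t < b -> 0 < f t).
Proof.
  intros Hf Hnz.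
  destruct (Classical_Prop.classic (exists t, a < t < b /\ 0 < f t)) as [(t0 & Ht0 & Hp)|N].
  - right; intros t Ht; destruct (Rtotal_order (f t) 0) as [Hlt|[He|]]; [|exfalso; apply (Hnz t Ht He)|assumption].
    exfalso; destruct (Rtotal_order t t0) as [H|[->|H]]; [|lra|].
    + destruct (lipschitz_zero f t t0) as (u & Hu & Eu); [apply lipschitz_sub with (1 := Hf); lra|lra|exact Hlt|exact Hp|].
      apply (Hnz u); [lra|exact Eu].
    + destruct (lipschitz_zero (fun x => - f x) t0 t) as (u & Hu & Eu);
        [apply lipschitz_opp, lipschitz_sub with (1 := Hf); lra|lra|lra|lra|].
      apply (Hnz u); lra.
  - left; intros t Ht; destruct (Rtotal_order (f t) 0) as [|[He|Hgt]]; [assumption|exfalso; apply (Hnz t Ht He)|].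
    exfalso; apply N; exists t; split; assumption.
Qed.

(** * Curves that meet no opposite-sign corner *)

Lemma rotation_midpoint y0 w0 th :
  y0 + (y0 * cos th + w0 * sin th) = 2 * (y0 * cos (th / 2) + w0 * sin (th / 2)) * cos (th / 2).
Proof.
  replace th with (2 * (th / 2)) at 1 2 by field; rewrite cos_2a_cos, sin_2a; ring.
Qed.

Lemma le_acos th x : 0 <= th <= PI -> -1 <= x <= 1 -> x <= cos th -> th <= acos x.
Proof.
  intros Hth Hx Hle; apply Rnot_lt_le; intros Hlt.
  assert (Hb := acos_bound x).
  assert (H : cos th < cos (acos x)) by (apply cos_decreasing_1; lra).
  rewrite cos_acos in H by exact Hx; lra.
Qed.

Section NoO.
Variables (F : frame) (K : R) (gh : quat) (T : R) (ga : R -> quat) (A B : R -> R).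
Hypothesis OK : frame_ok F.
Hypothesis E : ext F K gh T ga A B.
Let h := hh K gh T ga.

(** On the circle of [arc_h], the mean of the end values is the midpoint value times the cosine of
    half the angle. A bound on the switching function at the midpoint thus controls an arc between
    two visits to a corner. *)
Lemma arc_mid a b : 0 <= a -> b <= T -> a <= b -> arc_on F ga a b ->
  let y t := hq F h t - cc F * hp F h a in
  y a + y b = 2 * y ((a + b) / 2) * cos ((b - a) / al F / 2) /\ 0 <= cos ((b - a) / al F / 2).
Proof.
  intros Ha Hb Hab Harc y.
  assert (Hal := al_pos F OK).
  destruct (arc_h OK E (t := b) Ha Hb Harc) as (_ & E1 & _); [lra|].
  destruct (arc_h OK E (t := (a + b) / 2) Ha Hb Harc) as (_ & E2 & _); [lra|].
  fold h in E1, E2; unfold y; rewrite E1, E2.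
  replace (((a + b) / 2 - a) / al F) with ((b - a) / al F / 2) by (field; lra).
  split; [apply rotation_midpoint|].
  assert (Hp := arc_le_pi OK E (conj Ha Hab) Hb Harc).
  assert (0 <= (b - a) / al F <= PI).
  { split; [apply Rmult_le_pos; [lra|left; apply Rinv_0_lt_compat; lra]|].
    apply Rmult_le_reg_l with (al F); [lra|]; replace (al F * ((b - a) / al F)) with (b - a) by (field; lra); lra. }
  apply cos_ge_0; generalize PI_RGT_0; lra.
Qed.

Lemma arc_concat a b c : a <= b <= c -> arc_on F ga a b -> arc_on F ga b c -> arc_on F ga a c.
Proof.
  intros Habc H1 H2 t Ht; destruct (Rle_dec t b); [apply H1; lra|].
  rewrite (H2 t), (H1 b), <- qmul_assoc, rt_add by (try apply OK; lra).
  f_equal; f_equal; field; generalize (al_pos F OK); lra.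
Qed.

Lemma arc_angle a b : 0 <= a <= b -> b <= T -> arc_on F ga a b ->
  exists x, 0 <= x <= PI /\ b - a = al F * x /\ ga b = qmul (ga a) (rt (fP F) x).
Proof.
  intros Ha Hb Harc; assert (Hal := al_pos F OK); assert (Hp := arc_le_pi OK E Ha Hb Harc).
  exists ((b - a) / al F); split; [|split; [field; lra|apply Harc; lra]].
  split; [apply Rmult_le_pos; [lra|left; apply Rinv_0_lt_compat; lra]|].
  apply Rmult_le_reg_l with (al F); [lra|]; replace (al F * ((b - a) / al F)) with (b - a) by (field; lra); lra.
Qed.

(* At a same-sign corner with h_z = 0 the Q-component of any admissible motion
   is second order, since be <= cc * al pushes both controls to the same side. *)
Lemma corner_stay_arc a b : 0 <= a -> a <= b -> b <= T -> be F <= cc F * al F -> cc F < 1 ->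
  (forall t, a <= t <= b -> hp F h t = al F /\ hq F h t = be F /\ hz h t = 0) ->
  arc_on F ga a b.
Proof.
  intros Ha Hab Hb Hk Hc1 Hh.
  assert (Hal := al_pos F OK); assert (Hbe := be_pos F OK).
  destruct (scalar_facts OK E) as (C & HC & Hsf); fold h in Hsf.
  apply (straight_arc_gen OK E); try assumption; [intros t Ht; apply Hh, Ht|].
  (* With hz = 0 throughout, the equation for hz reads m x + n y = O(d^2) with m >= 0 and n > 0, and
     the cut inequality makes x and y nonnegative up to O(d^2). Hence y = O(d^2). *)
  set (n := al F - cc F * be F).
  assert (Hcc : 0 < cc F) by nra.
  assert (Hn : 0 < n) by (unfold n; nra).
  set (M1 := C / be F); set (m := cc F * al F - be F); set (M2 := C + m * (C / al F)).
  assert (HM1 : 0 <= M1) by (apply Rmult_le_pos; [lra|left; apply Rinv_0_lt_compat; lra]).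
  assert (HCa : 0 <= C / al F) by (apply Rmult_le_pos; [lra|left; apply Rinv_0_lt_compat; lra]).
  assert (Hm : 0 <= m) by (unfold m; lra).
  assert (HM2 : 0 <= M2 / n).
  { apply Rmult_le_pos; [unfold M2; nra|left; apply Rinv_0_lt_compat; lra]. }
  intros t Ht; exists (M1 + M2 / n); split; [lra|].
  intros s u Hs Hu _.
  destruct (Hsf s u) as [S1 _ _ _ _ _ SZ _ _ _]; [lra|lra|]; fold h in S1, SZ.
  assert (Hcost := ex_cost _ _ _ _ _ _ _ E s u (ltac:(lra)) (ltac:(lra))).
  destruct (Hh s) as (P1 & P2 & P3); [lra|]; destruct (Hh u) as (P4 & P5 & P6); [lra|].
  rewrite P1, P2 in S1; rewrite P1, P2, P3, P6 in SZ.
  set (x := A u - A s) in *; set (y := B u - B s) in *; set (d := u - s) in *.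
  assert (Hdd : 0 <= d * d) by apply Rle_0_sqr.
  generalize (Rle_abs x) (Rle_abs y) (Rle_abs (- x)) (Rle_abs (- y)); rewrite !Rabs_Ropp; intros A1 A2 A3 A4.
  assert (Hy : - (M1 * (d * d)) <= y).
  { assert (- (C * (d * d)) <= be F * y) by nra.
    apply Rmult_le_reg_l with (be F); [lra|]; unfold M1.
    replace (be F * - (C / be F * (d * d))) with (- (C * (d * d))) by (field; lra); lra. }
  assert (Hx : - (C / al F * (d * d)) <= x).
  { assert (- (C * (d * d)) <= al F * x) by nra.
    apply Rmult_le_reg_l with (al F); [lra|].
    replace (al F * - (C / al F * (d * d))) with (- (C * (d * d))) by (field; lra); lra. }
  assert (Hy2 : y <= M2 / n * (d * d)).
  { apply Rmult_le_reg_l with n; [lra|].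
    replace (n * (M2 / n * (d * d))) with (M2 * (d * d)) by (field; lra).
    apply Rabs_le_between in SZ; unfold M2, n, m in *.
    assert (G : (cc F * al F - be F) * - (C / al F * (d * d)) <= (cc F * al F - be F) * x)
      by (apply Rmult_le_compat_l; lra).
    nra. }
  assert (0 <= M1 * (d * d)) by (apply Rmult_le_pos; lra).
  assert (0 <= M2 / n * (d * d)) by (apply Rmult_le_pos; lra).
  apply Rabs_le; lra.
Qed.
End NoO.

(** A Q-arc between two visits to the corner (al, be) is impossible: as al > cc be, hp would be at
    least al at its midpoint. A P-arc may return to the corner, and [arc_mid] with hq >= -be bounds
    its angle. So there are at most a Q-arc, a P-arc and a Q-arc. *)
Lemma no_O_words F K gh T ga A B :
  frame_ok F -> ext F K gh T ga A B -> be F <= cc F * al F -> cc F < 1 ->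
  let h := hh K gh T ga in
  (forall t, 0 <= t <= T -> hp F h t = al F \/ hq F h t = be F) ->
  (forall t, 0 < t < T -> hp F h t <> - al F /\ hq F h t <> - be F) ->
  exists x y, 0 <= x <= PI /\ 0 <= y <= PI /\
   ((ga T = qmul (rt (fP F) x) (rt (fQ F) y) /\ T = al F * x + be F * y) \/
    (ga T = qmul (rt (fQ F) x) (rt (fP F) y) /\ T = be F * x + al F * y) \/
    exists t, 0 <= t <= 2 * acos ((cc F * al F - be F) / (cc F * al F + be F)) /\
      ga T = qmul (rt (fQ F) x) (qmul (rt (fP F) t) (rt (fQ F) y)) /\ T = be F * x + al F * t + be F * y).
Proof.
  intros OK E Hk Hc1 h Hcomp HnO.
  assert (Hal := al_pos F OK); assert (Hbe := be_pos F OK).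
  assert (HPI := PI_RGT_0).
  assert (HT := ex_T _ _ _ _ _ _ _ E).
  assert (Hcc : 0 < cc F) by nra.
  assert (OK' := rotF_ok F OK); assert (E' := ext_rot _ _ _ _ _ _ _ E).
  (* Compares the distances to the two bounds: f < 0 on P-arcs, f > 0 on Q-arcs, f = 0 at the corner
     (al, be). *)
  set (f := fun t => (al F - hp F h t) - (be F - hq F h t)).
  assert (Hpb := fun t => hp_bound OK E (t := t)); assert (Hqb := fun t => hq_bound OK E (t := t)).
  fold h in Hpb, Hqb.
  assert (Hf : lipschitz_on f 0 T).
  { destruct (scalar_facts OK E) as (C & HC & Hsf); fold h in Hsf.
    exists (C + C); split; [lra|]; intros s t Hs Ht.
    destruct (Hsf s t Hs Ht) as [_ _ _ _ _ _ _ H1 H2 _]; fold h in H1, H2; unfold f.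
    replace (al F - hp F h t - (be F - hq F h t) - (al F - hp F h s - (be F - hq F h s)))
      with (- (hp F h t - hp F h s) + (hq F h t - hq F h s)) by ring.
    eapply Rle_trans; [apply Rabs_triang|]; rewrite Rabs_Ropp; lra. }
  assert (fneg : forall t, 0 < t < T -> f t < 0 -> hp F h t = al F /\ Rabs (hq F h t) < be F).
  { intros t Ht Hn; unfold f in Hn; destruct (Hcomp t) as [H|H]; [lra| |].
    - split; [exact H|]; specialize (Hqb t (ltac:(lra))); apply Rabs_le_between in Hqb.
      destruct (HnO t Ht) as [_ Hq]; apply Rabs_def1; lra.
    - exfalso; specialize (Hpb t (ltac:(lra))); apply Rabs_le_between in Hpb; lra. }
  assert (fpos : forall t, 0 < t < T -> 0 < f t -> hq F h t = be F /\ Rabs (hp F h t) < al F).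
  { intros t Ht Hn; unfold f in Hn; destruct (Hcomp t) as [H|H]; [lra| |].
    - exfalso; specialize (Hqb t (ltac:(lra))); apply Rabs_le_between in Hqb; lra.
    - split; [exact H|]; specialize (Hpb t (ltac:(lra))); apply Rabs_le_between in Hpb.
      destruct (HnO t Ht) as [Hq _]; apply Rabs_def1; lra. }
  assert (f0 : forall t, 0 <= t <= T -> f t = 0 -> hp F h t = al F /\ hq F h t = be F).
  { intros t Ht H0; unfold f in H0; destruct (Hcomp t Ht); lra. }
  assert (arcP : forall a b, 0 <= a -> a <= b -> b <= T -> (forall t, a < t < b -> f t < 0) -> arc_on F ga a b).
  { intros a b Ha Hab Hb Hn; destruct Hab as [Hab| <-].
    - apply (face_arc OK E); try assumption; fold h.
      + intros t Ht; apply fneg; [lra|apply Hn; lra].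
      + exists ((a + b) / 2); split; [lra|].
        destruct (fneg ((a + b) / 2)) as [-> _]; [lra|apply Hn; lra|exact Hal].
    - intros t Ht; replace t with a by lra; unfold Rdiv; rewrite Rminus_diag, Rmult_0_l, rt_0, qmul_1_r; reflexivity. }
  assert (arcQ : forall a b, 0 <= a -> a <= b -> b <= T -> (forall t, a < t < b -> 0 < f t) -> arc_on (rotF F) ga a b).
  { intros a b Ha Hab Hb Hn; destruct Hab as [Hab| <-].
    - apply (face_arc OK' E'); try assumption; fold h.
      + intros t Ht; rewrite hq_rot, Rabs_Ropp; apply fpos; [lra|apply Hn; lra].
      + exists ((a + b) / 2); split; [lra|]; rewrite hp_rot.
        destruct (fpos ((a + b) / 2)) as [-> _]; [lra|apply Hn; lra|exact Hbe].
    - intros t Ht; replace t with a by lra; unfold Rdiv; rewrite Rminus_diag, Rmult_0_l, rt_0, qmul_1_r; reflexivity. }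
  assert (G0 := ex_0 _ _ _ _ _ _ _ E).
  destruct (Classical_Prop.classic (exists t, 0 <= t <= T /\ f t = 0)) as [HZ|HZ].
  2: { destruct (nonzero_sign Hf) as [Hs|Hs].
       { intros t Ht Z; apply HZ; exists t; split; [lra|exact Z]. }
       - destruct (arc_angle OK E (a := 0) (b := T)) as (x & Hx & Ex & Eg); [lra|lra|apply arcP; auto; lra|].
         exists x, 0; split; [exact Hx|]; split; [lra|]; left.
         rewrite Eg, G0, qmul_1_l, rt_0, qmul_1_r; split; [reflexivity|lra].
       - destruct (arc_angle OK' E' (a := 0) (b := T)) as (x & Hx & Ex & Eg); [lra|lra|apply arcQ; auto; lra|].
         exists x, 0; split; [exact Hx|]; split; [lra|]; right; left.
         rewrite Eg, G0, qmul_1_l, rt_0, qmul_1_r; split; [reflexivity|simpl in Ex; lra]. }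
  destruct (first_zero Hf HZ) as (ta & Hta & Ea & Fa).
  destruct (last_zero Hf HZ) as (tb & Htb & Eb & Lb).
  assert (Hab : ta <= tb).
  { apply Rnot_lt_le; intros Hlt; apply (Fa tb); [lra|exact Eb]. }
  assert (Hmid : forall t, ta <= t <= tb -> f t <= 0).
  { intros t Ht; apply Rnot_lt_le; intros Hp.
    destruct (@positive_component f ta tb t) as (u & v & Hu & Hv & Eu & Ev & Hpos);
      [apply lipschitz_sub with (1 := Hf); lra| |exact Hp|lra|lra|].
    { split; apply Rnot_le_lt; intros Hle;
        [replace t with ta in Hp by lra|replace t with tb in Hp by lra]; lra. }
    assert (Harc : arc_on (rotF F) ga u v) by (apply arcQ; try lra; exact Hpos).
    destruct (arc_mid OK' E' (a := u) (b := v)) as [M1 M2]; [lra|lra|lra|exact Harc|].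
    fold h in M1; simpl in M1, M2; rewrite !hq_rot, !hp_rot in M1.
    destruct (f0 u) as [U1 U2]; [lra|exact Eu|]; destruct (f0 v) as [V1 V2]; [lra|exact Ev|].
    destruct (fpos ((u + v) / 2)) as [_ M3]; [lra|apply Hpos; lra|].
    apply Rabs_def2 in M3; rewrite U1, U2, V1 in M1.
    set (cs := cos ((v - u) / be F / 2)) in *; set (m := hp F h ((u + v) / 2)) in *.
    assert (Hcs : cs <= 1) by apply COS_bound.
    assert (Hlt : 0 < al F - cc F * be F) by nra.
    assert (M4 : (m - cc F * be F) * cs = al F - cc F * be F) by lra.
    destruct (Rle_dec (m - cc F * be F) 0); nra. }
  assert (Hpm : forall t, ta <= t <= tb -> hp F h t = al F).
  { intros t Ht; destruct (Hmid t Ht) as [H|H]; [|apply f0; lra].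
    unfold f in H; destruct (Hcomp t) as [|Hq]; [lra|assumption|].
    specialize (Hpb t (ltac:(lra))); apply Rabs_le_between in Hpb; lra. }
  assert (Harc : arc_on F ga ta tb).
  { destruct (Classical_Prop.classic (exists t, ta < t < tb /\ Rabs (hq F h t) = be F /\ hz h t = 0)) as [(t0 & Ht0 & Q0 & Z0)|N].
    (* A single interior visit with hz = 0 pins h down: by conservation of the norm and hq <= be <=
       cc al, it stays at the corner during the whole stretch. *)
    - apply (corner_stay_arc OK E); try lra; fold h.
      intros t Ht; assert (P1 := Hpm t Ht).
      assert (N1 := h_const_norm OK E (t := t0) (ltac:(lra))); assert (N2 := h_const_norm OK E (t := t) (ltac:(lra))).
      fold h in N1, N2; rewrite <- N2, (Hpm t0), P1, Z0 in N1 by lra.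
      assert (Q0' : hq F h t0 = be F).
      { destruct (Rcase_abs (hq F h t0)) as [Hneg|Hpos]; [|rewrite Rabs_right in Q0; lra].
        rewrite Rabs_left in Q0 by lra; exfalso; apply (proj2 (HnO t0 (ltac:(lra)))); lra. }
      rewrite Q0' in N1; clear N2.
      specialize (Hqb t (ltac:(lra))); apply Rabs_le_between in Hqb.
      assert (Hsg := ok_sg0 F OK).
      set (q := hq F h t) in *; set (z := hz h t) in *.
      assert (N3 : (cc F * al F - q) * (cc F * al F - q) + sg F * sg F * (z * z) = (cc F * al F - be F) * (cc F * al F - be F)) by lra.
      assert (Hz2 : 0 <= sg F * sg F * (z * z)) by (apply Rmult_le_pos; apply Rle_0_sqr).
      assert (Hqq : q = be F) by nra.
      split; [exact P1|]; split; [exact Hqq|].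
      rewrite Hqq in N3; assert (Hz3 : sg F * sg F * (z * z) = 0) by lra.
      apply Rmult_integral in Hz3; destruct Hz3 as [H|H]; apply Rmult_integral in H; destruct H; try assumption; exfalso; apply Hsg; assumption.
    - apply (straight_arc OK E); try lra; fold h; [exact Hpm|].
      intros t Ht; specialize (Hqb t (ltac:(lra))); destruct Hqb as [H|H]; [left; exact H|].
      right; intros Z; apply N; exists t; repeat split; try assumption; lra. }
  destruct (@nonzero_sign f 0 ta) as [S1|S1]; [apply lipschitz_sub with (1 := Hf); lra|intros t Ht; apply Fa; lra| |];
  (destruct (@nonzero_sign f tb T) as [S2|S2]; [apply lipschitz_sub with (1 := Hf); lra|intros t Ht; apply Lb; lra| |]).
  - assert (A3 : arc_on F ga 0 T).
    { apply (arc_concat OK) with tb; [lra| |apply arcP; try lra; exact S2].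
      apply (arc_concat OK) with ta; [lra|apply arcP; try lra; exact S1|exact Harc]. }
    destruct (arc_angle OK E (a := 0) (b := T)) as (x & Hx & Ex & Eg); [lra|lra|exact A3|].
    exists x, 0; split; [exact Hx|]; split; [lra|]; left.
    rewrite Eg, G0, qmul_1_l, rt_0, qmul_1_r; split; [reflexivity|lra].
  - assert (A3 : arc_on F ga 0 tb).
    { apply (arc_concat OK) with ta; [lra|apply arcP; try lra; exact S1|exact Harc]. }
    destruct (arc_angle OK E (a := 0) (b := tb)) as (x & Hx & Ex & Eg); [lra|lra|exact A3|].
    destruct (arc_angle OK' E' (a := tb) (b := T)) as (y & Hy & Ey & Eg'); [lra|lra|apply arcQ; try lra; exact S2|].
    exists x, y; split; [exact Hx|]; split; [exact Hy|]; left.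
    rewrite Eg', Eg, G0, qmul_1_l; split; [reflexivity|simpl in Ey; lra].
  - assert (A3 : arc_on F ga ta T).
    { apply (arc_concat OK) with tb; [lra|exact Harc|apply arcP; try lra; exact S2]. }
    destruct (arc_angle OK' E' (a := 0) (b := ta)) as (x & Hx & Ex & Eg); [lra|lra|apply arcQ; try lra; exact S1|].
    destruct (arc_angle OK E (a := ta) (b := T)) as (y & Hy & Ey & Eg'); [lra|lra|exact A3|].
    exists x, y; split; [exact Hx|]; split; [exact Hy|]; right; left.
    rewrite Eg', Eg, G0, qmul_1_l; split; [reflexivity|simpl in Ex; lra].
  - destruct (arc_angle OK' E' (a := 0) (b := ta)) as (x & Hx & Ex & Eg); [lra|lra|apply arcQ; try lra; exact S1|].
    destruct (arc_angle OK E (a := ta) (b := tb)) as (t & Ht & Et & Egt); [lra|lra|exact Harc|].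
    destruct (arc_angle OK' E' (a := tb) (b := T)) as (y & Hy & Ey & Eg'); [lra|lra|apply arcQ; try lra; exact S2|].
    exists x, y; split; [exact Hx|]; split; [exact Hy|]; right; right; exists t.
    split; [|split; [rewrite Eg', Egt, Eg, G0, qmul_1_l; rewrite <- qmul_assoc; reflexivity|simpl in Ex, Ey; lra]].
    split; [lra|].
    destruct (arc_mid OK E (a := ta) (b := tb)) as [M1 M2]; [lra|lra|lra|exact Harc|].
    fold h in M1; simpl in M1, M2.
    replace ((tb - ta) / al F) with t in M1, M2 by (rewrite Et; field; lra).
    destruct (f0 ta) as [U1 U2]; [lra|exact Ea|]; destruct (f0 tb) as [V1 V2]; [lra|exact Eb|].
    rewrite U1, U2, V2 in M1.
    specialize (Hqb ((ta + tb) / 2) (ltac:(lra))); apply Rabs_le_between in Hqb.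
    set (m := hq F h ((ta + tb) / 2)) in *.
    assert (Hcs : (cc F * al F - be F) / (cc F * al F + be F) <= cos (t / 2)).
    { apply Rmult_le_reg_r with (cc F * al F + be F); [nra|].
      unfold Rdiv; rewrite Rmult_assoc, Rinv_l, Rmult_1_r by nra. nra. }
    replace t with (2 * (t / 2)) at 1 by field; apply Rmult_le_compat_l; [lra|].
    apply le_acos; [lra| |exact Hcs].
    assert (Hd : 0 < cc F * al F + be F) by nra.
    assert (Hn : 0 <= (cc F * al F - be F) / (cc F * al F + be F))
      by (apply Rmult_le_pos; [lra|left; apply Rinv_0_lt_compat; lra]).
    generalize (COS_bound (t / 2)); lra.
Qed.

(** * Second-order necessary condition *)

Lemma sin_cubic x : Rabs (sin x - x) <= Rabs x * (x * x).
Proof.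
  assert (H : forall y, 0 <= y -> Rabs (sin y - y) <= y * (y * y)).
  { intros y [Hy| <-]; [|rewrite sin_0, Rminus_0_r, Rabs_R0; lra].
    destruct (MVT_cor2 (fun u => sin u - u) (fun u => cos u - 1) 0 y Hy) as (u & Eu & Hu).
    { intros u _; apply derivable_pt_lim_minus; [apply derivable_pt_lim_sin|apply derivable_pt_lim_id]. }
    rewrite sin_0 in Eu; replace (sin y - y) with ((cos u - 1) * y) by lra.
    rewrite Rabs_mult, (Rabs_right y) by lra; rewrite Rmult_comm; apply Rmult_le_compat_l; [lra|].
    generalize (one_minus_cos u); intros; rewrite Rabs_left1 by lra; nra. }
  destruct (Rle_dec 0 x) as [Hx|Hx].
  - rewrite (Rabs_right x) by lra; apply H, Hx.
  - rewrite (Rabs_left x) by lra; specialize (H (- x) (ltac:(lra))).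
    rewrite sin_neg in H; replace (- sin x - - x) with (- (sin x - x)) in H by ring.
    rewrite Rabs_Ropp in H; replace (- x * - x) with (x * x) in H by ring; exact H.
Qed.

Lemma cos_cubic x : Rabs (cos x - 1 + x * x / 2) <= Rabs x * (x * x).
Proof.
  assert (H : forall y, 0 <= y -> Rabs (cos y - 1 + y * y / 2) <= y * (y * y)).
  { intros y [Hy| <-]; [|rewrite cos_0; replace (1 - 1 + 0 * 0 / 2) with 0 by field; rewrite Rabs_R0; lra].
    destruct (MVT_cor2 (fun u => cos u - 1 + u * u / 2) (fun u => - sin u + u) 0 y Hy) as (u & Eu & Hu).
    { intros u _; apply is_derive_Reals; auto_derive; [exact I|field]. }
    rewrite cos_0 in Eu; replace (cos y - 1 + y * y / 2) with ((- sin u + u) * y) by lra.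
    rewrite Rabs_mult, (Rabs_right y) by lra; rewrite Rmult_comm; apply Rmult_le_compat_l; [lra|].
    replace (- sin u + u) with (- (sin u - u)) by ring; rewrite Rabs_Ropp.
    eapply Rle_trans; [apply sin_minus_id; lra|nra]. }
  destruct (Rle_dec 0 x) as [Hx|Hx].
  - rewrite (Rabs_right x) by lra; apply H, Hx.
  - rewrite (Rabs_left x) by lra; specialize (H (- x) (ltac:(lra))).
    rewrite cos_neg in H; replace (- x * - x) with (x * x) in H by ring; exact H.
Qed.

Definition prodrt (l : list (quat * R)) (x : R) : quat :=
  fold_right (fun e q => qmul (rt (fst e) (x * snd e)) q) qone l.
(** [ord1] and [ord2] are the coefficients of x and x^2 in the expansion of [prodrt l x] at x =
    0. *)
Definition ord1 (l : list (quat * R)) : quat :=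
  fold_right (fun e q => qadd (qscal (snd e / 2) (fst e)) q) (mkQ 0 0 0 0) l.
Fixpoint ord2 (l : list (quat * R)) : quat :=
  match l with
  | [] => mkQ 0 0 0 0
  | e :: l' => qadd (qadd (qscal (- (snd e * snd e / 8)) qone) (ord2 l'))
                    (qmul (qscal (snd e / 2) (fst e)) (ord1 l'))
  end.

Lemma rt_expand3 v d : unitv v -> exists C, 0 <= C /\ forall x, -1 <= x <= 1 ->
  qn (qsub (rt v (x * d)) (qadd (qadd qone (qscal (x * (d / 2)) v)) (qscal (- (x * x * (d * d / 8))) qone)))
  <= C * (Rabs x * (x * x)).
Proof.
  intros [_ Hv]; exists (2 * (Rabs d * (d * d))).
  assert (Hd : 0 <= Rabs d * (d * d)) by (apply Rmult_le_pos; [apply Rabs_pos|apply Rle_0_sqr]).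
  split; [lra|]; intros x Hx.
  set (y := x * d / 2).
  replace (qsub _ _) with (qadd (qscal (cos y - 1 + y * y / 2) qone) (qscal (sin y - y) v))
    by (unfold rt, y; apply quat_ext; simpl; field).
  eapply Rle_trans; [apply qn_add|]; rewrite !qn_scal, (qn_unit v Hv), (qn_unit qone) by (unfold ip; simpl; ring).
  generalize (cos_cubic y) (sin_cubic y); intros H1 H2.
  assert (H3 : Rabs y * (y * y) <= Rabs d * (d * d) * (Rabs x * (x * x))).
  { unfold y, Rdiv; rewrite !Rabs_mult, (Rabs_right (/ 2)) by lra.
    assert (0 <= Rabs d * (d * d) * (Rabs x * (x * x)))
      by (apply Rmult_le_pos; [exact Hd|apply Rmult_le_pos; [apply Rabs_pos|apply Rle_0_sqr]]).
    replace (Rabs x * Rabs d * / 2 * (x * d * / 2 * (x * d * / 2)))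
      with (/ 8 * (Rabs d * (d * d) * (Rabs x * (x * x)))) by field.
    lra. }
  lra.
Qed.

Lemma prodrt_expand l : List.Forall (fun e => unitv (fst e)) l -> exists C, 0 <= C /\ forall x, -1 <= x <= 1 ->
  qn (qsub (prodrt l x) (qadd (qadd qone (qscal x (ord1 l))) (qscal (x * x) (ord2 l))))
  <= C * (Rabs x * (x * x)).
Proof.
  induction l as [|[v d] l IH]; intros HF.
  - exists 0; split; [lra|]; intros x _; simpl.
    replace (qsub _ _) with (qscal 0 qone) by qring; rewrite qn_scal, Rabs_R0; lra.
  - inversion HF as [|? ? Hv HF']; subst; simpl in Hv.
    destruct (IH HF') as (C1 & HC1 & H1); destruct (rt_expand3 d Hv) as (C2 & HC2 & H2).
    set (n1 := qn (ord1 l)); set (n2 := qn (ord2 l)); set (d2 := Rabs d / 2); set (d8 := d * d / 8).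
    assert (Hn1 : 0 <= n1) by apply qn_pos; assert (Hn2 : 0 <= n2) by apply qn_pos.
    assert (Hd2 : 0 <= d2) by (unfold d2; generalize (Rabs_pos d); lra).
    assert (Hd8 : 0 <= d8) by (unfold d8; generalize (Rle_0_sqr d); unfold Rsqr; lra).
    exists (C1 + C2 * (1 + n1 + n2) + d2 * n2 + d8 * (n1 + n2)); split.
    { assert (0 <= C2 * (1 + n1 + n2)) by (apply Rmult_le_pos; lra).
      assert (0 <= d2 * n2) by (apply Rmult_le_pos; lra).
      assert (0 <= d8 * (n1 + n2)) by (apply Rmult_le_pos; lra). lra. }
    intros x Hx; specialize (H1 x Hx); specialize (H2 x Hx).
    change (prodrt ((v, d) :: l) x) with (qmul (rt v (x * d)) (prodrt l x)).
    set (r := rt v (x * d)) in *; set (p := prodrt l x) in *.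
    change (ord1 ((v, d) :: l)) with (qadd (qscal (d / 2) v) (ord1 l)).
    change (ord2 ((v, d) :: l)) with (qadd (qadd (qscal (- (d * d / 8)) qone) (ord2 l)) (qmul (qscal (d / 2) v) (ord1 l))).
    set (o1 := ord1 l) in *; set (o2 := ord2 l) in *.
    set (e1 := qsub p (qadd (qadd qone (qscal x o1)) (qscal (x * x) o2))) in *.
    set (e2 := qsub r (qadd (qadd qone (qscal (x * (d / 2)) v)) (qscal (- (x * x * (d * d / 8))) qone))) in *.
    set (m := qadd (qadd qone (qscal x o1)) (qscal (x * x) o2)) in *.
    assert (EQ : qsub (qmul r p) (qadd (qadd qone (qscal x (qadd (qscal (d / 2) v) o1)))
        (qscal (x * x) (qadd (qadd (qscal (- (d * d / 8)) qone) o2) (qmul (qscal (d / 2) v) o1))))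
      = qadd (qadd (qmul r e1) (qmul e2 m))
         (qadd (qscal (x * x * x) (qmul (qscal (d / 2) v) o2))
               (qadd (qscal (- (x * x * x * (d * d / 8))) o1) (qscal (- (x * x * x * x * (d * d / 8))) o2)))).
    { unfold e1, e2, m; clearbody r p o1 o2; clear; apply quat_ext; simpl; field. }
    rewrite EQ; clear EQ.
    set (X := Rabs x * (x * x)) in *.
    assert (HX : 0 <= X) by (apply Rmult_le_pos; [apply Rabs_pos|apply Rle_0_sqr]).
    assert (Hx1 : Rabs x <= 1) by (apply Rabs_le; lra).
    assert (HX3 : Rabs (x * x * x) = X) by (unfold X; rewrite !Rabs_mult, <- (Rabs_right (x * x)) by (apply Rle_ge, Rle_0_sqr); rewrite Rabs_mult; ring).
    assert (HX4 : Rabs (x * x * x * x) <= X) by (rewrite Rabs_mult, HX3; nra).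
    assert (Hm : qn m <= 1 + n1 + n2).
    { unfold m; eapply Rle_trans; [apply qn_add|]; eapply Rle_trans; [apply Rplus_le_compat_r, qn_add|].
      rewrite !qn_scal, (qn_unit qone) by (unfold ip; simpl; ring); fold o1 o2 in n1, n2; fold n1 n2.
      assert (Rabs (x * x) <= 1) by (rewrite Rabs_mult; generalize (Rabs_pos x); nra).
      assert (Rabs x * n1 <= n1) by (rewrite <- (Rmult_1_l n1) at 2; apply Rmult_le_compat_r; lra).
      assert (Rabs (x * x) * n2 <= n2) by (rewrite <- (Rmult_1_l n2) at 2; apply Rmult_le_compat_r; lra).
      lra. }
    assert (Hr : qn r = 1) by (apply qn_unit, ip_rt, Hv).
    eapply Rle_trans; [apply qn_add|].
    eapply Rle_trans; [apply Rplus_le_compat; [apply qn_add|]|].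
    { eapply Rle_trans; [apply qn_add|]; apply Rplus_le_compat_l, qn_add. }
    rewrite !qn_mul, !qn_scal, !qn_mul, !qn_scal, Hr, HX3.
    destruct Hv as [_ Hv]; rewrite (qn_unit v Hv).
    fold o1 o2 in n1, n2; fold n1 n2.
    assert (B1 : qn e2 * qn m <= C2 * (1 + n1 + n2) * X).
    { replace (C2 * (1 + n1 + n2) * X) with (C2 * X * (1 + n1 + n2)) by ring.
      apply Rmult_le_compat; try apply qn_pos; assumption. }
    assert (B2 : X * (Rabs (d / 2) * 1 * n2) = d2 * n2 * X).
    { unfold d2, Rdiv; rewrite Rabs_mult, (Rabs_right (/ 2)) by lra; ring. }
    assert (B3 : Rabs (- (x * x * x * (d * d / 8))) * n1 = d8 * n1 * X).
    { rewrite Rabs_Ropp, Rabs_mult, HX3, (Rabs_right (d * d / 8)) by (apply Rle_ge, Hd8); unfold d8; ring. }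
    assert (B4 : Rabs (- (x * x * x * x * (d * d / 8))) * n2 <= d8 * n2 * X).
    { rewrite Rabs_Ropp, Rabs_mult, (Rabs_right (d * d / 8)) by (apply Rle_ge, Hd8); fold d8.
      replace (d8 * n2 * X) with (X * d8 * n2) by ring; apply Rmult_le_compat_r; [exact Hn2|].
      apply Rmult_le_compat_r; [exact Hd8|exact HX4]. }
    rewrite B2, B3; lra.
Qed.

(** The stretch [a, b] is replaced, at cost at most b - a, by a product whose letters are
    transported to the point g. With [ord1 l] = 0 the end point moves by x^2 [ord2 l] up to O(x^3),
    and a positive product with the covector would lower the penalty at order x^2. *)
Lemma second_order F K gh T ga A B (g : quat) l a b eta :
  ext F K gh T ga A B -> ip g g = 1 -> List.Forall (fun e => unitv (fst e)) l ->
  0 <= a <= b -> b <= T -> 0 < eta -> eta <= 1 -> ord1 l = mkQ 0 0 0 0 -> q0 (ord2 l) = 0 ->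
  (forall x, 0 < x < eta ->
     reach F (qmul (qmul (qconj (ga a)) g) (qmul (prodrt l x) (qmul (qconj g) (ga b)))) (b - a)) ->
  ip (qmul (qmul (qconj g) (lam K gh T ga)) g) (ord2 l) <= 0.
Proof.
  intros E Hg HF Hab HbT Het Het1 H1 H2 Hr.
  assert (HK := ex_K _ _ _ _ _ _ _ E).
  assert (Hgh := ex_gh _ _ _ _ _ _ _ E).
  assert (HgT := ga_T F K gh T ga A B E).
  set (S := qmul (qmul g (ord2 l)) (qconj g)).
  assert (ES : ip (qmul (qmul (qconj g) (lam K gh T ga)) g) (ord2 l) = ip (lam K gh T ga) S).
  { unfold S; rewrite ip_mul_r_conj, ip_mul_l_conj, qconj_conj, qmul_assoc; reflexivity. }
  rewrite ES, (lam_ip K gh T ga S) by (apply conj_imag, H2).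
  set (a0 := ip (ga T) gh); set (m := ip (qmul S (ga T)) gh).
  destruct (prodrt_expand HF) as (C & HC & Hexp); rewrite H1 in Hexp.
  assert (Ha0 : Rabs a0 <= 1) by apply (a0_le F K gh T ga A B E).
  set (M := Rabs m).
  assert (Hlin : forall x, 0 < x < eta -> 2 * (K * a0 * m) * x <= 0 * x + (2 * K * C) * (x * x)).
  { intros x Hx; specialize (Hexp x (ltac:(lra))).
    assert (Hm := ex_min _ _ _ _ _ _ _ E a b _ _ Hab HbT (Hr x Hx)).
    assert (Hua := ex_u _ _ _ _ _ _ _ E a (ltac:(lra))); assert (Hub := ex_u _ _ _ _ _ _ _ E b (ltac:(lra))).
    set (p := prodrt l x) in *.
    set (e := qsub p (qadd (qadd qone (qscal x (mkQ 0 0 0 0))) (qscal (x * x) (ord2 l)))) in *.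
    assert (Eq : qmul (qmul (ga a) (qmul (qmul (qconj (ga a)) g) (qmul p (qmul (qconj g) (ga b))))) (qmul (qconj (ga b)) (ga T))
       = qmul (qmul (qmul g p) (qconj g)) (ga T)).
    { rewrite !qmul_assoc, (qmul_conj_r _ Hua), qmul_1_l.
      rewrite <- (qmul_assoc _ (ga b) (qconj (ga b))), (qmul_conj_r _ Hub), qmul_1_r; reflexivity. }
    rewrite Eq in Hm; clear Eq.
    assert (Ef : ip (qmul (qmul (qmul g p) (qconj g)) (ga T)) gh
       = a0 + x * x * m + ip (qmul (qmul (qmul g e) (qconj g)) (ga T)) gh).
    { transitivity (ip (qadd (qadd (qmul (qmul g (qconj g)) (ga T)) (qscal (x * x) (qmul S (ga T)))) (qmul (qmul (qmul g e) (qconj g)) (ga T))) gh).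
      - apply (f_equal (fun u => ip u gh)).
        replace p with (qadd (qadd qone (qscal (x * x) (ord2 l))) e) by (unfold e; generalize p (ord2 l); qring).
        unfold S; generalize g (ga T) e (ord2 l); clear; qring.
      - rewrite !ip_add_l, ip_scal_l, (qmul_conj_r g Hg), qmul_1_l; reflexivity. }
    set (er := ip (qmul (qmul (qmul g e) (qconj g)) (ga T)) gh) in *.
    assert (Her : Rabs er <= C * (x * (x * x))).
    { unfold er; rewrite <- (Rmult_1_r (C * _)); apply ip_abs_le; [|right; apply qn_unit, Hgh].
      rewrite !qn_mul, qn_conj, (qn_unit g Hg), (qn_unit (ga T) HgT), Rmult_1_l, !Rmult_1_r.
      rewrite (Rabs_right x) in Hexp by lra; exact Hexp. }
    unfold pen in Hm; fold a0 in Hm; rewrite Ef in Hm.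
    assert (Hk : K * ((a0 + x * x * m + er) * (a0 + x * x * m + er)) <= K * (a0 * a0)) by lra.
    assert (Hk2 : K * (2 * a0 * (x * x * m) + 2 * a0 * er) <= 0).
    { assert (0 <= K * ((x * x * m + er) * (x * x * m + er))) by (apply Rmult_le_pos; [exact HK|apply Rle_0_sqr]). nra. }
    apply Rabs_le_between in Her; apply Rabs_le_between in Ha0.
    assert (Hk3 : - (a0 * er) <= C * (x * (x * x))) by nra.
    assert (Hk4 : 2 * K * (a0 * (x * x * m)) <= 2 * K * (C * (x * (x * x)))).
    { apply Rle_trans with (2 * K * - (a0 * er)); [lra|apply Rmult_le_compat_l; lra]. }
    apply Rmult_le_reg_r with x; [lra|]; nra. }
  assert (2 * (K * a0 * m) <= 0); [|lra].
  apply le_of_quadratic with (2 * K * C * eta); intros e He.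
  specialize (Hlin (e * eta) (ltac:(nra))).
  apply Rmult_le_reg_r with eta; [lra|]; nra.
Qed.

(** * Coordinates adapted to a frame *)

(** The rotation of the i, j plane that takes i to P. It is an automorphism of the quaternions
    ([emb_mul]), so identities may be checked with P = i and Q = cc i + sg j. *)
Definition emb (F : frame) (q : quat) : quat :=
  mkQ (q0 q) (q1 q * q1 (fP F) - q2 q * q2 (fP F)) (q1 q * q2 (fP F) + q2 q * q1 (fP F)) (q3 q).

Section Emb.
Variable F : frame.
Hypothesis OK : frame_ok F.

Lemma P_sq : q1 (fP F) * q1 (fP F) + q2 (fP F) * q2 (fP F) = 1.
Proof. destruct OK as [[P0 PP] P3 _ _ _ _ _ _ _]; unfold ip in PP; rewrite P0, P3 in PP; lra. Qed.

Lemma emb_mul p q : emb F (qmul p q) = qmul (emb F p) (emb F q).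
Proof.
  assert (H := P_sq); set (x := q1 (fP F)) in *; set (y := q2 (fP F)) in *.
  apply quat_ext; unfold emb; simpl; fold x y; try ring.
  - transitivity (q0 p * q0 q - (q1 p * q1 q + q2 p * q2 q) * (x * x + y * y) - q3 p * q3 q); [rewrite H|]; ring.
  - transitivity (q0 p * q3 q + (q1 p * q2 q - q2 p * q1 q) * (x * x + y * y) + q3 p * q0 q); [rewrite H|]; ring.
Qed.
Lemma emb_ip p q : ip (emb F p) (emb F q) = ip p q.
Proof.
  assert (H := P_sq); set (x := q1 (fP F)) in *; set (y := q2 (fP F)) in *.
  unfold ip, emb; simpl; fold x y.
  transitivity (q0 p * q0 q + (q1 p * q1 q + q2 p * q2 q) * (x * x + y * y) + q3 p * q3 q); [|rewrite H]; ring.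
Qed.
Lemma emb_add p q : emb F (qadd p q) = qadd (emb F p) (emb F q).
Proof. unfold emb; qring. Qed.
Lemma emb_scal a p : emb F (qscal a p) = qscal a (emb F p).
Proof. unfold emb; qring. Qed.
Lemma emb_conj p : emb F (qconj p) = qconj (emb F p).
Proof. unfold emb; qring. Qed.
Lemma emb_one : emb F qone = qone.
Proof. unfold emb; qring. Qed.
Lemma emb_P : emb F (pl 1 0) = fP F.
Proof. destruct OK as [[P0 PP] P3 _ _ _ _ _ _ _]; apply quat_ext; simpl; lra. Qed.
Lemma emb_Q : emb F (pl (cc F) (sg F)) = fQ F.
Proof.
  assert (H := P_sq); destruct OK as [[P0 PP] P3 [Q0 _] Q3 <- <- _ _ _].
  apply quat_ext; unfold ip in *; simpl; rewrite ?P0, ?P3, ?Q0, ?Q3; try lra.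
  - transitivity (q1 (fQ F) * (q1 (fP F) * q1 (fP F) + q2 (fP F) * q2 (fP F))); [ring|rewrite H; ring].
  - transitivity (q2 (fQ F) * (q1 (fP F) * q1 (fP F) + q2 (fP F) * q2 (fP F))); [ring|rewrite H; ring].
Qed.
Lemma emb_rt v a : emb F (rt v a) = rt (emb F v) a.
Proof. unfold rt; rewrite emb_add, !emb_scal, emb_one; reflexivity. Qed.
End Emb.

(** The infinitesimal form of |[prodrt l x]| = 1: the squared norm has x^2-coefficient 2 q0
    ([ord2 l]) + |[ord1 l]|^2. A variation with [ord1 l] = 0 therefore has a purely imaginary
    second-order term. *)
Lemma ord2_real l : List.Forall (fun e => unitv (fst e)) l ->
  q0 (ord1 l) = 0 /\ q0 (ord2 l) = - (ip (ord1 l) (ord1 l) / 2).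
Proof.
  induction l as [|[v d] l IH]; intros H.
  - unfold ip; simpl; split; [reflexivity|field].
  - inversion H as [|? ? [V0 V1] H']; subst; simpl in V0, V1; destruct (IH H') as [I1 I2].
    split; [simpl; rewrite V0, I1; ring|].
    change (ord1 ((v, d) :: l)) with (qadd (qscal (d / 2) v) (ord1 l)).
    change (ord2 ((v, d) :: l)) with (qadd (qadd (qscal (- (d * d / 8)) qone) (ord2 l)) (qmul (qscal (d / 2) v) (ord1 l))).
    transitivity (- (d * d / 8) + q0 (ord2 l) - d / 2 * ip v (ord1 l)).
    + unfold ip; simpl; rewrite V0, I1; ring.
    + rewrite I2; generalize (ord1 l); intros o; unfold ip in *; simpl.
      transitivity (- (d * d * (q0 v * q0 v + q1 v * q1 v + q2 v * q2 v + q3 v * q3 v) / 8) +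
         - ((q0 o * q0 o + q1 o * q1 o + q2 o * q2 o + q3 o * q3 o) / 2) -
         d / 2 * (q0 v * q0 o + q1 v * q1 o + q2 v * q2 o + q3 v * q3 o)); [rewrite V1; field|field].
Qed.

Lemma rt_conj_by m v y : ip m m = 1 -> rt (qmul (qmul (qconj m) v) m) y = qmul (qmul (qconj m) (rt v y)) m.
Proof.
  intros Hm; unfold rt.
  transitivity (qadd (qscal (cos (y / 2)) (qmul (qconj m) m)) (qscal (sin (y / 2)) (qmul (qmul (qconj m) v) m))).
  - rewrite qmul_conj_l by exact Hm; reflexivity.
  - qring.
Qed.

Lemma cancel_conj_l u x : ip u u = 1 -> qmul (qconj u) (qmul u x) = x.
Proof. intros H; rewrite qmul_assoc, qmul_conj_l, qmul_1_l by exact H; reflexivity. Qed.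
Lemma cancel_conj_r u x : ip u u = 1 -> qmul u (qmul (qconj u) x) = x.
Proof. intros H; rewrite qmul_assoc, qmul_conj_r, qmul_1_l by exact H; reflexivity. Qed.

Lemma unitv_conj m v : ip m m = 1 -> unitv v -> unitv (qmul (qmul (qconj m) v) m).
Proof.
  intros Hm [V0 V1]; split; [simpl; rewrite V0; ring|].
  rewrite !ip_mul_sq, ip_conj, Hm, V1; ring.
Qed.

(** The vectors are the letters P, Q, -P, -Q, P of five arcs, transported to the middle of the third
    one, in coordinates with P = i. C, S belong to half the angle of the inner P-arc and c, s to
    half the angle of the Q-arcs. The speeds solve sum d v = 0 and d1 + d3 + d5 = 0, so the
    variation is neutral to first order and free of cost. *)
Lemma five_identity (C S c s cc g : R) : C * C + S * S = 1 -> c * c + s * s = 1 -> cc * cc + g * g = 1 ->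
  let u1 := 1 - 2 * s * s * g * g in let u2 := 2 * s * s * cc * g in let u3 := 2 * g * s * c in
  let d1 := c * C - cc * s * S in let d5 := - (c * C + cc * s * S) in let d3 := 2 * cc * s * S in
  let d2 := 2 * S * s * (c * c + cc * cc * s * s) in
  let l := [(mkQ 0 u1 (u2 * C - u3 * S) (u2 * S + u3 * C), d1); (mkQ 0 cc (g * C) (g * S), d2);
            (mkQ 0 (-1) 0 0, d3); (mkQ 0 (- cc) (- (g * C)) (g * S), - d2);
            (mkQ 0 u1 (u2 * C + u3 * S) (u3 * C - u2 * S), d5)] in
  ord1 l = mkQ 0 0 0 0 /\
  ip (mkQ 0 (- (C * g * s)) (cc * s) c) (ord2 l)
    = g * s * S * (c * c + cc * cc * s * s) * (c * C - cc * s * S) * (c * C + cc * s * S).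
Proof.
  intros H1 H2 H3 u1 u2 u3 d1 d5 d3 d2 l.
  assert (K1 : C * C = 1 - S * S) by lra; assert (K2 : c * c = 1 - s * s) by lra; assert (K3 : cc * cc = 1 - g * g) by lra.
  split.
  - apply quat_ext; unfold l, u1, u2, u3, d1, d5, d3, d2; simpl; field [K1 K2 K3].
  - unfold ip, l, u1, u2, u3, d1, d5, d3, d2; simpl; field [K1 K2 K3].
Qed.

Lemma imag_coords F k : frame_ok F -> q0 k = 0 ->
  k = emb F (mkQ 0 (ip k (fP F)) ((ip k (fQ F) - cc F * ip k (fP F)) / sg F) (q3 k)).
Proof.
  intros OK K0; assert (H := P_sq OK); assert (Hs := ok_sg0 F OK).
  assert (E := emb_Q OK).
  assert (Hq : ip k (fQ F) - cc F * ip k (fP F) = sg F * (q2 k * q1 (fP F) - q1 k * q2 (fP F))).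
  { rewrite <- E; destruct (ok_P F OK) as [P0 _]; unfold ip, emb; simpl; rewrite P0, (ok_P3 F OK); ring. }
  rewrite Hq; destruct (ok_P F OK) as [P0 _]; assert (P3 := ok_P3 F OK).
  replace (sg F * (q2 k * q1 (fP F) - q1 k * q2 (fP F)) / sg F) with (q2 k * q1 (fP F) - q1 k * q2 (fP F)) by (field; exact Hs).
  apply quat_ext; unfold ip; simpl; rewrite ?K0, ?P0, ?P3; try ring.
  - transitivity (q1 k * (q1 (fP F) * q1 (fP F) + q2 (fP F) * q2 (fP F))); [rewrite H|]; ring.
  - transitivity (q2 k * (q1 (fP F) * q1 (fP F) + q2 (fP F) * q2 (fP F))); [rewrite H|]; ring.
Qed.

(* A rectangle P Q -P -Q P with five arcs admits a first-order neutral variation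
   along which the second variation of the cost is negative. *)
Lemma five_arcs F K gh T ga A B a b x1 ph th x5 :
  frame_ok F -> ext F K gh T ga A B -> 0 <= a <= b -> b <= T ->
  0 < x1 -> 0 < ph < PI -> 0 < th < PI -> 0 < x5 ->
  let g := qmul (ga a) (qmul (rt (fP F) x1) (qmul (rt (fQ F) ph) (rt (fP F) (- (th / 2))))) in
  ga b = qmul (ga a) (qmul (rt (fP F) x1) (qmul (rt (fQ F) ph)
           (qmul (rt (fP F) (- th)) (qmul (rt (fQ F) (- ph)) (rt (fP F) x5))))) ->
  b - a = al F * x1 + be F * ph + al F * th + be F * ph + al F * x5 ->
  qmul (qmul (qconj g) (lam K gh T ga)) g
    = emb F (mkQ 0 (- al F) (cc F * al F / (sg F * cos (th / 2))) (be F / (sg F * sin (th / 2)))) ->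
  al F * cos (ph / 2) * sin (th / 2) = be F * cos (th / 2) * sin (ph / 2) ->
  Rabs (cc F) * sin (ph / 2) * sin (th / 2) < cos (ph / 2) * cos (th / 2) -> False.
Proof.
  intros OK E Hab HbT Hx1 Hph Hth Hx5 g Eb Ecost Eh Erel Hpos.
  assert (Hal := al_pos F OK); assert (Hbe := be_pos F OK); assert (Hsg := ok_sg0 F OK).
  assert (UP := ok_P F OK); assert (UQ := ok_Q F OK).
  assert (Hcs := frame_id OK).
  set (C := cos (th / 2)) in *; set (S := sin (th / 2)) in *; set (c := cos (ph / 2)) in *; set (s := sin (ph / 2)) in *.
  assert (H1 : C * C + S * S = 1) by (unfold C, S; generalize (sin2_cos2 (th / 2)); unfold Rsqr; lra).
  assert (H2 : c * c + s * s = 1) by (unfold c, s; generalize (sin2_cos2 (ph / 2)); unfold Rsqr; lra).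
  assert (HS : 0 < S) by (apply sin_gt_0; lra).
  assert (Hs : 0 < s) by (apply sin_gt_0; lra).
  assert (HC : 0 < C) by (apply cos_gt_0; lra).
  assert (Hc : 0 < c) by (apply cos_gt_0; lra).
  destruct (five_identity H1 H2 Hcs) as [L1 L2].
  set (u1 := 1 - 2 * s * s * sg F * sg F) in *; set (u2 := 2 * s * s * cc F * sg F) in *; set (u3 := 2 * sg F * s * c) in *.
  set (d1 := c * C - cc F * s * S) in *; set (d5 := - (c * C + cc F * s * S)) in *; set (d3 := 2 * cc F * s * S) in *.
  set (d2 := 2 * S * s * (c * c + cc F * cc F * s * s)) in *.
  set (v1 := mkQ 0 u1 (u2 * C - u3 * S) (u2 * S + u3 * C)) in *; set (v2 := mkQ 0 (cc F) (sg F * C) (sg F * S)) in *.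
  set (v3 := mkQ 0 (-1) 0 0) in *; set (v4 := mkQ 0 (- cc F) (- (sg F * C)) (sg F * S)) in *.
  set (v5 := mkQ 0 u1 (u2 * C + u3 * S) (u3 * C - u2 * S)) in *.
  set (l0 := [(v1, d1); (v2, d2); (v3, d3); (v4, - d2); (v5, d5)]) in *.
  set (Rq := rt (fQ F) ph); set (Rm := rt (fP F) (- (th / 2))); set (Qm := rt (fQ F) (- ph)).
  assert (URq : ip Rq Rq = 1) by (apply ip_rt, UQ).
  assert (URm : ip Rm Rm = 1) by (apply ip_rt, UP).
  assert (UQm : ip Qm Qm = 1) by (apply ip_rt, UQ).
  assert (Uf : forall p q, ip p p = 1 -> ip q q = 1 -> ip (qmul p q) (qmul p q) = 1) by (intros p q Hp Hq; rewrite ip_mul_sq, Hp, Hq; ring).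
  assert (Uc : forall p, ip p p = 1 -> ip (qconj p) (qconj p) = 1) by (intros p Hp; rewrite ip_conj; exact Hp).
  (* the letters transported to the middle of the third arc *)
  assert (Q0u : unitv (pl (cc F) (sg F))) by (split; [reflexivity|unfold ip; simpl; lra]).
  assert (I0u : unitv (pl 1 0)) by (split; [reflexivity|unfold ip; simpl; ring]).
  assert (Ecph : cos ph = 1 - 2 * (s * s)).
  { unfold s; replace ph with (2 * (ph / 2)) at 1 by field; rewrite cos_2a_sin; ring. }
  assert (Esph : sin ph = 2 * s * c).
  { unfold s, c; replace ph with (2 * (ph / 2)) at 1 by field; rewrite sin_2a; ring. }
  assert (Eu : qmul (qmul (qconj (rt (pl (cc F) (sg F)) ph)) (pl 1 0)) (rt (pl (cc F) (sg F)) ph) = mkQ 0 u1 u2 u3).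
  { rewrite rt_conj_action by (exact Q0u || reflexivity); rewrite Ecph, Esph.
    unfold u1, u2, u3, ip; apply quat_ext; simpl; try field.
    transitivity (1 - 2 * (s * s) * (1 - cc F * cc F)); [field|].
    replace (1 - cc F * cc F) with (sg F * sg F) by lra; ring. }
  assert (E1 : emb F v1 = qmul (qmul (qconj (qmul Rq Rm)) (fP F)) (qmul Rq Rm)).
  { transitivity (qmul (qmul (qconj Rm) (qmul (qmul (qconj Rq) (fP F)) Rq)) Rm).
    2: { rewrite qconj_mul, !qmul_assoc; reflexivity. }
    unfold Rm, Rq; rewrite <- (emb_P OK), <- (emb_Q OK), <- !emb_rt, <- !emb_conj, <- !emb_mul by exact OK.
    f_equal; rewrite Eu, rt_conj_action by (exact I0u || reflexivity).
    rewrite cos_neg, sin_neg; fold C S; unfold v1, ip; apply quat_ext; simpl; field. }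
  assert (E2 : emb F v2 = qmul (qmul (qconj Rm) (fQ F)) Rm).
  { unfold Rm; rewrite <- (emb_P OK), <- (emb_Q OK), <- !emb_rt, <- !emb_conj, <- !emb_mul by exact OK.
    f_equal; rewrite rt_conj_action by (exact I0u || reflexivity).
    rewrite cos_neg, sin_neg; fold C S; unfold v2, ip; apply quat_ext; simpl; field. }
  assert (E3 : emb F v3 = qopp (fP F)).
  { rewrite <- (emb_P OK); unfold v3, emb; qring. }
  assert (ERm : Rm = qconj (rt (fP F) (th / 2))).
  { unfold Rm; rewrite rt_conj by apply UP; reflexivity. }
  assert (E4 : emb F v4 = qmul (qmul Rm (qopp (fQ F))) (qconj Rm)).
  { rewrite ERm, qconj_conj.
    replace (qopp (fQ F)) with (emb F (pl (- cc F) (- sg F))) by (rewrite <- (emb_Q OK) at 1; unfold emb; qring).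
    rewrite <- (emb_P OK), <- !emb_rt, <- !emb_conj, <- !emb_mul by exact OK.
    f_equal; rewrite rt_conj_action by (exact I0u || reflexivity).
    fold C S; unfold v4, ip; apply quat_ext; simpl; field. }
  assert (E5 : emb F v5 = qmul (qmul (qmul Rm Qm) (fP F)) (qconj (qmul Rm Qm))).
  { transitivity (qmul (qmul Rm (qmul (qmul Qm (fP F)) (qconj Qm))) (qconj Rm)).
    2: { rewrite qconj_mul, !qmul_assoc; reflexivity. }
    rewrite ERm, qconj_conj; unfold Qm.
    replace (rt (fQ F) (- ph)) with (qconj (rt (fQ F) ph)) by (rewrite rt_conj by apply UQ; reflexivity).
    rewrite qconj_conj.
    rewrite <- (emb_P OK), <- (emb_Q OK), <- !emb_rt, <- !emb_conj, <- !emb_mul by exact OK.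
    f_equal; rewrite Eu, rt_conj_action by (exact I0u || reflexivity).
    fold C S; unfold v5, ip; apply quat_ext; simpl; field. }
  set (l := map (fun e => (emb F (fst e), snd e)) l0).
  assert (Ord1 : ord1 l = mkQ 0 0 0 0).
  { assert (G : forall m, ord1 (map (fun e => (emb F (fst e), snd e)) m) = emb F (ord1 m)).
    { induction m as [|e m IH]; simpl; [unfold emb; qring|rewrite IH, emb_add, emb_scal; reflexivity]. }
    unfold l; rewrite G, L1; unfold emb; qring. }
  assert (Ord2 : ord2 l = emb F (ord2 l0)).
  { assert (G : forall m, ord1 (map (fun e => (emb F (fst e), snd e)) m) = emb F (ord1 m)).
    { induction m as [|e m IH]; simpl; [unfold emb; qring|rewrite IH, emb_add, emb_scal; reflexivity]. }
    assert (G2 : forall m, ord2 (map (fun e => (emb F (fst e), snd e)) m) = emb F (ord2 m)).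
    { induction m as [|e m IH]; [unfold emb; qring|].
      change (qadd (qadd (qscal (- (snd e * snd e / 8)) qone) (ord2 (map (fun e => (emb F (fst e), snd e)) m)))
                 (qmul (qscal (snd e / 2) (emb F (fst e))) (ord1 (map (fun e => (emb F (fst e), snd e)) m)))
              = emb F (qadd (qadd (qscal (- (snd e * snd e / 8)) qone) (ord2 m)) (qmul (qscal (snd e / 2) (fst e)) (ord1 m)))).
      rewrite IH, G, !emb_add, emb_mul, !emb_scal, emb_one by exact OK; reflexivity. }
    apply G2. }
  assert (HF : List.Forall (fun e => unitv (fst e)) l).
  { unfold l, l0; simpl; rewrite E1, E2, E3, E4, E5.
    assert (Hx : forall m v, ip m m = 1 -> unitv v -> unitv (qmul (qmul m v) (qconj m))).
    { intros m v Hm Hv; rewrite <- (qconj_conj m) at 1; apply unitv_conj; auto. }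
    repeat constructor; simpl fst; try (apply unitv_conj; auto); try (apply Hx; auto using unitv_opp); auto using unitv_opp.
    all: try (apply unitv_conj; auto); try (apply Hx; auto using unitv_opp); try (apply unitv_opp; auto). }
  assert (Hg : ip g g = 1).
  { unfold g; repeat apply Uf; auto; [apply (ex_u _ _ _ _ _ _ _ E); lra|apply ip_rt, UP]. }
  (* The speeds are at most 4 in absolute value, so for x < eta no angle changes by more than
     itself: the perturbed arcs keep their signs, and the cost is linear in the angles. *)
  set (eta := Rmin 1 (Rmin (Rmin x1 x5) (Rmin ph th) / 4)).
  assert (Heta : 0 < eta).
  { unfold eta; apply Rmin_glb_lt; [lra|]; apply Rdiv_lt_0_compat; [|lra]; repeat apply Rmin_glb_lt; lra. }
  assert (Heta1 : eta <= 1) by apply Rmin_l.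
  assert (Hetab : 4 * eta <= x1 /\ 4 * eta <= x5 /\ 4 * eta <= ph /\ 4 * eta <= th).
  { assert (eta <= Rmin (Rmin x1 x5) (Rmin ph th) / 4) by apply Rmin_r.
    generalize (Rmin_l (Rmin x1 x5) (Rmin ph th)) (Rmin_r (Rmin x1 x5) (Rmin ph th)) (Rmin_l x1 x5) (Rmin_r x1 x5) (Rmin_l ph th) (Rmin_r ph th).
    intros; repeat split; lra. }
  assert (Hcc : -1 <= cc F <= 1) by nra.
  assert (Hb1 : 0 < c <= 1) by nra. assert (Hb2 : 0 < s <= 1) by nra.
  assert (Hb3 : 0 < C <= 1) by nra. assert (Hb4 : 0 < S <= 1) by nra.
  assert (HsS : 0 < s * S <= 1) by nra.
  assert (HcC : 0 < c * C <= 1) by nra.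
  assert (HcsS : -1 <= cc F * s * S <= 1) by (rewrite Rmult_assoc; nra).
  assert (B1 : -4 <= d1 <= 4) by (unfold d1; lra).
  assert (B5 : -4 <= d5 <= 4) by (unfold d5; lra).
  assert (B3 : -4 <= d3 <= 4) by (unfold d3; lra).
  assert (B2 : -4 <= d2 <= 4).
  { unfold d2; assert (0 <= c * c + cc F * cc F * s * s <= 2) by (replace (cc F * cc F * s * s) with ((cc F * cc F) * (s * s)) by ring; nra).
    replace (2 * S * s) with (2 * (s * S)) by ring; nra. }
  assert (Hmul : forall d x, -4 <= d <= 4 -> 0 < x < eta -> - (4 * eta) <= x * d <= 4 * eta) by (intros; nra).
  assert (Hso := second_order (g := g) (l := l) (a := a) (b := b) (eta := eta) E Hg HF Hab HbT Heta Heta1 Ord1).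
  assert (Hq0 : q0 (ord2 l) = 0).
  { destruct (ord2_real HF) as [_ ->]; rewrite Ord1; unfold ip; simpl; field. }
  specialize (Hso Hq0).
  rewrite Eh, Ord2, emb_ip in Hso by exact OK.
  (* By [Erel] the covector at the middle is al / (C sg s) times the one of [five_identity]. *)
  assert (Hval : ip (mkQ 0 (- al F) (cc F * al F / (sg F * C)) (be F / (sg F * S))) (ord2 l0)
     = al F / (C * sg F * s) * (sg F * s * S * (c * c + cc F * cc F * s * s) * (c * C - cc F * s * S) * (c * C + cc F * s * S))).
  { fold d1; rewrite <- L2; rewrite <- ip_scal_l; apply (f_equal (fun k => ip k (ord2 l0))).
    apply quat_ext; simpl; try (field; repeat split; lra).
    apply Rmult_eq_reg_r with (C * S * s * sg F); [|repeat apply Rmult_integral_contrapositive_currified; lra].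
    transitivity (be F * C * s); [field; repeat split; lra|].
    rewrite <- Erel; field; repeat split; lra. }
  rewrite Hval in Hso.
  assert (Hcon : 0 < al F / (C * sg F * s) * (sg F * s * S * (c * c + cc F * cc F * s * s) * (c * C - cc F * s * S) * (c * C + cc F * s * S))).
  { replace (al F / (C * sg F * s) * (sg F * s * S * (c * c + cc F * cc F * s * s) * (c * C - cc F * s * S) * (c * C + cc F * s * S)))
      with (al F * S / C * (c * c + cc F * cc F * s * s) * (c * C - cc F * s * S) * (c * C + cc F * s * S)) by (field; repeat split; lra).
    assert (Hm1 : cc F * s * S <= Rabs (cc F) * s * S).
    { rewrite !Rmult_assoc; apply Rmult_le_compat_r; [lra|apply Rle_abs]. }
    assert (Hm2 : - (cc F * s * S) <= Rabs (cc F) * s * S).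
    { rewrite !Rmult_assoc, Ropp_mult_distr_l; apply Rmult_le_compat_r; [lra|]; rewrite <- Rabs_Ropp; apply Rle_abs. }
    repeat apply Rmult_lt_0_compat; try lra; try (apply Rinv_0_lt_compat; lra).
    replace (cc F * cc F * s * s) with ((cc F * cc F) * (s * s)) by ring; nra. }
  apply Rle_not_lt in Hso; [contradiction|]. intros x Hx; clear Hso Hcon Hval.
  destruct Hetab as (G1 & G2 & G3 & G4).
  (* The transports cancel against each other: the varied product is the same five-letter word with
     its angles changed by x times the speeds. *)
  assert (Word : qmul (qmul (qconj (ga a)) g) (qmul (prodrt l x) (qmul (qconj g) (ga b)))
     = qmul (rt (fP F) (x1 + x * d1)) (qmul (rt (fQ F) (ph + x * d2)) (qmul (rt (fP F) (- (th + x * d3)))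
         (qmul (rt (fQ F) (- (ph + x * - d2))) (rt (fP F) (x5 + x * d5)))))).
  { unfold l, l0, prodrt; simpl fold_right; rewrite E1, E2, E3, E4, E5.
    assert (Hx4 : forall m v y, ip m m = 1 -> rt (qmul (qmul m v) (qconj m)) y = qmul (qmul m (rt v y)) (qconj m)).
    { intros m v y Hm; rewrite <- (qconj_conj m) at 1; rewrite rt_conj_by by auto; rewrite qconj_conj; reflexivity. }
    rewrite !rt_conj_by, !Hx4, !rt_opp by auto.
    set (A0 := ga a) in *; assert (UA : ip A0 A0 = 1) by (apply (ex_u _ _ _ _ _ _ _ E); lra).
    set (R1 := rt (fP F) x1) in *; assert (UR1 : ip R1 R1 = 1) by (apply ip_rt, UP).
    set (p1 := rt (fP F) (x * d1)); set (p2 := rt (fQ F) (x * d2)); set (p3 := rt (fP F) (- (x * d3))).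
    set (p4 := rt (fQ F) (- (x * - d2))); set (p5 := rt (fP F) (x * d5)); set (R5 := rt (fP F) x5) in *.
    replace (rt (fP F) (x1 + x * d1)) with (qmul R1 p1) by (apply rt_add, UP).
    replace (rt (fQ F) (ph + x * d2)) with (qmul Rq p2) by (apply rt_add, UQ).
    replace (rt (fP F) (- (th + x * d3))) with (qmul Rm (qmul p3 Rm))
      by (unfold Rm, p3; rewrite !rt_add by exact UP; f_equal; field).
    replace (rt (fQ F) (- (ph + x * - d2))) with (qmul p4 Qm)
      by (unfold p4, Qm; rewrite rt_add by exact UQ; f_equal; ring).
    replace (rt (fP F) (x5 + x * d5)) with (qmul p5 R5)
      by (unfold p5, R5; rewrite rt_add by exact UP; f_equal; ring).
    rewrite Eb; fold A0 R1 Rq Qm R5.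
    replace (rt (fP F) (- th)) with (qmul Rm Rm) by (unfold Rm; rewrite rt_add by exact UP; f_equal; field).
    unfold g; fold A0 R1 Rq Rm; rewrite !qconj_mul, qmul_1_r, <- !qmul_assoc.
    repeat first [ rewrite (cancel_conj_l _ UA) | rewrite (cancel_conj_l _ UR1)
      | rewrite (cancel_conj_l _ URq) | rewrite (cancel_conj_l _ URm) | rewrite (cancel_conj_l _ UQm)
      | rewrite (cancel_conj_r _ UA) | rewrite (cancel_conj_r _ UR1)
      | rewrite (cancel_conj_r _ URq) | rewrite (cancel_conj_r _ URm) | rewrite (cancel_conj_r _ UQm) ].
    reflexivity. }
  rewrite Word.
  assert (K1 := Hmul d1 x B1 Hx); assert (K2 := Hmul d2 x B2 Hx); assert (K3 := Hmul d3 x B3 Hx); assert (K5 := Hmul d5 x B5 Hx).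
  eapply reach_le.
  { apply reach_mul; [apply (reach_P F OK)|]; apply reach_mul; [apply (reach_Q F OK)|]; apply reach_mul; [apply (reach_P F OK)|].
    apply reach_mul; [apply (reach_Q F OK)|apply (reach_P F OK)]. }
  rewrite !Rabs_Ropp, !Rabs_right by lra.
  (* The cost is unchanged because d1 + d3 + d5 = 0 and the two Q-arcs change by opposite
     amounts. *)
  rewrite Ecost; right; unfold d1, d5, d3; ring.
Qed.

(** * Rectangular extremals *)

Lemma asin_le x y : -1 <= x <= 1 -> -1 <= y <= 1 -> x <= y -> asin x <= asin y.
Proof.
  intros Hx Hy Hxy; apply Rnot_lt_le; intros Hlt.
  assert (H1 := asin_bound x); assert (H2 := asin_bound y).
  assert (H : sin (asin y) < sin (asin x)) by (apply sin_increasing_1; lra).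
  rewrite !sin_asin in H by assumption; lra.
Qed.

Lemma asin_polar y w rho : 0 < rho -> 0 < w -> y * y + w * w = rho * rho ->
  y = rho * sin (asin (y / rho)) /\ w = rho * cos (asin (y / rho)) /\ -1 < y / rho < 1 /\
  - PI / 2 < asin (y / rho) < PI / 2.
Proof.
  intros Hr Hw H.
  assert (Hy : - rho < y < rho) by nra.
  assert (B : -1 < y / rho < 1).
  { split; [apply Rmult_lt_reg_r with rho; [lra|]|apply Rmult_lt_reg_r with rho; [lra|]];
      unfold Rdiv; rewrite Rmult_assoc, Rinv_l; lra. }
  assert (E1 : y = rho * sin (asin (y / rho))) by (rewrite sin_asin by lra; field; lra).
  assert (Hb := asin_bound_lt _ B).
  assert (Hc : 0 < cos (asin (y / rho))) by (apply cos_gt_0; lra).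
  split; [exact E1|split; [|split; [exact B|lra]]].
  assert (Hs := sin2_cos2 (asin (y / rho))); unfold Rsqr in Hs.
  set (sn := sin (asin (y / rho))) in *; set (cs := cos (asin (y / rho))) in *.
  assert (w * w = (rho * cs) * (rho * cs)).
  { replace (rho * cs * (rho * cs)) with (rho * rho * (1 - sn * sn)) by (replace (1 - sn * sn) with (cs * cs) by lra; ring).
    rewrite E1 in H; lra. }
  assert (0 < rho * cs) by (apply Rmult_lt_0_compat; lra).
  nra.
Qed.

(** While w > 0 the point stays on one half of the circle, where asin (y / rho) is an angular
    coordinate. *)
Lemma rotation_angle y0 w0 rho th : 0 < rho -> 0 < w0 -> y0 * y0 + w0 * w0 = rho * rho -> 0 <= th <= PI ->
  0 < w0 * cos th - y0 * sin th ->
  th = asin ((y0 * cos th + w0 * sin th) / rho) - asin (y0 / rho).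
Proof.
  intros Hr Hw H Hth Hw1.
  destruct (asin_polar Hr Hw H) as (Ey & Ew & _ & Hb).
  set (ps := asin (y0 / rho)) in *.
  assert (E1 : y0 * cos th + w0 * sin th = rho * sin (ps + th)) by (rewrite Ey, Ew, sin_plus; ring).
  assert (E2 : w0 * cos th - y0 * sin th = rho * cos (ps + th)) by (rewrite Ey, Ew, cos_plus; ring).
  rewrite E1; replace (rho * sin (ps + th) / rho) with (sin (ps + th)) by (field; lra).
  assert (ps + th < PI / 2).
  { apply Rnot_le_lt; intros Hle; assert (cos (ps + th) <= 0) by (apply cos_le_0; lra). nra. }
  rewrite asin_sin by lra; ring.
Qed.

(** The radius of the circle of [arc_h] on the side hp = al, where L = sg^2 |lam|^2. [full] is the
    angle swept while hq runs from -be to be. *)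
Definition rho (F : frame) (L : R) : R := sqrt (L - sg F * sg F * (al F * al F)).
Definition full (F : frame) (L : R) : R :=
  asin ((be F - cc F * al F) / rho F L) + asin ((be F + cc F * al F) / rho F L).
(** On the whole rectangle the form p^2 + q^2 - 2 cc p q is at most the left-hand side, so [big]
    keeps hz away from 0. *)
Definition big (F : frame) (L : R) : Prop :=
  al F * al F + be F * be F + 2 * Rabs (cc F) * (al F * be F) < L.
(* The sum of |sg h_z| over the two kinds of corners. *)
Definition wsum (F : frame) (L : R) : R :=
  sqrt (L - (al F * al F + be F * be F - 2 * cc F * (al F * be F)))
  + sqrt (L - (al F * al F + be F * be F + 2 * cc F * (al F * be F))).

Lemma big_rot F L : big F L -> big (rotF F) L.
Proof. unfold big; simpl; rewrite Rabs_Ropp; nra. Qed.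
Lemma wsum_rot F L : wsum (rotF F) L = wsum F L.
Proof.
  unfold wsum; simpl; rewrite Rplus_comm; f_equal; f_equal; ring.
Qed.

Section Full.
Variables (F : frame) (L : R).
Hypothesis OK : frame_ok F.
Hypothesis HL : big F L.

Lemma abs_cc : - Rabs (cc F) <= cc F <= Rabs (cc F).
Proof. apply Rabs_le_between; lra. Qed.

Lemma rho_sq : rho F L * rho F L = L - sg F * sg F * (al F * al F) /\ 0 < rho F L /\
  be F + Rabs (cc F) * al F < rho F L.
Proof.
  assert (Ha := al_pos F OK); assert (Hb := be_pos F OK); assert (Hf := frame_id OK).
  assert (Hc := Rabs_pos (cc F)); assert (Hcc : Rabs (cc F) * Rabs (cc F) = cc F * cc F) by (rewrite <- Rabs_mult; apply Rabs_right, Rle_ge, Rle_0_sqr).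
  unfold big in HL.
  assert (H : (be F + Rabs (cc F) * al F) * (be F + Rabs (cc F) * al F) < L - sg F * sg F * (al F * al F)).
  { replace (sg F * sg F) with (1 - Rabs (cc F) * Rabs (cc F)) by lra; lra. }
  assert (Hp : 0 < be F + Rabs (cc F) * al F) by nra.
  assert (Hpp : 0 < L - sg F * sg F * (al F * al F)) by nra.
  unfold rho; split; [apply sqrt_sqrt; lra|]; split; [apply sqrt_lt_R0; lra|].
  rewrite <- (sqrt_square (be F + Rabs (cc F) * al F)) by lra; apply sqrt_lt_1_alt; split; [apply Rle_0_sqr|exact H].
Qed.

Lemma y_range q : - be F <= q <= be F -> -1 <= (q - cc F * al F) / rho F L <= 1.
Proof.
  intros Hq; destruct rho_sq as (_ & Hr & Hlt); assert (Ha := al_pos F OK); assert (Hc := abs_cc).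
  assert (- rho F L <= q - cc F * al F <= rho F L) by nra.
  split; apply Rmult_le_reg_r with (rho F L); try lra; unfold Rdiv; rewrite Rmult_assoc, Rinv_l; lra.
Qed.

Lemma full_eq : full F L = asin ((be F - cc F * al F) / rho F L) - asin ((- be F - cc F * al F) / rho F L).
Proof.
  unfold full; replace ((- be F - cc F * al F) / rho F L) with (- ((be F + cc F * al F) / rho F L)).
  - rewrite asin_opp; ring.
  - destruct rho_sq as (_ & Hr & _); field; lra.
Qed.

(** tan ([full] / 2) = 2 be / [wsum]: the tangent of half the difference of two angles is the
    difference of the sines over the sum of the cosines. As [wsum] is invariant under the quarter
    turn, the full angles p, q of the two letters satisfy al tan (p / 2) = be tan (q / 2), the
    relation of pattern (I). *)
Lemma full_tan : 0 < full F L < PI /\ sin (full F L / 2) * wsum F L = 2 * be F * cos (full F L / 2) /\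
  0 < wsum F L /\ 4 * Rabs (cc F) * (al F * be F) < wsum F L * wsum F L.
Proof.
  assert (Ha := al_pos F OK); assert (Hb := be_pos F OK); assert (Hf := frame_id OK); assert (Hc := abs_cc).
  destruct rho_sq as (Hr2 & Hr & Hlt).
  unfold wsum.
  set (X1 := L - (al F * al F + be F * be F - 2 * cc F * (al F * be F))).
  set (X2 := L - (al F * al F + be F * be F + 2 * cc F * (al F * be F))).
  assert (Hab : 0 < al F * be F) by nra.
  assert (H1 : 0 < X1) by (unfold X1; unfold big in HL; nra).
  assert (H2 : 0 < X2) by (unfold X2; unfold big in HL; nra).
  assert (S1 := sqrt_sqrt X1 (Rlt_le _ _ H1)); assert (S2 := sqrt_sqrt X2 (Rlt_le _ _ H2)).
  assert (P1 := sqrt_lt_R0 X1 H1); assert (P2 := sqrt_lt_R0 X2 H2).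
  set (w1 := sqrt X1) in *; set (w2 := sqrt X2) in *.
  destruct (@asin_polar (be F - cc F * al F) w1 (rho F L)) as (Y1 & W1 & _ & B1); [lra|lra| |].
  { rewrite Hr2, S1; unfold X1; replace (sg F * sg F) with (1 - cc F * cc F) by lra; ring. }
  destruct (@asin_polar (- be F - cc F * al F) w2 (rho F L)) as (Y2 & W2 & _ & B2); [lra|lra| |].
  { rewrite Hr2, S2; unfold X2; replace (sg F * sg F) with (1 - cc F * cc F) by lra; ring. }
  rewrite full_eq.
  set (p1 := asin ((be F - cc F * al F) / rho F L)) in *; set (p2 := asin ((- be F - cc F * al F) / rho F L)) in *.
  assert (Hpp : p2 < p1).
  { apply Rnot_le_lt; intros Hle.
    assert (sin p1 <= sin p2).
    { destruct Hle as [Hle|Hle]; [left; apply sin_increasing_1; lra|rewrite Hle; lra]. }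
    nra. }
  split; [lra|]; split; [|split; [lra|]].
  - rewrite W1, W2.
    replace (2 * be F) with (rho F L * (sin p1 - sin p2)) by lra.
    set (m := (p1 - p2) / 2); set (n := (p1 + p2) / 2).
    replace p1 with (n + m) by (unfold n, m; field); replace p2 with (n - m) by (unfold n, m; field).
    rewrite cos_plus, cos_minus, sin_plus, sin_minus; ring.
  - assert (Hx : Rabs (w1 * w1 - w2 * w2) = 4 * Rabs (cc F) * (al F * be F)).
    { rewrite S1, S2; unfold X1, X2.
      replace (_ - _) with (4 * (cc F * (al F * be F))) by ring.
      rewrite !Rabs_mult, (Rabs_right 4), (Rabs_right (al F)), (Rabs_right (be F)) by lra; ring. }
    rewrite <- Hx; apply Rabs_def1; nra.
Qed.
End Full.

Section Step.
Variables (F : frame) (K : R) (gh : quat) (T : R) (ga : R -> quat) (A B : R -> R).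
Hypothesis OK : frame_ok F.
Hypothesis E : ext F K gh T ga A B.
Let h := hh K gh T ga.
Let L := sg F * sg F * ip (lam K gh T ga) (lam K gh T ga).
Hypothesis HL : big F L.

(** With sg hz > 0, hq increases along a P-arc. The arc therefore leaves -be behind and can end only
    at hq = be, where the next letter takes over. *)
Lemma step t0 : 0 <= t0 < T -> (forall t, t0 <= t <= T -> 0 < sg F * hz h t) ->
  hp F h t0 = al F -> - be F <= hq F h t0 < be F ->
  exists t1, t0 < t1 <= T /\ arc_on F ga t0 t1 /\
    (t1 = T \/ (hp F h t1 = al F /\ hq F h t1 = be F)) /\
    (t1 - t0) / al F <= full F L /\
    (hq F h t0 = - be F -> hq F h t1 = be F -> (t1 - t0) / al F = full F L).
Proof.
  intros Ht0 Hz Hp0 Hq0.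
  assert (Ha := al_pos F OK); assert (Hb := be_pos F OK).
  assert (Hqb := fun t => hq_bound OK E (t := t)); fold h in Hqb.
  destruct (first_exit (fun t => Rabs (hq F h t) < be F) t0 T) as (t1 & Ht1 & Hin & Hex); [lra| | |].
  - destruct (Rle_lt_or_eq_dec _ _ (proj1 Hq0)) as [Hlt|Heq].
    + destruct (lipschitz_near _ _ _ (hq_lip OK E) t0 (Rmin (be F - hq F h t0) (hq F h t0 + be F))) as (eta & He & H);
        [lra|apply Rmin_glb_lt; lra|]; fold h in H.
      exists eta; split; [exact He|]; intros t Ht HtT.
      specialize (H t (ltac:(lra)) (ltac:(rewrite Rabs_right; lra))).
      generalize (Rmin_l (be F - hq F h t0) (hq F h t0 + be F)) (Rmin_r (be F - hq F h t0) (hq F h t0 + be F)); intros.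
      apply Rabs_lt_between in H; apply Rabs_def1; lra.
    (* At hq = -be the flipped frame sees its own corner (al, be) with negative sg hz. *)
    + destruct (corner_right (flipF_ok F OK) (ext_flip _ _ _ _ _ _ _ E) (t := t0)) as (eta & He & H); fold h.
      * lra.
      * rewrite hp_flip; exact Hp0.
      * rewrite hq_flip; simpl; lra.
      * simpl; specialize (Hz t0 (ltac:(lra))); lra.
      * exists eta; split; [exact He|]; intros t Ht HtT.
        destruct (H t Ht (ltac:(lra))) as [G _]; fold h in G; rewrite hq_flip, Rabs_Ropp in G; exact G.
  - intros t Ht HG.
    destruct (lipschitz_near _ _ _ (hq_lip OK E) t (be F - Rabs (hq F h t))) as (eta & He & H); [lra|lra|]; fold h in H.
    exists eta; split; [exact He|]; intros t' Hd Ht'; specialize (H t' (ltac:(lra)) Hd).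
    assert (G := Rabs_triang (hq F h t) (hq F h t' - hq F h t)).
    replace (hq F h t + (hq F h t' - hq F h t)) with (hq F h t') in G by ring; lra.
  - assert (Hface : arc_on F ga t0 t1 /\ forall t, t0 <= t <= t1 -> hp F h t = al F).
    { apply (face_arc OK E); try lra; [exact Hin|]; fold h.
      destruct (lipschitz_near _ _ _ (hp_lip OK E) t0 (al F)) as (eta & He & H); [lra|lra|]; fold h in H.
      set (d := Rmin (eta / 2) ((t1 - t0) / 2)).
      assert (Hd : 0 < d) by (apply Rmin_glb_lt; lra).
      assert (d <= eta / 2) by apply Rmin_l; assert (d <= (t1 - t0) / 2) by apply Rmin_r.
      exists (t0 + d); split; [lra|].
      specialize (H (t0 + d) (ltac:(lra)) (ltac:(rewrite Rabs_right; lra))).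
      rewrite Hp0 in H; apply Rabs_lt_between in H; lra. }
    destruct Hface as [Harc Hp].
    assert (Hle := arc_le_pi OK E (conj (proj1 Ht0) (Rlt_le _ _ (proj1 Ht1))) (proj2 Ht1) Harc).
    destruct (arc_h OK E (t := t1) (proj1 Ht0) (proj2 Ht1) Harc) as (_ & Ey & Ew); [lra|]; fold h in Ey, Ew.
    rewrite Hp0 in Ey, Ew.
    set (th := (t1 - t0) / al F) in *.
    assert (Hth : 0 < th <= PI).
    { split; [apply Rdiv_lt_0_compat; lra|].
      apply Rmult_le_reg_l with (al F); [lra|]; unfold th; replace (al F * ((t1 - t0) / al F)) with (t1 - t0) by (field; lra); lra. }
    destruct (rho_sq OK HL) as (Hr2 & Hr & Hlt).
    assert (Hw0 := Hz t0 (ltac:(lra))); assert (Hw1 := Hz t1 (ltac:(lra))).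
    assert (N0 := h_const_norm OK E (t := t0) (ltac:(lra))); fold h in N0; fold L in N0; rewrite Hp0 in N0.
    assert (Hf := frame_id OK).
    assert (Hcirc : (hq F h t0 - cc F * al F) * (hq F h t0 - cc F * al F) + sg F * hz h t0 * (sg F * hz h t0) = rho F L * rho F L).
    { rewrite Hr2, <- N0; replace (sg F * sg F * (al F * al F)) with ((1 - cc F * cc F) * (al F * al F)) by (replace (1 - cc F * cc F) with (sg F * sg F) by lra; ring); ring. }
    assert (Hang := rotation_angle (th := th) Hr Hw0 Hcirc (conj (Rlt_le _ _ (proj1 Hth)) (proj2 Hth))).
    rewrite <- Ey, <- Ew in Hang; specialize (Hang Hw1).
    assert (R0 := y_range OK HL (q := hq F h t0) (ltac:(lra))).
    assert (Hq1 := Hqb t1 (ltac:(lra))); apply Rabs_le_between in Hq1.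
    assert (R1 := y_range OK HL Hq1).
    assert (Rm := y_range OK HL (q := - be F) (ltac:(lra))); assert (Rp := y_range OK HL (q := be F) (ltac:(lra))).
    assert (Hmono : forall x y, x <= y -> (x - cc F * al F) / rho F L <= (y - cc F * al F) / rho F L).
    { intros x y Hxy; apply Rmult_le_compat_r; [left; apply Rinv_0_lt_compat; lra|lra]. }
    exists t1; split; [exact Ht1|]; split; [exact Harc|]; split; [|split].
    + destruct Hex as [->|Hex]; [left; reflexivity|right].
      split; [apply Hp; lra|].
      destruct (Rle_lt_or_eq_dec _ _ (proj2 Hq1)) as [Hlt1|]; [|assumption].
      exfalso; assert (E1 : hq F h t1 = - be F).
      { destruct (Rle_lt_or_eq_dec _ _ (proj1 Hq1)) as [Hlt2|]; [|symmetry; assumption].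
        exfalso; apply Hex, Rabs_def1; lra. }
      rewrite E1 in Hang.
      assert (asin ((- be F - cc F * al F) / rho F L) <= asin ((hq F h t0 - cc F * al F) / rho F L))
        by (apply asin_le; [exact Rm|exact R0|apply Hmono; lra]).
      lra.
    + fold th; rewrite Hang, (full_eq OK HL).
      assert (asin ((hq F h t1 - cc F * al F) / rho F L) <= asin ((be F - cc F * al F) / rho F L))
        by (apply asin_le; [exact R1|exact Rp|apply Hmono; lra]).
      assert (asin ((- be F - cc F * al F) / rho F L) <= asin ((hq F h t0 - cc F * al F) / rho F L))
        by (apply asin_le; [exact Rm|exact R0|apply Hmono; lra]).
      lra.
    + intros E0 E1; fold th; rewrite Hang, E0, E1, (full_eq OK HL); reflexivity.
Qed.
End Step.

Lemma full_rot2 F L : full (rotF (rotF F)) L = full F L.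
Proof. unfold full, rho; simpl; rewrite !Ropp_involutive; reflexivity. Qed.

Lemma cyclic_words F K gh T ga A B :
  frame_ok F -> ext F K gh T ga A B -> 0 < T ->
  let h := hh K gh T ga in
  let L := sg F * sg F * ip (lam K gh T ga) (lam K gh T ga) in
  big F L -> (forall t, 0 <= t <= T -> 0 < sg F * hz h t) ->
  hp F h 0 = al F -> - be F <= hq F h 0 < be F ->
  exists p q x y, 0 < p < PI /\ 0 < q < PI /\
    al F * (sin (p / 2) * cos (q / 2)) = be F * (cos (p / 2) * sin (q / 2)) /\
    0 <= x <= PI /\ 0 <= y <= PI /\
    ((ga T = qmul (rt (fP F) x) (rt (fQ F) y) /\ T = al F * x + be F * y) \/
     (x <= p /\ y <= p /\ ga T = qmul (rt (fP F) x) (qmul (rt (fQ F) q) (rt (fP F) (- y))) /\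
        T = al F * x + be F * q + al F * y) \/
     (x <= p /\ y <= q /\ ga T = qmul (rt (fP F) x) (qmul (rt (fQ F) q) (qmul (rt (fP F) (- p)) (rt (fQ F) (- y)))) /\
        T = al F * x + be F * q + al F * p + be F * y)).
Proof.
  intros OK E HT h L HL Hz Hp0 Hq0.
  assert (OK1 := rotF_ok F OK); assert (E1 := ext_rot _ _ _ _ _ _ _ E).
  assert (OK2 := rotF_ok _ OK1); assert (E2 := ext_rot _ _ _ _ _ _ _ E1).
  assert (OK3 := rotF_ok _ OK2); assert (E3 := ext_rot _ _ _ _ _ _ _ E2).
  assert (OK4 := rotF_ok _ OK3); assert (E4 := ext_rot _ _ _ _ _ _ _ E3).
  assert (HL1 := big_rot HL); assert (HL2 := big_rot HL1); assert (HL3 := big_rot HL2); assert (HL4 := big_rot HL3).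
  assert (Ha := al_pos F OK); assert (Hb := be_pos F OK); assert (Hs0 := ok_sg0 F OK).
  set (F1 := rotF F) in *; set (F2 := rotF F1) in *; set (F3 := rotF F2) in *; set (F4 := rotF F3) in *.
  destruct (full_tan OK HL) as (Bp & Tp & Wp & Wq).
  destruct (full_tan OK1 HL1) as (Bq & Tq & _ & _).
  unfold F1 in Tq; rewrite wsum_rot in Tq; fold F1 in Tq; simpl in Tq.
  set (p := full F L) in *; set (q := full F1 L) in *.
  assert (Ep2 : full F2 L = p) by apply full_rot2.
  assert (Eq3 : full F3 L = q) by apply full_rot2.
  assert (Hcp : 0 < cos (p / 2)) by (apply cos_gt_0; lra).
  assert (Hcq : 0 < cos (q / 2)) by (apply cos_gt_0; lra).
  assert (Hrel : al F * (sin (p / 2) * cos (q / 2)) = be F * (cos (p / 2) * sin (q / 2))).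
  { apply Rmult_eq_reg_r with (wsum F L); [|lra].
    replace (al F * (sin (p / 2) * cos (q / 2)) * wsum F L) with (al F * cos (q / 2) * (sin (p / 2) * wsum F L)) by ring.
    replace (be F * (cos (p / 2) * sin (q / 2)) * wsum F L) with (be F * cos (p / 2) * (sin (q / 2) * wsum F L)) by ring.
    rewrite Tp, Tq; ring. }
  assert (G0 := ex_0 _ _ _ _ _ _ _ E).
  exists p, q.
  destruct (step OK E HL (t0 := 0)) as (t1 & Ht1 & Arc1 & Ex1 & Le1 & _); try assumption; [lra|].
  change (t1 = T \/ hp F h t1 = al F /\ hq F h t1 = be F) in Ex1; change ((t1 - 0) / al F <= p) in Le1.
  destruct (arc_angle OK E (a := 0) (b := t1)) as (x1 & Hx1 & Ec1 & Eg1); [lra|lra|exact Arc1|].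
  rewrite G0, qmul_1_l in Eg1.
  replace ((t1 - 0) / al F) with x1 in Le1 by (rewrite Ec1; field; lra).
  destruct (Req_dec t1 T) as [->|N1].
  { exists x1, 0; repeat (split; [lra || assumption|]); left.
    rewrite Eg1, rt_0, qmul_1_r; split; [reflexivity|lra]. }
  destruct Ex1 as [?|[P1 Q1]]; [contradiction|].
  assert (Hz1 : forall t, t1 <= t <= T -> 0 < sg F1 * hz h t) by (intros t Ht; simpl; apply Hz; lra).
  destruct (step OK1 E1 HL1 (t0 := t1)) as (t2 & Ht2 & Arc2 & Ex2 & Le2 & Fu2); try assumption.
  { lra. } { fold h; unfold F1; rewrite hq_rot; simpl; lra. }
  change (t2 = T \/ hp F1 h t2 = al F1 /\ hq F1 h t2 = be F1) in Ex2; change ((t2 - t1) / al F1 <= q) in Le2.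
  change (hq F1 h t1 = - be F1 -> hq F1 h t2 = be F1 -> (t2 - t1) / al F1 = q) in Fu2.
  destruct (arc_angle OK1 E1 (a := t1) (b := t2)) as (x2 & Hx2 & Ec2 & Eg2); [lra|lra|exact Arc2|].
  replace ((t2 - t1) / al F1) with x2 in Le2, Fu2 by (rewrite Ec2; field; simpl; lra).
  simpl in Ec2, Eg2; rewrite Eg1 in Eg2.
  destruct (Req_dec t2 T) as [->|N2].
  { exists x1, x2; repeat (split; [lra || assumption|]); left.
    rewrite Eg2; split; [reflexivity|lra]. }
  destruct Ex2 as [?|[P2 Q2]]; [contradiction|].
  rewrite (Fu2 (ltac:(unfold F1; rewrite hq_rot; simpl; lra)) Q2) in *; clear Fu2.
  assert (Hz2 : forall t, t2 <= t <= T -> 0 < sg F2 * hz h t) by (intros t Ht; simpl; apply Hz; lra).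
  destruct (step OK2 E2 HL2 (t0 := t2)) as (t3 & Ht3 & Arc3 & Ex3 & Le3 & Fu3); try assumption.
  { lra. } { fold h; unfold F2; rewrite hq_rot, P2; simpl; lra. }
  change (t3 = T \/ hp F2 h t3 = al F2 /\ hq F2 h t3 = be F2) in Ex3; change ((t3 - t2) / al F2 <= full F2 L) in Le3.
  change (hq F2 h t2 = - be F2 -> hq F2 h t3 = be F2 -> (t3 - t2) / al F2 = full F2 L) in Fu3.
  rewrite Ep2 in Le3, Fu3.
  destruct (arc_angle OK2 E2 (a := t2) (b := t3)) as (x3 & Hx3 & Ec3 & Eg3); [lra|lra|exact Arc3|].
  replace ((t3 - t2) / al F2) with x3 in Le3, Fu3 by (rewrite Ec3; field; simpl; lra).
  simpl in Ec3, Eg3; rewrite Eg2, rt_opp in Eg3.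
  destruct (Req_dec t3 T) as [->|N3].
  { exists x1, x3; repeat (split; [lra || assumption|]); right; left.
    repeat (split; [lra|]); rewrite Eg3, qmul_assoc; split; [reflexivity|lra]. }
  destruct Ex3 as [?|[P3 Q3]]; [contradiction|].
  rewrite (Fu3 (ltac:(unfold F2; rewrite hq_rot, P2; reflexivity)) Q3) in *; clear Fu3.
  assert (Hz3 : forall t, t3 <= t <= T -> 0 < sg F3 * hz h t) by (intros t Ht; simpl; apply Hz; lra).
  destruct (step OK3 E3 HL3 (t0 := t3)) as (t4 & Ht4 & Arc4 & Ex4 & Le4 & Fu4); try assumption.
  { lra. } { fold h; unfold F3; rewrite hq_rot, P3; simpl; lra. }
  change (t4 = T \/ hp F3 h t4 = al F3 /\ hq F3 h t4 = be F3) in Ex4; change ((t4 - t3) / al F3 <= full F3 L) in Le4.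
  change (hq F3 h t3 = - be F3 -> hq F3 h t4 = be F3 -> (t4 - t3) / al F3 = full F3 L) in Fu4.
  rewrite Eq3 in Le4, Fu4.
  destruct (arc_angle OK3 E3 (a := t3) (b := t4)) as (x4 & Hx4 & Ec4 & Eg4); [lra|lra|exact Arc4|].
  replace ((t4 - t3) / al F3) with x4 in Le4, Fu4 by (rewrite Ec4; field; simpl; lra).
  simpl in Ec4, Eg4; rewrite Eg3, rt_opp in Eg4.
  destruct (Req_dec t4 T) as [->|N4].
  { exists x1, x4; repeat (split; [lra || assumption|]); right; right.
    repeat (split; [lra|]); rewrite Eg4, !qmul_assoc; split; [reflexivity|lra]. }
  destruct Ex4 as [?|[P4 Q4]]; [contradiction|].
  rewrite (Fu4 (ltac:(unfold F3; rewrite hq_rot, P3; reflexivity)) Q4) in *; clear Fu4.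
  assert (Hz4 : forall t, t4 <= t <= T -> 0 < sg F4 * hz h t) by (intros t Ht; simpl; apply Hz; lra).
  destruct (step OK4 E4 HL4 (t0 := t4)) as (t5 & Ht5 & Arc5 & _ & _ & _); try assumption.
  { lra. } { fold h; unfold F4; rewrite hq_rot, P4; simpl; lra. }
  destruct (arc_angle OK4 E4 (a := t4) (b := t5)) as (x5 & Hx5 & Ec5 & Eg5); [lra|lra|exact Arc5|].
  simpl in Ec5, Eg5; rewrite Eg4, !rt_opp, Ropp_involutive in Eg5.
  exfalso.
  assert (Px1 : 0 < x1) by nra. assert (Px5 : 0 < x5) by nra.
  (* The second variation is evaluated at the middle of the third arc, whose letter is -P. There hp
     = -al, and the two corners at the ends of the arc determine hq and hz explicitly. *)
  set (tm := (t2 + t3) / 2).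
  assert (Etm : ga tm = qmul (ga 0) (qmul (rt (fP F) x1) (qmul (rt (fQ F) q) (rt (fP F) (- (p / 2)))))).
  { rewrite (Arc3 tm) by (unfold tm; lra); simpl; rewrite rt_opp, Eg2, G0, qmul_1_l, !qmul_assoc; f_equal; f_equal.
    unfold tm; replace ((t2 + t3) / 2 - t2) with ((t3 - t2) / 2) by field; rewrite Ec3; field; lra. }
  apply (five_arcs (F := F) (a := 0) (b := t5) (x1 := x1) (ph := q) (th := p) (x5 := x5) OK E); try lra.
  - rewrite Eg5, G0, qmul_1_l, !qmul_assoc; reflexivity.
  - rewrite <- Etm.
    change (qmul (qmul (qconj (ga tm)) (lam K gh T ga)) (ga tm)) with (h tm).
    destruct (arc_mid OK2 E2 (a := t2) (b := t3)) as [M1 _]; [lra|lra|lra|exact Arc3|].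
    destruct (arc_h OK2 E2 (t := tm) (a := t2) (b := t3)) as (N5 & N6 & N7); [lra|lra|exact Arc3|unfold tm; lra|].
    fold h in M1, N5, N6, N7; fold tm in M1; simpl in M1.
    assert (Hq2 : hq F2 h t2 = - be F) by (unfold F2; rewrite hq_rot, P2; reflexivity).
    assert (Hp2 : hp F2 h t2 = al F) by (unfold F2; rewrite hp_rot, Q2; reflexivity).
    simpl in Q3; rewrite Hq2, Hp2 in M1; rewrite Hq2, Hp2 in N6; rewrite Hq2, Hp2 in N7.
    rewrite Q3 in M1; rewrite Hp2 in N5.
    replace ((t3 - t2) / al F / 2) with (p / 2) in M1 by (rewrite Ec3; field; lra).
    replace ((tm - t2) / al F2) with (p / 2) in N6, N7
      by (simpl; unfold tm; replace ((t2 + t3) / 2 - t2) with ((t3 - t2) / 2) by field; rewrite Ec3; field; lra).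
    assert (Ehp : hp F h tm = - al F).
    { unfold F2 in N5; rewrite hp_rot in N5; unfold F1 in N5; rewrite hq_rot in N5; lra. }
    assert (Ehq : hq F2 h tm = - hq F h tm) by (unfold F2; rewrite hq_rot; reflexivity).
    rewrite Ehq in M1, N6; simpl in N6, N7; rewrite !Ropp_involutive in *.
    set (C := cos (p / 2)) in *; set (S := sin (p / 2)) in *.
    assert (HS : 0 < S) by (apply sin_gt_0; lra).
    assert (HCS : C * C + S * S = 1) by (unfold C, S; generalize (sin2_cos2 (p / 2)); unfold Rsqr; lra).
    assert (Ey : hq F h tm + cc F * al F = cc F * al F / C).
    { apply Rmult_eq_reg_r with C; [|lra]; replace (cc F * al F / C * C) with (cc F * al F) by (field; lra); lra. }
    assert (Ew : sg F * hz h tm = be F / S).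
    { apply Rmult_eq_reg_r with S; [|lra]; replace (be F / S * S) with (be F) by (field; lra).
      rewrite N7; set (w0 := sg F * hz h t2) in *.
      assert (N8 : w0 * S = - (cc F * al F / C) + (be F + cc F * al F) * C) by lra.
      replace ((w0 * C - (- be F - cc F * al F) * S) * S) with (w0 * S * C + (be F + cc F * al F) * (S * S)) by ring.
      rewrite N8; replace (S * S) with (1 - C * C) by lra; field; lra. }
    rewrite (imag_coords (h tm) OK (h_0 K gh T ga tm)) at 1.
    change (ip (h tm) (fP F)) with (hp F h tm); change (ip (h tm) (fQ F)) with (hq F h tm); change (q3 (h tm)) with (hz h tm).
    rewrite Ehp; f_equal; f_equal.
    + replace (hq F h tm - cc F * - al F) with (hq F h tm + cc F * al F) by ring; rewrite Ey; field; lra.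
    + apply Rmult_eq_reg_l with (sg F); [|exact Hs0]; rewrite Ew; field; lra.
  - assert (Hsp : 0 < sin (p / 2)) by (apply sin_gt_0; lra).
    assert (Hsq : 0 < sin (q / 2)) by (apply sin_gt_0; lra).
    (* After multiplication by the square of [wsum], the formulas for the half-angle tangents reduce
       the claim to 4 |cc| al be < [wsum]^2. *)
    apply Rmult_lt_reg_r with (wsum F L * wsum F L); [nra|].
    replace (cos (q / 2) * cos (p / 2) * (wsum F L * wsum F L))
      with (cos (q / 2) * cos (p / 2) * (wsum F L * wsum F L)) by ring.
    replace (Rabs (cc F) * sin (q / 2) * sin (p / 2) * (wsum F L * wsum F L))
      with (Rabs (cc F) * (sin (q / 2) * wsum F L) * (sin (p / 2) * wsum F L)) by ring.
    rewrite Tp, Tq.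
    replace (Rabs (cc F) * (2 * al F * cos (q / 2)) * (2 * be F * cos (p / 2)))
      with (cos (q / 2) * cos (p / 2) * (4 * Rabs (cc F) * (al F * be F))) by ring.
    apply Rmult_lt_compat_l; [apply Rmult_lt_0_compat; assumption|exact Wq].
Qed.

(** * Shortening a complete excursion *)

Lemma atan_polar X Y : 0 < X ->
  X = sqrt (X * X + Y * Y) * cos (atan (Y / X)) /\ Y = sqrt (X * X + Y * Y) * sin (atan (Y / X)).
Proof.
  intros HX; assert (Hc := atan_bound (Y / X)).
  assert (Hcp : 0 < cos (atan (Y / X))) by (apply cos_gt_0; lra).
  assert (Ht : sin (atan (Y / X)) = Y / X * cos (atan (Y / X))).
  { rewrite <- (tan_atan (Y / X)) at 2; unfold tan; field; lra. }
  set (c := cos (atan (Y / X))) in *; set (s := sin (atan (Y / X))) in *.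
  assert (Hcs : s * s + c * c = 1) by (unfold s, c; generalize (sin2_cos2 (atan (Y / X))); unfold Rsqr; lra).
  assert (HXs : X * s = Y * c) by (rewrite Ht; field; lra).
  assert (E : sqrt (X * X + Y * Y) = X / c).
  { rewrite <- (sqrt_square (X / c)) by (left; apply Rdiv_lt_0_compat; lra); f_equal.
    apply Rmult_eq_reg_r with (c * c); [|nra].
    replace (X / c * (X / c) * (c * c)) with (X * X) by (field; lra).
    replace ((X * X + Y * Y) * (c * c)) with (X * X * (c * c) + (Y * c) * (Y * c)) by ring.
    rewrite <- HXs; replace (X * X * (c * c) + X * s * (X * s)) with (X * X * (s * s + c * c)) by ring; rewrite Hcs; ring. }
  rewrite E; split; [field; lra|].
  apply Rmult_eq_reg_r with c; [|lra]; rewrite <- HXs; field; lra.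
Qed.

Lemma atan_abs t : Rabs (atan t) <= Rabs t.
Proof.
  assert (H : forall x, 0 <= x -> 0 <= atan x <= x).
  { intros x [Hx| <-]; [|rewrite atan_0; lra].
    destruct (MVT_cor2 atan (fun y => / (1 + Rsqr y)) 0 x Hx) as (y & Ey & Hy).
    { intros y _; replace (Rsqr y) with (y * y) by reflexivity; generalize (derivable_pt_lim_atan y); unfold Rsqr; replace (y ^ 2) with (y * y) by ring; intros H; exact H. }
    rewrite atan_0 in Ey.
    unfold Rsqr in Ey; assert (0 < / (1 + y * y) <= 1).
    { split; [apply Rinv_0_lt_compat; nra|]; apply Rle_trans with (/ 1); [apply Rinv_le_contravar; nra|lra]. }
    nra. }
  destruct (Rle_dec 0 t) as [Ht|Ht].
  - specialize (H t Ht); rewrite !Rabs_right; lra.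
  - specialize (H (- t) (ltac:(lra))); rewrite atan_opp in H; rewrite !Rabs_left1; lra.
Qed.

Lemma continuous_pos f : continuous f 0 -> 0 < f 0 -> exists d, 0 < d /\ forall x, 0 <= x < d -> 0 < f x.
Proof.
  intros Hf H0.
  destruct (Hf (fun y => 0 < y)) as [d Hd].
  { exists (mkposreal _ H0); intros y Hy; change (Rabs (y - f 0) < f 0) in Hy; apply Rabs_lt_between in Hy; lra. }
  exists d; split; [apply cond_pos|]; intros x Hx; apply Hd; change (Rabs (x - 0) < d); rewrite Rminus_0_r, Rabs_right; lra.
Qed.

Lemma derivable_acos x : -1 < x < 1 -> is_derive acos x (- / sqrt (1 - x * x)).
Proof.
  intros Hx; apply is_derive_Reals.
  assert (H := derive_pt_acos x Hx); apply derive_pt_eq_1 in H.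
  replace (- / sqrt (1 - x * x)) with (-1 / sqrt (1 - Rsqr x)); [exact H|unfold Rsqr, Rdiv; ring].
Qed.

(* With u = tP / 2, su = sin u, cu = cos u, the product P^(-2u) W^(2w) is rewritten as
   Q^(ch+ps) P^(-x) Q^(ch-ps). In coordinates where Q is the first axis its components
   are (exQ0, exQ1) along the complex line of Q and sg * (exa, exb) across it, so that
   sin(x/2) e^(i ps) = exa + i exb; exE is the resulting cost, up to a constant. *)
Section Excursion.
Variables (al be cc s : R).
Hypothesis Ha : 0 < al.
Hypothesis Hb : 0 < be.
Hypothesis Hc : 0 < cc.
Hypothesis Hs : 0 < s.
Hypothesis Hcs : cc * cc + s * s = 1.

(** [exD] / s^2 is the squared length of the plane vector h with h.P = al and h.Q = -be, and [exd] /
    s is the cost of a unit angle about it. [exsu] and [excu] are the sine and cosine of [tP] / 2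
    ([half_tP]). *)
Definition exD : R := al * al + be * be + 2 * cc * (al * be).
Definition exd : R := sqrt exD.
Definition exsu : R := sqrt (be / (cc * al + be)).
Definition excu : R := sqrt (cc * al / (cc * al + be)).
Definition exA : R := excu * (al + cc * be) / (s * exd).
Definition exB : R := exsu * (cc * al + be) / (s * exd).
Definition exa (w : R) : R := exsu * cos w - exA * sin w.
Definition exb (w : R) : R := exB * sin w.
Definition exa' (w : R) : R := - exsu * sin w - exA * cos w.
Definition exb' (w : R) : R := exB * cos w.
Definition exr (w : R) : R := exa w * exa w + exb w * exb w.
(** Half the derivative of [exr] ([exr_derive]). *)
Definition exr' (w : R) : R := exa w * exa' w + exb w * exb' w.
Definition exE (w : R) : R :=
  al * acos (1 - 2 * exr w) - 2 * be * atan (exb w / exa w) + 2 * (exd / s) * w.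

Lemma ex_consts : 0 < exD /\ 0 < exd /\ exd * exd = exD /\ 0 < exsu /\ 0 < excu /\
  exsu * exsu = be / (cc * al + be) /\ excu * excu = cc * al / (cc * al + be) /\
  exsu * exsu + excu * excu = 1 /\ 0 < exA /\ 0 < exB /\ be * be < exD * (exsu * exsu) /\
  exsu * exB = be / (s * exd).
Proof.
  assert (Hab : 0 < al * be) by nra; assert (Hca : 0 < cc * al) by nra.
  assert (H1 : 0 < exD) by (unfold exD; nra).
  assert (H2 : 0 < exd) by (apply sqrt_lt_R0, H1).
  assert (H3 : exd * exd = exD) by (apply sqrt_sqrt; lra).
  assert (P1 : 0 < be / (cc * al + be)) by (apply Rdiv_lt_0_compat; lra).
  assert (P2 : 0 < cc * al / (cc * al + be)) by (apply Rdiv_lt_0_compat; lra).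
  assert (H4 : 0 < exsu) by (apply sqrt_lt_R0, P1).
  assert (H5 : 0 < excu) by (apply sqrt_lt_R0, P2).
  assert (H6 : exsu * exsu = be / (cc * al + be)) by (apply sqrt_sqrt; lra).
  assert (H7 : excu * excu = cc * al / (cc * al + be)) by (apply sqrt_sqrt; lra).
  assert (Hsd : 0 < s * exd) by nra.
  repeat split; try assumption.
  - rewrite H6, H7; field; lra.
  - unfold exA; apply Rdiv_lt_0_compat; [apply Rmult_lt_0_compat; nra|exact Hsd].
  - unfold exB; apply Rdiv_lt_0_compat; [apply Rmult_lt_0_compat; nra|exact Hsd].
  - rewrite H6; unfold exD; apply Rmult_lt_reg_r with (cc * al + be); [lra|].
    replace ((al * al + be * be + 2 * cc * (al * be)) * (be / (cc * al + be)) * (cc * al + be))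
      with (be * be * (cc * al + be) + be * (al * al) + cc * al * (be * be)) by (field; lra).
    assert (0 < be * (al * al)) by (apply Rmult_lt_0_compat; nra); assert (0 < cc * al * (be * be)) by (apply Rmult_lt_0_compat; nra); lra.
  - unfold exB; replace (exsu * (exsu * (cc * al + be) / (s * exd))) with (exsu * exsu * (cc * al + be) / (s * exd)) by (field; lra).
    rewrite H6; field; repeat split; lra.
Qed.

(** The two terms in the derivative of [exE] compete, and their squares differ by a multiple of this
    quantity. Its double zero r = exsu^2 is the value at w = 0, so that derivative vanishes to
    second order there. *)
Lemma ex_key w : let r := exr w in
  al * al * (s * s) * exD * r * (exr' w * exr' w) - (1 - r) * ((exD * r - be * be) * (exD * r - be * be))
  = exD * ((be + cc * al) * (be + cc * al)) * ((r - exsu * exsu) * (r - exsu * exsu)) * (r - be * be / exD).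
Proof.
  destruct ex_consts as (D0 & d0 & Dd & S0 & C0 & S2 & C2 & _ & _ & _ & _ & SB).
  intros r.
  assert (E1 : exr' w * exr' w = r * (exsu * exsu + exA * exA + exB * exB - r) - (exsu * exB) * (exsu * exB)).
  { unfold r, exr', exr, exa', exb', exa, exb.
    assert (H : cos w * cos w = 1 - sin w * sin w) by (generalize (sin2_cos2 w); unfold Rsqr; lra).
    generalize exsu exA exB; intros p q m; ring [H]. }
  rewrite E1, SB.
  assert (EA : exA * exA = cc * al * ((al + cc * be) * (al + cc * be)) / ((cc * al + be) * (s * s) * exD)).
  { unfold exA; replace (excu * (al + cc * be) / (s * exd) * (excu * (al + cc * be) / (s * exd)))
      with (excu * excu * ((al + cc * be) * (al + cc * be)) / (s * s * (exd * exd))) by (field; lra).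
    rewrite C2, Dd; field; repeat split; nra. }
  assert (EB : exB * exB = be * (cc * al + be) / (s * s * exD)).
  { unfold exB; replace (exsu * (cc * al + be) / (s * exd) * (exsu * (cc * al + be) / (s * exd)))
      with (exsu * exsu * ((cc * al + be) * (cc * al + be)) / (s * s * (exd * exd))) by (field; lra).
    rewrite S2, Dd; field; repeat split; nra. }
  rewrite EA, EB, S2.
  replace (be / (s * exd) * (be / (s * exd))) with (be * be / (s * s * exD)) by (rewrite <- Dd; field; lra).
  assert (Hn : 0 < cc * al + be) by nra.
  replace (s * s) with (1 - cc * cc) by lra.
  assert (0 < 1 - cc * cc) by nra.
  unfold exD in *; field; repeat split; lra.
Qed.

Lemma exr_derive w : is_derive exr w (2 * exr' w).
Proof.
  unfold exr, exr', exa, exb, exa', exb'; auto_derive; [exact I|].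
  generalize exsu exA exB; intros; ring.
Qed.

Lemma exE_derive w : 0 < exa w -> exr w < 1 ->
  is_derive exE w (2 * (al * exr' w / sqrt (exr w * (1 - exr w)) + (exD * exr w - be * be) / (s * exd * exr w))).
Proof.
  intros Haw Hr1.
  destruct ex_consts as (D0 & d0 & Dd & S0 & C0 & S2 & C2 & _ & _ & _ & _ & SB).
  assert (Hr0 : 0 < exr w) by (unfold exr; nra).
  assert (Hm : 0 < exr w * (1 - exr w)) by nra.
  assert (Hq : 0 < sqrt (exr w * (1 - exr w))) by (apply sqrt_lt_R0, Hm).
  assert (D1 : is_derive (fun w => acos (1 - 2 * exr w)) w (-2 * (2 * exr' w) * (- / sqrt (1 - (1 - 2 * exr w) * (1 - 2 * exr w))))).
  { apply (is_derive_comp acos (fun w => 1 - 2 * exr w)).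
    - apply derivable_acos; lra.
    - replace (-2 * (2 * exr' w)) with (0 - 2 * (2 * exr' w)) by ring.
      apply (is_derive_minus (fun _ => 1)); [apply (is_derive_const 1)|].
      apply is_derive_scal, exr_derive. }
  replace (1 - (1 - 2 * exr w) * (1 - 2 * exr w)) with (4 * (exr w * (1 - exr w))) in D1 by ring.
  rewrite sqrt_mult in D1 by lra.
  replace (sqrt 4) with 2 in D1 by (replace 4 with (2 * 2) by ring; rewrite sqrt_square; lra).
  assert (D2 : is_derive (fun w => exb w / exa w) w ((exb' w * exa w - exb w * exa' w) / (exa w * exa w))).
  { replace (exa w * exa w) with (exa w ^ 2) by ring.
    apply (is_derive_div exb exa); [| |lra].
    - unfold exb, exb'; auto_derive; [exact I|ring].
    - unfold exa, exa'; auto_derive; [exact I|ring]. }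
  assert (D3 : is_derive (fun w => atan (exb w / exa w)) w
     ((exb' w * exa w - exb w * exa' w) / (exa w * exa w) * / (1 + (exb w / exa w) * (exb w / exa w)))).
  { apply (is_derive_comp atan (fun w => exb w / exa w)); [|exact D2].
    apply is_derive_Reals; generalize (derivable_pt_lim_atan (exb w / exa w)); unfold Rsqr.
    replace ((exb w / exa w) ^ 2) with (exb w / exa w * (exb w / exa w)) by ring; intros H; exact H. }
  (* Constant Wronskian: (exa, exb) traces an ellipse about 0, and its polar angle has derivative be
     / (s exd exr). *)
  assert (EW : exb' w * exa w - exb w * exa' w = be / (s * exd)).
  { rewrite <- SB; unfold exb', exb, exa, exa'.
    assert (H : cos w * cos w + sin w * sin w = 1) by (generalize (sin2_cos2 w); unfold Rsqr; lra).
    transitivity (exsu * exB * (cos w * cos w + sin w * sin w)); [ring|rewrite H; ring]. }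
  rewrite EW in D3.
  replace (be / (s * exd) / (exa w * exa w) * / (1 + exb w / exa w * (exb w / exa w)))
    with (be / (s * exd) / exr w) in D3 by (unfold exr in *; field; repeat split; nra).
  unfold exE.
  evar_last.
  - apply (is_derive_plus (fun w => al * acos (1 - 2 * exr w) - 2 * be * atan (exb w / exa w))).
    + apply (is_derive_minus (fun w => al * acos (1 - 2 * exr w)) (fun w => 2 * be * atan (exb w / exa w))).
      * apply is_derive_scal, D1.
      * apply is_derive_scal, D3.
    + apply (is_derive_scal (fun w => w)), (is_derive_id w).
  - change (@eq R (al * (-2 * (2 * exr' w) * - / (2 * sqrt (exr w * (1 - exr w)))) - 2 * be * (be / (s * exd) / exr w) + 2 * (exd / s) * 1)
     (2 * (al * exr' w / sqrt (exr w * (1 - exr w)) + (exD * exr w - be * be) / (s * exd * exr w)))).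
    rewrite <- Dd; field; repeat split; lra.
Qed.

Lemma exr_0 : exr 0 = exsu * exsu.
Proof. unfold exr, exa, exb; rewrite cos_0, sin_0; ring. Qed.

(** For small w > 0 the first term in the derivative of [exE] is negative, because [exr] decreases,
    and the second is positive, because exr > be^2 / exD. By [ex_key] the first has the larger
    absolute value as soon as [exr] has left its initial value exsu^2. *)
Lemma exE_decreasing : exists d, 0 < d /\ forall w, 0 < w < d ->
  0 < exa w /\ 0 < exr w < 1 /\ exE w < exE 0.
Proof.
  destruct ex_consts as (D0 & d0 & Dd & S0 & C0 & S2 & C2 & SC & A0 & B0 & DS & SB).
  destruct (@continuous_pos exa) as (d1 & Hd1 & N1).
  { apply (ex_derive_continuous exa); unfold exa; auto_derive; exact I. }
  { unfold exa; rewrite cos_0, sin_0; lra. }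
  destruct (@continuous_pos (fun w => - exr' w)) as (d2 & Hd2 & N2).
  { apply (ex_derive_continuous (fun w => - exr' w)); unfold exr', exa, exa', exb, exb'; auto_derive; exact I. }
  { unfold exr', exa, exa', exb, exb'; rewrite cos_0, sin_0; nra. }
  assert (Cr : continuous exr 0) by (apply (ex_derive_continuous exr); eexists; apply exr_derive).
  destruct (@continuous_pos (fun w => 1 - exr w)) as (d3 & Hd3 & N3).
  { apply (continuous_minus (fun _ => 1)); [apply continuous_const|exact Cr]. }
  { rewrite exr_0; nra. }
  destruct (@continuous_pos (fun w => exr w - be * be / exD)) as (d4 & Hd4 & N4).
  { apply (continuous_minus exr); [exact Cr|apply continuous_const]. }
  { rewrite exr_0; apply Rmult_lt_reg_r with exD; [exact D0|].
    replace ((exsu * exsu - be * be / exD) * exD) with (exD * (exsu * exsu) - be * be) by (field; lra); lra. }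
  set (d := Rmin (Rmin d1 d2) (Rmin d3 d4)).
  assert (Hd : 0 < d /\ d <= d1 /\ d <= d2 /\ d <= d3 /\ d <= d4).
  { unfold d; generalize (Rmin_l (Rmin d1 d2) (Rmin d3 d4)) (Rmin_r (Rmin d1 d2) (Rmin d3 d4)) (Rmin_l d1 d2) (Rmin_r d1 d2) (Rmin_l d3 d4) (Rmin_r d3 d4).
    repeat split; try lra; repeat apply Rmin_glb_lt; assumption. }
  destruct Hd as (Hd & L1 & L2 & L3 & L4).
  assert (P : forall w, 0 <= w < d -> 0 < exa w /\ exr' w < 0 /\ exr w < 1 /\ be * be / exD < exr w /\ 0 < exr w).
  { intros w Hw; specialize (N1 w ltac:(lra)); specialize (N2 w ltac:(lra)); specialize (N3 w ltac:(lra)); specialize (N4 w ltac:(lra)).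
    repeat split; try lra; unfold exr; nra. }
  exists d; split; [exact Hd|]; intros w Hw.
  split; [apply P; lra|]; split; [split; apply P; lra|].
  destruct (MVT_cor2 exE (fun w => 2 * (al * exr' w / sqrt (exr w * (1 - exr w)) + (exD * exr w - be * be) / (s * exd * exr w))) 0 w) as (v & Ev & Hv); [lra| |].
  { intros v Hv; apply is_derive_Reals, exE_derive; apply P; lra. }
  destruct (MVT_cor2 exr (fun w => 2 * exr' w) 0 v) as (v' & Ev' & Hv'); [lra| |].
  { intros z Hz; apply is_derive_Reals, exr_derive. }
  rewrite exr_0 in Ev'.
  assert (Hlt : exr v < exsu * exsu).
  { destruct (P v' ltac:(lra)) as (_ & H & _); nra. }
  destruct (P v ltac:(lra)) as (Pa & Pr' & Pr1 & Prb & Pr0).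
  assert (K := ex_key v); cbv zeta in K.
  set (r := exr v) in *; set (r' := exr' v) in *.
  assert (Hrb : 0 < exD * r - be * be).
  { apply Rmult_lt_compat_r with (r := exD) in Prb; [|exact D0].
    replace (be * be / exD * exD) with (be * be) in Prb by (field; lra); lra. }
  assert (KP : 0 < exD * ((be + cc * al) * (be + cc * al)) * ((r - exsu * exsu) * (r - exsu * exsu)) * (r - be * be / exD)).
  { assert (0 < be + cc * al) by nra.
    assert (0 < (r - exsu * exsu) * (r - exsu * exsu)) by (apply Rlt_0_sqr; lra).
    apply Rmult_lt_0_compat; [apply Rmult_lt_0_compat; [apply Rmult_lt_0_compat; [lra|apply Rmult_lt_0_compat; lra]|assumption]|lra]. }
  rewrite <- K in KP.
  assert (Hq0 : 0 < r * (1 - r)) by nra.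
  set (q := sqrt (r * (1 - r))) in *.
  assert (Hq : 0 < q) by (apply sqrt_lt_R0, Hq0).
  assert (Hqq : q * q = r * (1 - r)) by (apply sqrt_sqrt; lra).
  assert (HH : (exD * r - be * be) * q < al * (- r') * (s * exd * r)).
  { apply Rsqr_incrst_0.
    - unfold Rsqr.
      replace ((exD * r - be * be) * q * ((exD * r - be * be) * q)) with ((exD * r - be * be) * (exD * r - be * be) * (q * q)) by ring.
      replace (al * - r' * (s * exd * r) * (al * - r' * (s * exd * r))) with (al * al * (s * s) * (exd * exd) * r * (r' * r') * r) by ring.
      rewrite Hqq, Dd; nra.
    - apply Rmult_le_pos; lra.
    - repeat apply Rmult_le_pos; lra. }
  assert (al * r' / q + (exD * r - be * be) / (s * exd * r) < 0).
  { assert (0 < s * exd * r) by (repeat apply Rmult_lt_0_compat; lra).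
    apply Rmult_lt_reg_r with (q * (s * exd * r)); [nra|].
    replace ((al * r' / q + (exD * r - be * be) / (s * exd * r)) * (q * (s * exd * r)))
      with ((exD * r - be * be) * q - al * (- r') * (s * exd * r)) by (field; repeat split; lra).
    lra. }
  nra.
Qed.

Definition exQ0 (w : R) : R := excu * cos w + exsu * sin w * (s * al / exd).
Definition exQ1 (w : R) : R := - (excu * sin w * (s * be / exd)) - cc * exsu * cos w.

(** The product in question is a unit quaternion whose two other components are s exa and s exb, up
    to sign. *)
Lemma exQ_norm w : exQ0 w * exQ0 w + exQ1 w * exQ1 w = 1 - s * s * exr w.
Proof.
  destruct ex_consts as (D0 & d0 & Dd & S0 & C0 & S2 & C2 & SC & A0 & B0 & DS & SB).
  assert (H : cos w * cos w + sin w * sin w = 1) by (generalize (sin2_cos2 w); unfold Rsqr; lra).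
  assert (EA : exA * (s * exd) = excu * (al + cc * be)) by (unfold exA; field; lra).
  assert (EB : exB * (s * exd) = exsu * (cc * al + be)) by (unfold exB; field; lra).
  unfold exQ0, exQ1, exr, exa, exb.
  assert (I1 : / exd * exd = 1) by (field; lra).
  assert (ED : exd * exd = al * al + be * be + 2 * cc * (al * be)) by (rewrite Dd; reflexivity).
  assert (EA' : s * exA = excu * (al + cc * be) * / exd) by (unfold exA; field; lra).
  assert (EB' : s * exB = exsu * (cc * al + be) * / exd) by (unfold exB; field; lra).
  unfold Rdiv.
  assert (E : (excu * cos w + exsu * sin w * (s * al * / exd)) * (excu * cos w + exsu * sin w * (s * al * / exd)) +
    (- (excu * sin w * (s * be * / exd)) - cc * exsu * cos w) * (- (excu * sin w * (s * be * / exd)) - cc * exsu * cos w) +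
    (s * exsu * cos w - s * exA * sin w) * (s * exsu * cos w - s * exA * sin w) + (s * exB * sin w) * (s * exB * sin w) = 1).
  { rewrite EA', EB'.
    transitivity (cos w * cos w * (excu * excu + (cc * cc + s * s) * (exsu * exsu)) + sin w * sin w * (/ exd * / exd)
      * (exsu * exsu * ((cc * cc + s * s) * (al * al) + be * be + 2 * cc * (al * be))
       + excu * excu * (al * al + (cc * cc + s * s) * (be * be) + 2 * cc * (al * be)))); [ring|].
    rewrite Hcs, !Rmult_1_l, <- ED.
    transitivity (cos w * cos w * (exsu * exsu + excu * excu) + sin w * sin w * (/ exd * exd) * (/ exd * exd) * (exsu * exsu + excu * excu)); [ring|].
    rewrite I1, SC; lra. }
  rewrite <- E; ring.
Qed.

Lemma excursion_shortcut eps : 0 < eps -> exists w x ps ch, 0 < w /\ 0 <= x <= PI /\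
  Rabs ps + Rabs ch <= eps /\
  sin (x / 2) * cos ps = exa w /\ sin (x / 2) * sin ps = exb w /\
  exQ0 w = cos ch * cos (x / 2) + cc * (sin ch * sin (x / 2)) /\
  exQ1 w = sin ch * cos (x / 2) - cc * (cos ch * sin (x / 2)) /\
  al * x - 2 * be * ps + 2 * (exd / s) * w < al * acos ((cc * al - be) / (cc * al + be)).
Proof.
  intros He.
  destruct ex_consts as (D0 & d0 & Dd & S0 & C0 & S2 & C2 & SC & A0 & B0 & DS & SB).
  destruct exE_decreasing as (d & Hd & HE).
  (* X + i Y is (exQ0 + i exQ1) (cos (x / 2) + i cc sin (x / 2)). The required equations say exQ0 +
     i exQ1 = e^(i ch) (cos (x / 2) - i cc sin (x / 2)), so ch is the argument of X + i Y, which is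
     0 at w = 0. *)
  set (X := fun w => exQ0 w * sqrt (1 - exr w) - cc * (exQ1 w * sqrt (exr w))).
  set (Y := fun w => exQ1 w * sqrt (1 - exr w) + cc * (exQ0 w * sqrt (exr w))).
  assert (S1 : sqrt (exr 0) = exsu) by (rewrite exr_0; apply sqrt_square; lra).
  assert (S1' : sqrt (1 - exr 0) = excu) by (rewrite exr_0; replace (1 - exsu * exsu) with (excu * excu) by lra; apply sqrt_square; lra).
  assert (Cr : continuous exr 0) by (apply (ex_derive_continuous exr); eexists; apply exr_derive).
  assert (C1 : continuous (fun w => sqrt (exr w)) 0) by (apply continuous_comp; [exact Cr|apply continuous_sqrt]).
  assert (C1' : continuous (fun w => sqrt (1 - exr w)) 0).
  { apply (continuous_comp (fun w => 1 - exr w) sqrt); [|apply continuous_sqrt].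
    apply (continuous_minus (fun _ => 1)); [apply continuous_const|exact Cr]. }
  assert (CQ0 : continuous exQ0 0) by (apply (ex_derive_continuous exQ0); unfold exQ0; auto_derive; exact I).
  assert (CQ1 : continuous exQ1 0) by (apply (ex_derive_continuous exQ1); unfold exQ1; auto_derive; exact I).
  assert (CX : continuous X 0).
  { apply (continuous_minus (fun w => exQ0 w * sqrt (1 - exr w))); [apply (continuous_mult exQ0); assumption|].
    apply (continuous_mult (fun _ => cc)); [apply continuous_const|apply (continuous_mult exQ1); assumption]. }
  assert (CY : continuous Y 0).
  { apply (continuous_plus (fun w => exQ1 w * sqrt (1 - exr w))); [apply (continuous_mult exQ1); assumption|].
    apply (continuous_mult (fun _ => cc)); [apply continuous_const|apply (continuous_mult exQ0); assumption]. }
  assert (Q00 : exQ0 0 = excu) by (unfold exQ0; rewrite cos_0, sin_0; ring).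
  assert (Q10 : exQ1 0 = - (cc * exsu)) by (unfold exQ1; rewrite cos_0, sin_0; ring).
  assert (X0 : 0 < X 0) by (unfold X; rewrite S1, S1', Q00, Q10; nra).
  assert (Y0 : Y 0 = 0) by (unfold Y; rewrite S1, S1', Q00, Q10; ring).
  destruct (@continuous_pos X CX X0) as (d1 & Hd1 & N1).
  assert (Cex : continuous exa 0) by (apply (ex_derive_continuous exa); unfold exa; auto_derive; exact I).
  assert (Cey : continuous exb 0) by (apply (ex_derive_continuous exb); unfold exb; auto_derive; exact I).
  assert (a0 : exa 0 = exsu) by (unfold exa; rewrite cos_0, sin_0; ring).
  assert (b0 : exb 0 = 0) by (unfold exb; rewrite sin_0; ring).
  destruct (@continuous_pos (fun w => eps / 2 * exa w - Rabs (exb w))) as (d2 & Hd2 & N2).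
  { apply (continuous_minus (fun w => eps / 2 * exa w)).
    - apply (continuous_mult (fun _ => eps / 2)); [apply continuous_const|exact Cex].
    - apply (continuous_comp exb Rabs); [exact Cey|apply continuous_Rabs]. }
  { rewrite a0, b0, Rabs_R0; nra. }
  destruct (@continuous_pos (fun w => eps / 2 * X w - Rabs (Y w))) as (d3 & Hd3 & N3).
  { apply (continuous_minus (fun w => eps / 2 * X w)).
    - apply (continuous_mult (fun _ => eps / 2)); [apply continuous_const|exact CX].
    - apply (continuous_comp Y Rabs); [exact CY|apply continuous_Rabs]. }
  { rewrite Y0, Rabs_R0; nra. }
  set (w := Rmin (Rmin d d1) (Rmin d2 d3) / 2).
  assert (Hw : 0 < w /\ w < d /\ w < d1 /\ w < d2 /\ w < d3).
  { assert (0 < Rmin (Rmin d d1) (Rmin d2 d3)) by (repeat apply Rmin_glb_lt; assumption).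
    unfold w; generalize (Rmin_l (Rmin d d1) (Rmin d2 d3)) (Rmin_r (Rmin d d1) (Rmin d2 d3)) (Rmin_l d d1) (Rmin_r d d1) (Rmin_l d2 d3) (Rmin_r d2 d3).
    repeat split; lra. }
  clearbody w; destruct Hw as (W0 & W1 & W2 & W3 & W4).
  destruct (HE w ltac:(lra)) as (Pa & [Pr0 Pr1] & PE).
  specialize (N1 w ltac:(lra)); specialize (N2 w ltac:(lra)); specialize (N3 w ltac:(lra)).
  set (x := acos (1 - 2 * exr w)).
  assert (Hx : 0 <= x <= PI) by (apply acos_bound).
  assert (Hcx : cos x = 1 - 2 * exr w) by (apply cos_acos; lra).
  assert (Hsx2 : sin (x / 2) * sin (x / 2) = exr w).
  { replace x with (2 * (x / 2)) in Hcx by field; rewrite cos_2a_sin in Hcx; lra. }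
  assert (Hsx : sin (x / 2) = sqrt (exr w)).
  { rewrite <- Hsx2; symmetry; apply sqrt_square; apply sin_ge_0; lra. }
  assert (Hcx2 : cos (x / 2) = sqrt (1 - exr w)).
  { rewrite <- (sqrt_square (cos (x / 2))) by (apply cos_ge_0; lra); f_equal.
    generalize (sin2_cos2 (x / 2)); unfold Rsqr; lra. }
  exists w, x, (atan (exb w / exa w)), (atan (Y w / X w)).
  destruct (@atan_polar (exa w) (exb w) Pa) as [Za Zb].
  destruct (@atan_polar (X w) (Y w) N1) as [ZX ZY].
  assert (EN : X w * X w + Y w * Y w = (1 - s * s * exr w) * (1 - s * s * exr w)).
  { assert (EQ := exQ_norm w).
    transitivity ((exQ0 w * exQ0 w + exQ1 w * exQ1 w) * (sqrt (1 - exr w) * sqrt (1 - exr w) + cc * cc * (sqrt (exr w) * sqrt (exr w)))); [unfold X, Y; ring|].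
    rewrite EQ, !sqrt_sqrt by lra; replace (cc * cc) with (1 - s * s) by lra; ring. }
  assert (Nn : 0 < 1 - s * s * exr w) by nra.
  rewrite EN, sqrt_square in ZX, ZY by lra.
  assert (NN : sqrt (1 - exr w) * sqrt (1 - exr w) + cc * cc * (sqrt (exr w) * sqrt (exr w)) = 1 - s * s * exr w).
  { rewrite !sqrt_sqrt by lra; replace (cc * cc) with (1 - s * s) by lra; ring. }
  split; [exact W0|]; split; [exact Hx|]; split.
  { generalize (atan_abs (exb w / exa w)) (atan_abs (Y w / X w)); unfold Rdiv; rewrite !Rabs_mult.
    rewrite (Rabs_right (/ exa w)), (Rabs_right (/ X w)) by (apply Rle_ge; left; apply Rinv_0_lt_compat; lra); intros M1 M2.
    assert (Rabs (exb w) * / exa w <= eps / 2).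
    { apply Rmult_le_reg_r with (exa w); [lra|]; replace (Rabs (exb w) * / exa w * exa w) with (Rabs (exb w)) by (field; lra); lra. }
    assert (Rabs (Y w) * / X w <= eps / 2).
    { apply Rmult_le_reg_r with (X w); [lra|]; replace (Rabs (Y w) * / X w * X w) with (Rabs (Y w)) by (field; lra); lra. }
    lra. }
  rewrite Hsx, Hcx2.
  split; [unfold exr at 1; lra|]; split; [unfold exr at 1; lra|].
  set (ch := atan (Y w / X w)) in *.
  split; [|split].
  - apply Rmult_eq_reg_l with (1 - s * s * exr w); [|lra].
    replace ((1 - s * s * exr w) * (cos ch * sqrt (1 - exr w) + cc * (sin ch * sqrt (exr w))))
      with (((1 - s * s * exr w) * cos ch) * sqrt (1 - exr w) + cc * (((1 - s * s * exr w) * sin ch) * sqrt (exr w))) by ring.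
    rewrite <- ZX, <- ZY, <- NN; unfold X, Y; ring.
  - apply Rmult_eq_reg_l with (1 - s * s * exr w); [|lra].
    replace ((1 - s * s * exr w) * (sin ch * sqrt (1 - exr w) - cc * (cos ch * sqrt (exr w))))
      with (((1 - s * s * exr w) * sin ch) * sqrt (1 - exr w) - cc * (((1 - s * s * exr w) * cos ch) * sqrt (exr w))) by ring.
    rewrite <- ZX, <- ZY, <- NN; unfold X, Y; ring.
  - unfold exE in PE; rewrite exr_0, b0, a0 in PE.
    replace (0 / exsu) with 0 in PE by (field; lra); rewrite atan_0 in PE.
    replace (1 - 2 * (exsu * exsu)) with ((cc * al - be) / (cc * al + be)) in PE by (rewrite S2; field; nra).
    fold x in PE; lra.
Qed.
End Excursion.

(** * The singular direction and complete excursions *)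

Lemma half_acos p : 0 <= p <= 1 -> sin (acos (1 - 2 * p) / 2) = sqrt p /\ cos (acos (1 - 2 * p) / 2) = sqrt (1 - p).
Proof.
  intros Hp; set (x := acos (1 - 2 * p)).
  assert (Hx : 0 <= x <= PI) by (apply acos_bound).
  assert (Hcx : cos x = 1 - 2 * p) by (apply cos_acos; lra).
  assert (Hs2 : sin (x / 2) * sin (x / 2) = p).
  { replace x with (2 * (x / 2)) in Hcx by field; rewrite cos_2a_sin in Hcx; lra. }
  split.
  - rewrite <- Hs2; symmetry; apply sqrt_square; apply sin_ge_0; lra.
  - rewrite <- (sqrt_square (cos (x / 2))) by (apply cos_ge_0; lra); f_equal.
    generalize (sin2_cos2 (x / 2)); unfold Rsqr; lra.
Qed.

Lemma anticommute a b : q0 a = 0 -> q0 b = 0 -> ip a b = 0 -> qmul a b = qopp (qmul b a).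
Proof.
  unfold ip; intros Ha Hb H; rewrite Ha, Hb in H.
  apply quat_ext; simpl; rewrite Ha, Hb; lra.
Qed.

Lemma rt_anti n m ph : qmul n m = qopp (qmul m n) -> qmul (rt n ph) m = qmul m (rt n (- ph)).
Proof.
  intros H; unfold rt; replace (- ph / 2) with (- (ph / 2)) by field; rewrite cos_neg, sin_neg.
  set (c := cos (ph / 2)); set (s := sin (ph / 2)).
  transitivity (qadd (qscal c m) (qscal s (qmul n m))); [qring|].
  rewrite H; qring.
Qed.

(** sg^2 times the plane vector h with h.P = al and h.Q = -be, so that turning about it fixes the
    covector at an O-corner in the plane. For al = 1 and be = kappa it is W_+. *)
Definition wv (F : frame) : quat := vec F (al F + cc F * be F) (- (be F + cc F * al F)).
Definition wlen (F : frame) : R := Rabs (sg F) * exd (al F) (be F) (cc F).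
Definition wdir (F : frame) : quat := qscal (/ wlen F) (wv F).
Definition wcost (F : frame) : R := exd (al F) (be F) (cc F) / Rabs (sg F).
(** The two angles of a complete excursion from the corner (al, -be): along P, hq climbs from -be to
    be in [tP]; along Q, hp then falls from al to -al in [tQ]. *)
Definition tP (F : frame) : R := acos ((cc F * al F - be F) / (cc F * al F + be F)).
Definition tQ (F : frame) : R := acos (- ((al F - cc F * be F) / (al F + cc F * be F))).
(** The reflection (P, Q) -> (-Q, -P). It keeps the corner (al, -be) and the direction W and
    reverses the wedge, so it exchanges excursions with hz of either sign. *)
Definition swapF (F : frame) : frame := rotF (flipF F).

Section Singular.
Variable F : frame.
Hypothesis OK : frame_ok F.
Hypothesis Hcc : 0 < cc F.

Let s := Rabs (sg F).
Let d := exd (al F) (be F) (cc F).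

Lemma s_pos : 0 < s.
Proof. apply Rabs_pos_lt, (ok_sg0 F OK). Qed.

Lemma s_sq : s * s = sg F * sg F.
Proof. unfold s; rewrite <- Rabs_mult; apply Rabs_right, Rle_ge; nra. Qed.

Lemma cc_s : cc F * cc F + s * s = 1.
Proof. rewrite s_sq; apply frame_id, OK. Qed.

Lemma d_sq : 0 < d /\ d * d = al F * al F + be F * be F + 2 * cc F * (al F * be F).
Proof.
  destruct (ex_consts (al_pos F OK) (be_pos F OK) Hcc s_pos) as (_ & H1 & H2 & _); split; [exact H1|exact H2].
Qed.

Lemma wlen_pos : 0 < wlen F.
Proof. apply Rmult_lt_0_compat; [apply s_pos|apply d_sq]. Qed.

Lemma ip_vec a b a' b' : ip (vec F a b) (vec F a' b') = a * a' + b * b' + cc F * (a * b' + b * a').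
Proof.
  destruct (ok_P F OK) as [_ HP]; destruct (ok_Q F OK) as [_ HQ]; assert (HC := ok_cc F OK).
  unfold vec.
  transitivity (a * a' * ip (fP F) (fP F) + b * b' * ip (fQ F) (fQ F) + (a * b' + b * a') * ip (fP F) (fQ F)); [unfold ip; simpl; ring|].
  rewrite HP, HQ, HC; ring.
Qed.

Lemma wv_sq : ip (wv F) (wv F) = wlen F * wlen F.
Proof.
  unfold wv; rewrite ip_vec; unfold wlen; fold s; fold d; destruct d_sq as [_ Hd]; assert (Hc := cc_s).
  replace (s * d * (s * d)) with (s * s * (d * d)) by ring; rewrite Hd; replace (s * s) with (1 - cc F * cc F) by lra; ring.
Qed.

Lemma wdir_unit : unitv (wdir F).
Proof.
  assert (H := wlen_pos); split.
  - unfold wdir, wv; simpl; destruct (ok_P F OK) as [-> _]; destruct (ok_Q F OK) as [-> _]; ring.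
  - unfold wdir; transitivity (/ wlen F * / wlen F * ip (wv F) (wv F)); [unfold ip; simpl; ring|].
    rewrite wv_sq; field; lra.
Qed.

Lemma wdir_3 : q3 (wdir F) = 0.
Proof. unfold wdir, wv; simpl; rewrite (ok_P3 F OK), (ok_Q3 F OK); ring. Qed.

Lemma ip_wdir : ip (wdir F) (fP F) = s * al F / d /\ ip (wdir F) (fQ F) = - (s * be F / d).
Proof.
  assert (Hs := s_pos); destruct d_sq as [Hd _]; assert (Hc := cc_s).
  destruct (ok_P F OK) as [_ HP]; destruct (ok_Q F OK) as [_ HQ]; assert (HC := ok_cc F OK).
  unfold wdir, wv, wlen; fold s; fold d; split.
  - transitivity (/ (s * d) * ((al F + cc F * be F) * ip (fP F) (fP F) - (be F + cc F * al F) * ip (fP F) (fQ F))); [unfold ip; simpl; ring|].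
    rewrite HP, HC; apply Rmult_eq_reg_r with (s * d); [|nra].
    transitivity (al F * (1 - cc F * cc F)); [field; lra|].
    replace (1 - cc F * cc F) with (s * s) by lra; field; lra.
  - transitivity (/ (s * d) * ((al F + cc F * be F) * ip (fP F) (fQ F) - (be F + cc F * al F) * ip (fQ F) (fQ F))); [unfold ip; simpl; ring|].
    rewrite HQ, HC; apply Rmult_eq_reg_r with (s * d); [|nra].
    transitivity (- be F * (1 - cc F * cc F)); [field; lra|].
    replace (1 - cc F * cc F) with (s * s) by lra; field; lra.
Qed.

Lemma reach_wdir ph : reach F (rt (wdir F) ph) (wcost F * Rabs ph).
Proof.
  assert (Hs := s_pos); destruct d_sq as [Hd Hdd]; assert (Hl := wlen_pos).
  assert (Ha := al_pos F OK); assert (Hb := be_pos F OK).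
  rewrite <- qexp_scal by apply wdir_unit.
  replace (qscal ph (wdir F)) with (vec F (ph * (/ wlen F * (al F + cc F * be F))) (- ph * (/ wlen F * (be F + cc F * al F))))
    by (unfold wdir, wv, vec; qring).
  eapply reach_le; [apply reach_exp|].
  assert (0 < / wlen F) by (apply Rinv_0_lt_compat, Hl).
  rewrite !Rabs_mult, Rabs_Ropp, (Rabs_right (/ wlen F)), !(Rabs_right (_ + _)) by nra.
  replace (al F * (Rabs ph * (/ wlen F * (al F + cc F * be F))) + be F * (Rabs ph * (/ wlen F * (be F + cc F * al F))))
    with (Rabs ph * (/ wlen F * (d * d))) by (rewrite Hdd; ring).
  unfold wcost, wlen; fold s; fold d; right; field; lra.
Qed.

Lemma half_tP : sin (tP F / 2) = exsu (al F) (be F) (cc F) /\ cos (tP F / 2) = excu (al F) (be F) (cc F).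
Proof.
  assert (Ha := al_pos F OK); assert (Hb := be_pos F OK); assert (Hca : 0 < cc F * al F) by nra.
  unfold tP, exsu, excu.
  replace ((cc F * al F - be F) / (cc F * al F + be F)) with (1 - 2 * (be F / (cc F * al F + be F))) by (field; lra).
  replace (cc F * al F / (cc F * al F + be F)) with (1 - be F / (cc F * al F + be F)) by (field; lra).
  apply half_acos; split.
  - left; apply Rdiv_lt_0_compat; lra.
  - apply Rmult_le_reg_r with (cc F * al F + be F); [lra|].
    replace (be F / (cc F * al F + be F) * (cc F * al F + be F)) with (be F) by (field; lra); lra.
Qed.

Lemma half_tQ : sin (tQ F / 2) = sqrt (al F / (al F + cc F * be F)) /\ cos (tQ F / 2) = sqrt (cc F * be F / (al F + cc F * be F)).
Proof.
  assert (Ha := al_pos F OK); assert (Hb := be_pos F OK); assert (Hca : 0 < cc F * be F) by nra.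
  unfold tQ.
  replace (- ((al F - cc F * be F) / (al F + cc F * be F))) with (1 - 2 * (al F / (al F + cc F * be F))) by (field; lra).
  replace (cc F * be F / (al F + cc F * be F)) with (1 - al F / (al F + cc F * be F)) by (field; lra).
  apply half_acos; split.
  - left; apply Rdiv_lt_0_compat; lra.
  - apply Rmult_le_reg_r with (al F + cc F * be F); [lra|].
    replace (al F / (al F + cc F * be F) * (al F + cc F * be F)) with (al F) by (field; lra); lra.
Qed.

Lemma tP_range : 0 < tP F < PI.
Proof.
  assert (Ha := al_pos F OK); assert (Hb := be_pos F OK); assert (Hca : 0 < cc F * al F) by nra.
  apply acos_bound_lt; split.
  - apply Rmult_lt_reg_r with (cc F * al F + be F); [lra|].
    replace ((cc F * al F - be F) / (cc F * al F + be F) * (cc F * al F + be F)) with (cc F * al F - be F) by (field; lra); lra.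
  - apply Rmult_lt_reg_r with (cc F * al F + be F); [lra|].
    replace ((cc F * al F - be F) / (cc F * al F + be F) * (cc F * al F + be F)) with (cc F * al F - be F) by (field; lra); lra.
Qed.

Lemma tQ_range : 0 < tQ F < PI.
Proof.
  assert (Ha := al_pos F OK); assert (Hb := be_pos F OK); assert (Hca : 0 < cc F * be F) by nra.
  apply acos_bound_lt; split.
  - apply Rmult_lt_reg_r with (al F + cc F * be F); [lra|].
    replace (- ((al F - cc F * be F) / (al F + cc F * be F)) * (al F + cc F * be F)) with (cc F * be F - al F) by (field; lra); lra.
  - apply Rmult_lt_reg_r with (al F + cc F * be F); [lra|].
    replace (- ((al F - cc F * be F) / (al F + cc F * be F)) * (al F + cc F * be F)) with (cc F * be F - al F) by (field; lra); lra.
Qed.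

(* The product of a complete excursion P^tP Q^tQ is a half-turn about an axis
   orthogonal to the singular direction. *)
Definition exc : quat := qmul (rt (fP F) (tP F)) (rt (fQ F) (tQ F)).

Lemma exc_axis : q0 exc = 0 /\ ip (wdir F) exc = 0.
Proof.
  destruct half_tP as [Su Cu]; destruct half_tQ as [Sv Cv].
  assert (Hs := s_pos); destruct d_sq as [Hd _]; destruct ip_wdir as [WP WQ].
  assert (Ha := al_pos F OK); assert (Hb := be_pos F OK); assert (Hca : 0 < cc F * al F) by nra; assert (Hcb : 0 < cc F * be F) by nra.
  destruct wdir_unit as [W0 _]; assert (W3 := wdir_3).
  set (N1 := cc F * al F + be F); set (N2 := al F + cc F * be F).
  assert (n1 : 0 < N1) by (unfold N1; lra); assert (n2 : 0 < N2) by (unfold N2; lra).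
  assert (I1 := Rinv_0_lt_compat _ n1); assert (I2 := Rinv_0_lt_compat _ n2).
  destruct (ok_P F OK) as [P0 _]; destruct (ok_Q F OK) as [Q0 _]; assert (HC := ok_cc F OK).
  assert (P3 := ok_P3 F OK); assert (Q3 := ok_Q3 F OK).
  unfold exc, rt; rewrite Su, Cu, Sv, Cv; unfold exsu, excu; fold N1 N2.
  rewrite !sqrt_div_alt, !sqrt_mult by lra.
  (* With the square roots of cc, al and be as variables, both claims become rational identities. *)
  set (rc := sqrt (cc F)); set (ra := sqrt (al F)); set (rb := sqrt (be F)).
  assert (Rc : rc * rc = cc F) by (apply sqrt_sqrt; lra).
  assert (Ra : ra * ra = al F) by (apply sqrt_sqrt; lra).
  assert (Rb : rb * rb = be F) by (apply sqrt_sqrt; lra).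
  assert (m1 : 0 < sqrt N1) by (apply sqrt_lt_R0; lra); assert (m2 : 0 < sqrt N2) by (apply sqrt_lt_R0; lra).
  set (M1 := sqrt N1) in *; set (M2 := sqrt N2) in *.
  split.
  - transitivity (rc * ra / M1 * (rc * rb / M2) - rb / M1 * (ra / M2) * ip (fP F) (fQ F)).
    + unfold ip; simpl; rewrite P0, Q0; ring.
    + rewrite HC, <- Rc; field; lra.
  - transitivity (rb / M1 * (rc * rb / M2) * ip (wdir F) (fP F) + rc * ra / M1 * (ra / M2) * ip (wdir F) (fQ F)).
    + revert W0 W3; generalize (wdir F) as n; intros n W0 W3; unfold ip; simpl; rewrite W0, W3, P0, Q0, P3, Q3; ring.
    + rewrite WP, WQ, <- Ra, <- Rb; field; lra.
Qed.

Lemma exc_conj : qconj exc = qopp exc.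
Proof. destruct exc_axis as [H _]; revert H; generalize exc; intros m H; apply quat_ext; simpl; rewrite ?H; ring. Qed.

Lemma exc_wdir ph : qmul (rt (wdir F) ph) exc = qmul exc (rt (wdir F) (- ph)).
Proof.
  apply rt_anti, anticommute; [apply wdir_unit|apply exc_axis|apply exc_axis].
Qed.

Lemma shortcut_identity eps : 0 < eps -> exists w x ps ch, 0 < w /\ 0 <= x <= PI /\
  Rabs ps + Rabs ch <= eps /\
  qmul (rt (fP F) (- tP F)) (rt (wdir F) (2 * w))
    = qmul (rt (fQ F) (ch + ps)) (qmul (rt (fP F) (- x)) (rt (fQ F) (ch - ps))) /\
  al F * x - 2 * be F * ps + 2 * wcost F * w < al F * tP F.
Proof.
  intros He.
  destruct (excursion_shortcut (al_pos F OK) (be_pos F OK) Hcc s_pos cc_s He)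
    as (w & x & ps & ch & Hw & Hx & Hpc & E1 & E2 & E3 & E4 & E5).
  exists w, x, ps, ch; repeat split; try assumption; try apply Hx.
  assert (Hs := s_pos); destruct d_sq as [Hd Hdd]; destruct half_tP as [Su Cu]; assert (Hc := cc_s).
  assert (OKr := rotF_ok F OK).
  (* The sign of the wedge: the formulas of the shortcut assume s > 0, and the coordinates across Q
     carry this sign. *)
  set (ep := sg F / s).
  assert (Hep : ep * s = sg F) by (unfold ep; field; lra).
  set (n := mkQ 0 (- (s * be F / d)) (- (ep * (al F + cc F * be F) / d)) 0).
  assert (EQ : fQ F = emb (rotF F) (pl 1 0)) by (rewrite (emb_P OKr); reflexivity).
  assert (EP : fP F = emb (rotF F) (pl (cc F) (- sg F))).
  { transitivity (qopp (fQ (rotF F))); [simpl; qring|].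
    transitivity (qopp (emb (rotF F) (pl (- cc F) (sg F)))); [rewrite <- (emb_Q OKr); reflexivity|unfold emb; qring]. }
  assert (EW : wdir F = emb (rotF F) n).
  { destruct wdir_unit as [W0 _]; destruct ip_wdir as [WP WQ].
    rewrite (imag_coords (wdir F) OKr W0); f_equal; unfold n; cbn [fP fQ cc sg rotF].
    assert (WPo : ip (wdir F) (qopp (fP F)) = - ip (wdir F) (fP F)) by (unfold ip; simpl; ring).
    rewrite WPo, WP, WQ, wdir_3; f_equal; try ring.
    assert (sg F <> 0) by apply (ok_sg0 F OK).
    apply Rmult_eq_reg_r with (sg F); [|assumption].
    transitivity (- (s * al F / d) - cc F * (s * be F / d)); [field; lra|].
    transitivity (- (ep * sg F * (al F + cc F * be F) / d)); [|field; lra].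
    assert (Hes : ep * sg F = s).
    { transitivity (sg F * sg F / s); [unfold ep; field; lra|rewrite <- s_sq; field; lra]. }
    rewrite Hes; field; lra. }
  rewrite EW, EP, EQ, <- !emb_rt, <- !emb_mul by exact OKr; f_equal.
  unfold rt; replace (- tP F / 2) with (- (tP F / 2)) by field; replace (2 * w / 2) with w by field.
  replace (- x / 2) with (- (x / 2)) by field; rewrite !cos_neg, !sin_neg, Su, Cu.
  replace ((ch + ps) / 2) with (ch / 2 + ps / 2) by field; replace ((ch - ps) / 2) with (ch / 2 - ps / 2) by field.
  assert (Fc : cos ch = cos (ch / 2) * cos (ch / 2) - sin (ch / 2) * sin (ch / 2)).
  { rewrite <- cos_plus; f_equal; field. }
  assert (Fs : sin ch = 2 * sin (ch / 2) * cos (ch / 2)).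
  { rewrite <- sin_2a; f_equal; field. }
  assert (Gc : cos ps = cos (ps / 2) * cos (ps / 2) - sin (ps / 2) * sin (ps / 2)).
  { rewrite <- cos_plus; f_equal; field. }
  assert (Gs : sin ps = 2 * sin (ps / 2) * cos (ps / 2)).
  { rewrite <- sin_2a; f_equal; field. }
  assert (Hch : cos (ch / 2) * cos (ch / 2) + sin (ch / 2) * sin (ch / 2) = 1) by (generalize (sin2_cos2 (ch / 2)); unfold Rsqr; lra).
  assert (Hps : cos (ps / 2) * cos (ps / 2) + sin (ps / 2) * sin (ps / 2) = 1) by (generalize (sin2_cos2 (ps / 2)); unfold Rsqr; lra).
  rewrite cos_plus, sin_plus, cos_minus, sin_minus.
  set (p := cos (ch / 2)) in *; set (q := sin (ch / 2)) in *; set (p' := cos (ps / 2)) in *; set (q' := sin (ps / 2)) in *.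
  set (cx := cos (x / 2)) in *; set (sx := sin (x / 2)) in *.
  unfold exQ0 in E3; unfold exQ1 in E4; unfold exa, exA in E1; unfold exb, exB in E2.
  fold s in E1, E2, E3, E4; fold d in E1, E2, E3, E4.
  set (su := exsu (al F) (be F) (cc F)) in *; set (cu := excu (al F) (be F) (cc F)) in *.
  rewrite Fc, Fs in E3, E4; rewrite Gc in E1; rewrite Gs in E2.
  assert (Hss : ep * ep = 1).
  { assert (s * s = ep * ep * (s * s)) by (rewrite s_sq at 1; rewrite <- Hep; ring).
    apply Rmult_eq_reg_r with (s * s); [lra|nra]. }
  unfold n; apply quat_ext; simpl.
  - transitivity (cu * cos w + su * sin w * (s * al F / d)).
    + rewrite <- Hep; transitivity (cu * cos w - su * cc F * sin w * (s * be F / d) + su * sin w * (ep * ep) * (s * (al F + cc F * be F) / d)); [field; lra|].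
      rewrite Hss; field; lra.
    + rewrite E3; transitivity ((p * p - q * q) * (p' * p' + q' * q') * cx + cc F * (2 * q * p * (p' * p' + q' * q') * sx)); [rewrite Hps; ring|ring].
  - transitivity (- (cu * sin w * (s * be F / d)) - cc F * su * cos w); [field; lra|].
    rewrite E4; transitivity (2 * q * p * (p' * p' + q' * q') * cx - cc F * ((p * p - q * q) * (p' * p' + q' * q') * sx)); [rewrite Hps; ring|ring].
  - transitivity (sg F * (sx * (p' * p' - q' * q'))).
    + rewrite E1, <- Hep; field; lra.
    + transitivity ((p * p + q * q) * (sg F * (sx * (p' * p' - q' * q')))); [rewrite Hch; ring|ring].
  - transitivity (sg F * (sx * (2 * q' * p'))).
    + rewrite E2, <- Hep.
      transitivity (su * sin w * ep * (cc F * al F + (cc F * cc F + s * s) * be F) / d); [field; lra|].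
      rewrite Hc; field; lra.
    + transitivity ((p * p + q * q) * (sg F * (sx * (2 * q' * p')))); [rewrite Hch; ring|ring].
Qed.

(** M = [exc] satisfies M^-1 = -M and W^(2w) M W^(2w) = M, so -M Q^q = W^(2w) M^-1 W^(2w) Q^q with
    M^-1 = Q^(-tQ) P^(-tP). The block P^(-tP) W^(2w) is replaced by its shortcut, whose outer Q-arcs
    merge with Q^(-tQ) and Q^q. *)
Lemma excursion_then_Q q : 0 < q ->
  exists x, x < al F * tP F + be F * tQ F + be F * q /\ reach F (qopp (qmul exc (rt (fQ F) q))) x.
Proof.
  intros Hq; assert (HQ := tQ_range).
  (* This bound on |ps| + |ch| keeps the signs of the merged Q-angles, so ch cancels from their
     total cost be (tQ + q - 2 ps). *)
  destruct (@shortcut_identity (Rmin q (tQ F))) as (w & x & ps & ch & Hw & Hx & Hpc & EI & Hlt).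
  { apply Rmin_glb_lt; lra. }
  assert (M1 := Rmin_l q (tQ F)); assert (M2 := Rmin_r q (tQ F)).
  assert (B1 := Rle_abs ps); assert (B2 := Rle_abs ch); assert (B3 := Rle_abs (- ps)); assert (B4 := Rle_abs (- ch)).
  rewrite Rabs_Ropp in B3, B4.
  assert (Ha := al_pos F OK); assert (Hb := be_pos F OK).
  exists (wcost F * Rabs (2 * w) + (be F * Rabs (- tQ F + (ch + ps)) + (al F * Rabs (- x) + be F * Rabs (ch - ps + q)))).
  split.
  - rewrite (Rabs_right (2 * w)), (Rabs_left1 (- tQ F + _)), (Rabs_left1 (- x)), (Rabs_right (_ + q)) by lra.
    replace (wcost F * (2 * w)) with (2 * wcost F * w) by ring.
    nra.
  - replace (qopp (qmul exc (rt (fQ F) q)))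
      with (qmul (rt (wdir F) (2 * w)) (qmul (rt (fQ F) (- tQ F + (ch + ps))) (qmul (rt (fP F) (- x)) (rt (fQ F) (ch - ps + q))))).
    { repeat apply reach_mul; [apply reach_wdir|apply reach_Q, OK|apply reach_P, OK|apply reach_Q, OK]. }
    rewrite <- (rt_add (fQ F) (- tQ F)), <- (rt_add (fQ F) (ch - ps) q) by apply OK.
    transitivity (qmul (rt (wdir F) (2 * w)) (qmul (rt (fQ F) (- tQ F)) (qmul
       (qmul (rt (fQ F) (ch + ps)) (qmul (rt (fP F) (- x)) (rt (fQ F) (ch - ps)))) (rt (fQ F) q)))).
    { rewrite !qmul_assoc; reflexivity. }
    rewrite <- EI.
    transitivity (qmul (qmul (qmul (rt (wdir F) (2 * w)) (qconj exc)) (rt (wdir F) (2 * w))) (rt (fQ F) q)).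
    { unfold exc; rewrite qconj_mul, !rt_conj by apply OK; rewrite !qmul_assoc; reflexivity. }
    rewrite exc_conj.
    transitivity (qopp (qmul (qmul (qmul (rt (wdir F) (2 * w)) exc) (rt (wdir F) (2 * w))) (rt (fQ F) q))); [generalize (rt (wdir F) (2 * w)) exc (rt (fQ F) q); qring|].
    rewrite exc_wdir, <- (qmul_assoc exc), rt_add by apply wdir_unit.
    replace (- (2 * w) + 2 * w) with 0 by ring; rewrite rt_0, qmul_1_r; reflexivity.
Qed.
End Singular.

Lemma swapF_ok F : frame_ok F -> frame_ok (swapF F).
Proof. intros OK; apply rotF_ok, flipF_ok, OK. Qed.

Lemma swap_data F : fP (swapF F) = qopp (fQ F) /\ fQ (swapF F) = qopp (fP F) /\ al (swapF F) = be F /\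
  be (swapF F) = al F /\ cc (swapF F) = cc F /\ sg (swapF F) = - sg F.
Proof. unfold swapF; simpl; rewrite Ropp_involutive; repeat split. Qed.

Lemma tP_swap F : tP (swapF F) = tQ F.
Proof.
  unfold tP, tQ; destruct (swap_data F) as (_ & _ & -> & -> & -> & _); f_equal; unfold Rdiv.
  rewrite (Rplus_comm (al F)); ring.
Qed.

Lemma tQ_swap F : tQ (swapF F) = tP F.
Proof.
  unfold tP, tQ; destruct (swap_data F) as (_ & _ & -> & -> & -> & _); f_equal; unfold Rdiv.
  rewrite (Rplus_comm (be F)); ring.
Qed.

Lemma wv_swap F : wv (swapF F) = wv F.
Proof.
  unfold wv, vec; destruct (swap_data F) as (-> & -> & -> & -> & -> & _); qring.
Qed.

Lemma exd_swap F : exd (al (swapF F)) (be (swapF F)) (cc (swapF F)) = exd (al F) (be F) (cc F).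
Proof.
  destruct (swap_data F) as (_ & _ & -> & -> & -> & _); unfold exd, exD; f_equal; ring.
Qed.

Lemma wlen_swap F : wlen (swapF F) = wlen F.
Proof.
  unfold wlen; rewrite exd_swap; destruct (swap_data F) as (_ & _ & _ & _ & _ & ->); rewrite Rabs_Ropp; reflexivity.
Qed.

Lemma wcost_swap F : wcost (swapF F) = wcost F.
Proof.
  unfold wcost; rewrite exd_swap; destruct (swap_data F) as (_ & _ & _ & _ & _ & ->); rewrite Rabs_Ropp; reflexivity.
Qed.

Lemma wdir_swap F : wdir (swapF F) = wdir F.
Proof. unfold wdir; rewrite wv_swap, wlen_swap; reflexivity. Qed.

Lemma exc_swap F : frame_ok F -> 0 < cc F -> exc (swapF F) = qopp (exc F).
Proof.
  intros OK Hc; rewrite <- (exc_conj OK Hc); unfold exc at 1 2.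
  rewrite tP_swap, tQ_swap; destruct (swap_data F) as (-> & -> & _).
  rewrite qconj_mul, !rt_conj, !rt_opp by apply OK; reflexivity.
Qed.

Lemma reach_swap F q x : reach (swapF F) q x -> reach F q x.
Proof. intros H; apply reach_flip_inv, reach_rot_inv, H. Qed.

Lemma excursion_then_P F q : frame_ok F -> 0 < cc F -> 0 < q ->
  exists x, x < al F * tP F + be F * tQ F + al F * q /\ reach F (qmul (exc F) (rt (fP F) (- q))) x.
Proof.
  intros OK Hc Hq.
  destruct (@excursion_then_Q (swapF F) (swapF_ok OK)) with q as (x & Hx & HR); [|exact Hq|].
  { destruct (swap_data F) as (_ & _ & _ & _ & -> & _); exact Hc. }
  rewrite tP_swap, tQ_swap, exc_swap in * by assumption.
  destruct (swap_data F) as (_ & EQ & Ea & Eb & _); rewrite EQ, rt_opp in HR; rewrite Ea, Eb in Hx.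
  exists x; split; [lra|]; apply reach_swap.
  replace (qmul (exc F) (rt (fP F) (- q))) with (qopp (qmul (qopp (exc F)) (rt (fP F) (- q)))) by qring; exact HR.
Qed.

(** * Time reversal *)

(** The tail of the curve from T - t on, reversed by [qrev]. As [qrev] fixes the letters of the
    plane and reverses products, this is the curve run backwards with the same letters, starting at
    1. *)
Definition rga (T : R) (ga : R -> quat) (t : R) : quat := qrev (qmul (qconj (ga (T - t))) (ga T)).

Lemma qrev_vec F a b : frame_ok F -> qrev (vec F a b) = vec F a b.
Proof. intros OK; apply quat_ext; simpl; rewrite ?(ok_P3 F OK), ?(ok_Q3 F OK); ring. Qed.

Lemma qn_rev q : qn (qrev q) = qn q.
Proof. unfold qn; rewrite ip_rev; reflexivity. Qed.

Lemma rga_T T ga : ga 0 = qone -> rga T ga T = qrev (ga T).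
Proof. intros H; unfold rga; rewrite Rminus_diag, H; qring. Qed.

Lemma rga_between T ga s t : ip (ga T) (ga T) = 1 ->
  qmul (qconj (rga T ga s)) (rga T ga t) = qrev (qmul (qconj (ga (T - t))) (ga (T - s))).
Proof.
  intros H; unfold rga; rewrite <- qrev_conj, <- qrev_mul, qconj_mul, qconj_conj; f_equal.
  rewrite <- qmul_assoc; f_equal; rewrite qmul_assoc, qmul_conj_r by exact H; apply qmul_1_l.
Qed.

Lemma ext_rev F K gh T ga A B : frame_ok F -> ext F K gh T ga A B ->
  ext F K (qrev gh) T (rga T ga) (fun t => A T - A (T - t)) (fun t => B T - B (T - t)).
Proof.
  intros OK E; destruct E as [EK Eg ET E0 Eu Ec El Em].
  assert (HT : ip (ga T) (ga T) = 1) by (apply Eu; lra).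
  constructor.
  - exact EK.
  - rewrite ip_rev; exact Eg.
  - exact ET.
  - unfold rga; rewrite Rminus_0_r, qmul_conj_l by exact HT; qring.
  - intros t Ht; unfold rga; rewrite ip_rev, ip_mul_sq, ip_conj, HT, Eu by lra; ring.
  - intros s t Hs Ht; specialize (Ec (T - t) (T - s) ltac:(lra) ltac:(lra)).
    replace (A T - A (T - t) - (A T - A (T - s))) with (A (T - s) - A (T - t)) by ring.
    replace (B T - B (T - t) - (B T - B (T - s))) with (B (T - s) - B (T - t)) by ring; lra.
  - destruct El as (C & HC & El); exists C; split; [exact HC|]; intros s t Hs Ht.
    rewrite rga_between by exact HT.
    replace (A T - A (T - t) - (A T - A (T - s))) with (A (T - s) - A (T - t)) by ring.
    replace (B T - B (T - t) - (B T - B (T - s))) with (B (T - s) - B (T - t)) by ring.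
    specialize (El (T - t) (T - s) ltac:(lra) ltac:(lra)).
    replace (T - s - (T - t)) with (t - s) in El by ring.
    rewrite <- (qrev_vec (A (T - s) - A (T - t)) (B (T - s) - B (T - t)) OK).
    rewrite <- qn_rev in El; eapply Rle_trans; [|exact El]; right; f_equal.
    generalize (qmul (qconj (ga (T - t))) (ga (T - s))) (vec F (A (T - s) - A (T - t)) (B (T - s) - B (T - t))); qring.
  - intros s t q x Hs Ht HR.
    specialize (Em (T - t) (T - s) (qrev q) x ltac:(lra) ltac:(lra) (reach_rev F OK q x HR)).
    rewrite rga_between, rga_T, Rminus_diag, E0 by assumption.
    unfold pen in *; rewrite ip_rev.
    replace (qmul (qmul (rga T ga s) q) (qrev (qmul (qconj qone) (ga (T - t)))))
      with (qrev (qmul (qmul (ga (T - t)) (qrev q)) (qmul (qconj (ga (T - s))) (ga T)))).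
    + rewrite ip_rev; lra.
    + unfold rga; rewrite !qrev_mul, !qrev_rev, <- !qmul_assoc; do 3 f_equal; qring.
Qed.

(** Consequently hp and hq are merely read backwards, while hz also changes sign. *)
Lemma hh_rev F K gh T ga A B t : ext F K gh T ga A B ->
  hh K (qrev gh) T (rga T ga) t = qrev (hh K gh T ga (T - t)).
Proof.
  intros E.
  assert (HT : ip (ga T) (ga T) = 1) by (apply (ex_u _ _ _ _ _ _ _ E); generalize (ex_T _ _ _ _ _ _ _ E); lra).
  assert (EL : lam K (qrev gh) T (rga T ga) = qrev (qmul (qmul (qconj (ga T)) (lam K gh T ga)) (ga T))).
  { unfold lam; rewrite rga_T by apply (ex_0 _ _ _ _ _ _ _ E); rewrite ip_rev.
    set (k := K * ip (ga T) gh).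
    assert (H : qmul (qconj (ga T)) (ga T) = qone) by (apply qmul_conj_l, HT).
    set (L := qmul gh (qconj (ga T))).
    assert (EI : mkQ 0 (q1 L) (q2 L) (q3 L) = qadd L (qscal (- q0 L) qone)) by qring.
    transitivity (qscal k (qrev (qadd (qmul (qmul (qconj (ga T)) L) (ga T)) (qscal (- q0 L) (qmul (qconj (ga T)) (ga T)))))).
    2:{ rewrite EI; generalize L (ga T); qring. }
    rewrite H; unfold L.
    rewrite <- (qmul_assoc _ (qmul gh (qconj (ga T)))), <- (qmul_assoc gh), H, qmul_1_r.
    apply quat_ext; simpl; ring. }
  unfold hh; rewrite EL; unfold rga; rewrite <- qrev_conj, <- !qrev_mul; f_equal.
  rewrite qconj_mul, qconj_conj, <- !qmul_assoc, !(cancel_conj_r _ HT); reflexivity.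
Qed.

Lemma hz_rev F K gh T ga A B t : ext F K gh T ga A B ->
  hz (hh K (qrev gh) T (rga T ga)) t = - hz (hh K gh T ga) (T - t).
Proof. intros E; unfold hz; rewrite (hh_rev t E); reflexivity. Qed.

Lemma hp_rev F K gh T ga A B t : frame_ok F -> ext F K gh T ga A B ->
  hp F (hh K (qrev gh) T (rga T ga)) t = hp F (hh K gh T ga) (T - t).
Proof.
  intros OK E; unfold hp; rewrite (hh_rev t E); unfold ip; simpl; rewrite (ok_P3 F OK); ring.
Qed.

Lemma hq_rev F K gh T ga A B t : frame_ok F -> ext F K gh T ga A B ->
  hq F (hh K (qrev gh) T (rga T ga)) t = hq F (hh K gh T ga) (T - t).
Proof.
  intros OK E; unfold hq; rewrite (hh_rev t E); unfold ip; simpl; rewrite (ok_Q3 F OK); ring.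
Qed.

Lemma lam_rev F K gh T ga A B : frame_ok F -> ext F K gh T ga A B ->
  ip (lam K (qrev gh) T (rga T ga)) (lam K (qrev gh) T (rga T ga)) = ip (lam K gh T ga) (lam K gh T ga).
Proof.
  intros OK E; assert (HT := ex_T _ _ _ _ _ _ _ E).
  rewrite <- (h_norm F K gh T ga A B E T) by lra.
  rewrite <- (h_norm F K (qrev gh) T (rga T ga) _ _ (ext_rev OK E) 0) by lra.
  rewrite (hh_rev 0 E), Rminus_0_r, ip_rev; reflexivity.
Qed.

(** * Singular arcs and excursions *)

Lemma swap_hp F h t : hp (swapF F) h t = - hq F h t.
Proof. unfold swapF; rewrite hp_rot, hq_flip; reflexivity. Qed.
Lemma swap_hq F h t : hq (swapF F) h t = - hp F h t.
Proof. unfold swapF; rewrite hq_rot, hp_flip; reflexivity. Qed.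

Section Sing.
Variables (F : frame) (K : R) (gh : quat) (T : R) (ga : R -> quat) (A B : R -> R).
Hypothesis OK : frame_ok F.
Hypothesis E : ext F K gh T ga A B.
Hypothesis Hcc : 0 < cc F.
Let h := hh K gh T ga.

(** At the corner with hz = 0, the cut inequality and the equation for hz give al x - be y = d and
    (be + cc al) x + (al + cc be) y = 0 for the increments x, y, up to O(d^2). The determinant is
    exd^2 > 0, and the solution is the velocity of W. *)
Lemma stay_arc a b : 0 <= a -> a <= b -> b <= T ->
  (forall t, a <= t <= b -> hp F h t = al F /\ hq F h t = - be F /\ hz h t = 0) ->
  forall t, a <= t <= b -> ga t = qmul (ga a) (rt (wdir F) ((t - a) / wcost F)).
Proof.
  intros Ha Hab Hb Hh t Ht.
  assert (Hal := al_pos F OK); assert (Hbe := be_pos F OK).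
  destruct (d_sq OK Hcc) as [Hd Hdd]; assert (Hs := s_pos OK).
  set (d := exd (al F) (be F) (cc F)) in *; set (s0 := Rabs (sg F)) in *.
  assert (HD : 0 < d * d) by nra; set (D := d * d) in *.
  replace ((t - a) / wcost F) with (/ wcost F * (t - a)) by (unfold wcost; fold d s0; field; lra).
  apply (curve_of_velocity ga (wdir F) (/ wcost F) a b Hab); [apply wdir_unit; assumption| | |exact Ht].
  { intros u Hu; apply (ex_u _ _ _ _ _ _ _ E); lra. }
  destruct (scalar_facts OK E) as (C & HC & Hsf); fold h in Hsf.
  destruct (ex_lin _ _ _ _ _ _ _ E) as (C1 & HC1 & Hlin).
  assert (HN : 0 < al F + cc F * be F) by nra; assert (HN' : 0 < be F + cc F * al F) by nra.
  set (M := ((al F + cc F * be F + be F) + (be F + cc F * al F + al F)) * C / D).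
  assert (HM : 0 <= M).
  { unfold M; apply Rmult_le_pos; [apply Rmult_le_pos; lra|left; apply Rinv_0_lt_compat; exact HD]. }
  exists (C1 + M); split; [lra|]; intros u v Hu Hv.
  specialize (Hlin u v ltac:(lra) ltac:(lra)).
  destruct (Hsf u v) as [S1 _ _ _ _ _ SZ _ _ _]; [lra|lra|]; fold h in S1, SZ.
  assert (Hcost := ex_cost _ _ _ _ _ _ _ E u v (ltac:(lra)) (ltac:(lra))).
  destruct (Hh u) as (P1 & P2 & P3); [lra|]; destruct (Hh v) as (P4 & P5 & P6); [lra|].
  rewrite P1, P2 in S1; rewrite P1, P2, P3, P6 in SZ.
  set (x := A v - A u) in *; set (y := B v - B u) in *; set (dl := v - u) in *.
  set (Q := qmul (qconj (ga u)) (ga v)) in *.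
  assert (Hdl : 0 <= dl * dl) by apply Rle_0_sqr.
  set (e1 := al F * x - be F * y - dl); set (e2 := (be F + cc F * al F) * x + (al F + cc F * be F) * y).
  assert (He1 : Rabs e1 <= C * (dl * dl)).
  { generalize (Rle_abs x) (Rle_abs (- y)); rewrite Rabs_Ropp; intros A1 A2; apply Rabs_le; unfold e1; split; nra. }
  assert (He2 : Rabs e2 <= C * (dl * dl)).
  { rewrite <- Rabs_Ropp; eapply Rle_trans; [|exact SZ]; right; f_equal; unfold e2; ring. }
  set (x' := x - dl * (al F + cc F * be F) / D); set (y' := y + dl * (be F + cc F * al F) / D).
  assert (Ex : x' = ((al F + cc F * be F) * e1 + be F * e2) / D).
  { unfold x', e1, e2; apply Rmult_eq_reg_r with D; [|lra].
    replace ((x - dl * (al F + cc F * be F) / D) * D) with (x * D - dl * (al F + cc F * be F)) by (field; lra).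
    match goal with |- _ = ?r / D * D => replace (r / D * D) with r by (field; lra) end.
    rewrite Hdd; ring. }
  assert (Ey : y' = (- (be F + cc F * al F) * e1 + al F * e2) / D).
  { unfold y', e1, e2; apply Rmult_eq_reg_r with D; [|lra].
    replace ((y + dl * (be F + cc F * al F) / D) * D) with (y * D + dl * (be F + cc F * al F)) by (field; lra).
    match goal with |- _ = ?r / D * D => replace (r / D * D) with r by (field; lra) end.
    rewrite Hdd; ring. }
  assert (Hxy : Rabs x' + Rabs y' <= M * (dl * dl)).
  { rewrite Ex, Ey; unfold Rdiv; rewrite !Rabs_mult, (Rabs_right (/ D)) by (apply Rle_ge; left; apply Rinv_0_lt_compat, HD).
    unfold M, Rdiv; rewrite <- Rmult_plus_distr_r.
    replace ((al F + cc F * be F + be F + (be F + cc F * al F + al F)) * C * / D * (dl * dl))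
      with (((al F + cc F * be F + be F + (be F + cc F * al F + al F)) * (C * (dl * dl))) * / D) by ring.
    apply Rmult_le_compat_r; [left; apply Rinv_0_lt_compat, HD|].
    generalize (Rabs_triang ((al F + cc F * be F) * e1) (be F * e2)) (Rabs_triang (- (be F + cc F * al F) * e1) (al F * e2)).
    rewrite !Rabs_mult, !(Rabs_right (al F)), !(Rabs_right (be F)), (Rabs_right (al F + cc F * be F)) by lra.
    rewrite Rabs_Ropp, (Rabs_right (be F + cc F * al F)) by lra.
    intros; nra. }
  assert (EV : qscal (/ 2) (qscal (/ wcost F * dl) (wdir F)) = qsub (qscal (/ 2) (vec F x y)) (qscal (/ 2) (vec F x' y'))).
  { assert (E1 : / wcost F * / wlen F = / D).
    { unfold wcost, wlen, D; fold d s0; field; lra. }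
    transitivity (qscal (/ 2 * dl * (/ wcost F * / wlen F)) (wv F)); [unfold wdir; generalize (wv F); qring|].
    rewrite E1; unfold wv, vec, x', y', Rdiv; generalize (fP F) (fQ F); qring. }
  rewrite EV.
  replace (qsub (qsub Q qone) (qsub (qscal (/ 2) (vec F x y)) (qscal (/ 2) (vec F x' y'))))
    with (qadd (qsub (qsub Q qone) (qscal (/ 2) (vec F x y))) (qscal (/ 2) (vec F x' y'))) by (generalize Q (vec F x y) (vec F x' y'); qring).
  eapply Rle_trans; [apply qn_add|].
  rewrite qn_scal, (Rabs_right (/ 2)) by lra.
  generalize (qn_vec F OK x' y') (qn_pos (vec F x' y')); nra.
Qed.

Hypothesis HL : sg F * sg F * ip (lam K gh T ga) (lam K gh T ga) = al F * al F + be F * be F + 2 * cc F * (al F * be F).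

(** For cc > 0 the form p^2 + q^2 - 2 cc p q attains its maximum over the rectangle only at the two
    opposite-sign corners, and [HL] puts the conserved norm at that maximum. *)
Lemma zero_corner t : 0 <= t <= T ->
  hz h t = 0 <-> (hp F h t = al F /\ hq F h t = - be F) \/ (hp F h t = - al F /\ hq F h t = be F).
Proof.
  intros Ht; assert (Hn := h_const_norm OK E Ht); rewrite HL in Hn; fold h in Hn.
  assert (Bp := hp_bound OK E Ht); assert (Bq := hq_bound OK E Ht); fold h in Bp, Bq.
  apply Rabs_le_between in Bp; apply Rabs_le_between in Bq.
  assert (Hal := al_pos F OK); assert (Hbe := be_pos F OK).
  set (p := hp F h t) in *; set (q := hq F h t) in *.
  split.
  - intros Z; rewrite Z in Hn.
    assert (N1 : 0 <= al F * al F - p * p) by nra.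
    assert (N2 : 0 <= be F * be F - q * q) by nra.
    assert (N3 : 0 <= al F * be F + p * q) by nra.
    assert (N4 : al F * be F + p * q = 0).
    { assert (H0 : 0 <= cc F * (al F * be F + p * q)) by (apply Rmult_le_pos; lra).
      assert (H : cc F * (al F * be F + p * q) = 0) by nra.
      apply Rmult_integral in H; lra. }
    assert (N5 : al F * al F - p * p = 0) by nra.
    assert (N6 : (al F - p) * (al F + p) = 0) by lra.
    apply Rmult_integral in N6; destruct N6 as [N6|N6].
    + left; split; [lra|]; replace p with (al F) in N4 by lra.
      assert (H : al F * (be F + q) = 0) by lra; apply Rmult_integral in H; lra.
    + right; split; [lra|]; replace p with (- al F) in N4 by lra.
      assert (H : al F * (be F - q) = 0) by lra; apply Rmult_integral in H; lra.
  - assert (S0 := ok_sg0 F OK); assert (0 < sg F * sg F) by (apply Rlt_0_sqr; exact S0).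
    intros [[H1 H2]|[H1 H2]]; rewrite H1, H2 in Hn;
      assert (H3 : sg F * sg F * (hz h t * hz h t) = 0) by lra;
      apply Rmult_integral in H3; destruct H3 as [H3|H3]; try lra; apply Rmult_integral in H3; lra.
Qed.

(** [corner_right] does not apply, as hz = 0 at the start. Near the corner h stays on one of the two
    adjacent sides, because a change of side passes through the corner, where hz = 0; and an arc on
    the side hq = -be would make sg hz negative. *)
Lemma leave_first u v : 0 <= u < v -> v <= T -> hp F h u = al F -> hq F h u = - be F ->
  (forall t, u < t < v -> 0 < sg F * hz h t) ->
  exists w x, u < w <= v /\ 0 < x <= tP F /\ w - u = al F * x /\ ga w = qmul (ga u) (rt (fP F) x) /\
    0 < sg F * hz h w /\ (w = v \/ (x = tP F /\ hp F h w = al F /\ hq F h w = be F)).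
Proof.
  intros Hu Hv Ep Eq Hz.
  assert (Hal := al_pos F OK); assert (Hbe := be_pos F OK); assert (Hca : 0 < cc F * al F) by nra.
  assert (Hcb : 0 < cc F * be F) by nra.
  destruct (lipschitz_near _ _ _ (hp_lip OK E) u (al F)) as (e1 & He1 & H1); [lra|lra|]; fold h in H1.
  destruct (lipschitz_near _ _ _ (hq_lip OK E) u (be F)) as (e2 & He2 & H2); [lra|lra|]; fold h in H2.
  assert (Hb : exists b, u < b <= v /\ b < u + e1 /\ b < u + e2).
  { exists (u + Rmin (v - u) (Rmin (e1 / 2) (e2 / 2))).
    assert (0 < Rmin (v - u) (Rmin (e1 / 2) (e2 / 2))) by (repeat apply Rmin_glb_lt; lra).
    generalize (Rmin_l (v - u) (Rmin (e1 / 2) (e2 / 2))) (Rmin_r (v - u) (Rmin (e1 / 2) (e2 / 2))) (Rmin_l (e1 / 2) (e2 / 2)) (Rmin_r (e1 / 2) (e2 / 2)).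
    repeat split; lra. }
  destruct Hb as (b & Hb & Hb1 & Hb2).
  assert (Hsg : forall t, u < t < b -> 0 < hp F h t /\ hq F h t < 0).
  { intros t Ht; specialize (H1 t ltac:(lra) ltac:(rewrite Rabs_right; lra)); specialize (H2 t ltac:(lra) ltac:(rewrite Rabs_right; lra)).
    rewrite Ep in H1; rewrite Eq in H2; apply Rabs_lt_between in H1; apply Rabs_lt_between in H2; lra. }
  assert (Hbd : forall t, u < t < b -> (hp F h t = al F \/ hq F h t = - be F) /\ ~ (hp F h t = al F /\ hq F h t = - be F)
     /\ hp F h t <= al F /\ - be F <= hq F h t).
  { intros t Ht; destruct (Hsg t Ht) as [G1 G2].
    assert (Bp := hp_bound OK E (t := t) ltac:(lra)); assert (Bq := hq_bound OK E (t := t) ltac:(lra)); fold h in Bp, Bq.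
    apply Rabs_le_between in Bp; apply Rabs_le_between in Bq.
    repeat split; try lra.
    - destruct (on_boundary OK E (t := t)) as [G|G]; [lra|lra| |]; fold h in G.
      + left; rewrite Rabs_right in G; lra.
      + right; rewrite Rabs_left in G; lra.
    - intros G; assert (G' : hz h t = 0) by (apply zero_corner; [lra|left; exact G]).
      specialize (Hz t ltac:(lra)); rewrite G' in Hz; lra. }
  set (f := fun t => (al F - hp F h t) - (be F + hq F h t)).
  assert (Lf : lipschitz_on f u b).
  { destruct (hp_lip OK E) as (Cp & HCp & Lp); destruct (hq_lip OK E) as (Cq & HCq & Lq).
    exists (Cp + Cq); split; [lra|]; intros s t Hs Ht; unfold f.
    specialize (Lp s t ltac:(lra) ltac:(lra)); specialize (Lq s t ltac:(lra) ltac:(lra)); fold h in Lp, Lq.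
    apply Rabs_le_between in Lp; apply Rabs_le_between in Lq; apply Rabs_le; lra. }
  assert (Hin : forall t, u < t < b -> Rabs (hq F h t) < be F).
  { destruct (nonzero_sign Lf) as [N|N].
    - intros t Ht; destruct (Hbd t Ht) as (G & G' & _); unfold f; lra.
    - intros t Ht; specialize (N t Ht); destruct (Hbd t Ht) as (G & G' & G1 & G2); destruct (Hsg t Ht).
      unfold f in N; apply Rabs_def1; lra.
    - exfalso.
      assert (OKs := swapF_ok OK); assert (Es := ext_rot _ _ _ _ _ _ _ (ext_flip _ _ _ _ _ _ _ E)); fold (swapF F) in Es.
      destruct (swap_data F) as (_ & _ & Ea & Eb & Ec & Esg).
      destruct (face_arc OKs Es (a := u) (b := b)) as [Arc _]; [lra|lra|lra| | |].
      + intros t Ht; specialize (N t Ht); destruct (Hbd t Ht) as (G & G' & G1 & G2); destruct (Hsg t Ht).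
        fold h; rewrite swap_hq, Rabs_Ropp, Eb; unfold f in N; apply Rabs_def1; lra.
      + exists ((u + b) / 2); split; [lra|]; fold h; rewrite swap_hp; destruct (Hsg ((u + b) / 2)); lra.
      + assert (Hpi := arc_le_pi OKs Es (a := u) (b := b) ltac:(lra) ltac:(lra) Arc); rewrite Ea in Hpi.
        set (t := (u + b) / 2).
        destruct (arc_h OKs Es (a := u) (b := b) (t := t)) as (_ & _ & G); [lra|lra|exact Arc|unfold t; lra|]; fold h in G.
        rewrite swap_hp, swap_hq, Ep, Eq, Ea, Ec, Esg in G.
        assert (Z0 : hz h u = 0) by (apply zero_corner; [lra|left; split; assumption]).
        rewrite Z0 in G.
        specialize (Hz t ltac:(unfold t; lra)).
        assert (0 < sin ((t - u) / be F)).
        { apply sin_gt_0.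
          - apply Rdiv_lt_0_compat; unfold t; lra.
          - apply Rmult_lt_reg_r with (be F); [lra|]; replace ((t - u) / be F * be F) with (t - u) by (field; lra); unfold t; lra. }
        nra. }
  destruct (first_exit (fun t => Rabs (hq F h t) < be F) u v) as (w & Hw & Gw & Gend); [lra| | |].
  - exists (b - u); split; [lra|]; intros t Ht _; apply Hin; lra.
  - intros t Ht Gt; apply Rabs_lt_between in Gt.
    destruct (lipschitz_near _ _ _ (hq_lip OK E) t (Rmin (be F - hq F h t) (be F + hq F h t))) as (e & He & HH); [lra|apply Rmin_glb_lt; lra|]; fold h in HH.
    exists e; split; [exact He|]; intros t' D' Ht'; specialize (HH t' ltac:(lra) D').
    generalize (Rmin_l (be F - hq F h t) (be F + hq F h t)) (Rmin_r (be F - hq F h t) (be F + hq F h t)); intros.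
    apply Rabs_lt_between in HH; apply Rabs_def1; lra.
  - destruct (face_arc OK E (a := u) (b := w)) as [Arc Hpw]; [lra|lra|lra|exact Gw| |].
    { exists ((u + Rmin w b) / 2).
      assert (u < Rmin w b) by (apply Rmin_glb_lt; lra).
      generalize (Rmin_l w b) (Rmin_r w b); intros; split; [lra|]; apply Hsg; lra. }
    fold h in Hpw.
    assert (Hpi := arc_le_pi OK E (a := u) (b := w) ltac:(lra) ltac:(lra) Arc).
    destruct (arc_h OK E (a := u) (b := w) (t := w)) as (_ & G1 & G2); [lra|lra|exact Arc|lra|]; fold h in G1, G2.
    assert (Z0 : hz h u = 0) by (apply zero_corner; [lra|left; split; assumption]).
    rewrite Ep, Eq, Z0 in G1, G2.
    set (x := (w - u) / al F) in *.
    assert (Ex : w - u = al F * x) by (unfold x; field; lra).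
    assert (Hx : 0 < x <= PI).
    { split; [unfold x; apply Rdiv_lt_0_compat; lra|]; apply Rmult_le_reg_l with (al F); [lra|]; lra. }
    assert (Bq := hq_bound OK E (t := w) ltac:(lra)); fold h in Bq; apply Rabs_le_between in Bq.
    assert (HtP := tP_range OK Hcc).
    (* [tP] is the angle at which hq would reach its bound be. *)
    assert (HxP : x <= tP F).
    { apply le_acos; [lra| |].
      - split; apply Rmult_le_reg_r with (cc F * al F + be F); try lra;
          replace ((cc F * al F - be F) / (cc F * al F + be F) * (cc F * al F + be F)) with (cc F * al F - be F) by (field; lra); lra.
      - apply Rmult_le_reg_r with (cc F * al F + be F); [lra|];
          replace ((cc F * al F - be F) / (cc F * al F + be F) * (cc F * al F + be F)) with (cc F * al F - be F) by (field; lra); lra. }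
    assert (Hsx : 0 < sin x) by (apply sin_gt_0; lra).
    assert (Hzw : 0 < sg F * hz h w) by nra.
    exists w, x; split; [lra|]; split; [lra|]; split; [exact Ex|]; split; [apply (Arc w); lra|]; split; [exact Hzw|].
    destruct Gend as [->|Gend]; [left; reflexivity|].
    destruct (Rle_lt_or_eq_dec w v) as [Hwv| ->]; [lra| |left; reflexivity].
    right; assert (Epw : hp F h w = al F) by (apply Hpw; lra).
    assert (Eqw : hq F h w = be F).
    { destruct (Req_dec (hq F h w) (be F)) as [H|H]; [exact H|exfalso].
      destruct (Req_dec (hq F h w) (- be F)) as [H'|H'].
      - assert (Z : hz h w = 0) by (apply zero_corner; [lra|left; split; assumption]); rewrite Z in Hzw; lra.
      - apply Gend, Rabs_def1; lra. }
    split; [|split; assumption].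
    unfold tP; rewrite <- (acos_cos x) by lra; f_equal.
    rewrite Eqw in G1; apply Rmult_eq_reg_r with (cc F * al F + be F); [|lra].
    replace ((cc F * al F - be F) / (cc F * al F + be F) * (cc F * al F + be F)) with (cc F * al F - be F) by (field; lra); lra.
Qed.
End Sing.

Definition negF (F : frame) : frame := rotF (rotF F).
(** The exchange (P, Q) -> (Q, P), which presents the second arc of an excursion as an arc of the
    first letter. *)
Definition trF (F : frame) : frame := negF (swapF F).

Lemma qopp_opp q : qopp (qopp q) = q.
Proof. qring. Qed.

Lemma trF_data F : fP (trF F) = fQ F /\ fQ (trF F) = fP F /\ al (trF F) = be F /\
  be (trF F) = al F /\ cc (trF F) = cc F /\ sg (trF F) = - sg F.
Proof. unfold trF, negF, swapF; simpl; rewrite !Ropp_involutive, !qopp_opp; repeat split. Qed.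

Lemma negF_data F : fP (negF F) = qopp (fP F) /\ fQ (negF F) = qopp (fQ F) /\ al (negF F) = al F /\
  be (negF F) = be F /\ cc (negF F) = cc F /\ sg (negF F) = sg F.
Proof. unfold negF; simpl; rewrite !Ropp_involutive; repeat split. Qed.

Lemma negF_ok F : frame_ok F -> frame_ok (negF F).
Proof. intros OK; apply rotF_ok, rotF_ok, OK. Qed.

Lemma ext_neg F K gh T ga A B : ext F K gh T ga A B -> ext (negF F) K gh T ga (fun t => - A t) (fun t => - B t).
Proof. intros E; apply ext_rot in E; apply ext_rot in E; exact E. Qed.

Lemma ext_swap F K gh T ga A B : ext F K gh T ga A B -> ext (swapF F) K gh T ga (fun t => - B t) (fun t => - A t).
Proof. intros E; apply ext_flip in E; apply ext_rot in E; exact E. Qed.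

Lemma neg_hp F h t : hp (negF F) h t = - hp F h t.
Proof. unfold negF; rewrite hp_rot, hq_rot; reflexivity. Qed.
Lemma neg_hq F h t : hq (negF F) h t = - hq F h t.
Proof. unfold negF; rewrite hq_rot, hp_rot; reflexivity. Qed.

(* The critical length of the covector, for which h_z vanishes exactly at the
   opposite-sign corners. *)
Definition balanced (F : frame) (l : quat) : Prop :=
  sg F * sg F * ip l l = al F * al F + be F * be F + 2 * cc F * (al F * be F).

Lemma balanced_swap F l : balanced F l -> balanced (swapF F) l.
Proof.
  unfold balanced; destruct (swap_data F) as (_ & _ & -> & -> & -> & ->).
  intros H; replace (- sg F * - sg F) with (sg F * sg F) by ring; rewrite H; ring.
Qed.
Lemma balanced_neg F l : balanced F l -> balanced (negF F) l.
Proof. unfold balanced; destruct (negF_data F) as (_ & _ & -> & -> & -> & ->); exact (fun H => H). Qed.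

Section Leave.
Variables (F : frame) (K : R) (gh : quat) (T : R) (ga : R -> quat) (A B : R -> R).
Hypothesis OK : frame_ok F.
Hypothesis E : ext F K gh T ga A B.
Hypothesis Hcc : 0 < cc F.
Let h := hh K gh T ga.
Hypothesis HL : balanced F (lam K gh T ga).

(** On the Q-arc sg hz = R0 sin (tQ - th) with R0 = al + cc be, so hz first vanishes at th = tQ. *)
Lemma leave_second w v : 0 <= w < v -> v <= T -> hp F h w = al F -> hq F h w = be F ->
  (forall t, w <= t < v -> 0 < sg F * hz h t) ->
  exists y, 0 < y <= tQ F /\ v - w = be F * y /\ ga v = qmul (ga w) (rt (fQ F) y) /\
    (hz h v = 0 -> y = tQ F) /\ hq F h v = be F.
Proof.
  intros Hw Hv Ep Eq Hz.
  assert (Hal := al_pos F OK); assert (Hbe := be_pos F OK); assert (Hca : 0 < cc F * al F) by nra.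
  assert (Hcb : 0 < cc F * be F) by nra.
  assert (OK' : frame_ok (trF F)) by apply negF_ok, swapF_ok, OK.
  assert (E' := ext_neg (ext_swap E)); fold (trF F) in E'.
  assert (Hp' : forall t, hp (trF F) h t = hq F h t) by (intros t; unfold trF; rewrite neg_hp, swap_hp; ring).
  assert (Hq' : forall t, hq (trF F) h t = hp F h t) by (intros t; unfold trF; rewrite neg_hq, swap_hq; ring).
  destruct (trF_data F) as (DP & DQ & Da & Db & Dc & Ds).
  destruct (corner_right OK' E' (t := w)) as (e & He & HC).
  { lra. }
  { fold h; rewrite Hp', Da; exact Eq. }
  { fold h; rewrite Hq', Db; exact Ep. }
  { fold h; rewrite Ds; specialize (Hz w ltac:(lra)); lra. }
  fold h in HC.
  set (W := sg F * hz h w); assert (HW : 0 < W) by (apply Hz; lra).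
  set (y0 := al F - cc F * be F).
  destruct (first_exit (fun t => Rabs (hp F h t) < al F) w v) as (v1 & Hv1 & Gv & Gend); [lra| | |].
  - exists e; split; [exact He|]; intros t Ht Htv; destruct (HC t) as [G _]; [lra|lra|]; rewrite Hq', Db in G; exact G.
  - intros t Ht Gt; apply Rabs_lt_between in Gt.
    destruct (lipschitz_near _ _ _ (hp_lip OK E) t (Rmin (al F - hp F h t) (al F + hp F h t))) as (e' & He' & HH); [lra|apply Rmin_glb_lt; lra|]; fold h in HH.
    exists e'; split; [exact He'|]; intros t' D' Ht'; specialize (HH t' ltac:(lra) D').
    generalize (Rmin_l (al F - hp F h t) (al F + hp F h t)) (Rmin_r (al F - hp F h t) (al F + hp F h t)); intros.
    apply Rabs_lt_between in HH; apply Rabs_def1; lra.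
  - destruct (face_arc OK' E' (a := w) (b := v1)) as [Arc Hpw]; [lra|lra|lra| | |]; fold h.
    { intros t Ht; rewrite Hq', Db; apply Gv, Ht. }
    { exists (w + Rmin (v1 - w) e / 2).
      assert (0 < Rmin (v1 - w) e) by (apply Rmin_glb_lt; lra).
      generalize (Rmin_l (v1 - w) e) (Rmin_r (v1 - w) e); intros; split; [lra|]; apply HC; lra. }
    assert (Hpw' : forall t, w <= t <= v1 -> hq F h t = be F) by (intros t Ht; rewrite <- Hp', Hpw by exact Ht; exact Da).
    assert (Hpi := arc_le_pi OK' E' (a := w) (b := v1) ltac:(lra) ltac:(lra) Arc); rewrite Da in Hpi.
    assert (G : forall t, w <= t <= v1 -> let th := (t - w) / be F in
       hp F h t - cc F * be F = y0 * cos th - W * sin th /\ sg F * hz h t = W * cos th + y0 * sin th).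
    { intros t Ht th; destruct (arc_h OK' E' (a := w) (b := v1) (t := t)) as (_ & G1 & G2); [lra|lra|exact Arc|lra|]; fold h in G1, G2.
      rewrite !Hq', !Hp', Da, Dc, Ds, Ep, Eq in G1; rewrite !Hq', !Hp', Da, Dc, Ds, Ep, Eq in G2.
      unfold y0, W, th; split; lra. }
    (* The arc cannot end before v: at hp = -al, hz would vanish, and a return to hp = al would make
       sg hz negative. *)
    assert (Ev : v1 = v).
    { destruct Gend as [H|Gend]; [exact H|]; destruct (Rle_lt_or_eq_dec v1 v) as [H|H]; [lra| |exact H]; exfalso.
      assert (Z1 := Hz v1 ltac:(lra)).
      destruct (Req_dec (hp F h v1) (- al F)) as [H1|H1].
      { assert (Z : hz h v1 = 0) by (apply (zero_corner OK E Hcc HL); [lra|right; split; [exact H1|apply Hpw'; lra]]).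
        rewrite Z in Z1; lra. }
      assert (Bp := hp_bound OK E (t := v1) ltac:(lra)); fold h in Bp; apply Rabs_le_between in Bp.
      destruct (Req_dec (hp F h v1) (al F)) as [H2|H2]; [|apply Gend, Rabs_def1; lra].
      destruct (G v1) as [G1 G2]; [lra|]; rewrite H2 in G1; rewrite G2 in Z1; fold y0 in G1.
      set (th := (v1 - w) / be F) in *.
      assert (Hth : 0 < th <= PI).
      { split; [unfold th; apply Rdiv_lt_0_compat; lra|]; apply Rmult_le_reg_r with (be F); [lra|]; unfold th.
        replace ((v1 - w) / be F * be F) with (v1 - w) by (field; lra); lra. }
      assert (Hc1 : cos th < 1) by (rewrite <- cos_0; apply cos_decreasing_1; lra).
      assert (Hsc : sin th * sin th + cos th * cos th = 1) by (generalize (sin2_cos2 th); unfold Rsqr; lra).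
      assert (Hprod : (W * cos th + y0 * sin th) * (1 - cos th) = W * (cos th - 1)).
      { replace ((W * cos th + y0 * sin th) * (1 - cos th)) with (W * cos th * (1 - cos th) + (y0 - y0 * cos th) * sin th) by ring.
        replace (y0 - y0 * cos th) with (- W * sin th) by lra.
        transitivity (W * cos th - W * (sin th * sin th + cos th * cos th)); [ring|rewrite Hsc; ring]. }
      assert (0 < (W * cos th + y0 * sin th) * (1 - cos th)) by (apply Rmult_lt_0_compat; lra).
      nra. }
    subst v1; clear Gend Gv.
    set (y := (v - w) / be F).
    assert (Ey : v - w = be F * y) by (unfold y; field; lra).
    assert (Hy : 0 < y <= PI).
    { split; [unfold y; apply Rdiv_lt_0_compat; lra|]; apply Rmult_le_reg_l with (be F); [lra|]; lra. }
    assert (HtQ := tQ_range OK Hcc).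
    set (R0 := al F + cc F * be F); assert (HR : 0 < R0) by (unfold R0; lra).
    assert (Ct : R0 * cos (tQ F) = - y0).
    { unfold tQ; rewrite cos_acos.
      - unfold R0, y0; field; fold R0; lra.
      - fold R0; fold y0; split; apply Rmult_le_reg_r with R0; try lra;
          replace (- (y0 / R0) * R0) with (- y0) by (field; lra); unfold y0, R0; lra. }
    assert (St : R0 * sin (tQ F) = W).
    { assert (Hst : 0 < sin (tQ F)) by (apply sin_gt_0; lra).
      assert (Hn := h_const_norm OK E (t := w) ltac:(lra)); fold h in Hn; rewrite HL, Ep, Eq in Hn.
      apply Rsqr_inj; [nra|lra|]; unfold Rsqr.
      replace (W * W) with (4 * cc F * (al F * be F)) by (unfold W; lra).
      transitivity (R0 * R0 - (R0 * cos (tQ F)) * (R0 * cos (tQ F))).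
      - transitivity (R0 * R0 * (1 - cos (tQ F) * cos (tQ F))); [|ring].
        replace (1 - cos (tQ F) * cos (tQ F)) with (sin (tQ F) * sin (tQ F)); [ring|].
        generalize (sin2_cos2 (tQ F)); unfold Rsqr; lra.
      - rewrite Ct; unfold R0, y0; ring. }
    assert (G' : forall t, w <= t <= v -> sg F * hz h t = R0 * sin (tQ F - (t - w) / be F)).
    { intros t Ht; destruct (G t Ht) as [_ ->]; rewrite sin_minus.
      replace W with (R0 * sin (tQ F)) by exact St; replace y0 with (- (R0 * cos (tQ F))) by lra; ring. }
    exists y; split; [split; [lra|]|].
    + apply Rnot_lt_le; intros Hlt.
      set (t := w + be F * tQ F).
      assert (Ht : w <= t < v) by (unfold t; split; [nra|]; nra).
      assert (Z := Hz t Ht); rewrite G' in Z by lra.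
      replace (tQ F - (t - w) / be F) with 0 in Z by (unfold t; field; lra); rewrite sin_0 in Z; lra.
    + split; [exact Ey|]; split; [|split; [|apply Hpw'; lra]].
      * rewrite (Arc v) by lra; rewrite DP, Da; reflexivity.
      * intros Z; assert (Zv := G' v ltac:(lra)); rewrite Z in Zv; fold y in Zv.
        destruct (Rle_lt_dec (tQ F) y) as [Hge|Hlt]; [|exfalso].
        -- apply Rle_antisym; [|exact Hge]; apply Rnot_lt_le; intros Hlt.
           set (t := w + be F * tQ F).
           assert (Ht : w <= t < v) by (unfold t; split; [nra|]; nra).
           assert (Z' := Hz t Ht); rewrite G' in Z' by lra.
           replace (tQ F - (t - w) / be F) with 0 in Z' by (unfold t; field; lra); rewrite sin_0 in Z'; lra.
        -- assert (0 < sin (tQ F - y)) by (apply sin_gt_0; lra); nra.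
Qed.

Lemma leave u v : 0 <= u < v -> v <= T -> hp F h u = al F -> hq F h u = - be F ->
  (forall t, u < t < v -> 0 < sg F * hz h t) ->
  exists x y, 0 < x <= tP F /\ 0 <= y <= tQ F /\ (x = tP F \/ y = 0) /\
    ga v = qmul (ga u) (qmul (rt (fP F) x) (rt (fQ F) y)) /\ v - u = al F * x + be F * y /\
    (hz h v = 0 -> x = tP F /\ y = tQ F /\ hq F h v = be F).
Proof.
  intros Hu Hv Ep Eq Hz; assert (HQ := tQ_range OK Hcc).
  destruct (leave_first OK E Hcc HL Hu Hv Ep Eq Hz) as (w & x & Hw & Hx & Ex & Eg & Zw & [->|(Ext & Hp & Hq)]).
  - exists x, 0; split; [lra|]; split; [lra|]; split; [right; reflexivity|]; split; [|split; [lra|]].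
    + rewrite rt_0, qmul_1_r; exact Eg.
    + intros Z; fold h in Zw; rewrite Z in Zw; lra.
  - destruct (Rle_lt_or_eq_dec w v) as [Hwv| ->]; [lra| |].
    + destruct (@leave_second w v) as (y & Hy & Ey & Eg' & EZ & Hqv); [lra|lra|exact Hp|exact Hq| |].
      { intros t Ht; destruct (Rle_lt_or_eq_dec w t) as [H| <-]; [lra| |exact Zw]; apply Hz; lra. }
      exists x, y; split; [lra|]; split; [lra|]; split; [left; exact Ext|]; split; [|split; [lra|]].
      * rewrite Eg', Eg, <- qmul_assoc; reflexivity.
      * intros Z; repeat split; [exact Ext|exact (EZ Z)|exact Hqv].
    + exists x, 0; split; [lra|]; split; [lra|]; split; [right; reflexivity|]; split; [|split; [lra|]].
      * rewrite rt_0, qmul_1_r; exact Eg.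
      * intros Z; fold h in Zw; rewrite Z in Zw; lra.
Qed.
End Leave.

Lemma first_nonzero f a b : lipschitz_on f a b -> f a = 0 -> (exists t, a <= t <= b /\ f t <> 0) ->
  exists m, a <= m < b /\ (forall t, a <= t <= m -> f t = 0) /\
    forall e, 0 < e -> exists t, m < t < m + e /\ t <= b /\ f t <> 0.
Proof.
  intros L F0 (t0 & Ht0 & N0).
  set (S := fun m => a <= m <= b /\ forall t, a <= t <= m -> f t = 0).
  assert (Sa : S a) by (split; [lra|]; intros t Ht; replace t with a by lra; exact F0).
  destruct (completeness S) as (m & Hub & Hlub).
  { exists b; intros x [Hx _]; lra. }
  { exists a; exact Sa. }
  assert (Ham : a <= m) by (apply Hub, Sa).
  assert (Hbelow : forall t, a <= t < m -> f t = 0).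
  { intros t Ht; destruct (classic (exists x, S x /\ t < x)) as [(x & [_ Hx] & Htx)|N]; [apply Hx; lra|].
    exfalso; assert (m <= t); [|lra]; apply Hlub; intros x Sx; apply Rnot_lt_le; intros H; apply N; exists x; split; assumption. }
  assert (Hmt : m <= t0).
  { apply Rnot_lt_le; intros H; apply N0, Hbelow; lra. }
  assert (Hm : f m = 0).
  { destruct (Rle_lt_or_eq_dec a m Ham) as [H| <-]; [|exact F0].
    apply NNPP; intros N.
    destruct (lipschitz_near f a b L m (Rabs (f m))) as (e & He & HN); [lra|apply Rabs_pos_lt, N|].
    set (t := m - Rmin (e / 2) (m - a)).
    assert (0 < Rmin (e / 2) (m - a)) by (apply Rmin_glb_lt; lra).
    assert (M1 := Rmin_l (e / 2) (m - a)); assert (M2 := Rmin_r (e / 2) (m - a)).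
    specialize (HN t); rewrite (Hbelow t) in HN by (unfold t; lra).
    assert (Rabs (0 - f m) < Rabs (f m)); [|rewrite Rminus_0_l, Rabs_Ropp in *; lra].
    apply HN; unfold t; [lra|]; rewrite Rabs_left; lra. }
  assert (Hmt' : m < t0) by (destruct Hmt as [H|H]; [exact H|subst; contradiction]).
  exists m; split; [lra|]; split.
  { intros t Ht; destruct (Rle_lt_or_eq_dec t m) as [H| ->]; [lra|apply Hbelow; lra|exact Hm]. }
  intros e He; apply NNPP; intros N.
  assert (Sx : S (m + Rmin (e / 2) (t0 - m))).
  { assert (0 < Rmin (e / 2) (t0 - m)) by (apply Rmin_glb_lt; lra).
    generalize (Rmin_l (e / 2) (t0 - m)) (Rmin_r (e / 2) (t0 - m)); intros M1 M2.
    split; [lra|]; intros t Ht.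
    destruct (Rlt_le_dec m t) as [H1|H1].
    - apply NNPP; intros N'; apply N; exists t; repeat split; try lra; exact N'.
    - destruct (Rle_lt_or_eq_dec t m) as [H2| ->]; [lra|apply Hbelow; lra|exact Hm]. }
  apply Hub in Sx; assert (0 < Rmin (e / 2) (t0 - m)) by (apply Rmin_glb_lt; lra); lra.
Qed.

(** A word for the same stretch, up to the sign of the quaternion, leaves the penalty unchanged, so
    minimality compares costs alone. *)
Lemma no_shortcut F K gh T ga A B s t q x : ext F K gh T ga A B -> 0 <= s <= t -> t <= T -> reach F q x ->
  (q = qmul (qconj (ga s)) (ga t) \/ q = qopp (qmul (qconj (ga s)) (ga t))) -> t - s <= x.
Proof.
  intros E Hs Ht HR Hq; assert (H := ex_min _ _ _ _ _ _ _ E s t q x Hs Ht HR).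
  assert (Us : ip (ga s) (ga s) = 1) by (apply (ex_u _ _ _ _ _ _ _ E); lra).
  assert (Ut : ip (ga t) (ga t) = 1) by (apply (ex_u _ _ _ _ _ _ _ E); lra).
  assert (EQ : qmul (qmul (ga s) (qmul (qconj (ga s)) (ga t))) (qmul (qconj (ga t)) (ga T)) = ga T).
  { rewrite (cancel_conj_r _ Us), (cancel_conj_r _ Ut); reflexivity. }
  assert (EP : pen gh (qmul (qmul (ga s) q) (qmul (qconj (ga t)) (ga T))) = pen gh (ga T)).
  { destruct Hq as [->| ->]; [rewrite EQ; reflexivity|].
    replace (qmul (qmul (ga s) (qopp (qmul (qconj (ga s)) (ga t)))) (qmul (qconj (ga t)) (ga T)))
      with (qopp (qmul (qmul (ga s) (qmul (qconj (ga s)) (ga t))) (qmul (qconj (ga t)) (ga T)))) by (generalize (qmul (qconj (ga s)) (ga t)) (ga s) (qmul (qconj (ga t)) (ga T)); qring).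
    rewrite EQ; unfold pen, qopp; rewrite ip_scal_l; ring. }
  rewrite EP in H; lra.
Qed.

(** A and B are hidden because the symmetries of the frame and the time reversal replace them. *)
Definition sing (K : R) (gh : quat) (T : R) (ga : R -> quat) (F : frame) : Prop :=
  frame_ok F /\ (exists A B, ext F K gh T ga A B) /\ 0 < cc F /\ balanced F (lam K gh T ga).

Lemma sing_swap K gh T ga F : sing K gh T ga F -> sing K gh T ga (swapF F).
Proof.
  intros (OK & (A & B & E) & Hc & HL); split; [apply swapF_ok, OK|]; split; [|split].
  - do 2 eexists; apply (ext_swap E).
  - destruct (swap_data F) as (_ & _ & _ & _ & -> & _); exact Hc.
  - apply balanced_swap, HL.
Qed.

Lemma sing_neg K gh T ga F : sing K gh T ga F -> sing K gh T ga (negF F).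
Proof.
  intros (OK & (A & B & E) & Hc & HL); split; [apply negF_ok, OK|]; split; [|split].
  - do 2 eexists; apply (ext_neg E).
  - destruct (negF_data F) as (_ & _ & _ & _ & -> & _); exact Hc.
  - apply balanced_neg, HL.
Qed.

Lemma sing_rev K gh T ga F : sing K gh T ga F -> sing K (qrev gh) T (rga T ga) F.
Proof.
  intros (OK & (A & B & E) & Hc & HL); split; [exact OK|]; split; [|split].
  - do 2 eexists; apply (ext_rev OK E).
  - exact Hc.
  - unfold balanced; rewrite (lam_rev OK E); exact HL.
Qed.

Definition ell (F : frame) : R := al F * tP F + be F * tQ F.

Lemma ell_swap F : ell (swapF F) = ell F.
Proof. unfold ell; rewrite tP_swap, tQ_swap; destruct (swap_data F) as (_ & _ & -> & -> & _); ring. Qed.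
Lemma tP_neg F : tP (negF F) = tP F.
Proof. unfold tP; destruct (negF_data F) as (_ & _ & -> & -> & -> & _); reflexivity. Qed.
Lemma tQ_neg F : tQ (negF F) = tQ F.
Proof. unfold tQ; destruct (negF_data F) as (_ & _ & -> & -> & -> & _); reflexivity. Qed.
Lemma ell_neg F : ell (negF F) = ell F.
Proof. unfold ell; rewrite tP_neg, tQ_neg; destruct (negF_data F) as (_ & _ & -> & -> & _); reflexivity. Qed.
Lemma wcost_neg F : wcost (negF F) = wcost F.
Proof. unfold wcost; destruct (negF_data F) as (_ & _ & -> & -> & -> & ->); reflexivity. Qed.
Lemma wdir_neg F : wdir (negF F) = qopp (wdir F).
Proof.
  unfold wdir, wlen, wv, vec; destruct (negF_data F) as (-> & -> & -> & -> & -> & ->); generalize (fP F) (fQ F); qring.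
Qed.
Lemma wcost_pos F : frame_ok F -> 0 < cc F -> 0 < wcost F.
Proof. intros OK Hc; apply Rdiv_lt_0_compat; [apply (d_sq OK Hc)|apply (s_pos OK)]. Qed.

Section SW.
Variables (K : R) (gh : quat) (T : R) (ga : R -> quat).
Let h := hh K gh T ga.
Let sg' := sing K gh T ga.

Definition at_O (F : frame) (u : R) : Prop := hp F h u = al F /\ hq F h u = - be F.

Lemma sing_facts F : sg' F -> lipschitz_on (hz h) 0 T /\ lipschitz_on (hp F h) 0 T /\
  (forall t, 0 <= t <= T -> hz h t = 0 <-> at_O F t \/ at_O (negF F) t).
Proof.
  intros (OK & (A & B & E) & Hc & HL); split; [apply (hz_lip OK E)|]; split; [apply (hp_lip OK E)|].
  intros t Ht; assert (Z := zero_corner OK E Hc HL Ht); fold h in Z; rewrite Z; unfold at_O; rewrite neg_hp, neg_hq.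
  destruct (negF_data F) as (_ & _ & -> & -> & _).
  split; (intros [H|[H1 H2]]; [left; exact H|right; split; lra]).
Qed.

Lemma at_O_swap F u : at_O F u -> at_O (swapF F) u.
Proof.
  unfold at_O; rewrite swap_hp, swap_hq; destruct (swap_data F) as (_ & _ & -> & -> & _); lra.
Qed.

(** On the way from one O-corner to the other hp would take the value 0, which does not occur where
    hz = 0. *)
Lemma at_O_const F a b : sg' F -> 0 <= a -> b <= T -> (forall t, a <= t <= b -> hz h t = 0) ->
  forall s t, a <= s <= b -> a <= t <= b -> at_O F s -> at_O F t.
Proof.
  intros HS Ha Hb Hz s t Hs Ht HO; destruct (sing_facts HS) as (_ & Lp & ZC).
  assert (Hal : 0 < al F) by (apply al_pos, HS).
  destruct (proj1 (ZC t ltac:(lra)) (Hz t Ht)) as [H|H]; [exact H|exfalso].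
  destruct HO as [HO _]; destruct H as [H _]; rewrite neg_hp in H; destruct (negF_data F) as (_ & _ & Ea & _); rewrite Ea in H.
  assert (HZ : exists x, a <= x <= b /\ hp F h x = 0).
  { destruct (Rtotal_order s t) as [L|[->|L]]; [|lra|].
    - destruct (lipschitz_zero (fun x => - hp F h x) s t) as (x & Hx & Ex); try lra.
      { apply lipschitz_opp, lipschitz_sub with (1 := Lp); lra. }
      exists x; split; lra.
    - destruct (lipschitz_zero (hp F h) t s) as (x & Hx & Ex); try lra.
      { apply lipschitz_sub with (1 := Lp); lra. }
      exists x; split; lra. }
  destruct HZ as (x & Hx & Ex).
  destruct (proj1 (ZC x ltac:(lra)) (Hz x Hx)) as [[H' _]|[H' _]]; [lra|].
  rewrite neg_hp, Ea in H'; lra.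
Qed.

(** [swapF] keeps the corner and reverses the wedge, so one of the two frames has sg hz > 0. *)
Lemma leave_frame F u v : sg' F -> 0 <= u < v -> v <= T -> at_O F u -> (forall t, u < t < v -> hz h t <> 0) ->
  exists G, (G = F \/ G = swapF F) /\ sg' G /\ at_O G u /\ (forall t, u < t < v -> 0 < sg G * hz h t).
Proof.
  intros HS Hu Hv HO Hz; destruct (sing_facts HS) as (Lz & _).
  assert (S0 : sg F <> 0) by apply (ok_sg0 F (proj1 HS)).
  assert (Lf : lipschitz_on (fun t => sg F * hz h t) u v).
  { destruct Lz as (C & HC & L); exists (Rabs (sg F) * C); split; [apply Rmult_le_pos; [apply Rabs_pos|exact HC]|].
    intros s t Hs Ht; rewrite <- Rmult_minus_distr_l, Rabs_mult, Rmult_assoc.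
    apply Rmult_le_compat_l; [apply Rabs_pos|]; apply L; lra. }
  destruct (nonzero_sign Lf) as [N|N].
  - intros t Ht H; apply Rmult_integral in H; destruct H as [H|H]; [exact (S0 H)|exact (Hz t Ht H)].
  - exists (swapF F); split; [right; reflexivity|]; split; [apply sing_swap, HS|]; split; [apply at_O_swap, HO|].
    intros t Ht; specialize (N t Ht); cbv beta in N; destruct (swap_data F) as (_ & _ & _ & _ & _ & ->); lra.
  - exists F; split; [left; reflexivity|]; split; [exact HS|]; split; [exact HO|exact N].
Qed.

Lemma leave_sing F u v : sg' F -> 0 <= u < v -> v <= T -> at_O F u -> (forall t, u < t < v -> 0 < sg F * hz h t) ->
  exists x y, 0 < x <= tP F /\ 0 <= y <= tQ F /\ (x = tP F \/ y = 0) /\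
    ga v = qmul (ga u) (qmul (rt (fP F) x) (rt (fQ F) y)) /\ v - u = al F * x + be F * y /\
    (hz h v = 0 -> x = tP F /\ y = tQ F /\ at_O (negF F) v).
Proof.
  intros HS Hu Hv [H1 H2] Hz; destruct (sing_facts HS) as (_ & _ & ZC); destruct HS as (OK & (A & B & E) & Hc & HL).
  destruct (leave OK E Hc HL Hu Hv H1 H2 Hz) as (x & y & Hx & Hy & Hxy & Eg & Ec & EZ).
  exists x, y; repeat (split; [assumption|]).
  intros Z; destruct (EZ Z) as (E1 & E2 & E3); repeat (split; [assumption|]).
  destruct (proj1 (ZC v ltac:(lra)) Z) as [[_ H]|H]; [exfalso|exact H].
  assert (Hb := be_pos F OK); unfold h in H; rewrite E3 in H; lra.
Qed.

Lemma excursion_full F u v : sg' F -> 0 <= u < v -> v <= T -> hz h u = 0 -> hz h v = 0 ->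
  (forall t, u < t < v -> hz h t <> 0) ->
  exists G, (G = F \/ G = swapF F \/ G = negF F \/ G = swapF (negF F)) /\ sg' G /\ at_O G u /\ at_O (negF G) v /\
    ga v = qmul (ga u) (exc G) /\ v - u = ell F /\ ell G = ell F.
Proof.
  intros HS Hu Hv Zu Zv Hz; destruct (sing_facts HS) as (_ & _ & ZC).
  assert (HG : exists G0, (G0 = F \/ G0 = negF F) /\ sg' G0 /\ at_O G0 u /\ ell G0 = ell F).
  { destruct (proj1 (ZC u ltac:(lra)) Zu) as [H|H].
    - exists F; split; [left; reflexivity|]; split; [exact HS|]; split; [exact H|reflexivity].
    - exists (negF F); split; [right; reflexivity|]; split; [apply sing_neg, HS|]; split; [exact H|apply ell_neg]. }
  destruct HG as (G0 & HG0 & HS0 & HO0 & HE0).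
  destruct (leave_frame HS0 Hu Hv HO0 Hz) as (G & HG & HSG & HOG & Hpos).
  assert (HE : ell G = ell F) by (destruct HG as [->| ->]; rewrite ?ell_swap; exact HE0).
  destruct (leave_sing HSG Hu Hv HOG Hpos) as (x & y & _ & _ & _ & Eg & Ec & EZ).
  destruct (EZ Zv) as (-> & -> & HOv).
  exists G; split.
  { destruct HG0 as [->| ->]; destruct HG as [->| ->]; tauto. }
  split; [exact HSG|]; split; [exact HOG|]; split; [exact HOv|]; split; [exact Eg|]; split; [rewrite <- HE; exact Ec|exact HE].
Qed.

Lemma ell_pos F : sg' F -> 0 < ell F.
Proof.
  intros (OK & _ & Hc & _); assert (HP := tP_range OK Hc); assert (HQ := tQ_range OK Hc).
  assert (Ha := al_pos F OK); assert (Hb := be_pos F OK); unfold ell; nra.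
Qed.

Lemma component f a b t : lipschitz_on f a b -> a < t < b -> f t <> 0 -> f a = 0 -> f b = 0 ->
  exists u v, a <= u < t /\ t < v <= b /\ f u = 0 /\ f v = 0 /\ forall x, u < x < v -> f x <> 0.
Proof.
  intros L Ht N Fa Fb; destruct (Rtotal_order (f t) 0) as [H|[H|H]]; [|contradiction|].
  - destruct (positive_component (lipschitz_opp _ _ _ L) Ht) as (u & v & Hu & Hv & Eu & Ev & P); try lra.
    exists u, v; repeat split; try lra; intros x Hx; specialize (P x Hx); lra.
  - destruct (positive_component L Ht) as (u & v & Hu & Hv & Eu & Ev & P); try lra.
    exists u, v; repeat split; try lra; intros x Hx; specialize (P x Hx); lra.
Qed.

(* Complete excursions all last [ell F], so they cannot accumulate. *)
Lemma after_zero F a : sg' F -> 0 <= a -> hz h a = 0 ->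
  (forall e, 0 < e -> exists t, a < t < a + e /\ t <= T /\ hz h t <> 0) ->
  exists b, a < b <= T /\ forall t, a < t < b -> hz h t <> 0.
Proof.
  intros HS Ha Za Hacc; destruct (sing_facts HS) as (Lz & _); assert (Hl := ell_pos HS).
  destruct (Hacc (ell F) Hl) as (t1 & Ht1 & Ht1T & N1).
  destruct (@last_zero (hz h) a t1) as (a' & Ha' & Za' & Na').
  { apply lipschitz_sub with (1 := Lz); lra. }
  { exists a; split; [lra|exact Za]. }
  assert (Hat : a' < t1) by (destruct (Rle_lt_or_eq_dec a' t1) as [H| ->]; [lra|exact H|contradiction]).
  destruct (Rle_lt_or_eq_dec a a') as [H| <-]; [lra| |].
  - exfalso; destruct (Hacc (a' - a)) as (t2 & Ht2 & _ & N2); [lra|].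
    destruct (@component (hz h) a a' t2) as (u & v & Hu & Hv & Zu & Zv & Huv); try assumption; [|lra|].
    { apply lipschitz_sub with (1 := Lz); lra. }
    destruct (excursion_full HS (u := u) (v := v)) as (_ & _ & _ & _ & _ & _ & EL & _); try assumption; lra.
  - exists t1; split; [lra|]; intros t Ht; apply Na'; lra.
Qed.

Lemma stay_sing F a b : sg' F -> 0 <= a -> a <= b -> b <= T -> (forall t, a <= t <= b -> hz h t = 0) -> at_O F a ->
  ga b = qmul (ga a) (rt (wdir F) ((b - a) / wcost F)).
Proof.
  intros HS Ha Hab Hb Hz HO; assert (HC := at_O_const HS Ha Hb Hz); destruct HS as (OK & (A & B & E) & Hc & HL).
  apply (stay_arc OK E Hc) with (b := b); try lra.
  intros t Ht; destruct (HC a t ltac:(lra) Ht HO) as [H1 H2]; repeat split; [exact H1|exact H2|apply Hz, Ht].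
Qed.

(** Before its next departure the curve may rest at the opposite corner, along an arc about -W. By M
    W^(-q) = W^q M this arc slides in front of the excursion, so that M is followed directly by the
    next arc, and [excursion_then_P] or [excursion_then_Q] applies. *)
Lemma after_excursion F u v : sg' F -> 0 <= u < v -> v <= T -> hz h u = 0 -> hz h v = 0 ->
  (forall t, u < t < v -> hz h t <> 0) -> forall t, v <= t <= T -> hz h t = 0.
Proof.
  intros HS Hu Hv Zu Zv Hz t0 Ht0; apply NNPP; intros N0.
  destruct (sing_facts HS) as (Lz & _).
  destruct (excursion_full HS Hu Hv Zu Zv Hz) as (G & _ & HSG & HOG & HOv & Eg & _).
  destruct (@first_nonzero (hz h) v T) as (m & Hm & Zm & Hacc).
  { apply lipschitz_sub with (1 := Lz); lra. } { exact Zv. } { exists t0; split; assumption. }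
  assert (HSn := sing_neg HSG).
  destruct (@after_zero (negF G) m HSn) as (b & Hb & Nb); [lra|apply Zm; lra|exact Hacc|].
  assert (HOm : at_O (negF G) m) by (apply (at_O_const HSn (a := v) (b := m)) with (s := v); try lra; assumption).
  assert (Est := stay_sing HSn (a := v) (b := m) ltac:(lra) ltac:(lra) ltac:(lra) Zm HOv).
  rewrite wdir_neg, rt_opp, wcost_neg in Est.
  set (q := (m - v) / wcost G) in *.
  destruct (leave_frame HSn (u := m) (v := b)) as (G' & HG' & HSG' & HOG' & Pos); [lra|lra|exact HOm|exact Nb|].
  assert (OK' : frame_ok G') by apply HSG'; assert (Hc' : 0 < cc G') by apply HSG'.
  assert (HP' := tP_range OK' Hc'); assert (Ha' := al_pos G' OK'); assert (Hb' := be_pos G' OK').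
  assert (HaP : 0 < al G' * tP G') by nra.
  (* Only the beginning of the next excursion, so short that it consists of a single arc. *)
  set (v' := Rmin b (m + al G' * tP G' / 2)).
  assert (Hv' : m < v' <= b /\ v' <= m + al G' * tP G' / 2).
  { unfold v'; generalize (Rmin_l b (m + al G' * tP G' / 2)) (Rmin_r b (m + al G' * tP G' / 2)); intros.
    assert (m < Rmin b (m + al G' * tP G' / 2)) by (apply Rmin_glb_lt; lra); lra. }
  destruct (leave_sing HSG' (u := m) (v := v')) as (x & y & Hx & Hy & Hxy & Eg' & Ec' & _);
    [lra|lra|exact HOG'|intros t Ht; apply Pos; lra|].
  assert (y = 0).
  { destruct Hxy as [->|H]; [exfalso|exact H]. assert (0 <= be G' * y) by nra; lra. }
  subst y; rewrite rt_0, qmul_1_r in Eg'.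
  destruct HSG as (OK & (A & B & E) & Hc & HL).
  assert (Hw := wcost_pos OK Hc).
  assert (Hq : 0 <= q) by (unfold q; apply Rmult_le_pos; [lra|left; apply Rinv_0_lt_compat, Hw]).
  assert (Ewq : wcost G * q = m - v) by (unfold q; field; lra).
  assert (Uu : ip (ga u) (ga u) = 1) by (apply (ex_u _ _ _ _ _ _ _ E); lra).
  assert (Etot : qmul (qconj (ga u)) (ga v') = qmul (rt (wdir G) q) (qmul (exc G) (rt (fP G') x))).
  { rewrite Eg', Est, Eg, <- !qmul_assoc, (cancel_conj_l _ Uu), !qmul_assoc; f_equal.
    rewrite (exc_wdir OK Hc); reflexivity. }
  assert (HEx : v - u = al G * tP G + be G * tQ G).
  { destruct (leave_frame (F := G) (u := u) (v := v)) as (G1 & HG1 & HSG1 & HO1 & P1); try assumption.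
    - split; [exact OK|]; split; [exists A, B; exact E|split; assumption].
    - destruct (leave_sing HSG1 Hu Hv HO1 P1) as (x1 & y1 & _ & _ & _ & _ & Ec1 & EZ1).
      destruct (EZ1 Zv) as (-> & -> & _); fold (ell G1) in Ec1; fold (ell G).
      destruct HG1 as [->| ->]; rewrite ?ell_swap in Ec1; exact Ec1. }
  assert (RW := reach_wdir OK Hc q); rewrite (Rabs_right q) in RW by lra.
  (* The opposite corner is left by -P or by Q. *)
  destruct HG' as [->| ->].
  - destruct (negF_data G) as (DP & _ & Da & _); rewrite DP, rt_opp in Etot; rewrite Da in Ec'.
    destruct (@excursion_then_P G x OK Hc) as (X & HX & RX); [lra|].
    assert (H := no_shortcut (s := u) (t := v') E ltac:(lra) ltac:(lra) (reach_mul _ _ _ _ _ RW RX) (or_introl (eq_sym Etot))).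
    lra.
  - destruct (swap_data (negF G)) as (DP & _ & Da & _); destruct (negF_data G) as (_ & DQ & _ & Db & _).
    rewrite DP, DQ, qopp_opp in Etot; rewrite Da, Db in Ec'.
    destruct (@excursion_then_Q G OK Hc x) as (X & HX & RX); [lra|].
    assert (H := no_shortcut (s := u) (t := v') E ltac:(lra) ltac:(lra) (reach_mul _ _ _ _ _ RW RX)).
    assert (v' - u <= wcost G * q + X); [|lra].
    apply H; right; rewrite Etot; generalize (rt (wdir G) q) (exc G) (rt (fQ G) x); qring.
Qed.
End SW.

(** An initial piece of an excursion, with its cost: the second arc starts only after the first is
    complete. *)
Definition exw (F : frame) (q : quat) (c : R) : Prop :=
  exists x y, 0 <= x <= tP F /\ 0 <= y <= tQ F /\ (x = tP F \/ y = 0) /\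
    q = qmul (rt (fP F) x) (rt (fQ F) y) /\ c = al F * x + be F * y.

Lemma before_excursion K gh T ga F u v : let h := hh K gh T ga in sing K gh T ga F ->
  0 <= u < v -> v <= T -> hz h u = 0 -> hz h v = 0 ->
  (forall t, u < t < v -> hz h t <> 0) -> forall t, 0 <= t <= u -> hz h t = 0.
Proof.
  intros h HS Hu Hv Zu Zv Hz t Ht.
  assert (HS' := sing_rev HS); destruct HS as (OK & (A & B & E) & Hc & HL).
  assert (HR : forall t, hz (hh K (qrev gh) T (rga T ga)) t = - hz h (T - t)) by (intros; apply (hz_rev _ E)).
  assert (H := after_excursion HS' (u := T - v) (v := T - u)).
  replace t with (T - (T - t)) by ring.
  apply Ropp_eq_reg; rewrite Ropp_0, <- HR; apply H; try lra.
  - rewrite HR; replace (T - (T - v)) with v by ring; lra.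
  - rewrite HR; replace (T - (T - u)) with u by ring; lra.
  - intros t' Ht'; rewrite HR; intros N; apply (Hz (T - t')); lra.
Qed.

Lemma tail_words K gh T ga F m : let h := hh K gh T ga in sing K gh T ga F ->
  0 <= m <= T -> at_O K gh T ga F m -> (forall t, m < t < T -> hz h t <> 0) ->
  exists q, (exw F q (T - m) \/ exw (swapF F) q (T - m)) /\ ga T = qmul (ga m) q.
Proof.
  intros h HS Hm HO Hz.
  destruct (Rle_lt_or_eq_dec m T) as [H|H]; [lra| |].
  - destruct (leave_frame HS (u := m) (v := T)) as (G & HG & HSG & HOG & Pos); [lra|lra|exact HO|exact Hz|].
    destruct (leave_sing HSG (u := m) (v := T)) as (x & y & Hx & Hy & Hxy & Eg & Ec & _); [lra|lra|exact HOG|exact Pos|].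
    exists (qmul (rt (fP G) x) (rt (fQ G) y)); split; [|exact Eg].
    assert (HW : exw G (qmul (rt (fP G) x) (rt (fQ G) y)) (T - m)).
    { exists x, y; repeat split; try lra; exact Hxy. }
    destruct HG as [->| ->]; [left|right]; exact HW.
  - subst m; exists qone; split; [left|rewrite qmul_1_r; reflexivity].
    destruct HS as (OK & _ & Hc & _); assert (HP := tP_range OK Hc); assert (HQ := tQ_range OK Hc).
    exists 0, 0; repeat split; try lra; rewrite !rt_0; qring.
Qed.

(** If hz <> 0 somewhere between its first and last zero, a complete excursion occurs there, and
    [before_excursion] and [after_excursion] give hz = 0 outside it. Otherwise the curve rests from
    the first zero to the last; the part before is a tail of the reversed curve, whence the
    [qrev]. *)
Lemma singular_words K gh T ga F : let h := hh K gh T ga in sing K gh T ga F ->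
  (exists t, 0 <= t <= T /\ hz h t = 0) ->
  exists G, (G = F \/ G = negF F) /\ exists p1 c1 p2 c2 t, 0 <= t /\
    (exw G p1 c1 \/ exw (swapF G) p1 c1) /\ (exw G p2 c2 \/ exw (swapF G) p2 c2) /\
    ga T = qmul (qrev p1) (qmul (rt (wdir G) t) p2) /\ T = c1 + wcost G * t + c2.
Proof.
  intros h HS HZ; destruct (sing_facts HS) as (Lz & _ & ZC); fold h in Lz, ZC.
  assert (E0 : ga 0 = qone) by (destruct HS as (_ & (A & B & E) & _); apply (ex_0 _ _ _ _ _ _ _ E)).
  destruct (first_zero Lz HZ) as (m & Hm & Zm & Nm).
  destruct (last_zero Lz HZ) as (M & HM & ZM & NM).
  assert (HmM : m <= M) by (apply Rnot_lt_le; intros H; apply (NM m); [lra|exact Zm]).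
  destruct (classic (exists t, m <= t <= M /\ hz h t <> 0)) as [(t0 & Ht0 & N0)|HN].
  - assert (Hin : m < t0 < M).
    { split.
      - destruct (Rle_lt_or_eq_dec m t0) as [H| ->]; [lra|exact H|contradiction].
      - destruct (Rle_lt_or_eq_dec t0 M) as [H| ->]; [lra|exact H|contradiction]. }
    destruct (@component (hz h) m M t0) as (u & v & Hu & Hv & Zu & Zv & Huv); try assumption.
    { apply lipschitz_sub with (1 := Lz); lra. }
    assert (Z1 := before_excursion HS (u := u) (v := v) ltac:(lra) ltac:(lra) Zu Zv Huv).
    assert (Z2 := after_excursion HS (u := u) (v := v) ltac:(lra) ltac:(lra) Zu Zv Huv).
    destruct (excursion_full HS (u := u) (v := v)) as (H & HH & HSH & HOu & HOv & Eg & EL & EL'); try assumption; try lra.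
    assert (HO0 : at_O K gh T ga H 0) by (apply (at_O_const HSH (a := 0) (b := u)) with (s := u); try lra; assumption).
    assert (S1 := stay_sing HSH (a := 0) (b := u) ltac:(lra) ltac:(lra) ltac:(lra) Z1 HO0).
    assert (S2 := stay_sing (sing_neg HSH) (a := v) (b := T) ltac:(lra) ltac:(lra) ltac:(lra) Z2 HOv).
    rewrite wdir_neg, rt_opp, wcost_neg in S2; rewrite Rminus_0_r, E0, qmul_1_l in S1.
    assert (OKH : frame_ok H) by apply HSH; assert (HcH : 0 < cc H) by apply HSH.
    assert (Hw := wcost_pos OKH HcH).
    (* The W-arcs before and after the excursion run in opposite directions; sliding the later one
       through the half-turn adds their angles. *)
    set (t := u / wcost H + (T - v) / wcost H).
    assert (Et : ga T = qmul (rt (wdir H) t) (exc H)).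
    { rewrite S2, Eg, S1, <- qmul_assoc, <- (exc_wdir OKH HcH), qmul_assoc, rt_add by (apply wdir_unit; assumption); reflexivity. }
    assert (Ht : 0 <= t).
    { unfold t; apply Rplus_le_le_0_compat; (apply Rmult_le_pos; [lra|left; apply Rinv_0_lt_compat, Hw]). }
    assert (ET : T = wcost H * t + ell H) by (unfold t; rewrite EL', <- EL; field; lra).
    assert (HP := tP_range OKH HcH); assert (HQ := tQ_range OKH HcH).
    assert (HX : exw H (exc H) (ell H)).
    { exists (tP H), (tQ H); repeat split; try lra; left; reflexivity. }
    assert (HG : exists G, (G = F \/ G = negF F) /\ (H = G \/ H = swapF G)).
    { destruct HH as [->|[->|[->| ->]]]; [exists F|exists F|exists (negF F)|exists (negF F)]; tauto. }
    destruct HG as (G & HG & HGH); exists G; split; [exact HG|].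
    assert (HSG : sing K gh T ga G) by (destruct HG as [->| ->]; [exact HS|apply sing_neg, HS]).
    assert (HPG := tP_range (proj1 HSG) (proj1 (proj2 (proj2 HSG)))); assert (HQG := tQ_range (proj1 HSG) (proj1 (proj2 (proj2 HSG)))).
    exists qone, 0, (exc H), (ell H), t; split; [exact Ht|]; split; [|split; [|split]].
    + left; exists 0, 0; repeat split; try lra; rewrite !rt_0; qring.
    + destruct HGH as [->| ->]; [left|right]; exact HX.
    + replace (wdir G) with (wdir H) by (destruct HGH as [->| ->]; [reflexivity|apply wdir_swap]).
      rewrite Et; replace (qrev qone) with qone by qring; rewrite qmul_1_l; reflexivity.
    + replace (wcost G) with (wcost H) by (destruct HGH as [->| ->]; [reflexivity|apply wcost_swap]); lra.
  - assert (Z : forall t, m <= t <= M -> hz h t = 0).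
    { intros t Ht; apply NNPP; intros N; apply HN; exists t; split; assumption. }
    assert (HG : exists G, (G = F \/ G = negF F) /\ sing K gh T ga G /\ at_O K gh T ga G m).
    { destruct (proj1 (ZC m Hm) Zm) as [H|H]; [exists F|exists (negF F)].
      - split; [left; reflexivity|split; [exact HS|exact H]].
      - split; [right; reflexivity|split; [apply sing_neg, HS|exact H]]. }
    destruct HG as (G & HG & HSG & HOm); exists G; split; [exact HG|].
    assert (HOM : at_O K gh T ga G M) by (apply (at_O_const HSG (a := m) (b := M)) with (s := m); try lra; assumption).
    assert (S := stay_sing HSG (a := m) (b := M) ltac:(lra) ltac:(lra) ltac:(lra) Z HOm).
    destruct (@tail_words K gh T ga G M HSG) as (p2 & HP2 & Eg2); [lra|exact HOM|intros t Ht; apply NM; lra|].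
    assert (HSR := sing_rev HSG).
    assert (OKG : frame_ok G) by apply HSG; assert (HcG : 0 < cc G) by apply HSG; assert (Hw := wcost_pos OKG HcG).
    destruct HSG as (_ & (A & B & E) & _).
    destruct (@tail_words K (qrev gh) T (rga T ga) G (T - m) HSR) as (p1 & HP1 & Eg1); [lra| | |].
    { destruct HOm as [H1 H2]; split.
      - rewrite (hp_rev _ OKG E); replace (T - (T - m)) with m by ring; exact H1.
      - rewrite (hq_rev _ OKG E); replace (T - (T - m)) with m by ring; exact H2. }
    { intros t Ht; rewrite (hz_rev _ E); intros N; apply (Nm (T - t)); [lra|]; unfold h; lra. }
    replace (T - (T - m)) with m in HP1 by ring.
    assert (UT : ip (ga T) (ga T) = 1) by (apply (ex_u _ _ _ _ _ _ _ E); lra).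
    assert (Um : ip (ga m) (ga m) = 1) by (apply (ex_u _ _ _ _ _ _ _ E); lra).
    assert (Em : ga m = qrev p1).
    { rewrite (rga_T _ _ E0) in Eg1; unfold rga in Eg1; replace (T - (T - m)) with m in Eg1 by ring.
      apply (f_equal qrev) in Eg1; rewrite qrev_mul, !qrev_rev in Eg1.
      apply (f_equal (fun q => qmul q (qmul (qconj (ga T)) (ga m)))) in Eg1.
      rewrite (cancel_conj_r _ UT), <- !qmul_assoc, (cancel_conj_r _ UT), (qmul_conj_l _ Um), qmul_1_r in Eg1.
      exact Eg1. }
    exists p1, m, p2, (T - M), ((M - m) / wcost G); split; [|split; [exact HP1|split; [exact HP2|split]]].
    + apply Rmult_le_pos; [lra|left; apply Rinv_0_lt_compat, Hw].
    + rewrite Eg2, S, Em, <- qmul_assoc; reflexivity.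
    + field; lra.
Qed.

(** * The words of an extremal curve *)

(* words_A: no opposite-sign corner is met. words_B: the covector is longer than at
   a planar opposite-sign corner, and the letters cycle through P, Q, -P, -Q.
   words_C: the critical length, a singular arc between two partial excursions. *)
Definition words_A (F : frame) (q : quat) (T : R) : Prop :=
  exists x y, 0 <= x <= PI /\ 0 <= y <= PI /\
   ((q = qmul (rt (fP F) x) (rt (fQ F) y) /\ T = al F * x + be F * y) \/
    (q = qmul (rt (fQ F) x) (rt (fP F) y) /\ T = be F * x + al F * y) \/
    exists t, 0 <= t <= 2 * tP F /\
      q = qmul (rt (fQ F) x) (qmul (rt (fP F) t) (rt (fQ F) y)) /\ T = be F * x + al F * t + be F * y).

Definition words_B (F : frame) (g : quat) (T : R) : Prop :=
  exists p q x y, 0 < p < PI /\ 0 < q < PI /\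
    al F * (sin (p / 2) * cos (q / 2)) = be F * (cos (p / 2) * sin (q / 2)) /\
    0 <= x <= PI /\ 0 <= y <= PI /\
    ((g = qmul (rt (fP F) x) (rt (fQ F) y) /\ T = al F * x + be F * y) \/
     (x <= p /\ y <= p /\ g = qmul (rt (fP F) x) (qmul (rt (fQ F) q) (rt (fP F) (- y))) /\
        T = al F * x + be F * q + al F * y) \/
     (x <= p /\ y <= q /\ g = qmul (rt (fP F) x) (qmul (rt (fQ F) q) (qmul (rt (fP F) (- p)) (rt (fQ F) (- y)))) /\
        T = al F * x + be F * q + al F * p + be F * y)).

Definition words_C (F : frame) (q : quat) (T : R) : Prop :=
  exists p1 c1 p2 c2 t, 0 <= t /\
    (exw F p1 c1 \/ exw (swapF F) p1 c1) /\ (exw F p2 c2 \/ exw (swapF F) p2 c2) /\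
    q = qmul (qrev p1) (qmul (rt (wdir F) t) p2) /\ T = c1 + wcost F * t + c2.

Definition rots (F : frame) : list frame := [F; rotF F; rotF (rotF F); rotF (rotF (rotF F))].

(** The sides are taken half-open, each corner belonging to the side whose arc starts there, so that
    one of the four rotations brings the initial covector into the position that [cyclic_words] asks
    for. *)
Lemma rot_choice F K gh T ga A B : frame_ok F -> ext F K gh T ga A B -> 0 < T ->
  let h := hh K gh T ga in let L := sg F * sg F * ip (lam K gh T ga) (lam K gh T ga) in
  big F L -> (forall t, 0 <= t <= T -> 0 < sg F * hz h t) ->
  exists G, In G (rots F) /\ words_B G (ga T) T.
Proof.
  intros OK E HT h L HL Hz.
  assert (OK1 := rotF_ok F OK); assert (E1 := ext_rot _ _ _ _ _ _ _ E).
  assert (OK2 := rotF_ok _ OK1); assert (E2 := ext_rot _ _ _ _ _ _ _ E1).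
  assert (OK3 := rotF_ok _ OK2); assert (E3 := ext_rot _ _ _ _ _ _ _ E2).
  assert (HL1 := big_rot HL); assert (HL2 := big_rot HL1); assert (HL3 := big_rot HL2).
  assert (Ha := al_pos F OK); assert (Hb := be_pos F OK).
  assert (W0 := cyclic_words OK E HT HL Hz).
  assert (W1 := cyclic_words OK1 E1 HT HL1 Hz).
  assert (W2 := cyclic_words OK2 E2 HT HL2 Hz).
  assert (W3 := cyclic_words OK3 E3 HT HL3 Hz).
  cbv zeta in *; fold h in W0, W1, W2, W3.
  assert (Bp := hp_bound OK E (t := 0) ltac:(lra)); assert (Bq := hq_bound OK E (t := 0) ltac:(lra)); fold h in Bp, Bq.
  apply Rabs_le_between in Bp; apply Rabs_le_between in Bq.
  assert (Bd := on_boundary OK E (t := 0) ltac:(lra) HT); fold h in Bd.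
  assert (Hcase : (hp F h 0 = al F /\ - be F <= hq F h 0 < be F) \/ (hq F h 0 = be F /\ - al F <= - hp F h 0 < al F)
     \/ (- hp F h 0 = al F /\ - be F <= - hq F h 0 < be F) \/ (- hq F h 0 = be F /\ - al F <= - - hp F h 0 < al F)).
  { unfold Rabs in Bd; destruct (Rcase_abs (hp F h 0)), (Rcase_abs (hq F h 0)); lra. }
  destruct Hcase as [[H1 H2]|[[H1 H2]|[[H1 H2]|[H1 H2]]]].
  - exists F; split; [simpl; tauto|exact (W0 H1 H2)].
  - exists (rotF F); split; [simpl; tauto|apply W1; [rewrite hp_rot; exact H1|rewrite hq_rot; exact H2]].
  - exists (rotF (rotF F)); split; [simpl; tauto|apply W2; [rewrite hp_rot, hq_rot; exact H1|rewrite hq_rot, hp_rot; exact H2]].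
  - exists (rotF (rotF (rotF F))); split; [simpl; tauto|apply W3; [rewrite !hp_rot, hq_rot, ?hp_rot; exact H1|rewrite hq_rot, hp_rot, hq_rot; exact H2]].
Qed.

Lemma extremal_words F K gh T ga A B : frame_ok F -> ext F K gh T ga A B -> be F <= cc F * al F ->
  (exists G, (G = F \/ G = negF F) /\ words_A G (ga T) T) \/
  (exists G, In G (rots F ++ rots (flipF F)) /\ words_B G (ga T) T) \/
  (exists G, (G = F \/ G = negF F) /\ words_C G (ga T) T).
Proof.
  intros OK E Hk.
  assert (Ha := al_pos F OK); assert (Hb := be_pos F OK).
  assert (Hid := frame_id OK); assert (S0 := ok_sg0 F OK).
  assert (Hss : 0 < sg F * sg F) by (apply Rlt_0_sqr; exact S0).
  assert (Hcc : 0 < cc F) by nra.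
  assert (Hc1 : cc F < 1) by nra.
  set (h := hh K gh T ga).
  assert (ET := ex_T _ _ _ _ _ _ _ E).
  destruct (Rle_lt_or_eq_dec _ _ ET) as [HT|HT].
  2:{ left; exists F; split; [left; reflexivity|]; exists 0, 0; assert (HPI := PI_RGT_0); split; [lra|]; split; [lra|]; left.
      rewrite !rt_0, <- HT, (ex_0 _ _ _ _ _ _ _ E); split; [qring|ring]. }
  assert (Bp : forall t, 0 <= t <= T -> - al F <= hp F h t <= al F).
  { intros t Ht; apply Rabs_le_between, (hp_bound OK E Ht). }
  assert (Bq : forall t, 0 <= t <= T -> - be F <= hq F h t <= be F).
  { intros t Ht; apply Rabs_le_between, (hq_bound OK E Ht). }
  assert (Bd : forall t, 0 <= t <= T -> (al F - hp F h t) * (be F - hq F h t) = 0 \/ (al F + hp F h t) * (be F + hq F h t) = 0).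
  { intros t Ht; assert (H := on_boundary OK E Ht HT); fold h in H.
    unfold Rabs in H; destruct (Rcase_abs (hp F h t)), (Rcase_abs (hq F h t)); destruct H as [H|H];
      (left; replace 0 with (0 * 0) by ring; first [replace (al F - hp F h t) with 0 by lra|replace (be F - hq F h t) with 0 by lra]; ring) ||
      (right; first [replace (al F + hp F h t) with 0 by lra|replace (be F + hq F h t) with 0 by lra]; ring). }
  (* An O-corner met only at an end time with hz <> 0 does not count: [no_O_words] excludes
     O-corners at interior times only. *)
  destruct (classic (exists t, 0 <= t <= T /\ ((hp F h t = al F /\ hq F h t = - be F) \/ (hp F h t = - al F /\ hq F h t = be F)) /\
     (hz h t = 0 \/ 0 < t < T))) as [(t0 & Ht0 & HO & _)|HN].
  - right.
    assert (Hn := h_const_norm OK E Ht0); fold h in Hn.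
    assert (Hn' : al F * al F + be F * be F + 2 * cc F * (al F * be F) + sg F * sg F * (hz h t0 * hz h t0)
       = sg F * sg F * ip (lam K gh T ga) (lam K gh T ga)).
    { rewrite <- Hn; destruct HO as [[-> ->]|[-> ->]]; ring. }
    destruct (Req_dec (hz h t0) 0) as [Z|Z].
    + right; destruct (@singular_words K gh T ga F) as (G & HG & HW).
      * split; [exact OK|]; split; [exists A, B; exact E|]; split; [exact Hcc|].
        unfold balanced; rewrite <- Hn', Z; ring.
      * exists t0; split; assumption.
      * exists G; split; [exact HG|exact HW].
    + left; set (L := sg F * sg F * ip (lam K gh T ga) (lam K gh T ga)) in *.
      assert (HZ : 0 < hz h t0 * hz h t0) by (apply Rlt_0_sqr; exact Z).
      assert (HLb : al F * al F + be F * be F + 2 * cc F * (al F * be F) < L) by nra.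
      assert (HL : big F L) by (unfold big; rewrite Rabs_right by lra; exact HLb).
      assert (HL' : big (flipF F) L) by (unfold big; simpl; rewrite Rabs_Ropp, Rabs_right by lra; exact HLb).
      assert (Nz : forall t, 0 <= t <= T -> hz h t <> 0).
      { intros t Ht Zt; assert (Hnt := h_const_norm OK E Ht); fold h L in Hnt; rewrite Zt in Hnt.
        specialize (Bp t Ht); specialize (Bq t Ht).
        assert (0 <= al F * al F - hp F h t * hp F h t) by nra.
        assert (0 <= be F * be F - hq F h t * hq F h t) by nra.
        assert (0 <= al F * be F + hp F h t * hq F h t) by nra.
        nra. }
      assert (Sgn : (forall t, 0 <= t <= T -> 0 < sg F * hz h t) \/ (forall t, 0 <= t <= T -> 0 < - sg F * hz h t)).
      { set (f := fun t => sg F * hz h t).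
        assert (Lf : lipschitz_on f 0 T).
        { destruct (hz_lip OK E) as (C & HC & Lz); exists (Rabs (sg F) * C); split; [apply Rmult_le_pos; [apply Rabs_pos|exact HC]|].
          intros s t Hs Ht; unfold f; rewrite <- Rmult_minus_distr_l, Rabs_mult, Rmult_assoc.
          apply Rmult_le_compat_l; [apply Rabs_pos|]; apply Lz; lra. }
        assert (Nf : forall t, 0 <= t <= T -> f t <> 0).
        { intros t Ht H; apply Rmult_integral in H; destruct H as [H|H]; [exact (S0 H)|exact (Nz t Ht H)]. }
        assert (Key : forall s t, 0 <= s <= T -> 0 <= t <= T -> 0 < f s -> 0 < f t).
        { intros s t Hs Ht Hfs; apply Rnot_le_lt; intros [Hft|Hft]; [|exact (Nf t Ht Hft)].
          destruct (Rtotal_order s t) as [Hl|[->|Hl]]; [|lra|].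
          - destruct (lipschitz_zero (fun x => - f x) s t) as (x & Hx & Ex); try lra.
            { apply lipschitz_opp, lipschitz_sub with (1 := Lf); lra. }
            apply (Nf x); lra.
          - destruct (lipschitz_zero f t s) as (x & Hx & Ex); try lra.
            { apply lipschitz_sub with (1 := Lf); lra. }
            apply (Nf x); lra. }
        destruct (Rlt_le_dec 0 (f t0)) as [H|H].
        - left; intros t Ht; apply (Key t0 t Ht0 Ht H).
        - right; intros t Ht; apply Rnot_le_lt; intros H'.
          assert (f t <> 0) by (apply Nf, Ht).
          assert (0 < f t) by (unfold f in *; lra).
          assert (0 < f t0) by (apply (Key t t0); assumption); lra. }
      destruct Sgn as [P|P].
      * destruct (rot_choice OK E HT HL P) as (G & HG & HW).
        exists G; split; [apply in_or_app; left; exact HG|exact HW].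
      * assert (OKf := flipF_ok F OK); assert (Ef := ext_flip _ _ _ _ _ _ _ E).
        destruct (@rot_choice (flipF F) K gh T ga _ _ OKf Ef HT) as (G & HG & HW).
        { simpl; replace (- sg F * - sg F) with (sg F * sg F) by ring; exact HL'. }
        { exact P. }
        exists G; split; [apply in_or_app; right; exact HG|exact HW].
  - left.
    (* On the boundary of the rectangle f vanishes only at the two O-corners. Its sign on (0, T)
       therefore tells whether h runs on the sides hp = al, hq = be or on the opposite ones. *)
    set (f := fun t => al F * hq F h t + be F * hp F h t).
    assert (Lf : lipschitz_on f 0 T).
    { destruct (hp_lip OK E) as (Cp & HCp & Lp); destruct (hq_lip OK E) as (Cq & HCq & Lq).
      exists (be F * Cp + al F * Cq); split; [nra|]; intros s t Hs Ht; unfold f.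
      specialize (Lp s t Hs Ht); specialize (Lq s t Hs Ht); fold h in Lp, Lq.
      apply Rabs_le_between in Lp; apply Rabs_le_between in Lq; apply Rabs_le; split; nra. }
    assert (Id : forall t, (al F - hp F h t) * (be F - hq F h t) - (al F + hp F h t) * (be F + hq F h t) = - (2 * f t)) by (intros; unfold f; ring).
    assert (Nf : forall t, 0 < t < T -> f t <> 0).
    { intros t Ht Ft; apply HN; exists t; split; [lra|]; split; [|right; exact Ht].
      assert (I := Id t); rewrite Ft in I.
      assert (H1 : (al F - hp F h t) * (be F - hq F h t) = 0) by (destruct (Bd t ltac:(lra)); lra).
      assert (H2 : (al F + hp F h t) * (be F + hq F h t) = 0) by lra.
      apply Rmult_integral in H1; apply Rmult_integral in H2.
      destruct H1 as [H1|H1], H2 as [H2|H2]; lra. }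
    assert (Edge : forall t, 0 <= t <= T -> (0 <= f t -> (al F - hp F h t) * (be F - hq F h t) = 0) /\
       (f t <= 0 -> (al F + hp F h t) * (be F + hq F h t) = 0)).
    { intros t Ht; specialize (Bp t Ht); specialize (Bq t Ht); assert (I := Id t).
      assert (0 <= (al F - hp F h t) * (be F - hq F h t)) by (apply Rmult_le_pos; lra).
      assert (0 <= (al F + hp F h t) * (be F + hq F h t)) by (apply Rmult_le_pos; lra).
      destruct (Bd t Ht) as [H1|H1]; split; intros; lra. }
    assert (Close : forall g, lipschitz_on g 0 T -> (forall t, 0 < t < T -> 0 < g t) -> forall t, 0 <= t <= T -> 0 <= g t).
    { intros g Lg Hg t Ht; apply (lipschitz_nonneg_closed Lg Ht); intros e He.
      destruct (Rle_lt_dec t (T / 2)) as [H|H].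
      - exists (t + Rmin (e / 2) (T / 4)).
        assert (0 < Rmin (e / 2) (T / 4)) by (apply Rmin_glb_lt; lra).
        generalize (Rmin_l (e / 2) (T / 4)) (Rmin_r (e / 2) (T / 4)); intros M1 M2.
        split; [lra|]; split; [rewrite Rabs_right; lra|left; apply Hg; lra].
      - exists (t - Rmin (e / 2) (T / 4)).
        assert (0 < Rmin (e / 2) (T / 4)) by (apply Rmin_glb_lt; lra).
        generalize (Rmin_l (e / 2) (T / 4)) (Rmin_r (e / 2) (T / 4)); intros M1 M2.
        split; [lra|]; split; [rewrite Rabs_left; lra|left; apply Hg; lra]. }
    destruct (nonzero_sign Lf Nf) as [N|N].
    + exists (negF F); split; [right; reflexivity|].
      assert (Np : forall t, 0 <= t <= T -> f t <= 0).
      { intros t Ht; apply Ropp_le_cancel; rewrite Ropp_0.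
        apply (Close (fun t => - f t)); [apply lipschitz_opp, Lf|intros u Hu; specialize (N u Hu); lra|exact Ht]. }
      destruct (negF_data F) as (_ & _ & Da & Db & Dc & _).
      assert (W := no_O_words (negF_ok OK) (ext_neg E)); cbv zeta in W; fold h in W.
      unfold words_A, tP; apply W; rewrite ?Da, ?Db, ?Dc; try assumption.
      * intros t Ht; rewrite neg_hp, neg_hq; destruct (Edge t Ht) as [_ H]; specialize (H (Np t Ht)).
        apply Rmult_integral in H; destruct H; [left|right]; lra.
      * intros t Ht; rewrite neg_hp, neg_hq; specialize (N t Ht); assert (Ht' : 0 <= t <= T) by lra.
        destruct (Edge t Ht') as [_ H]; specialize (H (Np t Ht')); assert (I := Id t).
        specialize (Bp t Ht'); specialize (Bq t Ht').
        split; intros H'.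
        -- replace (al F - hp F h t) with 0 in I by lra; lra.
        -- replace (be F - hq F h t) with 0 in I by lra; lra.
    + exists F; split; [left; reflexivity|].
      assert (W := no_O_words OK E); cbv zeta in W; fold h in W.
      unfold words_A, tP; apply W; try assumption.
      * intros t Ht; destruct (Edge t Ht) as [H _]; specialize (H (Close f Lf N t Ht)).
        apply Rmult_integral in H; destruct H; [left|right]; lra.
      * intros t Ht; assert (Nt := N t Ht); assert (Ht' : 0 <= t <= T) by lra.
        destruct (Edge t Ht') as [H _]; specialize (H (Close f Lf N t Ht')); assert (I := Id t).
        split; intros H'.
        -- replace (al F + hp F h t) with 0 in I by lra; lra.
        -- replace (be F + hq F h t) with 0 in I by lra; lra.
Qed.

(** * Slices of the listed patterns *)

Record slice := mkS { s_pat : pat_id; s_gens : list gen; s_pre : pattern; s_first : tm * label;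
                      s_mid : pattern; s_last : tm * label; s_post : pattern }.

(* [km = (k, m)] selects the [m] consecutive letters of the pattern from position [k] on. *)
Definition cut_slice (p : pat_id) (gs : list gen) (km : nat * nat) : slice :=
  let l := apply_gens gs (pat p) in let k := fst km in let m := snd km in
  mkS p gs (firstn k l) (nth k l (TPi, pX)) (firstn (m - 2) (skipn (S k) l))
      (nth (k + m - 1) l (TPi, pX)) (skipn (k + m) l).

Definition slice_ok (i : slice) : Prop :=
  apply_gens (s_gens i) (pat (s_pat i)) = s_pre i ++ s_first i :: s_mid i ++ s_last i :: s_post i /\
  List.Forall (gen_allowed (s_pat i)) (s_gens i).

Definition gens8 : list (list gen) :=
  [[]; [Gnu]; [Grho]; [Gnu; Grho]; [Gvsig]; [Gnu; Gvsig]; [Gvsig; Grho]; [Gnu; Gvsig; Grho]].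
Definition gens4 : list (list gen) := [[]; [Gnu]; [Gvsig]; [Gnu; Gvsig]].

(** Shorter words are covered because the two end letters may have time 0, and beginnings with any
    other letter by the images of the patterns. The list is finite, so one slice recurs in the limit
    of growing penalty. *)
Definition slices : list slice :=
  flat_map (fun gs => map (cut_slice PI_I gs) [(0, 2); (0, 3); (0, 4)]%nat) gens8 ++
  flat_map (fun gs => map (cut_slice PI_VIII gs) [(0, 3)]%nat) [[]; [Gnu]] ++
  flat_map (fun gs => map (cut_slice PI_IV gs) [(0, 4); (0, 5); (1, 3); (1, 4)]%nat) gens4 ++
  flat_map (fun gs => map (cut_slice PI_V gs) [(0, 4); (0, 5); (1, 3); (1, 4)]%nat) gens4.

Lemma slices_ok : List.Forall slice_ok slices.
Proof.
  unfold slices; simpl; repeat constructor.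
Qed.

Section Patterns.
Variables (ka c s : R).
Hypothesis Hka : 0 < ka.
Hypothesis Hkc : ka <= c.
Hypothesis Hs : 0 < s.
Hypothesis Hcs : c * c + s * s = 1.

Definition F0 : frame := mkFr (pl 1 0) (pl c s) 1 ka c s.

Lemma F0_ok : frame_ok F0.
Proof.
  constructor; simpl; try (unfold ip; simpl; lra); try lra.
  - split; unfold ip; simpl; ring.
  - split; unfold ip; simpl; [ring|lra].
Qed.

Definition feval (f : factor) : quat := eexp F0 (ftau f * fa f, ftau f * fb f).
Definition fq (w : list factor) : quat := fold_right (fun f q => qmul (feval f) q) qone w.

Definition lfac (t : R) (l : label) : factor := mkF t (fst (label_coef ka c l)) (snd (label_coef ka c l)).

Definition cw (i : slice) (tX tY t x y : R) : list factor :=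
  lfac x (snd (s_first i)) :: pattern_word ka c tX tY t (s_mid i) ++ [lfac y (snd (s_last i))].

(** The conditions of [pat_constraint] with weak inequalities, which pass to the limit. All that is
    added is tX = tY = 0 in pattern (I) ([degenerate_times]). *)
Definition closed_constraint (p : pat_id) (tX tY t : R) : Prop :=
  match p with
  | PI_I => 0 <= tX <= PI /\ 0 <= tY <= PI /\
            sin (tX / 2) * cos (tY / 2) = ka * (cos (tX / 2) * sin (tY / 2))
  | PI_IV => 0 <= t
  | PI_V => 0 <= t
  | PI_VIII => 0 <= t <= 2 * hat_tX ka c
  end.

Definition cw_valid (i : slice) (tX tY t x y : R) : Prop :=
  closed_constraint (s_pat i) tX tY t /\
  0 <= x <= tm_val ka c tX tY t (fst (s_first i)) /\ 0 <= y <= tm_val ka c tX tY t (fst (s_last i)).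

Lemma rt_qexp a b u (k t : R) : unitv u -> vec F0 a b = qscal k u -> eexp F0 (t * a, t * b) = rt u (t * k).
Proof.
  intros Hu H; unfold eexp; simpl; rewrite <- (qexp_scal u (t * k) Hu); f_equal.
  transitivity (qscal t (vec F0 a b)); [unfold vec; qring|rewrite H; qring].
Qed.

Lemma feval_X b t : feval (lfac t (b, BX)) = rt (fP F0) (if b then - t else t).
Proof.
  unfold feval, lfac; destruct b; simpl.
  - rewrite (@rt_qexp _ _ (pl 1 0) (-1) t); [f_equal; ring|apply (ok_P F0 F0_ok)|unfold vec; simpl; qring].
  - rewrite (@rt_qexp _ _ (pl 1 0) 1 t); [f_equal; ring|apply (ok_P F0 F0_ok)|unfold vec; simpl; qring].
Qed.

Lemma feval_Y b t : feval (lfac t (b, BY)) = rt (fQ F0) (if b then - t else t).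
Proof.
  unfold feval, lfac; destruct b; simpl.
  - rewrite (@rt_qexp _ _ (pl c s) (-1) t); [f_equal; ring|apply (ok_Q F0 F0_ok)|unfold vec; simpl; qring].
  - rewrite (@rt_qexp _ _ (pl c s) 1 t); [f_equal; ring|apply (ok_Q F0 F0_ok)|unfold vec; simpl; qring].
Qed.

Lemma c_pos : 0 < c.
Proof. lra. Qed.

Lemma feval_W b t : feval (lfac t (b, BWp)) = rt (wdir F0) ((if b then - t else t) * wlen F0).
Proof.
  assert (Hw := wlen_pos F0_ok c_pos).
  assert (E : vec F0 (1 + ka * c) (- (ka + c)) = qscal (wlen F0) (wdir F0)).
  { unfold wdir; transitivity (wv F0); [unfold wv, vec; simpl; qring|].
    generalize (wv F0); intros v; apply quat_ext; simpl; field; lra. }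
  unfold feval, lfac; destruct b; simpl.
  - rewrite (@rt_qexp _ _ (wdir F0) (- wlen F0) t); [f_equal; ring|apply (wdir_unit F0_ok c_pos)|].
    transitivity (qopp (vec F0 (1 + ka * c) (- (ka + c)))); [unfold vec; simpl; qring|rewrite E; generalize (wdir F0); qring].
  - apply rt_qexp; [apply (wdir_unit F0_ok c_pos)|exact E].
Qed.

Lemma tP_F0 : tP F0 = hat_tX ka c.
Proof. unfold tP, hat_tX; simpl; rewrite Rmult_1_r; reflexivity. Qed.
Lemma tQ_F0 : tQ F0 = hat_tY ka c.
Proof. unfold tQ, hat_tY; simpl; rewrite (Rmult_comm c); reflexivity. Qed.

(** The bounds make the parameters of a sequence converge along the ultrafilter once T is bounded.
    The slack 2 PI accommodates the middle time of pattern (VIII), at most twice an arccosine. *)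
Definition realized (q : quat) (T : R) : Prop :=
  exists i tX tY t x y, In i slices /\ cw_valid i tX tY t x y /\
    (0 <= tX <= PI /\ 0 <= tY <= PI /\ 0 <= t <= T + 2 * PI) /\
    fq (cw i tX tY t x y) = q /\ word_cost ka (cw i tX tY t x y) = T.

Ltac in_slices := unfold slices; simpl; repeat (first [left; reflexivity | right]).
Ltac abs1 := repeat first [rewrite Rabs_R0 | rewrite Rabs_R1 | rewrite Rabs_Ropp].

Lemma pattern_word_lfac tX tY t l :
  pattern_word ka c tX tY t l = map (fun e => lfac (tm_val ka c tX tY t (fst e)) (snd e)) l.
Proof. reflexivity. Qed.

Ltac word_eq := unfold cw; rewrite pattern_word_lfac; unfold cut_slice; simpl; unfold lab_nu, pX, mX, pY, mY, pWp; simpl;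
  rewrite ?feval_X, ?feval_Y, ?feval_W; simpl; rewrite ?rt_opp, ?Ropp_involutive, ?qmul_1_r; try reflexivity.
Ltac cost_eq := unfold cw; rewrite pattern_word_lfac; unfold cut_slice; simpl; abs1; try lra.

(** At tX = tY = PI both sides of the relation vanish. A word of two arcs with arbitrary angles up
    to PI is thus a slice of pattern (I) with these times. *)
Lemma constraint_PI : closed_constraint PI_I PI PI 0.
Proof. simpl; assert (H := PI_RGT_0); rewrite cos_PI2; repeat split; lra. Qed.

Ltac two_arcs gs x y := exists (cut_slice PI_I gs (0, 2)%nat), PI, PI, 0, x, y;
  split; [in_slices|split; [split; [exact constraint_PI|split; simpl; lra]|split; [lra|split; [word_eq|cost_eq]]]].

Ltac form2 gs tx ty x y := 
    exists (cut_slice PI_I gs (0, 3)%nat), tx, ty, 0, x, y;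
    split; [in_slices|split; [split; [simpl; simpl in *; lra|split; simpl; lra]|split; [simpl in *; lra|split; [word_eq|cost_eq]]]].
Ltac form3 gs tx ty x y :=
    exists (cut_slice PI_I gs (0, 4)%nat), tx, ty, 0, x, y;
    split; [in_slices|split; [split; [simpl; simpl in *; lra|split; simpl; lra]|split; [simpl in *; lra|split; [word_eq|cost_eq]]]].
Ltac allB gs tx ty x y HW :=
    destruct HW as [(-> & ->)|[(H1 & H2 & -> & ->)|(H1 & H2 & -> & ->)]];
      [two_arcs gs x y|form2 gs tx ty x y|form3 gs tx ty x y].

(** The dihedral orbit of the frame matches the eight images of pattern (I). For odd quarter turns
    the two full angles trade places, just as [Gvsig] exchanges the times of X and Y. *)
Lemma realized_B G q T : In G (rots F0 ++ rots (flipF F0)) -> 0 <= T -> words_B G q T -> realized q T.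
Proof.
  intros HG HT (a & b & x & y & Ha & Hb & Hab & Hx & Hy & HW).
  unfold rots in HG; simpl in HG.
  destruct HG as [<-|[<-|[<-|[<-|[<-|[<-|[<-|[<-|[]]]]]]]]].
  - allB (@nil gen) a b x y HW.
  - allB [Gvsig; Grho] b a x y HW.
  - allB [Gnu] a b x y HW.
  - allB [Gnu; Gvsig; Grho] b a x y HW.
  - allB [Grho] a b x y HW.
  - allB [Gnu; Gvsig] b a x y HW.
  - allB [Gnu; Grho] a b x y HW.
  - allB [Gvsig] b a x y HW.
Qed.

Lemma realized_A G q T : G = F0 \/ G = negF F0 -> 0 <= T -> words_A G q T -> realized q T.
Proof.
  intros HG HT (x & y & Hx & Hy & HW); assert (HTX := acos_bound ((c - ka) / (c + ka))); fold (hat_tX ka c) in HTX.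
  destruct HG as [->| ->].
  - destruct HW as [(-> & ->)|[(-> & ->)|(t & Ht & -> & ->)]].
    + two_arcs (@nil gen) x y.
    + two_arcs [Gvsig] x y.
    + rewrite tP_F0 in Ht; exists (cut_slice PI_VIII [] (0, 3)%nat), PI, PI, t, x, y;
        split; [in_slices|split; [split; [simpl; lra|split; simpl; lra]|split; [lra|split; [word_eq|cost_eq]]]].
  - destruct HW as [(-> & ->)|[(-> & ->)|(t & Ht & -> & ->)]].
    + two_arcs [Gnu] x y.
    + two_arcs [Gnu; Gvsig] x y.
    + rewrite tP_neg, tP_F0 in Ht; exists (cut_slice PI_VIII [Gnu] (0, 3)%nat), PI, PI, t, x, y;
        split; [in_slices|split; [split; [simpl; lra|split; simpl; lra]|split; [lra|split; [word_eq|cost_eq]]]].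
Qed.

Lemma exw_cases F p e : exw F p e ->
  (exists y, 0 <= y <= tQ F /\ p = qmul (rt (fP F) (tP F)) (rt (fQ F) y) /\ e = al F * tP F + be F * y) \/
  (exists x, 0 <= x <= tP F /\ p = rt (fP F) x /\ e = al F * x).
Proof.
  intros (x & y & Hx & Hy & [->| ->] & -> & ->); [left; exists y|right; exists x]; repeat split; try lra.
  rewrite rt_0, qmul_1_r; reflexivity.
Qed.

Lemma qrev_rt v t : q3 v = 0 -> qrev (rt v t) = rt v t.
Proof. intros H; apply quat_ext; simpl; rewrite ?H; ring. Qed.

Lemma W_cost : wcost F0 = (1 + ka * c + ka * (ka + c)) / wlen F0.
Proof.
  assert (Hw := wlen_pos F0_ok c_pos); destruct (d_sq F0_ok c_pos) as [Hd Hdd]; assert (Hp := s_pos F0_ok).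
  unfold wcost, wlen in *; simpl in *; set (d := exd 1 ka c) in *; set (s' := Rabs s) in *.
  replace (1 + ka * c + ka * (ka + c)) with (d * d) by (rewrite Hdd; ring); field; lra.
Qed.

Definition sgn (b : bool) (r : R) : R := if b then - r else r.

(** The four shapes of a partial excursion in the letters X and Y: it leaves by P or, in the swapped
    frame, by -Q, and stops in its second or in its first arc. The flag b stands for the negated
    frame. *)
Definition half_word (b : bool) (p : quat) (e : R) : Prop :=
  (exists y, 0 <= y <= hat_tY ka c /\ p = qmul (rt (fP F0) (sgn b (hat_tX ka c))) (rt (fQ F0) (sgn b y)) /\ e = hat_tX ka c + ka * y) \/
  (exists x, 0 <= x <= hat_tX ka c /\ p = rt (fP F0) (sgn b x) /\ e = x) \/
  (exists y, 0 <= y <= hat_tX ka c /\ p = qmul (rt (fQ F0) (sgn (negb b) (hat_tY ka c))) (rt (fP F0) (sgn (negb b) y)) /\ e = ka * hat_tY ka c + y) \/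
  (exists x, 0 <= x <= hat_tY ka c /\ p = rt (fQ F0) (sgn (negb b) x) /\ e = ka * x).

Lemma exw_half_word (b : bool) p e : let G := if b then negF F0 else F0 in exw G p e \/ exw (swapF G) p e -> half_word b p e.
Proof.
  intros G H; destruct (swap_data G) as (S1 & S2 & S3 & S4 & _); destruct (negF_data F0) as (N1 & N2 & N3 & N4 & _).
  assert (EP : tP G = hat_tX ka c) by (unfold G; destruct b; rewrite ?tP_neg; apply tP_F0).
  assert (EQ : tQ G = hat_tY ka c) by (unfold G; destruct b; rewrite ?tQ_neg; apply tQ_F0).
  assert (Ea : al G = 1) by (unfold G; destruct b; reflexivity).
  assert (Eb : be G = ka) by (unfold G; destruct b; reflexivity).
  assert (RP : forall a, rt (fP G) a = rt (fP F0) (sgn b a)).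
  { intros a; unfold G; destruct b; [rewrite N1, rt_opp|]; reflexivity. }
  assert (RQ : forall a, rt (fQ G) a = rt (fQ F0) (sgn b a)).
  { intros a; unfold G; destruct b; [rewrite N2, rt_opp|]; reflexivity. }
  assert (Sn : forall a, sgn b (- a) = sgn (negb b) a) by (intros a; destruct b; simpl; ring).
  destruct H as [H|H]; apply exw_cases in H; destruct H as [(y & Hy & -> & ->)|(y & Hy & -> & ->)].
  - left; exists y; rewrite EP, EQ, Ea, Eb, RP, RQ in *; repeat split; try lra.
  - right; left; exists y; rewrite EP, Ea, RP in *; repeat split; try lra.
  - right; right; left; exists y; rewrite tP_swap, tQ_swap, S1, S2, S3, S4, !rt_opp, RP, RQ, !Sn, EP, EQ, Ea, Eb in *; repeat split; try lra.
  - right; right; right; exists y; rewrite tP_swap, S1, S3, rt_opp, RQ, Sn, EQ, Eb in *; repeat split; try lra.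
Qed.

Lemma half_word_pos b p e : half_word b p e -> 0 <= e.
Proof.
  assert (H1 := tP_range F0_ok c_pos); assert (H2 := tQ_range F0_ok c_pos); rewrite tP_F0 in H1; rewrite tQ_F0 in H2.
  intros [(x & Hx & _ & ->)|[(x & Hx & _ & ->)|[(x & Hx & _ & ->)|(x & Hx & _ & ->)]]]; nra.
Qed.

Lemma abs_W : Rabs (1 + ka * c) = 1 + ka * c /\ Rabs (ka + c) = ka + c.
Proof. split; apply Rabs_right; nra. Qed.

Ltac form5 p gs km t x y := exists (cut_slice p gs km), PI, PI, t, x, y;
  split; [in_slices|split; [split; [simpl; assumption|split; simpl; lra]|split; [lra|split; [word_eq|cost_eq; rewrite (proj1 abs_W), (proj2 abs_W); lra]]]].

Lemma realized_C G q T : G = F0 \/ G = negF F0 -> words_C G q T -> realized q T.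
Proof.
  intros HG (p1 & c1 & p2 & c2 & t & Ht & H1 & H2 & -> & ->).
  assert (Hw := wlen_pos F0_ok c_pos).
  set (t' := t / wlen F0).
  assert (Ht' : 0 <= t') by (apply Rmult_le_pos; [lra|left; apply Rinv_0_lt_compat, Hw]).
  assert (Et : t = t' * wlen F0) by (unfold t'; field; lra).
  assert (Hwc : wcost F0 * t = (1 + ka * c + ka * (ka + c)) * t') by (rewrite W_cost; unfold t'; field; lra).
  assert (R1 : forall a, qrev (rt (fP F0) a) = rt (fP F0) a) by (intros; apply qrev_rt; reflexivity).
  assert (R2 : forall a, qrev (rt (fQ F0) a) = rt (fQ F0) a) by (intros; apply qrev_rt; reflexivity).
  assert (HXY : 0 < hat_tX ka c < PI /\ 0 < hat_tY ka c < PI).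
  { rewrite <- tP_F0, <- tQ_F0; split; [apply (tP_range F0_ok c_pos)|apply (tQ_range F0_ok c_pos)]. }
  assert (HB : exists b : bool, G = (if b then negF F0 else F0)) by (destruct HG as [->| ->]; [exists false|exists true]; reflexivity).
  destruct HB as (b & ->).
  apply exw_half_word in H1; apply exw_half_word in H2.
  assert (EW : rt (wdir (if b then negF F0 else F0)) t = rt (wdir F0) ((if b then - t' else t') * wlen F0)).
  { destruct b; [rewrite wdir_neg, rt_opp|]; f_equal; lra. }
  assert (EC : wcost (if b then negF F0 else F0) * t = (1 + ka * c + ka * (ka + c)) * t').
  { destruct b; [rewrite wcost_neg|]; exact Hwc. }
  assert (Hn1 : 0 <= c1) by (apply (half_word_pos H1)); assert (Hn2 : 0 <= c2) by (apply (half_word_pos H2)).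
  rewrite EW, EC.
  assert (HtT : t' <= c1 + (1 + ka * c + ka * (ka + c)) * t' + c2).
  { assert (0 <= (ka * c + ka * (ka + c)) * t') by (apply Rmult_le_pos; nra); lra. }
  clear Hn1 Hn2 EW EC Et Hwc; clearbody t'; clear t Ht HG.
  unfold half_word in H1, H2.
  destruct b; simpl negb in H1, H2; unfold sgn in H1, H2.
  all: destruct H1 as [(x & Hx & -> & ->)|[(x & Hx & -> & ->)|[(x & Hx & -> & ->)|(x & Hx & -> & ->)]]].
  all: destruct H2 as [(y & Hy & -> & ->)|[(y & Hy & -> & ->)|[(y & Hy & -> & ->)|(y & Hy & -> & ->)]]].
  all: rewrite ?qrev_mul, ?R1, ?R2, <- ?qmul_assoc.
  (* Two halves that leave in the same way give pattern (IV), halves that leave in different ways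
     pattern (V). A half that stops in its first arc shortens the slice at its end. *)
  1: form5 PI_IV [Gnu] (0, 5)%nat t' x y.
  1: form5 PI_IV [Gnu] (0, 4)%nat t' x y.
  1: form5 PI_V [Gnu] (0, 5)%nat t' x y.
  1: form5 PI_V [Gnu] (0, 4)%nat t' x y.
  1: form5 PI_IV [Gnu] (1, 4)%nat t' x y.
  1: form5 PI_IV [Gnu] (1, 3)%nat t' x y.
  1: form5 PI_V [Gnu] (1, 4)%nat t' x y.
  1: form5 PI_V [Gnu] (1, 3)%nat t' x y.
  1: form5 PI_V [Gvsig] (0, 5)%nat t' x y.
  1: form5 PI_V [Gvsig] (0, 4)%nat t' x y.
  1: form5 PI_IV [Gvsig] (0, 5)%nat t' x y.
  1: form5 PI_IV [Gvsig] (0, 4)%nat t' x y.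
  1: form5 PI_V [Gvsig] (1, 4)%nat t' x y.
  1: form5 PI_V [Gvsig] (1, 3)%nat t' x y.
  1: form5 PI_IV [Gvsig] (1, 4)%nat t' x y.
  1: form5 PI_IV [Gvsig] (1, 3)%nat t' x y.
  1: form5 PI_IV (@nil gen) (0, 5)%nat t' x y.
  1: form5 PI_IV (@nil gen) (0, 4)%nat t' x y.
  1: form5 PI_V (@nil gen) (0, 5)%nat t' x y.
  1: form5 PI_V (@nil gen) (0, 4)%nat t' x y.
  1: form5 PI_IV (@nil gen) (1, 4)%nat t' x y.
  1: form5 PI_IV (@nil gen) (1, 3)%nat t' x y.
  1: form5 PI_V (@nil gen) (1, 4)%nat t' x y.
  1: form5 PI_V (@nil gen) (1, 3)%nat t' x y.
  1: form5 PI_V [Gnu; Gvsig] (0, 5)%nat t' x y.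
  1: form5 PI_V [Gnu; Gvsig] (0, 4)%nat t' x y.
  1: form5 PI_IV [Gnu; Gvsig] (0, 5)%nat t' x y.
  1: form5 PI_IV [Gnu; Gvsig] (0, 4)%nat t' x y.
  1: form5 PI_V [Gnu; Gvsig] (1, 4)%nat t' x y.
  1: form5 PI_V [Gnu; Gvsig] (1, 3)%nat t' x y.
  1: form5 PI_IV [Gnu; Gvsig] (1, 4)%nat t' x y.
  1: form5 PI_IV [Gnu; Gvsig] (1, 3)%nat t' x y.
Qed.
End Patterns.

(** * Letting the penalty tend to infinity *)

Lemma ultra_pigeonhole {A : Type} (U : (nat -> Prop) -> Prop) {FU : ProperFilter U} :
  (forall P, U P \/ U (fun n => ~ P n)) ->
  forall (l : list A) (f : nat -> A), U (fun n => In (f n) l) -> exists a, In a l /\ U (fun n => f n = a).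
Proof.
  intros HU l; induction l as [|a l IH]; intros f Hf.
  - exfalso; apply (@filter_not_empty _ U _); revert Hf; apply filter_imp; simpl; tauto.
  - destruct (HU (fun n => f n = a)) as [H|H]; [exists a; split; [left; reflexivity|exact H]|].
    destruct (IH f) as (b & Hb & Hfb).
    + generalize (filter_and _ _ Hf H); apply filter_imp; intros n [[E|E] N]; [congruence|exact E].
    + exists b; split; [right; exact Hb|exact Hfb].
Qed.

Lemma flim_ext_U (U : (nat -> Prop) -> Prop) {FU : ProperFilter U} u v a :
  U (fun n => u n = v n) -> @flim U u a -> @flim U v a.
Proof. intros H; apply filterlim_ext_loc; exact H. Qed.

Section Limit.
Variables (ka c s : R).
Hypothesis Hka : 0 < ka.
Hypothesis Hkc : ka <= c.
Hypothesis Hs : 0 < s.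
Hypothesis Hcs : c * c + s * s = 1.
Context {U : (nat -> Prop) -> Prop} {FU : ProperFilter U}.

Lemma qlim_rt u x y : @flim U x y -> @qlim U (fun n => rt u (x n)) (rt u y).
Proof.
  intros H; unfold rt; apply qlim_add; (apply qlim_scal; [|apply qlim_const]).
  - apply (flim_cont x y (fun z => cos (z / 2))); [|exact H].
    apply (ex_derive_continuous (fun z => cos (z / 2))); auto_derive; exact I.
  - apply (flim_cont x y (fun z => sin (z / 2))); [|exact H].
    apply (ex_derive_continuous (fun z => sin (z / 2))); auto_derive; exact I.
Qed.

Lemma qlim_feval x y a b : @flim U x y -> @qlim U (fun n => feval ka c s (mkF (x n) a b)) (feval ka c s (mkF y a b)).
Proof.
  intros H; destruct (qexp_polar (vec (F0 ka c s) a b)) as (u & k & Hu & _ & E & _).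
  { unfold vec; simpl; ring. }
  unfold feval; simpl; rewrite (rt_qexp y Hu E).
  apply qlim_ext with (fun n => rt u (x n * k)).
  { intros n; rewrite (rt_qexp (x n) Hu E); reflexivity. }
  apply qlim_rt, flim_mult; [exact H|apply flim_const].
Qed.

Variables (tX tY t x y : nat -> R) (lX lY lt lx ly : R).
Hypothesis LX : @flim U tX lX.
Hypothesis LY : @flim U tY lY.
Hypothesis Lt : @flim U t lt.
Hypothesis Lx : @flim U x lx.
Hypothesis Ly : @flim U y ly.

Lemma flim_tm m : @flim U (fun n => tm_val ka c (tX n) (tY n) (t n) m) (tm_val ka c lX lY lt m).
Proof. destruct m; simpl; try assumption; apply flim_const. Qed.

Lemma fq_app w w' : fq ka c s (w ++ w') = qmul (fq ka c s w) (fq ka c s w').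
Proof.
  induction w as [|f w IH]; simpl; [rewrite qmul_1_l; reflexivity|].
  change (qmul (feval ka c s f) (fq ka c s (w ++ w')) = qmul (qmul (feval ka c s f) (fq ka c s w)) (fq ka c s w')).
  rewrite IH; apply qmul_assoc.
Qed.

Lemma word_cost_app w w' : word_cost ka (w ++ w') = word_cost ka w + word_cost ka w'.
Proof.
  induction w as [|f w IH]; simpl; [ring|].
  unfold word_cost in *; rewrite IH; ring.
Qed.

Lemma qlim_mid l : @qlim U (fun n => fq ka c s (pattern_word ka c (tX n) (tY n) (t n) l)) (fq ka c s (pattern_word ka c lX lY lt l)).
Proof.
  induction l as [|e l IH]; simpl; [apply qlim_const|].
  apply qlim_mul; [|exact IH].
  apply (qlim_feval _ _ (flim_tm (fst e))).
Qed.

Lemma flim_mid l : @flim U (fun n => word_cost ka (pattern_word ka c (tX n) (tY n) (t n) l)) (word_cost ka (pattern_word ka c lX lY lt l)).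
Proof.
  induction l as [|e l IH]; simpl; [apply flim_const|].
  apply flim_plus; [|exact IH].
  apply flim_mult; [apply flim_tm|apply flim_const].
Qed.

Lemma fq_cw i a b e x' y' : fq ka c s (cw ka c i a b e x' y')
  = qmul (feval ka c s (lfac ka c x' (snd (s_first i))))
      (qmul (fq ka c s (pattern_word ka c a b e (s_mid i))) (feval ka c s (lfac ka c y' (snd (s_last i))))).
Proof.
  unfold cw; cbn [fq fold_right]; fold (fq ka c s (pattern_word ka c a b e (s_mid i) ++ [lfac ka c y' (snd (s_last i))])).
  rewrite fq_app; cbn [fq fold_right]; rewrite qmul_1_r; reflexivity.
Qed.

Lemma cost_cw i a b e x' y' : word_cost ka (cw ka c i a b e x' y')
  = word_cost ka [lfac ka c x' (snd (s_first i))] +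
      (word_cost ka (pattern_word ka c a b e (s_mid i)) + word_cost ka [lfac ka c y' (snd (s_last i))]).
Proof. rewrite <- word_cost_app, <- word_cost_app; reflexivity. Qed.

Lemma flim_letter u l a : @flim U u l -> @flim U (fun n => word_cost ka [lfac ka c (u n) a]) (word_cost ka [lfac ka c l a]).
Proof.
  intros L; simpl; apply flim_plus; [apply flim_mult; [exact L|apply flim_const]|apply flim_const].
Qed.

Lemma qlim_cw i : @qlim U (fun n => fq ka c s (cw ka c i (tX n) (tY n) (t n) (x n) (y n))) (fq ka c s (cw ka c i lX lY lt lx ly)).
Proof.
  rewrite fq_cw; eapply qlim_ext; [intros n; symmetry; apply fq_cw|].
  apply qlim_mul; [apply qlim_feval, Lx|]; apply qlim_mul; [apply qlim_mid|apply qlim_feval, Ly].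
Qed.

Lemma flim_cw i : @flim U (fun n => word_cost ka (cw ka c i (tX n) (tY n) (t n) (x n) (y n))) (word_cost ka (cw ka c i lX lY lt lx ly)).
Proof.
  rewrite cost_cw; eapply flim_ext; [intros n; symmetry; apply cost_cw|].
  apply flim_plus; [apply flim_letter, Lx|]; apply flim_plus; [apply flim_mid|apply flim_letter, Ly].
Qed.

Lemma flim_between u l a b : U (fun n => a <= u n <= b) -> @flim U u l -> a <= l <= b.
Proof.
  intros H L; split.
  - apply (flim_le (fun _ => a) u); [revert H; apply filter_imp; intros n Hn; apply Hn|apply flim_const|exact L].
  - apply (flim_le u (fun _ => b)); [revert H; apply filter_imp; intros n Hn; apply Hn|exact L|apply flim_const].
Qed.

Lemma cw_valid_lim i : U (fun n => cw_valid ka c i (tX n) (tY n) (t n) (x n) (y n)) -> cw_valid ka c i lX lY lt lx ly.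
Proof.
  intros H; unfold cw_valid in *; split; [|split].
  - assert (H1 : U (fun n => closed_constraint ka c (s_pat i) (tX n) (tY n) (t n))) by (revert H; apply filter_imp; tauto); clear H.
    destruct (s_pat i); simpl in *.
    + split; [|split].
      * apply (@flim_between tX); [revert H1; apply filter_imp; tauto|exact LX].
      * apply (@flim_between tY); [revert H1; apply filter_imp; tauto|exact LY].
      * assert (Hh : forall f, continuous f (lX / 2) -> @flim U (fun n => f (tX n / 2)) (f (lX / 2))).
        { intros f Hf; apply (flim_cont (fun n => tX n / 2) (lX / 2) f Hf); apply flim_mult; [exact LX|apply flim_const]. }
        assert (Hh' : forall f, continuous f (lY / 2) -> @flim U (fun n => f (tY n / 2)) (f (lY / 2))).
        { intros f Hf; apply (flim_cont (fun n => tY n / 2) (lY / 2) f Hf); apply flim_mult; [exact LY|apply flim_const]. }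
        apply (@flim_unique U FU (fun n => sin (tX n / 2) * cos (tY n / 2))).
        -- apply flim_mult; [apply Hh, continuous_sin|apply Hh', continuous_cos].
        -- apply flim_ext_U with (fun n => ka * (cos (tX n / 2) * sin (tY n / 2))); [exact FU| |].
           ++ revert H1; apply filter_imp; intros n Hn; symmetry; apply Hn.
           ++ apply flim_mult; [apply flim_const|]; apply flim_mult; [apply Hh, continuous_cos|apply Hh', continuous_sin].
    + apply (flim_le (fun _ => 0) t); [exact H1|apply flim_const|exact Lt].
    + apply (flim_le (fun _ => 0) t); [exact H1|apply flim_const|exact Lt].
    + apply (@flim_between t); [exact H1|exact Lt].
  - split.
    + apply (flim_le (fun _ => 0) x); [revert H; apply filter_imp; tauto|apply flim_const|exact Lx].
    + eapply flim_le; [|exact Lx|apply flim_tm]; revert H; apply filter_imp; tauto.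
  - split.
    + apply (flim_le (fun _ => 0) y); [revert H; apply filter_imp; tauto|apply flim_const|exact Ly].
    + eapply flim_le; [|exact Ly|apply flim_tm]; revert H; apply filter_imp; tauto.
Qed.
End Limit.

Lemma ip_one p q : ip p p = 1 -> ip q q = 1 -> ip p q = 1 -> p = q.
Proof.
  unfold ip; intros H1 H2 H3.
  assert (H : (q0 p - q0 q) * (q0 p - q0 q) + (q1 p - q1 q) * (q1 p - q1 q) + (q2 p - q2 q) * (q2 p - q2 q) + (q3 p - q3 q) * (q3 p - q3 q) = 0) by lra.
  assert (S0 := Rle_0_sqr (q0 p - q0 q)); assert (S1 := Rle_0_sqr (q1 p - q1 q)).
  assert (S2 := Rle_0_sqr (q2 p - q2 q)); assert (S3 := Rle_0_sqr (q3 p - q3 q)); unfold Rsqr in *.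
  apply quat_ext; apply Rminus_diag_uniq, Rsqr_0_uniq; unfold Rsqr; lra.
Qed.

(** The minimiser for weight n has value at most that of any word for [gh] or its opposite, where
    the penalty is 0. So its cost is a lower bound for all of them, while n times its penalty is at
    most x0. *)
Theorem best_word ka c s gh x0 : 0 < ka -> ka <= c -> 0 < s -> c * c + s * s = 1 -> ip gh gh = 1 ->
  reach (F0 ka c s) gh x0 ->
  exists i tX tY t x y, In i slices /\ cw_valid ka c i tX tY t x y /\ (0 <= tX /\ 0 <= tY /\ 0 <= t) /\
    (fq ka c s (cw ka c i tX tY t x y) = gh \/ fq ka c s (cw ka c i tX tY t x y) = qopp gh) /\
    forall q z, q = gh \/ q = qopp gh -> reach (F0 ka c s) q z -> word_cost ka (cw ka c i tX tY t x y) <= z.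
Proof.
  intros Hka Hkc Hs Hcs Hgh HR0.
  set (F := F0 ka c s) in *.
  assert (OK : frame_ok F) by (apply F0_ok; assumption).
  assert (HPI := PI_RGT_0).
  (* The data for weight n are packed into one tuple, so that a single choice selects them all. *)
  assert (Hn : forall n : nat, exists r : (slice * (R * R) * (R * R) * R) * (quat * R),
     let '((((i, (tX, tY)), (x, y)), t), (q, T)) := r in
     In i slices /\ cw_valid ka c i tX tY t x y /\ (0 <= tX <= PI /\ 0 <= tY <= PI /\ 0 <= t <= T + 2 * PI) /\
     fq ka c s (cw ka c i tX tY t x y) = q /\ word_cost ka (cw ka c i tX tY t x y) = T /\
     ip q q = 1 /\ 0 <= T /\ forall p z, p = gh \/ p = qopp gh -> reach F p z -> T + INR n * pen gh q <= z).
  { intros n; destruct (ext_exists F (INR n) gh OK (pos_INR n) Hgh) as (T & ga & A & B & E).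
    assert (HT := ex_T _ _ _ _ _ _ _ E).
    assert (HW : realized ka c s (ga T) T).
    { destruct (extremal_words OK E) as [(G & HG & HW)|[(G & HG & HW)|(G & HG & HW)]].
      - simpl; lra.
      - eapply realized_A; eassumption.
      - eapply realized_B; eassumption.
      - eapply realized_C; eassumption. }
    destruct HW as (i & tX & tY & t & x & y & H1 & H2 & H3 & H4 & H5).
    exists (((i, (tX, tY)), (x, y), t), (ga T, T)).
    split; [exact H1|]; split; [exact H2|]; split; [exact H3|]; split; [exact H4|]; split; [exact H5|].
    split; [apply (ex_u _ _ _ _ _ _ _ E); lra|]; split; [exact HT|].
    intros p z Hp HR.
    assert (Hm := ex_min _ _ _ _ _ _ _ E 0 T p z ltac:(lra) ltac:(lra) HR).
    rewrite (ex_0 _ _ _ _ _ _ _ E), qmul_1_l, qmul_conj_l, qmul_1_r in Hm by (apply (ex_u _ _ _ _ _ _ _ E); lra).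
    assert (Hp0 : pen gh p = 0).
    { unfold pen; destruct Hp as [->| ->]; [|unfold qopp; rewrite ip_scal_l]; rewrite Hgh; ring. }
    rewrite Hp0 in Hm; lra. }
  apply functional_choice in Hn; destruct Hn as (r & Hr).
  set (ii := fun n => fst (fst (fst (fst (r n))))).
  set (tX := fun n => fst (snd (fst (fst (fst (r n)))))); set (tY := fun n => snd (snd (fst (fst (fst (r n)))))).
  set (x := fun n => fst (snd (fst (fst (r n))))); set (y := fun n => snd (snd (fst (fst (r n))))).
  set (t := fun n => snd (fst (r n))); set (q := fun n => fst (snd (r n))); set (T := fun n => snd (snd (r n))).
  assert (HH : forall n, In (ii n) slices /\ cw_valid ka c (ii n) (tX n) (tY n) (t n) (x n) (y n) /\
     (0 <= tX n <= PI /\ 0 <= tY n <= PI /\ 0 <= t n <= T n + 2 * PI) /\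
     fq ka c s (cw ka c (ii n) (tX n) (tY n) (t n) (x n) (y n)) = q n /\ word_cost ka (cw ka c (ii n) (tX n) (tY n) (t n) (x n) (y n)) = T n /\
     ip (q n) (q n) = 1 /\ 0 <= T n /\ forall p z, p = gh \/ p = qopp gh -> reach F p z -> T n + INR n * pen gh (q n) <= z).
  { intros n; specialize (Hr n); unfold ii, tX, tY, x, y, t, q, T; destruct (r n) as [[[[i' [a b]] [a' b']] t'] [q' T']]; exact Hr. }
  clearbody ii tX tY x y t q T; clear Hr r.
  assert (HT : forall n, 0 <= T n <= x0 /\ INR n * pen gh (q n) <= x0 /\ 0 <= pen gh (q n)).
  { intros n; destruct (HH n) as (_ & _ & _ & _ & _ & Hq & HT & Hm); specialize (Hm gh x0 (or_introl eq_refl) HR0).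
    assert (Hp := pen_pos gh (q n) Hgh Hq); assert (0 <= INR n * pen gh (q n)) by (apply Rmult_le_pos; [apply pos_INR|exact Hp]); lra. }
  destruct ultrafilter_exists as (U & FU & HU & Hev).
  assert (BL := @ultra_limit U FU HU).
  set (M := x0 + 2 * PI).
  assert (Htm : forall n m, tm_val ka c (tX n) (tY n) (t n) m <= M).
  { intros n m; destruct (HH n) as (_ & _ & HB & _); destruct (HT n) as (HT1 & _); unfold M.
    destruct m; simpl; try lra.
    - unfold hat_tX; assert (Hb := acos_bound ((c - ka) / (c + ka))); lra.
    - unfold hat_tY; assert (Hb := acos_bound (- ((1 - ka * c) / (1 + ka * c)))); lra. }
  destruct (BL tX PI) as (lX & LX); [intros n; destruct (HH n) as (_ & _ & HB & _); rewrite Rabs_right; lra|].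
  destruct (BL tY PI) as (lY & LY); [intros n; destruct (HH n) as (_ & _ & HB & _); rewrite Rabs_right; lra|].
  destruct (BL t M) as (lt & Lt); [intros n; destruct (HH n) as (_ & _ & HB & _); destruct (HT n) as (HT1 & _); unfold M; rewrite Rabs_right; lra|].
  destruct (BL x M) as (lx & Lx).
  { intros n; destruct (HH n) as (_ & (_ & HV & _) & _); assert (Hb := Htm n (fst (s_first (ii n)))); rewrite Rabs_right; lra. }
  destruct (BL y M) as (ly & Ly).
  { intros n; destruct (HH n) as (_ & (_ & _ & HV) & _); assert (Hb := Htm n (fst (s_last (ii n)))); rewrite Rabs_right; lra. }
  (* The slice varies with n; as the list is finite, one slice occurs for almost all n. *)
  destruct (@ultra_pigeonhole slice U FU HU slices ii) as (i & Hi & Ui).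
  { apply filter_forall; intros n; apply HH. }
  exists i, lX, lY, lt, lx, ly; split; [exact Hi|]; split.
  { eapply cw_valid_lim; try eassumption; revert Ui; apply filter_imp; intros n <-; apply HH. }
  split.
  { split; [|split].
    - apply (@flim_le U FU (fun _ => 0) tX); [apply filter_forall; intros n; apply HH|apply flim_const|exact LX].
    - apply (@flim_le U FU (fun _ => 0) tY); [apply filter_forall; intros n; apply HH|apply flim_const|exact LY].
    - apply (@flim_le U FU (fun _ => 0) t); [apply filter_forall; intros n; apply HH|apply flim_const|exact Lt]. }
  assert (LQ : @qlim U (fun n => fq ka c s (cw ka c i (tX n) (tY n) (t n) (x n) (y n))) (fq ka c s (cw ka c i lX lY lt lx ly)))
    by (apply qlim_cw; assumption).
  assert (LC : @flim U (fun n => word_cost ka (cw ka c i (tX n) (tY n) (t n) (x n) (y n))) (word_cost ka (cw ka c i lX lY lt lx ly)))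
    by (apply flim_cw; assumption).
  set (w := cw ka c i lX lY lt lx ly) in *.
  assert (LI := flim_ip _ _ _ _ LQ (qlim_const gh)).
  assert (LN := flim_ip _ _ _ _ LQ LQ).
  assert (EN : ip (fq ka c s w) (fq ka c s w) = 1).
  { apply (@flim_unique U FU _ _ _ LN); apply flim_ext_U with (fun _ => 1); [exact FU| |apply flim_const].
    revert Ui; apply filter_imp; intros n <-; destruct (HH n) as (_ & _ & _ & -> & _ & -> & _); reflexivity. }
  assert (LP : @flim U (fun n => pen gh (q n)) (pen gh (fq ka c s w))).
  { assert (LI' : @flim U (fun n => ip (q n) gh) (ip (fq ka c s w) gh)).
    { refine (@flim_ext_U U FU _ _ _ _ LI); revert Ui; apply filter_imp; intros n <-; destruct (HH n) as (_ & _ & _ & -> & _); reflexivity. }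
    unfold pen; apply flim_minus; [apply flim_const|apply flim_mult; exact LI']. }
  (* The penalties are at most x0 / n, so the limit word has penalty 0. *)
  assert (Hp0 : pen gh (fq ka c s w) <= 0).
  { apply Rnot_lt_le; intros Hpos; set (p := pen gh (fq ka c s w)) in *.
    destruct (INR_unbounded (2 * x0 / p)) as (N & HN).
    assert (p / 2 >= p); [|lra].
    apply Rle_ge, (@flim_le U FU (fun n => pen gh (q n)) (fun _ => p / 2)); [|exact LP|apply flim_const].
    generalize (Hev N); apply filter_imp; intros n Hn.
    destruct (HT n) as (_ & H1 & H2).
    apply le_INR in Hn.
    assert (Hx : 2 * x0 < INR n * p).
    { apply Rle_lt_trans with (2 * x0 / p * p); [right; field; lra|].
      apply Rmult_lt_compat_r; lra. }
    apply Rnot_lt_le; intros Hlt.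
    assert (0 < INR n).
    { destruct (Rle_lt_dec (INR n) 0) as [H0|H0]; [|exact H0].
      assert (0 <= x0) by (apply (reach_pos F OK gh x0 HR0)).
      assert (INR n = 0) by (generalize (pos_INR n); lra); rewrite H0 in *; nra. }
    nra. }
  split.
  - assert (Hq1 : ip (fq ka c s w) gh * ip (fq ka c s w) gh = 1).
    { assert (Hp1 := pen_pos gh _ Hgh EN); unfold pen in *; lra. }
    assert (Hq2 : (ip (fq ka c s w) gh - 1) * (ip (fq ka c s w) gh + 1) = 0) by lra.
    apply Rmult_integral in Hq2; destruct Hq2 as [H|H].
    + left; apply ip_one; [exact EN|exact Hgh|lra].
    + right; apply ip_one; [exact EN| |].
      * unfold qopp; rewrite ip_scal_l, ip_comm, ip_scal_l, Hgh; ring.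
      * rewrite ip_comm; unfold qopp; rewrite ip_scal_l, ip_comm; lra.
  - intros p z Hp HR.
    apply (@flim_le U FU _ (fun _ => z) _ _) with (2 := LC); [|apply flim_const].
    revert Ui; apply filter_imp; intros n <-; destruct (HH n) as (_ & _ & _ & _ & -> & _ & _ & Hm).
    specialize (Hm p z Hp HR); destruct (HT n) as (_ & _ & H2).
    assert (0 <= INR n * pen gh (q n)) by (apply Rmult_le_pos; [apply pos_INR|exact H2]); lra.
Qed.

(** * Quaternions and rotations *)

Definition qmat (q : quat) : M3 :=
  let a := q0 q in let x := q1 q in let y := q2 q in let z := q3 q in
  mkM (a * a + x * x - y * y - z * z) (2 * (x * y - a * z)) (2 * (x * z + a * y))
      (2 * (x * y + a * z)) (a * a - x * x + y * y - z * z) (2 * (y * z - a * x))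
      (2 * (x * z - a * y)) (2 * (y * z + a * x)) (a * a - x * x - y * y + z * z).

Lemma M3_ext (A B : M3) : m11 A = m11 B -> m12 A = m12 B -> m13 A = m13 B -> m21 A = m21 B -> m22 A = m22 B ->
  m23 A = m23 B -> m31 A = m31 B -> m32 A = m32 B -> m33 A = m33 B -> A = B.
Proof. destruct A, B; simpl; intros; subst; reflexivity. Qed.

Ltac mring := apply M3_ext; simpl; ring.

Lemma mmul_assoc A B C : mmul A (mmul B C) = mmul (mmul A B) C.
Proof. mring. Qed.
Lemma mmul_1_l A : mmul Defs.mid A = A.
Proof. mring. Qed.
Lemma mmul_1_r A : mmul A Defs.mid = A.
Proof. mring. Qed.
Lemma mtr_mul A B : mtr (mmul A B) = mmul (mtr B) (mtr A).
Proof. mring. Qed.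

Lemma qmat_mul p q : qmat (qmul p q) = mmul (qmat p) (qmat q).
Proof. mring. Qed.
Lemma qmat_one : qmat qone = Defs.mid.
Proof. mring. Qed.
Lemma qmat_opp q : qmat (qopp q) = qmat q.
Proof. mring. Qed.

(** The matrix and the norm determine all products of two coordinates. Hence the square of the inner
    product of p and q equals that of q with itself, which is 1, the case of equality in Cauchy's
    inequality. *)
Lemma qmat_inj p q : ip p p = 1 -> ip q q = 1 -> qmat p = qmat q -> p = q \/ p = qopp q.
Proof.
  intros Hp Hq H.
  assert (E1 := f_equal m11 H); assert (E2 := f_equal m12 H); assert (E3 := f_equal m13 H).
  assert (E4 := f_equal m21 H); assert (E5 := f_equal m22 H); assert (E6 := f_equal m23 H).
  assert (E7 := f_equal m31 H); assert (E8 := f_equal m32 H); assert (E9 := f_equal m33 H).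
  simpl in *; clear H; unfold ip in Hp, Hq.
  assert (S00 : q0 p * q0 p = q0 q * q0 q) by lra; assert (S11 : q1 p * q1 p = q1 q * q1 q) by lra.
  assert (S22 : q2 p * q2 p = q2 q * q2 q) by lra; assert (S33 : q3 p * q3 p = q3 q * q3 q) by lra.
  assert (S01 : q0 p * q1 p = q0 q * q1 q) by lra; assert (S02 : q0 p * q2 p = q0 q * q2 q) by lra.
  assert (S03 : q0 p * q3 p = q0 q * q3 q) by lra; assert (S12 : q1 p * q2 p = q1 q * q2 q) by lra.
  assert (S13 : q1 p * q3 p = q1 q * q3 q) by lra; assert (S23 : q2 p * q3 p = q2 q * q3 q) by lra.
  assert (HI : ip p q * ip p q = 1).
  { unfold ip.
    transitivity ((q0 p * q0 p) * (q0 q * q0 q) + (q1 p * q1 p) * (q1 q * q1 q) + (q2 p * q2 p) * (q2 q * q2 q) + (q3 p * q3 p) * (q3 q * q3 q)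
      + 2 * ((q0 p * q1 p) * (q0 q * q1 q) + (q0 p * q2 p) * (q0 q * q2 q) + (q0 p * q3 p) * (q0 q * q3 q)
      + (q1 p * q2 p) * (q1 q * q2 q) + (q1 p * q3 p) * (q1 q * q3 q) + (q2 p * q3 p) * (q2 q * q3 q))); [ring|].
    rewrite S00, S11, S22, S33, S01, S02, S03, S12, S13, S23.
    transitivity ((q0 q * q0 q + q1 q * q1 q + q2 q * q2 q + q3 q * q3 q) * (q0 q * q0 q + q1 q * q1 q + q2 q * q2 q + q3 q * q3 q)); [ring|rewrite Hq; ring]. }
  assert (H2 : (ip p q - 1) * (ip p q + 1) = 0) by lra.
  apply Rmult_integral in H2; destruct H2 as [H|H].
  - left; apply ip_one; [exact Hp|exact Hq|lra].
  - right; apply ip_one; [exact Hp| |].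
    + unfold ip in *; simpl; lra.
    + unfold ip in *; simpl; lra.
Qed.

Lemma qmat_rt u v th : u * u + v * v = 1 -> qmat (rt (pl u v) th) = rot_unit th (mkV u v 0).
Proof.
  intros Huv.
  assert (Hc : cos th = cos (th / 2) * cos (th / 2) - sin (th / 2) * sin (th / 2)) by (rewrite <- cos_plus; f_equal; field).
  assert (Hn : sin th = 2 * sin (th / 2) * cos (th / 2)) by (rewrite <- sin_2a; f_equal; field).
  assert (H1 : cos (th / 2) * cos (th / 2) = 1 - sin (th / 2) * sin (th / 2)) by (generalize (sin2_cos2 (th / 2)); unfold Rsqr; lra).
  unfold qmat, rot_unit, rt; simpl; rewrite Hc, Hn.
  set (C := cos (th / 2)) in *; set (S := sin (th / 2)) in *.
  assert (Hv : v * v = 1 - u * u) by lra.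
  apply M3_ext; simpl; try ring [H1]; ring [H1 Hv].
Qed.

Lemma polar x y : x * x + y * y = 1 -> exists t, 0 <= t /\ x = cos t /\ y = sin t.
Proof.
  intros H; assert (Hx : -1 <= x <= 1) by nra.
  assert (Hb := acos_bound x); assert (Hc := cos_acos x Hx).
  assert (Hs : sin (acos x) * sin (acos x) = y * y) by (generalize (sin2_cos2 (acos x)); unfold Rsqr; rewrite Hc; lra).
  assert (Hs0 : 0 <= sin (acos x)) by (apply sin_ge_0; lra).
  destruct (Rle_lt_dec 0 y) as [Hy|Hy].
  - exists (acos x); repeat split; [lra|symmetry; exact Hc|].
    apply Rsqr_inj; [lra|exact Hs0|]; unfold Rsqr; lra.
  - exists (2 * PI - acos x); repeat split; [lra| |].
    + rewrite cos_minus, cos_2PI, sin_2PI, Hc; ring.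
    + rewrite sin_minus, cos_2PI, sin_2PI.
      assert (- y = sin (acos x)); [|lra].
      apply Rsqr_inj; [lra|exact Hs0|]; unfold Rsqr; lra.
Qed.

Lemma SO3_mul A B : SO3 A -> SO3 B -> SO3 (mmul A B).
Proof.
  intros [A1 A2] [B1 B2]; split.
  - rewrite mtr_mul, <- mmul_assoc, (mmul_assoc (mtr A)), A1, mmul_1_l; exact B1.
  - transitivity (mdet A * mdet B); [unfold mdet; simpl; ring|rewrite A2, B2; ring].
Qed.

Lemma SO3_qmat q : ip q q = 1 -> SO3 (qmat q).
Proof.
  unfold ip; intros H; split.
  - apply M3_ext; simpl; try ring;
      transitivity ((q0 q * q0 q + q1 q * q1 q + q2 q * q2 q + q3 q * q3 q) * (q0 q * q0 q + q1 q * q1 q + q2 q * q2 q + q3 q * q3 q));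
      try ring; rewrite H; ring.
  - transitivity ((q0 q * q0 q + q1 q * q1 q + q2 q * q2 q + q3 q * q3 q) * (q0 q * q0 q + q1 q * q1 q + q2 q * q2 q + q3 q * q3 q) * (q0 q * q0 q + q1 q * q1 q + q2 q * q2 q + q3 q * q3 q)).
    + unfold mdet; simpl; ring.
    + rewrite H; ring.
Qed.

Lemma mtr_qmat q : mtr (qmat q) = qmat (qconj q).
Proof. mring. Qed.

Lemma SO3_fix N : SO3 N -> m11 N = 1 -> m21 N = 0 -> m31 N = 0 -> exists t, 0 <= t /\ N = qmat (rt (pl 1 0) t).
Proof.
  intros [H D] E1 E2 E3.
  assert (F12 := f_equal m12 H); assert (F13 := f_equal m13 H); assert (F22 := f_equal m22 H); assert (F33 := f_equal m33 H).
  simpl in *; unfold mdet in D; rewrite E1, E2, E3 in *.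
  assert (Z12 : m12 N = 0) by lra; assert (Z13 : m13 N = 0) by lra; rewrite Z12, Z13 in *.
  assert (S : (m22 N - m33 N) * (m22 N - m33 N) + (m23 N + m32 N) * (m23 N + m32 N) = 0) by lra.
  assert (Q1 := Rle_0_sqr (m22 N - m33 N)); assert (Q2 := Rle_0_sqr (m23 N + m32 N)); unfold Rsqr in *.
  assert (W1 : m22 N - m33 N = 0) by (apply Rsqr_0_uniq; unfold Rsqr; lra).
  assert (W2 : m23 N + m32 N = 0) by (apply Rsqr_0_uniq; unfold Rsqr; lra).
  destruct (@polar (m22 N) (m32 N)) as (t & Ht & Ec & Es); [lra|].
  exists t; split; [exact Ht|]; rewrite qmat_rt by ring; unfold rot_unit; simpl; rewrite <- Ec, <- Es.
  apply M3_ext; simpl; rewrite ?E1, ?E2, ?E3, ?Z12, ?Z13; lra.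
Qed.

(** Euler angles about the first and second axis, chosen nonnegative because they become the times
    of a word. *)
Lemma euler N : SO3 N -> exists a b d, 0 <= a /\ 0 <= b /\ 0 <= d /\
  N = qmat (qmul (rt (pl 1 0) a) (qmul (rt (pl 0 1) b) (rt (pl 1 0) d))).
Proof.
  intros HN; assert (H := proj1 HN).
  assert (F11 := f_equal m11 H); simpl in F11.
  set (r := sqrt (m21 N * m21 N + m31 N * m31 N)).
  assert (Hr : r * r = m21 N * m21 N + m31 N * m31 N) by (apply sqrt_sqrt; nra).
  destruct (@polar (m11 N) (- r)) as (b & Hb & Cb & Sb); [lra|].
  assert (HA : exists a, 0 <= a /\ m21 N = - (r * sin a) /\ m31 N = r * cos a).
  { destruct (Req_dec r 0) as [Z|Z].
    - exists 0; rewrite Z in *; repeat split; try lra; nra.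
    - destruct (@polar (m31 N / r) (- (m21 N / r))) as (a & Ha & Ca & Sa).
      + apply Rmult_eq_reg_r with (r * r); [|nra].
        replace ((m31 N / r * (m31 N / r) + - (m21 N / r) * - (m21 N / r)) * (r * r)) with (m21 N * m21 N + m31 N * m31 N) by (field; exact Z); lra.
      + exists a; split; [exact Ha|]; rewrite <- Ca, <- Sa; split; field; exact Z. }
  destruct HA as (a & Ha & M2 & M3').
  assert (U1 : unitv (pl 1 0)) by (split; unfold ip; simpl; ring).
  assert (U2 : unitv (pl 0 1)) by (split; unfold ip; simpl; ring).
  set (p := qmul (rt (pl 1 0) a) (rt (pl 0 1) b)).
  assert (Up : ip p p = 1) by (unfold p; rewrite ip_mul_sq, !ip_rt by assumption; ring).
  assert (EA : qmat p = mmul (rot_unit a (mkV 1 0 0)) (rot_unit b (mkV 0 1 0))).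
  { unfold p; rewrite qmat_mul, !qmat_rt by ring; reflexivity. }
  (* p moves the first basis vector as N does, so p^-1 N fixes that vector and [SO3_fix] applies. *)
  assert (HN' : SO3 (mmul (qmat (qconj p)) N)).
  { apply SO3_mul; [apply SO3_qmat; rewrite ip_conj; exact Up|exact HN]. }
  assert (Ea := sin2_cos2 a); assert (Eb := sin2_cos2 b); unfold Rsqr in Ea, Eb.
  destruct (SO3_fix HN') as (d & Hd & Ed).
  - rewrite <- mtr_qmat, EA; unfold rot_unit; simpl; rewrite Cb, M2, M3'.
    replace r with (- sin b) by lra.
    transitivity (cos b * cos b + sin b * sin b * (sin a * sin a + cos a * cos a)); [ring|rewrite Ea; lra].
  - rewrite <- mtr_qmat, EA; unfold rot_unit; simpl; rewrite Cb, M2, M3'; ring.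
  - rewrite <- mtr_qmat, EA; unfold rot_unit; simpl; rewrite Cb, M2, M3'.
    replace r with (- sin b) by lra.
    transitivity (cos b * sin b * (1 - (sin a * sin a + cos a * cos a))); [ring|rewrite Ea; ring].
  - exists a, b, d; repeat split; try assumption.
    rewrite qmul_assoc, qmat_mul; fold p; rewrite <- Ed, mmul_assoc, <- qmat_mul, qmul_conj_r by exact Up.
    rewrite qmat_one, mmul_1_l; reflexivity.
Qed.

(** * Transfer to the given vectors X and Y *)

Definition madj (A : M3) : M3 :=
  mkM (m22 A * m33 A - m23 A * m32 A) (m13 A * m32 A - m12 A * m33 A) (m12 A * m23 A - m13 A * m22 A)
      (m23 A * m31 A - m21 A * m33 A) (m11 A * m33 A - m13 A * m31 A) (m13 A * m21 A - m11 A * m23 A)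
      (m21 A * m32 A - m22 A * m31 A) (m12 A * m31 A - m11 A * m32 A) (m11 A * m22 A - m12 A * m21 A).

Lemma mmul_adj A : mdet A = 1 -> mmul A (madj A) = Defs.mid.
Proof. unfold mdet; intros H; apply M3_ext; simpl; try ring; rewrite <- H; ring. Qed.

(** The adjugate is a right inverse, hence equal to the left inverse that the definition
    provides. *)
Lemma SO3_tr A : SO3 A -> mmul A (mtr A) = Defs.mid.
Proof.
  intros [H D]; rewrite <- (mmul_1_r (mtr A)), <- (mmul_adj (A := A) D), (mmul_assoc (mtr A)), H, mmul_1_l.
  reflexivity.
Qed.

Section Basis.
Variables (X e : V3) (ka c s : R).
Hypothesis HX : dot X X = 1.
Hypothesis He : dot e e = 1.
Hypothesis HXe : dot X e = 0.
Hypothesis Hka : 0 < ka.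
Hypothesis Hs : 0 < s.
Hypothesis Hcs : c * c + s * s = 1.

Let Y := vadd (vscale c X) (vscale s e).
Definition cross (u v : V3) : V3 :=
  mkV (vy u * vz v - vz u * vy v) (vz u * vx v - vx u * vz v) (vx u * vy v - vy u * vx v).
Definition bmat (u v : V3) : M3 :=
  let w := cross u v in mkM (vx u) (vx v) (vx w) (vy u) (vy v) (vy w) (vz u) (vz v) (vz w).

Lemma bmat_det : mdet (bmat X e) = 1.
Proof.
  transitivity (dot X X * dot e e - dot X e * dot X e); [unfold mdet, dot; simpl; ring|rewrite HX, He, HXe; ring].
Qed.

Lemma bmat_l : mmul (mtr (bmat X e)) (bmat X e) = Defs.mid.
Proof.
  assert (H : dot X X * dot e e - dot X e * dot X e = 1) by (rewrite HX, He, HXe; ring).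
  unfold dot in HX, He, HXe, H; apply M3_ext; simpl; lra.
Qed.

Lemma bmat_r : mmul (bmat X e) (mtr (bmat X e)) = Defs.mid.
Proof. apply SO3_tr; split; [exact bmat_l|exact bmat_det]. Qed.

Lemma bmat_axis : cross e (cross X e) = X /\ cross (cross X e) X = e.
Proof.
  assert (E : forall u v, cross v (cross u v) = vadd (vscale (dot v v) u) (vscale (- dot u v) v)).
  { intros u v; unfold cross, vadd, vscale, dot; simpl; f_equal; ring. }
  assert (E' : forall u v, cross (cross u v) u = vadd (vscale (dot u u) v) (vscale (- dot u v) u)).
  { intros u v; unfold cross, vadd, vscale, dot; simpl; f_equal; ring. }
  rewrite E, E', HX, He, HXe; unfold vadd, vscale; destruct X, e; simpl; split; f_equal; ring.
Qed.

(** The rotation of q written in the orthonormal basis X, e, X x e: the quaternions i and j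
    correspond to X and e, so the second letter of [F0] corresponds to Y. *)
Definition RR (q : quat) : M3 := mmul (bmat X e) (mmul (qmat q) (mtr (bmat X e))).

Lemma RR_mul p q : RR (qmul p q) = mmul (RR p) (RR q).
Proof.
  unfold RR; rewrite qmat_mul.
  transitivity (mmul (bmat X e) (mmul (qmat p) (mmul (mmul (mtr (bmat X e)) (bmat X e)) (mmul (qmat q) (mtr (bmat X e)))))).
  - rewrite bmat_l, mmul_1_l, <- !mmul_assoc; reflexivity.
  - rewrite <- !mmul_assoc; reflexivity.
Qed.

Lemma RR_one : RR qone = Defs.mid.
Proof. unfold RR; rewrite qmat_one, mmul_1_l; apply bmat_r. Qed.

Lemma RR_opp q : RR (qopp q) = RR q.
Proof. unfold RR; rewrite qmat_opp; reflexivity. Qed.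

Lemma RR_inj p q : ip p p = 1 -> ip q q = 1 -> RR p = RR q -> p = q \/ p = qopp q.
Proof.
  intros Hp Hq H; apply qmat_inj; try assumption.
  assert (C : forall r, mmul (mtr (bmat X e)) (mmul (RR r) (bmat X e)) = qmat r).
  { intros r; unfold RR.
    transitivity (mmul (mmul (mtr (bmat X e)) (bmat X e)) (mmul (qmat r) (mmul (mtr (bmat X e)) (bmat X e)))); [rewrite <- !mmul_assoc; reflexivity|].
    rewrite bmat_l, mmul_1_l, mmul_1_r; reflexivity. }
  rewrite <- (C p), <- (C q), H; reflexivity.
Qed.

Lemma RR_rot u v th : u * u + v * v = 1 -> RR (rt (pl u v) th) = rot_unit th (vadd (vscale u X) (vscale v e)).
Proof.
  intros Huv; unfold RR; rewrite qmat_rt by exact Huv.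
  destruct bmat_axis as [A1 A2]; assert (B := bmat_r).
  assert (B1 := f_equal m11 B); assert (B2 := f_equal m12 B); assert (B3 := f_equal m13 B).
  assert (B5 := f_equal m22 B); assert (B6 := f_equal m23 B); assert (B9 := f_equal m33 B).
  assert (C1 := f_equal vx A1); assert (C2 := f_equal vy A1); assert (C3 := f_equal vz A1).
  assert (D1 := f_equal vx A2); assert (D2 := f_equal vy A2); assert (D3 := f_equal vz A2).
  unfold rot_unit, bmat; simpl in *.
  set (w := cross X e) in *.
  replace (vy X * vz e - vz X * vy e) with (vx w) in * by reflexivity.
  replace (vz X * vx e - vx X * vz e) with (vy w) in * by reflexivity.
  replace (vx X * vy e - vy X * vx e) with (vz w) in * by reflexivity.
  clearbody w.
  set (S := sin th); set (C := cos th).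
  apply M3_ext; simpl.
  - transitivity (C * (vx X * vx X + vx e * vx e + vx w * vx w) + (1 - C) * (u * vx X + v * vx e) * (u * vx X + v * vx e)); [ring|rewrite B1; ring].
  - transitivity (C * (vx X * vy X + vx e * vy e + vx w * vy w) + S * - (u * (vx e * vy w - vy e * vx w) + v * (vx w * vy X - vy w * vx X))
      + (1 - C) * (u * vx X + v * vx e) * (u * vy X + v * vy e)); [ring|rewrite B2, C3, D3; ring].
  - transitivity (C * (vx X * vz X + vx e * vz e + vx w * vz w) + S * (u * (vz e * vx w - vx e * vz w) + v * (vz w * vx X - vx w * vz X))
      + (1 - C) * (u * vx X + v * vx e) * (u * vz X + v * vz e)); [ring|rewrite B3, C2, D2; ring].
  - transitivity (C * (vx X * vy X + vx e * vy e + vx w * vy w) + S * (u * (vx e * vy w - vy e * vx w) + v * (vx w * vy X - vy w * vx X))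
      + (1 - C) * (u * vx X + v * vx e) * (u * vy X + v * vy e)); [ring|rewrite B2, C3, D3; ring].
  - transitivity (C * (vy X * vy X + vy e * vy e + vy w * vy w) + (1 - C) * (u * vy X + v * vy e) * (u * vy X + v * vy e)); [ring|rewrite B5; ring].
  - transitivity (C * (vy X * vz X + vy e * vz e + vy w * vz w) + S * - (u * (vy e * vz w - vz e * vy w) + v * (vy w * vz X - vz w * vy X))
      + (1 - C) * (u * vy X + v * vy e) * (u * vz X + v * vz e)); [ring|rewrite B6, C1, D1; ring].
  - transitivity (C * (vx X * vz X + vx e * vz e + vx w * vz w) + S * - (u * (vz e * vx w - vx e * vz w) + v * (vz w * vx X - vx w * vz X))
      + (1 - C) * (u * vx X + v * vx e) * (u * vz X + v * vz e)); [ring|rewrite B3, C2, D2; ring].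
  - transitivity (C * (vy X * vz X + vy e * vz e + vy w * vz w) + S * (u * (vy e * vz w - vz e * vy w) + v * (vy w * vz X - vz w * vy X))
      + (1 - C) * (u * vy X + v * vy e) * (u * vz X + v * vz e)); [ring|rewrite B6, C1, D1; ring].
  - transitivity (C * (vz X * vz X + vz e * vz e + vz w * vz w) + (1 - C) * (u * vz X + v * vz e) * (u * vz X + v * vz e)); [ring|rewrite B9; ring].
Qed.

Lemma RR_feval f : ~ (fa f = 0 /\ fb f = 0) -> RR (feval ka c s f) = rot (ftau f) (fvec X Y f).
Proof.
  destruct f as [t a b]; simpl; intros Hab.
  set (w := fvec X Y (mkF t a b)).
  assert (Ew : w = vadd (vscale (a + b * c) X) (vscale (b * s) e)).
  { unfold w, fvec, Y, vadd, vscale; simpl; f_equal; ring. }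
  assert (Dw : dot w w = (a + b * c) * (a + b * c) + b * s * (b * s)).
  { rewrite Ew; transitivity ((a + b * c) * (a + b * c) * dot X X + b * s * (b * s) * dot e e + 2 * (a + b * c) * (b * s) * dot X e).
    - unfold dot, vadd, vscale; simpl; ring.
    - rewrite HX, He, HXe; ring. }
  assert (Pw : 0 < dot w w).
  { rewrite Dw; destruct (Req_dec b 0) as [->|Hb].
    - assert (a <> 0) by (intros ->; apply Hab; split; reflexivity).
      replace ((a + 0 * c) * (a + 0 * c) + 0 * s * (0 * s)) with (Rsqr a) by (unfold Rsqr; ring); apply Rlt_0_sqr; assumption.
    - assert (0 < Rsqr (b * s)) by (apply Rlt_0_sqr, Rmult_integral_contrapositive_currified; lra); unfold Rsqr in *.
      assert (H0 := Rle_0_sqr (a + b * c)); unfold Rsqr in H0; lra. }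
  unfold rot, vnorm; fold w; set (k := sqrt (dot w w)).
  assert (Hk : 0 < k) by (apply sqrt_lt_R0, Pw).
  assert (Hkk : k * k = dot w w) by (apply sqrt_sqrt; lra).
  assert (Hu : (a + b * c) / k * ((a + b * c) / k) + b * s / k * (b * s / k) = 1).
  { apply Rmult_eq_reg_r with (k * k); [|nra].
    transitivity ((a + b * c) * (a + b * c) + b * s * (b * s)); [field; lra|rewrite <- Dw, Hkk; ring]. }
  unfold feval; simpl.
  rewrite (@rt_qexp ka c s a b (pl ((a + b * c) / k) (b * s / k)) k t).
  - rewrite RR_rot by exact Hu; f_equal.
    rewrite Ew; unfold vadd, vscale; simpl; f_equal; field; lra.
  - split; [reflexivity|]; unfold ip; simpl; lra.
  - apply quat_ext; simpl; field; lra.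
Qed.

Lemma eval_RR w : List.Forall (fun f => 0 <= ftau f /\ ~ (fa f = 0 /\ fb f = 0)) w -> word_eval X Y w = RR (fq ka c s w).
Proof.
  induction 1 as [|f w [_ Hf] _ IH]; [symmetry; apply RR_one|].
  change (word_eval X Y (f :: w)) with (mmul (rot (ftau f) (fvec X Y f)) (word_eval X Y w)).
  change (fq ka c s (f :: w)) with (qmul (feval ka c s f) (fq ka c s w)).
  rewrite RR_mul, IH, (RR_feval f Hf); reflexivity.
Qed.

Lemma reach_word w : List.Forall (fun f => 0 <= ftau f /\ ~ (fa f = 0 /\ fb f = 0)) w ->
  reach (F0 ka c s) (fq ka c s w) (word_cost ka w).
Proof.
  intros H; exists (map (fun f => (ftau f * fa f, ftau f * fb f)) w); split.
  - clear H; induction w as [|f w IH]; [reflexivity|]; simpl; rewrite IH; reflexivity.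
  - induction H as [|f w [Hf _] _ IH]; [apply Rle_refl|]; simpl.
    apply Rplus_le_compat; [|exact IH]; unfold ecost; simpl; rewrite !Rabs_mult, (Rabs_right (ftau f)) by lra.
    right; ring.
Qed.

Lemma fq_unit w : ip (fq ka c s w) (fq ka c s w) = 1.
Proof.
  induction w as [|f w IH]; [unfold ip; simpl; ring|].
  change (fq ka c s (f :: w)) with (qmul (feval ka c s f) (fq ka c s w)); rewrite ip_mul_sq, IH.
  unfold feval, eexp; rewrite ip_qexp; [ring|unfold vec; simpl; ring].
Qed.

(** Supplies the lift of g and the finite cost from which [best_word] starts. *)
Lemma word_exists g : SO3 g -> exists w, is_decomposition X Y w g.
Proof.
  intros Hg.
  assert (HE : SO3 (mtr (bmat X e))).
  { split.
    - transitivity (mmul (bmat X e) (mtr (bmat X e))); [reflexivity|apply bmat_r].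
    - transitivity (mdet (bmat X e)); [unfold mdet; simpl; ring|apply bmat_det]. }
  assert (HE' : SO3 (bmat X e)) by (split; [apply bmat_l|apply bmat_det]).
  destruct (euler (SO3_mul HE (SO3_mul Hg HE'))) as (a & b & d & Ha & Hb & Hd & EN).
  (* The vector - c X + Y is s e and has length s, hence the time b / s for a rotation by b about
     e. *)
  set (w := [mkF a 1 0; mkF (b / s) (- c) 1; mkF d 1 0]).
  assert (HF : List.Forall (fun f => 0 <= ftau f /\ ~ (fa f = 0 /\ fb f = 0)) w).
  { assert (0 <= b / s) by (apply Rmult_le_pos; [lra|left; apply Rinv_0_lt_compat, Hs]).
    unfold w; apply Forall_cons; [|apply Forall_cons; [|apply Forall_cons; [|apply Forall_nil]]]; simpl; split; try assumption; lra. }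
  exists w; split; [exact HF|]; rewrite (eval_RR HF); unfold RR.
  assert (Eq : fq ka c s w = qmul (rt (pl 1 0) a) (qmul (rt (pl 0 1) b) (rt (pl 1 0) d))).
  { unfold w; cbn [fq fold_right]; rewrite qmul_1_r; f_equal; [|f_equal].
    - unfold feval; simpl; rewrite (@rt_qexp ka c s 1 0 (pl 1 0) 1 a); [f_equal; ring|split; unfold ip; simpl; ring|unfold vec; simpl; qring].
    - unfold feval; simpl; rewrite (@rt_qexp ka c s (- c) 1 (pl 0 1) s (b / s)); [f_equal; field; lra|split; unfold ip; simpl; ring|unfold vec; simpl; qring].
    - unfold feval; simpl; rewrite (@rt_qexp ka c s 1 0 (pl 1 0) 1 d); [f_equal; ring|split; unfold ip; simpl; ring|unfold vec; simpl; qring]. }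
  rewrite Eq, <- EN.
  transitivity (mmul (mmul (bmat X e) (mtr (bmat X e))) (mmul g (mmul (bmat X e) (mtr (bmat X e))))); [rewrite <- !mmul_assoc; reflexivity|].
  rewrite bmat_r, mmul_1_l, mmul_1_r; reflexivity.
Qed.
End Basis.

(** * From slices to optimal subwords of the patterns *)

(** Every letter of such a slice carries one of the two times of pattern (I), so the word is the
    identity when both are 0 ([cw_trivial]). *)
Lemma slices_I : List.Forall (fun i => s_pat i = PI_I ->
  List.Forall (fun e => fst e = TX \/ fst e = TY) (s_first i :: s_mid i ++ [s_last i])) slices.
Proof.
  unfold slices; simpl; repeat (apply List.Forall_cons; [intros E; try discriminate E; simpl;
    repeat (apply List.Forall_cons; [simpl; tauto|]); apply List.Forall_nil|]); apply List.Forall_nil.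
Qed.

Lemma label_coef_neq ka c l : 0 < ka -> ka <= c -> c < 1 ->
  ~ (fst (label_coef ka c l) = 0 /\ snd (label_coef ka c l) = 0).
Proof.
  intros H1 H2 H3; assert (0 < ka * c < 1) by nra.
  destruct l as [[] []]; unfold label_coef; simpl; lra.
Qed.

Lemma cw_decomposition ka c i tX tY t x y : 0 < ka -> ka <= c -> c < 1 -> 0 <= tX -> 0 <= tY -> 0 <= t -> 0 <= x -> 0 <= y ->
  List.Forall (fun f => 0 <= ftau f /\ ~ (fa f = 0 /\ fb f = 0)) (cw ka c i tX tY t x y).
Proof.
  intros H1 H2 H3 HtX HtY Ht Hx Hy; unfold cw.
  apply List.Forall_cons; [split; [exact Hx|apply label_coef_neq; assumption]|].
  apply List.Forall_app; split.
  - apply List.Forall_map, List.Forall_forall; intros e _; split; [|apply label_coef_neq; assumption]; simpl.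
    destruct (fst e); simpl; try assumption; try apply acos_bound; left; apply PI_RGT_0.
  - apply List.Forall_cons; [split; [exact Hy|apply label_coef_neq; assumption]|apply List.Forall_nil].
Qed.

Lemma cw_subword ka c i tX tY t x y : slice_ok i -> cw_valid ka c i tX tY t x y ->
  subword (cw ka c i tX tY t x y) (pattern_word ka c tX tY t (apply_gens (s_gens i) (pat (s_pat i)))).
Proof.
  intros [Ei _] (_ & Hx & Hy); right; rewrite Ei.
  exists (pattern_word ka c tX tY t (s_pre i)), (lfac ka c (tm_val ka c tX tY t (fst (s_first i))) (snd (s_first i))),
    (pattern_word ka c tX tY t (s_mid i)), (lfac ka c (tm_val ka c tX tY t (fst (s_last i))) (snd (s_last i))),
    (pattern_word ka c tX tY t (s_post i)), (lfac ka c x (snd (s_first i))), (lfac ka c y (snd (s_last i))).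
  split; [|split; [|split]].
  - unfold pattern_word; rewrite map_app; simpl; rewrite map_app; reflexivity.
  - repeat split; simpl; lra.
  - repeat split; simpl; lra.
  - reflexivity.
Qed.

Lemma feval_0 ka c s a b : feval ka c s (mkF 0 a b) = qone.
Proof. unfold feval; simpl; rewrite !Rmult_0_l; apply eexp_00. Qed.

Lemma cw_trivial ka c s i x y t : List.Forall (fun e => fst e = TX \/ fst e = TY) (s_first i :: s_mid i ++ [s_last i]) ->
  cw_valid ka c i 0 0 t x y -> fq ka c s (cw ka c i 0 0 t x y) = qone.
Proof.
  intros HF (_ & Hx & Hy).
  inversion HF as [|? ? H1 H2]; subst; apply List.Forall_app in H2; destruct H2 as [H2 H3].
  inversion H3 as [|? ? H4 _]; subst.
  assert (Z : forall m, m = TX \/ m = TY -> tm_val ka c 0 0 t m = 0) by (intros m [->| ->]; reflexivity).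
  rewrite (Z _ H1) in Hx; rewrite (Z _ H4) in Hy.
  replace x with 0 by lra; replace y with 0 by lra.
  rewrite fq_cw; unfold lfac; rewrite !feval_0, qmul_1_l, qmul_1_r.
  clear - H2 Z; induction H2 as [|m l Hm _ IH]; [reflexivity|].
  change (qmul (feval ka c s (mkF (tm_val ka c 0 0 t (fst m)) (fst (label_coef ka c (snd m))) (snd (label_coef ka c (snd m)))))
    (fq ka c s (pattern_word ka c 0 0 t l)) = qone).
  rewrite (Z _ Hm), feval_0, IH; apply qmul_1_l.
Qed.

(** If one time is 0, the relation makes the sine of half the other one vanish on [0, pi / 2]. In
    the limit the two times thus collapse together or not at all. *)
Lemma degenerate_times ka tX tY : 0 < ka -> 0 <= tX <= PI -> 0 <= tY <= PI ->
  sin (tX / 2) * cos (tY / 2) = ka * (cos (tX / 2) * sin (tY / 2)) ->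
  (0 < tX /\ 0 < tY) \/ (tX = 0 /\ tY = 0).
Proof.
  intros Hka HX HY H; assert (HPI := PI_RGT_0).
  destruct (Rle_lt_or_eq_dec 0 tX) as [PX|ZX]; [lra| |]; (destruct (Rle_lt_or_eq_dec 0 tY) as [PY|ZY]; [lra| |]).
  - left; lra.
  - exfalso; subst tY; replace (0 / 2) with 0 in H by field; rewrite sin_0, cos_0 in H.
    assert (0 < sin (tX / 2)) by (apply sin_gt_0; lra); lra.
  - exfalso; subst tX; replace (0 / 2) with 0 in H by field; rewrite sin_0, cos_0 in H.
    assert (0 < sin (tY / 2)) by (apply sin_gt_0; lra); nra.
  - right; lra.
Qed.

Theorem theorem2p3 (X Y : V3) (kappa : R) :
  vnorm X = 1 -> vnorm Y = 1 ->
  0 < kappa -> kappa <= dot X Y -> dot X Y < 1 ->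
  forall g : M3, SO3 g ->
    exists w : list factor,
      optimal_decomposition X Y kappa w g /\
      subword_of_listed_pattern kappa (dot X Y) w.
Proof.
  intros HX HY Hka Hkc Hc1 g Hg.
  assert (NX : dot X X = 1).
  { assert (0 <= dot X X) by (unfold dot; nra); unfold vnorm in HX; rewrite <- (sqrt_sqrt (dot X X)), HX by assumption; ring. }
  assert (NY : dot Y Y = 1).
  { assert (0 <= dot Y Y) by (unfold dot; nra); unfold vnorm in HY; rewrite <- (sqrt_sqrt (dot Y Y)), HY by assumption; ring. }
  set (c := dot X Y) in *.
  set (s := sqrt (1 - c * c)).
  assert (Hcc : 0 < 1 - c * c) by nra.
  assert (Hs : 0 < s) by (apply sqrt_lt_R0, Hcc).
  assert (Hcs : c * c + s * s = 1) by (unfold s; rewrite sqrt_sqrt; lra).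
  (* Gram-Schmidt: e completes X to an orthonormal basis of the plane of X and Y. *)
  set (e := vscale (/ s) (vadd Y (vscale (- c) X))).
  assert (EY : Y = vadd (vscale c X) (vscale s e)).
  { unfold e, vadd, vscale; destruct Y; simpl; f_equal; field; lra. }
  assert (He : dot e e = 1).
  { transitivity (/ s * / s * (dot Y Y - 2 * c * dot X Y + c * c * dot X X)); [unfold e, dot, vadd, vscale; simpl; ring|].
    fold c; rewrite NX, NY; replace (1 - 2 * c * c + c * c * 1) with (s * s) by lra; field; lra. }
  assert (HXe : dot X e = 0).
  { transitivity (/ s * (dot X Y - c * dot X X)); [unfold e, dot, vadd, vscale; simpl; ring|].
    fold c; rewrite NX; ring. }
  clearbody e s c.
  destruct (@word_exists X e) with c s g as (w0 & HF0 & Ew0); try assumption.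
  rewrite <- EY in Ew0.
  assert (Ev : forall w, List.Forall (fun f => 0 <= ftau f /\ ~ (fa f = 0 /\ fb f = 0)) w -> word_eval X Y w = RR X e (fq kappa c s w)).
  { intros w HF; rewrite EY; apply eval_RR; assumption. }
  set (gh := fq kappa c s w0).
  assert (Eg : RR X e gh = g) by (unfold gh; rewrite <- Ev by exact HF0; exact Ew0).
  assert (Hgh : ip gh gh = 1) by apply fq_unit.
  (* A decomposition of g lifts to a word for one of the two quaternions above g, and [best_word]
     minimises over both. *)
  assert (Hopt : forall w', is_decomposition X Y w' g -> exists q, (q = gh \/ q = qopp gh) /\ reach (F0 kappa c s) q (word_cost kappa w')).
  { intros w' [HF' Ew']; exists (fq kappa c s w'); split; [|apply reach_word; exact HF'].
    apply (@RR_inj X e NX He HXe); [apply fq_unit|exact Hgh|rewrite <- Ev, Ew', Eg by exact HF'; reflexivity]. }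
  destruct (@best_word kappa c s gh (word_cost kappa w0)) as (i & tX & tY & t & x & y & Hi & HV & (P1 & P2 & P3) & Hq & Hbest);
    try assumption; [apply reach_word, HF0|].
  assert (Si := proj1 (List.Forall_forall _ _) slices_ok i Hi).
  assert (Cons : forall w, List.Forall (fun f => 0 <= ftau f /\ ~ (fa f = 0 /\ fb f = 0)) w -> fq kappa c s w = gh \/ fq kappa c s w = qopp gh ->
     is_decomposition X Y w g).
  { intros w HF Hw; split; [exact HF|]; rewrite Ev by exact HF; destruct Hw as [->| ->]; [exact Eg|rewrite RR_opp; exact Eg]. }
  assert (Main : pat_constraint kappa c (s_pat i) tX tY t ->
     exists w, optimal_decomposition X Y kappa w g /\ subword_of_listed_pattern kappa c w).
  { intros HC; exists (cw kappa c i tX tY t x y); split; [split|].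
    - apply Cons; [|exact Hq]; destruct HV as (_ & Hx & Hy); apply cw_decomposition; lra.
    - intros w' Hw'; destruct (Hopt w' Hw') as (q & Hq' & HR); exact (Hbest q _ Hq' HR).
    - exists (s_pat i), (s_gens i), tX, tY, t; split; [apply Si|]; split; [exact HC|apply cw_subword; assumption]. }
  destruct (s_pat i) eqn:Ep; try (apply Main; destruct HV as [HV _]; rewrite Ep in HV; exact HV).
  assert (HC := proj1 HV); rewrite Ep in HC; destruct HC as (B1 & B2 & B3).
  destruct (degenerate_times Hka B1 B2 B3) as [[Q1 Q2]|[-> ->]]; [apply Main; repeat split; try lra; exact B3|].
  (* Both times have collapsed to 0, so the limit word is the identity, and so is g. Pattern (I)
     with times PI and two end arcs of length 0 provides a listed word of cost 0. *)
  assert (HT := proj1 (List.Forall_forall _ _) slices_I i Hi Ep).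
  rewrite (cw_trivial s HT HV) in Hq.
  assert (HPI := PI_RGT_0).
  set (i0 := cut_slice PI_I [] (0, 2)%nat).
  assert (V0 : cw_valid kappa c i0 PI PI 0 0 0) by (split; [apply constraint_PI; assumption|simpl; lra]).
  assert (S0 : slice_ok i0) by (split; [reflexivity|apply List.Forall_nil]).
  exists (cw kappa c i0 PI PI 0 0 0); split; [split|].
  - apply Cons; [apply cw_decomposition; lra|].
    rewrite fq_cw; unfold lfac; rewrite !feval_0; simpl; rewrite !qmul_1_l; exact Hq.
  - intros w' [HF' _]; apply Rle_trans with 0; [right; unfold cw; simpl; ring|].
    clear - HF' Hka; induction HF' as [|f w [Hf _] _ IH]; [apply Rle_refl|].
    change (word_cost kappa (f :: w)) with (ftau f * (Rabs (fa f) + kappa * Rabs (fb f)) + word_cost kappa w).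
    assert (0 <= ftau f * (Rabs (fa f) + kappa * Rabs (fb f))).
    { apply Rmult_le_pos; [exact Hf|]; generalize (Rabs_pos (fa f)) (Rabs_pos (fb f)); nra. }
    lra.
  - exists PI_I, [], PI, PI, 0; split; [apply List.Forall_nil|]; split; [|apply (cw_subword S0 V0)].
    destruct V0 as [(V1 & V2 & V3') _]; repeat split; try lra; exact V3'.
Qed.
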